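(* Let $p,r,n$ be integers with $1\le r\le p-2$, $n\ge 1$ and $n\ge \frac{4-r}{p-r-1}$, and let $\Omega$ be a planar multi-patch domain with an analysis-suitable $G^1$ multi-patch spline parametrization, with vertices $\mathbf x^{(i)}$, $i\in\mathcal I_{\mathcal X}$. Let $\mathcal A$ be the Argyris isogeometric space defined in the context. If $\varphi_h\in\mathcal A$, then $\varphi_h\in C^1(\Omega)$ and $\varphi_h\in C^2(\mathbf x^{(i)})$ for all $i\in\mathcal I_{\mathcal X}$.
   Context: **Splines.** For integers $p,r,n$, $h=1/n$, $\mathcal S^{p,r}_h$ is the space of $C^r$ piecewise polynomials of degree $p$ on $[0,1]$ with $n$ uniform elements (open knot vector, interior knots of multiplicity $p-r$), with standard B-spline basis $b_0,\dots,b_{N-1}$, $N=(p-r)(n-1)+p+1$. $\mathcal S^{\mathbf p,\mathbf r}_h=\mathcal S^{p,r}_h\otimes\mathcal S^{p,r}_h$ on $[0,1]^2$ has the basis $b_{\mathbf j}(\xi_1,\xi_2)=b_{j_1}(\xi_1)b_{j_2}(\xi_2)$. Also $\{b^+_j\}_{j=0}^{N^+-1}$ and $\{b^-_j\}_{j=0}^{N^--1}$ are the B-spline bases of $\mathcal S^{p,r+1}_h$ and $\mathcal S^{p-1,r}_h$ (same mesh), $N^-=(p-r-1)(n-1)+p$, $N^+=N^-+1$. Put $c_0=b_0+b_1$, $c_1=\frac hp b_1$. **Domain.** $\Omega\subset\mathbb R^2$ is open, connected, regular, $\Gamma=\partial\Omega$, $\overline\Omega=\bigcup_{i\in\mathcal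 I_\Omega}\overline{\Omega^{(i)}}$ (finite), where the $\Omega^{(i)}$ are disjoint open patches, $\overline{\Omega^{(i)}}$ is parametrized one-to-one by $\mathbf F^{(i)}:[0,1]^2\to\overline{\Omega^{(i)}}$, $\mathbf F^{(i)}\in\mathcal S^{\mathbf p,\mathbf r}_h\times\mathcal S^{\mathbf p,\mathbf r}_h$, $\det[\partial_1\mathbf F^{(i)},\partial_2\mathbf F^{(i)}]>0$ on $[0,1]^2$. Edges (open) and vertices are the images of the sides and corners of $[0,1]^2$. No hanging nodes: distinct closed patches are disjoint, or share exactly one vertex, or exactly one closed edge, along which the two parametrizations agree up to orientation. $\mathcal I_\Sigma=\mathcal I^\circ_\Sigma\,\dot\cup\,\mathcal I^\Gamma_\Sigma$ indexes edges $\Sigma^{(i)}$ (interfaces, i.e. edges inside $\Omega$ shared by two patches; boundary edges); $\mathcal I_{\mathcal X}$ indexes all vertices $\mathbf x^{(i)}$, interior and boundary. $C^2(\mathbf x^{(i)})$ is the set of piecewise smooth functions whose derivatives up to order 2 are continuous at $\mathbf x^{(i)}$. **Standard form.** Patches may be reparametrized by rotations of $[0,1]^2$ by multiples of $\pi/2$, separately for each edge or vertex considered. An interface $\Sigma^{(i)}$ between $\Omega^{(\imath_1)},\Omega^{(\imath_2)}$ is in standard form if $\mathbf F^{(\imath_1)}(0,\xi)=\mathbf F^{(\imath_2)}(\xi,0)$ for $\xi\in[0,1]$, this being the parametrization of $\overline{\Sigma^{(i)}}$. A boundary edge of $\Omega^{(\imath_1)}$ is in standard form if it is $\{\mathbf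 F^{(\imath_1)}(0,\xi):0<\xi<1\}$. **Analysis-suitable $G^1$.** For each interface in standard form there are polynomials $\alpha^{(i,\imath_1)},\alpha^{(i,\imath_2)},\beta^{(i,\imath_1)},\beta^{(i,\imath_2)}$ of degree at most $1$ (gluing data, fixed once and for all), with $\alpha^{(i,\imath_1)},\alpha^{(i,\imath_2)}$ relatively prime, such that on $[0,1]$: $\alpha^{(i,\imath_1)}\alpha^{(i,\imath_2)}>0$ and, with $\beta^{(i)}=\alpha^{(i,\imath_1)}\beta^{(i,\imath_2)}+\alpha^{(i,\imath_2)}\beta^{(i,\imath_1)}$, $$\alpha^{(i,\imath_1)}(\xi)\,\partial_2\mathbf F^{(\imath_2)}(\xi,0)+\alpha^{(i,\imath_2)}(\xi)\,\partial_1\mathbf F^{(\imath_1)}(0,\xi)+\beta^{(i)}(\xi)\,\partial_2\mathbf F^{(\imath_1)}(0,\xi)=\mathbf 0.$$ If the roles of the two patches are swapped (opposite orientation of the interface), the data are transported by $\alpha(\xi)\mapsto\alpha(1-\xi)$, $\beta(\xi)\mapsto-\beta(1-\xi)$. **Patch-interior space.** $\mathrm B^{(i)}_{\mathbf j}:\overline{\Omega^{(i)}}\to\mathbb R$ is defined by $\mathrm B^{(i)}_{\mathbf j}\circ\mathbf F^{(i)}=b_{\mathbf j}$; $\mathcal A^\circ_{\Omega^{(i)}}=\mathrm{span}\{\mathrm B^{(i)}_{\mathbf j}:\mathbf j\in\{2,\dots,N-3\}^2\}$. **Edge space.** For an interface in standard form, $\overline{\mathrm B}^{(i)}_{\mathbf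 j}:\overline{\Omega^{(\imath_1)}}\cup\overline{\Omega^{(\imath_2)}}\to\mathbb R$ is defined, for $0\le j\le N^+-1$, by $$\overline{\mathrm B}^{(i)}_{(j,0)}\circ\mathbf F^{(\imath_1)}=b^+_j(\xi_2)c_0(\xi_1)-\beta^{(i,\imath_1)}(\xi_2)(b^+_j)'(\xi_2)c_1(\xi_1),\quad \overline{\mathrm B}^{(i)}_{(j,0)}\circ\mathbf F^{(\imath_2)}=b^+_j(\xi_1)c_0(\xi_2)-\beta^{(i,\imath_2)}(\xi_1)(b^+_j)'(\xi_1)c_1(\xi_2),$$ and, for $0\le j\le N^--1$, by $$\overline{\mathrm B}^{(i)}_{(j,1)}\circ\mathbf F^{(\imath_1)}=\alpha^{(i,\imath_1)}(\xi_2)b^-_j(\xi_2)b_1(\xi_1),\quad \overline{\mathrm B}^{(i)}_{(j,1)}\circ\mathbf F^{(\imath_2)}=-\alpha^{(i,\imath_2)}(\xi_1)b^-_j(\xi_1)b_1(\xi_2).$$ For a boundary edge in standard form: $\overline{\mathrm B}^{(i)}_{(j,0)}\circ\mathbf F^{(\imath_1)}=b^+_j(\xi_2)c_0(\xi_1)$, $\overline{\mathrm B}^{(i)}_{(j,1)}\circ\mathbf F^{(\imath_1)}=b^-_j(\xi_2)b_1(\xi_1)$ (with $\xi_1,\xi_2$ exchanged if the edge is at $\xi_2=0$). $\mathcal A^\circ_{\Sigma^{(i)}}$ is the span of the $\overline{\mathrm B}^{(i)}_{(j_1,j_2)}$, $j_2\in\{0,1\}$, with $j_1+j_2\ge3$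 and $j_1\le N^--3$. **Vertex space.** Let $\mathbf x^{(i)}$ be a vertex contained in $\nu$ patches $\Omega^{(\imath_2)},\Omega^{(\imath_4)},\dots,\Omega^{(\imath_{2\nu})}$, in counterclockwise order, in standard form: $\mathbf F^{(\imath_{2\ell})}(0,0)=\mathbf x^{(i)}$ and $\mathbf F^{(\imath_{2\ell})}(0,\xi)=\mathbf F^{(\imath_{2\ell+2})}(\xi,0)$ for $\ell=1,\dots,\nu$ (interior vertex, sub-indices modulo $2\nu$) or $\ell=1,\dots,\nu-1$ (boundary vertex). $\Sigma^{(\imath_{2\ell+1})}$ is the interface between $\Omega^{(\imath_{2\ell})}$ (first patch) and $\Omega^{(\imath_{2\ell+2})}$ (second patch); at a boundary vertex, $\Sigma^{(\imath_1)}$ and $\Sigma^{(\imath_{2\nu+1})}$ are the boundary edges $\{\mathbf F^{(\imath_2)}(\xi,0)\}$ and $\{\mathbf F^{(\imath_{2\nu})}(0,\xi)\}$. For even $k$, $\Pi_k\varphi$ is the unique element of $\mathrm{span}\{\mathrm B^{(\imath_k)}_{\mathbf j}:\mathbf j\in\{0,1\}^2\}$ with $\partial_1^{m_1}\partial_2^{m_2}(\Pi_k\varphi\circ\mathbf F^{(\imath_k)})(0,0)=\partial_1^{m_1}\partial_2^{m_2}(\varphi\circ\mathbf F^{(\imath_k)})(0,0)$ for $0\le m_1,m_2\le1$. For odd $k$, $\Pi_k\varphi$ is the unique element of $\mathrm{span}\{\overline{\mathrm B}^{(\imath_k)}_{\mathbf j}:0\le j_1,\,0\le j_2\le1,\,j_1+j_2\le2\}$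 such that $\partial_1^{m_1}\partial_2^{m_2}$ of $\Pi_k\varphi\circ\mathbf F^{(\imath_{k\pm1})}$ and $\varphi\circ\mathbf F^{(\imath_{k\pm1})}$ agree at $(0,0)$ for $m_1+m_2\le2$, with $m_1\le1$ on the patch $\imath_{k-1}$ and $m_2\le1$ on the patch $\imath_{k+1}$ (for those of the two patches that exist). All functions are extended by zero outside their patches. Then $\Pi_{\mathcal A_{\mathbf x^{(i)}}}=\sum_k(-1)^{k+1}\Pi_k$, with $k=1,\dots,2\nu$ (interior vertex) or $k=1,\dots,2\nu+1$ (boundary vertex), and $\mathcal A_{\mathbf x^{(i)}}$ is the image of $C^2(\mathbf x^{(i)})$ under $\Pi_{\mathcal A_{\mathbf x^{(i)}}}$. **Argyris isogeometric space.** $\mathcal A=\big(\bigoplus_{i\in\mathcal I_\Omega}\mathcal A^\circ_{\Omega^{(i)}}\big)\oplus\big(\bigoplus_{i\in\mathcal I_\Sigma}\mathcal A^\circ_{\Sigma^{(i)}}\big)\oplus\big(\bigoplus_{i\in\mathcal I_{\mathcal X}}\mathcal A_{\mathbf x^{(i)}}\big)$, all functions being extended by zero to $\overline\Omega$. *)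

(* Defs.v *)
From HB Require Import structures.
From mathcomp Require Export all_boot all_order all_algebra.
From mathcomp Require Export all_classical all_reals all_analysis.
Export Order.TTheory GRing.Theory Num.Theory numFieldNormedType.Exports.

Set Implicit Arguments.
Unset Strict Implicit.
Unset Printing Implicit Defensive.

Local Open Scope classical_set_scope.
Local Open Scope ring_scope.

(* Derivative of a function on [0,1]: difference quotients only use points of
   [0,1], so it is the one-sided derivative at 0 and at 1. *)
Definition der01 (R : realType) (V : normedModType R) (g : R -> V) (x : R) : V :=
  lim ((y - x)^-1 *: (g y - g x) @[y --> within `[0, 1] x^']).

Definition d1 (R : realType) (V : normedModType R) (g : R -> R -> V) : R -> R -> V :=
  fun x y => der01 (fun t => g t y) x.

Definition d2 (R : realType) (V : normedModType R) (g : R -> R -> V) : R -> R -> V :=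
  fun x y => der01 (fun t => g x t) y.

Definition mixed_der00 (R : realType) (m1 m2 : nat) (g : R -> R -> R) : R :=
  iter m1 (@d1 R R) (iter m2 (@d2 R R) g) 0 0.

Definition in01 (R : realType) (x : R) : Prop := 0 <= x <= 1.

Definition pderiv (R : realType) (c : 'I_2) (f : 'rV[R]_2 -> R) : 'rV[R]_2 -> R :=
  fun x => 'D_(delta_mx 0 c) f x.

Definition pderivs (R : realType) (s : seq 'I_2) (f : 'rV[R]_2 -> R) :
    'rV[R]_2 -> R :=
  foldr (@pderiv R) f s.

(* C^k on a set U, meant for open U. *)
Definition Ck (R : realType) (k : nat) (U : set 'rV[R]_2) (f : 'rV[R]_2 -> R) : Prop :=
  forall s : seq 'I_2, (size s <= k)%N -> forall x, U x ->
    {for x, continuous (pderivs s f)} /\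
    ((size s < k)%N -> forall c : 'I_2, derivable (pderivs s f) x (delta_mx 0 c)).

Definition smooth_on (R : realType) (U : set 'rV[R]_2) (f : 'rV[R]_2 -> R) : Prop :=
  forall k, Ck k U f.

Definition dimS (p r n : nat) : nat := ((p - r) * (n - 1) + p + 1)%N.

(* Open knot vector of S^{p,r}_h, h = 1/n: end knots repeated p+1 times and
   each interior knot i/n repeated p-r times. *)
Definition knots (R : realType) (p r n : nat) : seq R :=
  nseq p.+1 0 ++
  flatten [seq nseq (p - r) (i%:R / n%:R) | i <- iota 1 (n - 1)] ++
  nseq p.+1 1.

(* Cox-de Boor recursion; a quotient with zero denominator is 0 (x / 0 = 0).
   The last nonempty knot span is closed on the right, so that the basis
   functions are continuous on [0,1] up to the right end point. *)
Fixpoint cox_de_boor (R : realType) (t : nat -> R) (q j : nat) (x : R) : R :=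
  match q with
  | 0%N =>
      if (t j <= x < t j.+1) || [&& x == 1, t j < t j.+1 & t j.+1 == 1]
      then 1 else 0
  | q'.+1 =>
      (x - t j) / (t (j + q)%N - t j) * cox_de_boor t q' j x +
      (t (j + q).+1 - x) / (t (j + q).+1 - t j.+1) * cox_de_boor t q' j.+1 x
  end.

Definition bspline (R : realType) (p r n j : nat) : R -> R :=
  cox_de_boor (fun k => nth 1 (knots R p r n) k) p j.

Definition Nplus (p r n : nat) : nat := dimS p r.+1 n.
Definition Nminus (p r n : nat) : nat := dimS p.-1 r n.

Definition bplus (R : realType) (p r n j : nat) : R -> R := bspline p r.+1 n j.
Definition bminus (R : realType) (p r n j : nat) : R -> R := bspline p.-1 r n j.

Definition c0 (R : realType) (p r n : nat) : R -> R :=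
  fun x => bspline p r n 0 x + bspline p r n 1 x.

Definition c1 (R : realType) (p r n : nat) : R -> R :=
  fun x => n%:R^-1 / p%:R * bspline p r n 1 x.

Definition tensor_spline (R : realType) (p r n : nat) (g : R -> R -> R) : Prop :=
  exists C : 'M[R]_(dimS p r n), forall x y, in01 x -> in01 y ->
    g x y = \sum_(j1 < dimS p r n) \sum_(j2 < dimS p r n)
              C j1 j2 * (bspline p r n j1 x * bspline p r n j2 y).

(* Composition of g with rho^k, where rho (x, y) = (1 - y, x) is the rotation
   of [0,1]^2 by pi/2. *)
Definition rot1 (R : realType) (T : Type) (g : R -> R -> T) : R -> R -> T :=
  fun x y => g (1 - y) x.

Definition rotate (R : realType) (T : Type) (k : 'Z_4) (g : R -> R -> T) :
    R -> R -> T :=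
  iter k (@rot1 R T) g.

Definition swap_args (R : realType) (g : R -> R -> R) : R -> R -> R :=
  fun x y => g y x.

Section Multipatch.
Variables (R : realType) (p r n : nat).

(* A pair (i, k) stands for the patch i reparametrized by rho^k, i.e. with
   parametrization F i o rho^k. *)
Record multipatch := Multipatch {
  Omega : set 'rV[R]_2;
  patchI : finType;
  geo : patchI -> R -> R -> 'rV[R]_2;
  (* interfaces, with the reparametrized first and second patch of a
     standard form *)
  ifaceI : finType;
  iface : ifaceI -> (patchI * 'Z_4) * (patchI * 'Z_4);
  (* boundary edges, with the reparametrized patch of a standard form *)
  bedgeI : finType;
  bedge : bedgeI -> patchI * 'Z_4;
  (* vertices, with the reparametrized patches around a vertex in
     counterclockwise order *)
  vertexI : finType;
  vertex : vertexI -> 'rV[R]_2;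
  fan : vertexI -> seq (patchI * 'Z_4)
}.

Definition side (D : multipatch) : Type := (patchI D * 'Z_4)%type.

Section Geometry.
Variable D : multipatch.

Definition geoS (s : side D) : R -> R -> 'rV[R]_2 := rotate s.2 (geo s.1).

Definition Gamma : set 'rV[R]_2 := closure (Omega D) `\` Omega D.

Definition closed_patch (i : patchI D) : set 'rV[R]_2 :=
  [set z | exists x y, [/\ in01 x, in01 y & z = geo i x y]].

Definition open_patch (i : patchI D) : set 'rV[R]_2 :=
  [set z | exists x y, [/\ 0 < x < 1, 0 < y < 1 & z = geo i x y]].

(* The edge {F(0, xi)} and the vertex F(0, 0) of a reparametrized patch; every
   edge and every corner of patch i is obtained from exactly one rotation. *)
Definition open_edge (s : side D) : set 'rV[R]_2 :=
  [set z | exists t, 0 < t < 1 /\ z = geoS s 0 t].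

Definition closed_edge (s : side D) : set 'rV[R]_2 :=
  [set z | exists t, in01 t /\ z = geoS s 0 t].

Definition corner (s : side D) : 'rV[R]_2 := geoS s 0 0.

Definition share_vertex (i j : patchI D) : Prop :=
  exists s t : side D, [/\ s.1 = i, t.1 = j, corner s = corner t &
    closed_patch i `&` closed_patch j = [set corner s]].

Definition share_edge (i j : patchI D) : Prop :=
  exists s t : side D, [/\ s.1 = i, t.1 = j,
    closed_patch i `&` closed_patch j = closed_edge s &
    (forall x, in01 x -> geoS s 0 x = geoS t 0 x) \/
    (forall x, in01 x -> geoS s 0 x = geoS t 0 (1 - x))].

(* s1 and s2 are the first and the second patch of an interface in standard
   form. *)
Definition std_iface (s1 s2 : side D) : Prop :=
  s1.1 <> s2.1 /\ forall x, in01 x -> geoS s1 0 x = geoS s2 x 0.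

(* For the vertex v with nu patches, the patch with sub-index 2l (l = 1..nu) of
   the standard form. At an interior vertex sub-indices are taken modulo 2 nu;
   at a boundary vertex there is no patch for l = 0 and l = nu + 1. *)
Definition fan_patch (v : vertexI D) (l : nat) : option (side D) :=
  let nu := size (fan v) in
  if `[< Omega D (vertex v) >] then onth (fan v) ((l + nu - 1) %% nu)
  else if l is l'.+1 then onth (fan v) l' else None.

Record is_multipatch : Prop := IsMultipatch {
  Omega_open : open (Omega D);
  Omega_connected : connected (Omega D);
  (* regular: the interior of its closure *)
  Omega_regular : interior (closure (Omega D)) = Omega D;
  Omega_cover : closure (Omega D) = \bigcup_(i in [set: patchI D]) closed_patch i;
  patches_disjoint : forall i j, i <> j -> open_patch i `&` open_patch j = set0;
  geo_inj : forall (i : patchI D) x y x' y', in01 x -> in01 y -> in01 x' -> in01 y' ->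
    geo i x y = geo i x' y' -> x = x' /\ y = y';
  geo_spline : forall (i : patchI D) (c : 'I_2),
    tensor_spline p r n (fun x y => geo i x y 0 c);
  geo_det : forall (i : patchI D) x y, in01 x -> in01 y ->
    0 < \det (row_mx (d1 (geo i) x y)^T (d2 (geo i) x y)^T : 'M[R]_2);
  no_hanging : forall i j, i <> j ->
    [\/ closed_patch i `&` closed_patch j = set0, share_vertex i j | share_edge i j];
  iface_std : forall e, std_iface (iface e).1 (iface e).2;
  iface_inside : forall e, open_edge (iface e).1 `<=` Omega D;
  iface_inj : injective (fun e : ifaceI D => open_edge (iface e).1);
  bedge_boundary : forall e, open_edge (bedge e) `<=` Gamma;
  bedge_inj : injective (fun e : bedgeI D => open_edge (bedge e));
  edge_cover : forall s : side D,
    (exists e, open_edge s = open_edge (iface e).1) \/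
    (exists e, open_edge s = open_edge (bedge e));
  vertex_inj : injective (@vertex D);
  vertex_cover : range (@vertex D) = range corner;
  fan_uniq : forall v : vertexI D, uniq [seq s.1 | s <- fan v];
  fan_patches : forall (v : vertexI D) (i : patchI D),
    i \in [seq s.1 | s <- fan v] <-> closed_patch i (vertex v);
  fan_corner : forall (v : vertexI D) s, s \in fan v -> corner s = vertex v;
  fan_std : forall (v : vertexI D) l s1 s2, fan_patch v l = Some s1 ->
    fan_patch v l.+1 = Some s2 -> std_iface s1 s2;
  fan_first : forall (v : vertexI D) s, Gamma (vertex v) -> fan_patch v 1 = Some s ->
    [set z | exists t, 0 < t < 1 /\ z = geoS s t 0] `<=` Gamma;
  fan_last : forall (v : vertexI D) s, Gamma (vertex v) ->
    fan_patch v (size (fan v)) = Some s -> open_edge s `<=` Gamma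
}.

Record gluing_polys := GluingPolys {
  al1 : {poly R}; al2 : {poly R}; be1 : {poly R}; be2 : {poly R}
}.

Definition gluing_beta (q : gluing_polys) : {poly R} :=
  al1 q * be2 q + al2 q * be1 q.

(* The other standard form of the interface with standard form (s1, s2) is
   (snd_as_first s2, fst_as_second s1): the roles of the two patches are
   swapped and the interface is traversed in the opposite direction. *)
Definition snd_as_first (s : side D) : side D := (s.1, s.2 + 1).
Definition fst_as_second (s : side D) : side D := (s.1, s.2 - 1).

Definition transport (q : gluing_polys) : gluing_polys :=
  GluingPolys (al2 q \Po (1 - 'X)) (al1 q \Po (1 - 'X))
              (- (be2 q \Po (1 - 'X))) (- (be1 q \Po (1 - 'X))).

(* gd s1 s2 is only meaningful when (s1, s2) is an interface in standard form. *)
Definition analysis_suitable_G1 (gd : side D -> side D -> gluing_polys) : Prop :=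
  forall s1 s2, std_iface s1 s2 ->
  let q := gd s1 s2 in
  [/\ [/\ (size (al1 q) <= 2)%N, (size (al2 q) <= 2)%N,
          (size (be1 q) <= 2)%N & (size (be2 q) <= 2)%N],
      coprimep (al1 q) (al2 q),
      forall x, in01 x -> 0 < (al1 q).[x] * (al2 q).[x],
      forall x, in01 x ->
        (al1 q).[x] *: d2 (geoS s2) x 0 + (al2 q).[x] *: d1 (geoS s1) 0 x
        + (gluing_beta q).[x] *: d2 (geoS s1) 0 x = 0 &
      gd (snd_as_first s2) (fst_as_second s1) = transport q].

(* A patchwise function phi on the closure of Omega is given by its pullbacks
   phi i = phi|_{closed patch i} o F i on [0,1]^2. Values of different patches
   at common points are kept apart: extension by zero outside a patch (or a
   pair of patches) is discontinuous, and the sum of such extensions is taken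
   patch by patch. Values outside [0,1]^2 are irrelevant. *)
Definition bfun : Type := patchI D -> R -> R -> R.

Definition pullback (s : side D) (phi : bfun) : R -> R -> R := rotate s.2 (phi s.1).

(* The function whose pullback by s is g, extended by zero. *)
Definition on_patch (s : side D) (g : R -> R -> R) : bfun :=
  fun i => if i == s.1 then rotate (- s.2) g else fun _ _ => 0.

Definition bspan (J : finType) (P : pred J) (B : J -> bfun) : set bfun :=
  [set phi | exists c : J -> R, forall i x y, in01 x -> in01 y ->
     phi i x y = \sum_(j | P j) c j * B j i x y].

Definition closed_cell (i : patchI D) (a b : 'I_n) : set 'rV[R]_2 :=
  [set z | exists x y, [/\ a%:R / n%:R <= x <= a.+1%:R / n%:R,
     b%:R / n%:R <= y <= b.+1%:R / n%:R & z = geo i x y]].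

Definition open_cell (i : patchI D) (a b : 'I_n) : set 'rV[R]_2 :=
  [set z | exists x y, [/\ a%:R / n%:R < x < a.+1%:R / n%:R,
     b%:R / n%:R < y < b.+1%:R / n%:R & z = geo i x y]].

Definition piecewise_smooth (f : 'rV[R]_2 -> R) : Prop :=
  forall i a b, exists U g, [/\ open U, closed_cell i a b `<=` U,
    smooth_on U g & {in closed_cell i a b, f =1 g}].

(* Piecewise smooth functions on the closure of Omega whose derivatives up to
   order 2 are continuous at z; derivatives are taken in the open mesh
   elements, where they exist classically. *)
Definition C2_at (z : 'rV[R]_2) (f : 'rV[R]_2 -> R) : Prop :=
  piecewise_smooth f /\
  forall s : seq 'I_2, (size s <= 2)%N ->
    cvg (pderivs s f y @[y --> within
      [set y | exists i a b, open_cell i a b y] (nbhs z)]).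

Variable gd : side D -> side D -> gluing_polys.

Local Notation N := (dimS p r n).
Local Notation Np := (Nplus p r n).
Local Notation Nm := (Nminus p r n).
Local Notation b := (@bspline R p r n).

Definition patch_basis (s : side D) (j : 'I_N * 'I_N) : bfun :=
  on_patch s (fun x y => b j.1 x * b j.2 y).

Definition patch_space (i : patchI D) : set bfun :=
  bspan (fun j : 'I_N * 'I_N =>
           [&& (2 <= j.1)%N, (j.1 + 3 <= N)%N, (2 <= j.2)%N & (j.2 + 3 <= N)%N])
        (patch_basis (i, 0)).

(* Profile of the edge functions on a patch whose edge is at x = 0. *)
Definition edge_profile (al be : {poly R}) (j1 j2 : nat) : R -> R -> R :=
  fun x y =>
    if j2 == 0%N then
      bplus p r n j1 y * c0 p r n x
      - be.[y] * der01 (@bplus R p r n j1) y * c1 p r n x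
    else al.[y] * bminus p r n j1 y * b 1 x.

(* An edge in standard form is given by its first and its second patch: both
   for an interface, only the first one for a boundary edge at xi_1 = 0, only
   the second one for a boundary edge at xi_2 = 0. *)
Definition edge_basis (o1 o2 : option (side D)) (j : 'I_Np * 'I_2) : bfun :=
  match o1, o2 with
  | Some s1, Some s2 =>
      let q := gd s1 s2 in
      fun i x y =>
        on_patch s1 (edge_profile (al1 q) (be1 q) j.1 j.2) i x y +
        on_patch s2 (swap_args (edge_profile (- al2 q) (be2 q) j.1 j.2)) i x y
  | Some s1, None => on_patch s1 (edge_profile 1 0 j.1 j.2)
  | None, Some s2 => on_patch s2 (swap_args (edge_profile 1 0 j.1 j.2))
  | None, None => fun _ _ _ => 0
  end.

Definition edge_space (o1 o2 : option (side D)) : set bfun :=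
  bspan (fun j : 'I_Np * 'I_2 => (3 <= j.1 + j.2)%N && (j.1 + 3 <= Nm)%N)
        (edge_basis o1 o2).

(* psi = Pi_k f for even k, where s is the patch with sub-index k. *)
Definition is_Pi_patch (s : side D) (f : 'rV[R]_2 -> R) (psi : bfun) : Prop :=
  bspan (fun j : 'I_N * 'I_N => (j.1 <= 1)%N && (j.2 <= 1)%N) (patch_basis s) psi /\
  forall m1 m2, (m1 <= 1)%N -> (m2 <= 1)%N ->
    mixed_der00 m1 m2 (pullback s psi) =
    mixed_der00 m1 m2 (fun x y => f (geoS s x y)).

(* psi = Pi_k f for odd k, where o1 and o2 are the patches with sub-indices
   k - 1 and k + 1, if they exist. *)
Definition is_Pi_edge (o1 o2 : option (side D)) (f : 'rV[R]_2 -> R) (psi : bfun) :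
    Prop :=
  [/\ bspan (fun j : 'I_Np * 'I_2 => (j.1 + j.2 <= 2)%N) (edge_basis o1 o2) psi,
      forall s m1 m2, o1 = Some s -> (m1 + m2 <= 2)%N -> (m1 <= 1)%N ->
        mixed_der00 m1 m2 (pullback s psi) =
        mixed_der00 m1 m2 (fun x y => f (geoS s x y)) &
      forall s m1 m2, o2 = Some s -> (m1 + m2 <= 2)%N -> (m2 <= 1)%N ->
        mixed_der00 m1 m2 (pullback s psi) =
        mixed_der00 m1 m2 (fun x y => f (geoS s x y))].

Definition is_Pi (v : vertexI D) (k : nat) (f : 'rV[R]_2 -> R) (psi : bfun) : Prop :=
  if odd k then is_Pi_edge (fan_patch v k./2) (fan_patch v k./2.+1) f psi
  else exists2 s, fan_patch v k./2 = Some s & is_Pi_patch s f psi.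

Definition vertex_last (v : vertexI D) : nat :=
  if `[< Omega D (vertex v) >] then (size (fan v)).*2 else (size (fan v)).*2.+1.

Definition vertex_space (v : vertexI D) : set bfun :=
  [set psi | exists (f : 'rV[R]_2 -> R) (P : nat -> bfun),
    [/\ C2_at (vertex v) f,
        forall k, (1 <= k <= vertex_last v)%N -> is_Pi v k f (P k) &
        forall i x y, in01 x -> in01 y ->
          psi i x y = \sum_(1 <= k < (vertex_last v).+1) (-1) ^+ k.+1 * P k i x y]].

Definition argyris : set bfun :=
  [set phi | exists (fP : patchI D -> bfun) (fI : ifaceI D -> bfun)
                    (fB : bedgeI D -> bfun) (fV : vertexI D -> bfun),
    [/\ forall i, patch_space i (fP i),
        forall e, edge_space (Some (iface e).1) (Some (iface e).2) (fI e),
        forall e, edge_space (Some (bedge e)) None (fB e),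
        forall v, vertex_space v (fV v) &
        forall i x y, in01 x -> in01 y ->
          phi i x y = \sum_k fP k i x y + \sum_e fI e i x y
                      + \sum_e fB e i x y + \sum_v fV v i x y]].

(* f is the (single-valued) function on the closure of Omega whose
   restrictions to the closed patches are the components of phi. *)
Definition represents (f : 'rV[R]_2 -> R) (phi : bfun) : Prop :=
  forall i x y, in01 x -> in01 y -> f (geo i x y) = phi i x y.

End Geometry.
End Multipatch.

(* Main.v *)
Require Import Defs.
From mathcomp Require Import ring lra.
From mathcomp Require Import zify.

Set Implicit Arguments.
Unset Strict Implicit.
Unset Printing Implicit Defensive.

Local Open Scope classical_set_scope.
Local Open Scope ring_scope.

(*FILE A*)
Lemma dvdp_XsubC_deriv (R : realType) (p : {poly R}) a e :
  p.[a] = 0 -> ('X - a%:P) ^+ e %| p^`() -> ('X - a%:P) ^+ e.+1 %| p.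
Proof.
move=> pa; have [->|p0] := eqVneq p 0; first by rewrite dvdp0.
have [k [s]] := multiplicity_XsubC p a.
rewrite p0 /= => sa ep.
case: k ep => [|k] ep.
  by move: sa; rewrite /root -[s]mulr1 -[1]/(('X - a%:P) ^+ 0) -ep pa eqxx.
have -> : p^`() = ('X - a%:P) ^+ k * (s^`() * ('X - a%:P) + s *+ k.+1).
  rewrite ep derivM deriv_exp derivXsubC /= exprSr -mulr_natr -[s *+ _]mulr_natr. ring.
move=> h; rewrite {}ep; apply: dvdp_mull; apply: dvdp_exp2l.
rewrite ltnS leqNgt; apply/negP => ke.
move: h; rewrite -(subnKC ke) addSn -addnS exprD dvdp_mul2l ?expf_neq0 ?polyXsubC_eq0 //.
rewrite exprS => /(dvdp_trans (dvdp_mulr _ (dvdpp _))).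
rewrite dvdp_XsubCl /root hornerD hornerM hornerXsubC hornerMn subrr mulr0 add0r.
by rewrite mulrn_eq0 /= => h; move: sa; rewrite /root h.
Qed.

Section BsplinePieces.
Variables (R : realType) (t : nat -> R).
Hypothesis tmono : forall i j, (i <= j)%N -> t i <= t j.
Hypothesis tle1 : forall i, t i <= 1.

(* The polynomial coinciding with the B-spline of index [j] and degree [q] on
   the knot span [[t k, t k.+1)]. *)
Fixpoint bpiece (k q j : nat) : {poly R} :=
  match q with
  | 0%N => (j == k)%:R
  | q'.+1 =>
    (t (j + q)%N - t j)^-1 *: (('X - (t j)%:P) * bpiece k q' j) +
    (t (j + q).+1 - t j.+1)^-1 *: (((t (j + q).+1)%:P - 'X) * bpiece k q' j.+1)
  end.

Lemma cox_de_boor_piece k q j x :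
  (t k <= x < t k.+1) \/ [/\ x = 1, t k < 1 & t k.+1 = 1] ->
  cox_de_boor t q j x = (bpiece k q j).[x].
Proof.
move=> hx; elim: q j => [|q IH] j /=.
  have [-> |njk] := eqVneq j k.
    rewrite /= hornerC.
    by case: hx => [-> //|[-> h1 h2]]; rewrite h2 h1 eqxx ltxx andbF.
  rewrite /= horner0; case: ifPn => // h; exfalso.
  have h0 := tle1 j.+1; have h0k := tle1 k.+1.
  have {njk} [jk|kj] : (j < k)%N \/ (k < j)%N by lia.
    have h1 := tmono jk; have h2 : t j <= t j.+1 by apply: tmono.
    by case: hx => [/andP[a b]|[a b c]];
       case/orP: h => [/andP[d e]|/and3P[/eqP d e /eqP f]]; lra.
  have h1 := tmono kj; have h2 : t j <= t j.+1 by apply: tmono.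
  by case: hx => [/andP[a b]|[a b c]];
     case/orP: h => [/andP[d e]|/and3P[/eqP d e /eqP f]]; lra.
by rewrite !IH !(hornerD, hornerZ, hornerM, hornerN, hornerX, hornerC); ring.
Qed.

Lemma bpiece_out k q j : (k < j)%N || (j + q < k)%N -> bpiece k q j = 0.
Proof.
elim: q j => [|q IH] j h /=; first by case: eqVneq h => // ->; lia.
by rewrite !IH; [rewrite !mulr0 !scaler0 addr0|lia..].
Qed.

Local Notation d j q := (t (j + q)%N - t j)^-1.

Lemma deriv_bpiece k q j : (bpiece k q.+1 j)^`() =
  q.+1%:R *: (d j q.+1 *: bpiece k q j - d j.+1 q.+1 *: bpiece k q j.+1).
Proof.
elim: q j => [|q IH] j.
  rewrite /= !(derivD, derivZ, derivM, derivN, derivX, derivC).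
  rewrite -!(rmorph_nat (@polyC R)) !derivC -!mul_polyC !addn1 /=.
  by rewrite ?addSn ?addn1; ring.
rewrite [bpiece]lock /= -lock.
rewrite [in LHS]/bpiece -/bpiece [LHS]/= !derivD !derivZ !derivM !derivB !derivX !derivC.
rewrite -/(bpiece k q.+1 j) -/(bpiece k q.+1 j.+1).
rewrite !IH /= !addSn !addnS.
set B0 := bpiece k q j; set B1 := bpiece k q j.+1; set B2 := bpiece k q j.+2.
set a := t j; set b := t j.+1; set c := t j.+2; set e := t (j + q).+1.
set f := t (j + q).+2; set g := t (j + q).+3.
have E1 : (f - b)^-1 * ((f - a)^-1 * (f - a) - 1) = 0 :> R.
  have [h|h] := eqVneq f a; last by rewrite mulVf ?subr_eq0 // subrr mulr0.
  have -> : f = b; last by rewrite subrr invr0 mul0r.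
  by apply/le_anti; rewrite {1}h /f /b /a !tmono //; lia.
have E2 : (f - b)^-1 * ((g - b)^-1 * (g - b) - 1) = 0 :> R.
  have [h|h] := eqVneq g b; last by rewrite mulVf ?subr_eq0 // subrr mulr0.
  have -> : f = b; last by rewrite subrr invr0 mul0r.
  by apply/le_anti; rewrite -{1}h /f /g /b !tmono //; lia.
have {}E1 : ((f - b)^-1)%:P * (((f - a)^-1)%:P * (f%:P - a%:P) - 1) = 0 :> {poly R}.
  by rewrite -polyCB -polyCM -polyC1 -polyCB -polyCM E1.
have {}E2 : ((f - b)^-1)%:P * (((g - b)^-1)%:P * (g%:P - b%:P) - 1) = 0 :> {poly R}.
  by rewrite -polyCB -polyCM -polyC1 -polyCB -polyCM E2.
rewrite -!mul_polyC [in RHS]mulrSr polyCD polyC1.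
apply/eqP; rewrite -subr_eq0; apply/eqP.
transitivity ((q.+1%:R)%:P * B1 *
  (((f - b)^-1)%:P * (((g - b)^-1)%:P * (g%:P - b%:P) - 1) -
   ((f - b)^-1)%:P * (((f - a)^-1)%:P * (f%:P - a%:P) - 1)) : {poly R}); first by ring.
by rewrite E1 E2; ring.
Qed.

Lemma bpiece_right k m q j : (q <= m)%N -> t k.+1 = t (k + m)%N ->
  t (k + m)%N < t (k + m).+1 ->
  (bpiece (k + m) q j).[t (k + m)%N] = (j == k + m - q)%N%:R.
Proof.
move=> + t1 t2; elim: q j => [|q IH] j qm; first by rewrite subn0 /= -[_%:R]polyC_natr hornerC.
have tt i : (k < i <= k + m)%N -> t i = t (k + m)%N.
  by move=> /andP[h1 h2]; apply/le_anti; rewrite tmono // -t1 tmono.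
rewrite /= !(hornerD, hornerZ, hornerM, hornerN, hornerX, hornerC) !IH ?(ltnW qm) //.
have [e1|n1] := eqVneq j (k + m - q)%N.
  have -> : (j.+1 == k + m - q)%N = false by lia.
  have -> : (j == k + m - q.+1)%N = false by lia.
  by rewrite (tt j) ?subrr; [rewrite /= mulr0n; ring|lia].
rewrite mulr0 mulr0 add0r.
have [e2|n2] := eqVneq j.+1 (k + m - q)%N; last first.
  by have -> : (j == k + m - q.+1)%N = false; [lia|rewrite /= ?mulr0n ?mulr0].
have -> : (j == k + m - q.+1)%N by lia.
have -> : (j + q.+1).+1 = (k + m).+1 by lia.
by rewrite (tt j.+1) ?mulr1 ?mulVf ?subr_eq0 ?gt_eqF //; lia.
Qed.

Lemma bpiece_left k m q j : (0 < m)%N -> (q <= m)%N -> t k < t k.+1 ->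
  t k.+1 = t (k + m)%N ->
  (bpiece k q j).[t (k + m)%N] = (j == k)%:R.
Proof.
move=> m0 + t1 t2; elim: q j => [|q IH] j qm; first by rewrite /= -[_%:R]polyC_natr hornerC.
have tt i : (k < i <= k + m)%N -> t i = t (k + m)%N.
  by move=> /andP[h1 h2]; apply/le_anti; rewrite tmono // -t2 tmono.
rewrite /= !(hornerD, hornerZ, hornerM, hornerN, hornerX, hornerC) !IH ?(ltnW qm) //.
have [e1|n1] := eqVneq j k.
  have -> : (j.+1 == k)%N = false by lia.
  rewrite e1 (tt (k + q.+1)%N); last lia.
  by rewrite !mulr1 !mulr0 addr0 mulVf // subr_eq0 -t2 gt_eqF.
rewrite mulr0 mulr0 add0r.
have [e2|n2] := eqVneq j.+1 k; last by rewrite /= ?mulr0n ?mulr0.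
by rewrite (_ : (j + q.+1).+1 = k + q.+1)%N; [rewrite (tt (k + q.+1)%N) ?subrr; [rewrite /= mulr0n; ring|lia]|lia].
Qed.

Lemma bpiece_cont k m q j : (0 < m <= q)%N -> t k < t k.+1 ->
  t k.+1 = t (k + m)%N -> t (k + m)%N < t (k + m).+1 ->
  (bpiece (k + m) q j).[t (k + m)%N] = (bpiece k q j).[t (k + m)%N].
Proof.
move=> /andP[m0 mq] t0 t1 t2; rewrite -(subnKC mq).
elim: (q - m)%N j => [|e IH] j.
  by rewrite addn0 bpiece_right // bpiece_left // addnK.
by rewrite addnS /= !(hornerD, hornerZ, hornerM) !IH.
Qed.

Lemma bpiece_jump k m q j : (0 < m <= q)%N -> t k < t k.+1 ->
  t k.+1 = t (k + m)%N -> t (k + m)%N < t (k + m).+1 ->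
  ('X - (t (k + m)%N)%:P) ^+ (q - m).+1 %| bpiece (k + m) q j - bpiece k q j.
Proof.
move=> /andP[m0 mq] t0 t1 t2; rewrite -(subnKC mq) addKn.
elim: (q - m)%N j => [|e IH] j.
  by rewrite expr1 dvdp_XsubCl /root hornerD hornerN (bpiece_cont _ _ t0) ?subrr // m0 leq_addr.
apply: dvdp_XsubC_deriv.
  by rewrite hornerD hornerN (bpiece_cont _ _ t0) ?subrr // m0 leq_addr.
rewrite derivB addnS !deriv_bpiece -scalerBr dvdpZr ?pnatr_eq0 //.
set a := (t _ - _)^-1; set b := (t _ - _)^-1.
rewrite [X in _ %| X](_ : _ = a *: (bpiece (k + m) (m + e) j - bpiece k (m + e) j)
   - b *: (bpiece (k + m) (m + e) j.+1 - bpiece k (m + e) j.+1)).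
  by apply: dvdp_sub; rewrite -mul_polyC dvdp_mull //.
by rewrite -!mul_polyC; ring.
Qed.

Lemma bpiece_first p q j : (forall i, (i <= p)%N -> t i = 0) -> (q <= p)%N ->
  'X^(j - (p - q)) %| bpiece p q j.
Proof.
move=> t0; elim: q j => [|q IH] j qp.
  rewrite subn0 /=; case: eqVneq => [->|]; first by rewrite subnn expr0 dvd1p.
  by rewrite dvdp0.
have [pj|jp] := ltnP p j; first by rewrite bpiece_out ?pj // dvdp0.
rewrite /= dvdp_add //; rewrite -mul_polyC dvdp_mull //.
  rewrite t0 // subr0; apply: (@dvdp_trans _ ('X * 'X^(j - (p - q)))).
    by rewrite -exprS dvdp_exp2l //; lia.
  by rewrite dvdp_mul2l ?polyX_eq0 // IH // ltnW.
rewrite dvdp_mull //; apply: dvdp_trans (IH _ (ltnW qp)).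
by rewrite dvdp_exp2l //; lia.
Qed.

Lemma bpiece_last k q j : (forall i, (k < i)%N -> t i = 1) ->
  ('X - 1%:P) ^+ (k - j) %| bpiece k q j.
Proof.
move=> t1; elim: q j => [|q IH] j.
  rewrite /=; case: eqVneq => [->|]; first by rewrite subnn expr0 dvd1p.
  by rewrite dvdp0.
rewrite /= dvdp_add //; rewrite -mul_polyC dvdp_mull //; first by rewrite dvdp_mull.
have [h|h] := ltnP (j + q.+1) k.
  by rewrite (bpiece_out (j := j.+1)) ?mulr0 ?dvdp0 //; lia.
rewrite t1 //; apply: (@dvdp_trans _ (('X - 1%:P) * ('X - 1%:P) ^+ (k - j.+1))).
  by rewrite -exprS dvdp_exp2l //; lia.
by rewrite dvdp_mul // -dvdpNl opprB.
Qed.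

End BsplinePieces.


Definition knot (R : realType) (p m n k : nat) : R :=
  if (k <= p)%N then 0 else (minn ((k - p.+1) %/ m).+1 n)%:R / n%:R.

Lemma nth_flatten_nseq (T : Type) (x : T) (f : nat -> T) m c a k : (0 < m)%N ->
  nth x (flatten [seq nseq m (f i) | i <- iota a c]) k =
  if (k < c * m)%N then f (a + k %/ m)%N else x.
Proof.
move=> m0; elim: c a k => [|c IH] a k /=; first by rewrite nth_nil.
rewrite nth_cat size_nseq; case: ltnP => km.
  by rewrite nth_nseq km divn_small // addn0 (leq_trans km) // mulSn leq_addr.
rewrite IH -[X in _ = if (X < _)%N then f (_ + X %/ _)%N else _](subnKC km).
by rewrite mulSn ltn_add2l divnDl // divnn m0 addSnnS add1n.
Qed.

Lemma nth_knots (R : realType) p r n k : (0 < p - r)%N -> (0 < n)%N ->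
  nth 1 (knots R p r n) k = knot R p (p - r) n k.
Proof.
move=> m0 n0; rewrite /knots /knot nth_cat size_nseq ltnS.
case: leqP => kp; first by rewrite nth_nseq ltnS kp.
rewrite nth_cat nth_flatten_nseq // size_flatten /shape -map_comp.
rewrite (_ : sumn _ = (n - 1) * (p - r))%N; last first.
  rewrite (eq_map (_ : _ =1 fun=> (p - r)%N)); last by move=> i /=; rewrite size_nseq.
  have H c a : sumn [seq (p - r)%N | _ <- iota a c] = (c * (p - r))%N.
    by elim: c a => [|c IH] a //=; rewrite IH mulSn.
  exact: H.
have E : (k - p.+1 < (n - 1) * (p - r))%N = ((k - p.+1) %/ (p - r) < n - 1)%N.
  by rewrite ltn_divLR.
case: ifP => h.
  by rewrite h add1n (minn_idPl _) //; move: h; rewrite E; lia.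
rewrite (minn_idPr _) ?divff ?pnatr_eq0 ?lt0n_neq0 //; last by move: h; rewrite E; lia.
by rewrite nth_nseq; case: ifP.
Qed.

Section Knot.
Variables (R : realType) (p m n : nat).
Hypotheses (m0 : (0 < m)%N) (n0 : (0 < n)%N).

Lemma knot_mono i j : (i <= j)%N -> knot R p m n i <= knot R p m n j.
Proof.
move=> ij; rewrite /knot; case: (leqP i p) => ip; case: (leqP j p) => jp //.
- by lia.
rewrite ler_wpM2r ?invr_ge0 // ler_nat.
by rewrite leq_min geq_minr andbT geq_min ltnS leq_div2r // leq_sub2r.
Qed.

Lemma knot_le1 i : knot R p m n i <= 1.
Proof.
rewrite /knot; case: leqP => // _.
by rewrite ler_pdivrMr ?ltr0n // mul1r ler_nat geq_minr.
Qed.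

Lemma knot_span a i : (a <= n)%N -> (0 < i <= m)%N ->
  knot R p m n (p + a * m + i) = (minn a.+1 n)%:R / n%:R.
Proof.
move=> an /andP[i0 im]; rewrite /knot leqNgt (_ : (p < _)%N) /=; last lia.
rewrite (_ : (_ - _ = a * m + i.-1)%N); last lia.
by rewrite divnMDl // (divn_small (_ : (i.-1 < m)%N)) ?addn0 //; lia.
Qed.

Lemma knot_spanS a : (a < n)%N -> knot R p m n (p + a * m).+1 = a.+1%:R / n%:R.
Proof. by move=> an; rewrite -addn1 knot_span ?(ltnW an) // (minn_idPl _). Qed.

Lemma knot_span0 a : (a <= n)%N -> knot R p m n (p + a * m) = a%:R / n%:R.
Proof.
case: a => [|a] an; first by rewrite mul0n addn0 /knot leqnn mul0r.
rewrite mulSn [(m + _)%N]addnC addnA knot_span ?(ltnW an) //; last by rewrite m0 leqnn.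
by rewrite (minn_idPl _).
Qed.

Lemma knot_first i : (i <= p)%N -> knot R p m n i = 0.
Proof. by rewrite /knot => ->. Qed.

Lemma knot_last i : (p + n.-1 * m < i)%N -> knot R p m n i = 1.
Proof.
move=> h; rewrite /knot leqNgt (leq_ltn_trans (leq_addr _ _) h) /=.
have : (n.-1 <= (i - p.+1) %/ m)%N by rewrite leq_divRL //; lia.
move=> h2; rewrite (minn_idPr _) ?divff ?pnatr_eq0 ?lt0n_neq0 //.
by move: (_ %/ _)%N h2 n0; lia.
Qed.

End Knot.

(*FILE B*)
Section StrictDiff.
Variable R : realType.
Implicit Types (f g h : R -> R -> R) (x y d e : R).

Definition box x0 y0 d x y : Prop := `|x - x0| < d /\ `|y - y0| < d.

Lemma box_center x y d : 0 < d -> box x y d x y.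
Proof. by rewrite /box !subrr normr0. Qed.

Lemma box_le x0 y0 d d' x y : d <= d' -> box x0 y0 d x y -> box x0 y0 d' x y.
Proof. by move=> dd [h1 h2]; split; apply: lt_le_trans dd. Qed.

Lemma right0_ex (P : R -> Prop) : (\forall d \near 0^'+, P d) ->
  exists2 d, 0 < d & P d.
Proof.
move=> H; have [d [Pd d0]] : exists d, P d /\ 0 < d.
  by apply: (@filter_ex _ (0:R)^'+); apply: filterI => //; exact: nbhs_right_gt.
by exists d.
Qed.

Lemma right0_le (P : R -> Prop) d : 0 < d -> (forall d', 0 < d' <= d -> P d') ->
  \forall d \near 0^'+, P d.
Proof.
move=> d0 H; near=> d'; apply: H; apply/andP; split; near: d'.
  exact: nbhs_right_gt.
exact: nbhs_right_le.
Unshelve. all: by end_near. Qed.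

Definition sdiff g x0 y0 a b := forall e, 0 < e ->
  \forall d \near 0^'+, forall x y x' y', box x0 y0 d x y -> box x0 y0 d x' y' ->
  `|g x' y' - g x y - (a * (x' - x) + b * (y' - y))| <= e * (`|x' - x| + `|y' - y|).

Lemma sdiff_lip g x0 y0 a b : sdiff g x0 y0 a b ->
  \forall d \near 0^'+, forall x y x' y', box x0 y0 d x y -> box x0 y0 d x' y' ->
  `|g x' y' - g x y| <= (`|a| + `|b| + 1) * (`|x' - x| + `|y' - y|).
Proof.
move=> /(_ 1 ltr01); apply: filterS => d H x y x' y' h1 h2.
have := H _ _ _ _ h1 h2; set D := g x' y' - g x y.
have : `|a * (x' - x) + b * (y' - y)| <= `|a| * `|x' - x| + `|b| * `|y' - y|.
  by rewrite -!normrM ler_normD.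
have := normr_ge0 a; have := normr_ge0 b; have := normr_ge0 (x' - x).
have := normr_ge0 (y' - y).
have := ler_normD (D - (a * (x' - x) + b * (y' - y))) (a * (x' - x) + b * (y' - y)).
rewrite subrK.
move: `|a| `|b| `|x' - x| `|y' - y| `|D| `|D - _| `|_ + _| => A B X Y S T U.
by nra.
Qed.

Lemma sdiff_cont g x0 y0 a b r : sdiff g x0 y0 a b -> 0 < r ->
  \forall d \near 0^'+, forall x y, box x0 y0 d x y -> `|g x y - g x0 y0| < r.
Proof.
move=> /sdiff_lip H r0; near=> d => x y h.
have d0 : 0 < d by near: d; exact: nbhs_right_gt.
have H1 : forall x y x' y', box x0 y0 d x y -> box x0 y0 d x' y' ->
  `|g x' y' - g x y| <= (`|a| + `|b| + 1) * (`|x' - x| + `|y' - y|) by near: d.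
apply: le_lt_trans (H1 _ _ _ _ (box_center x0 y0 d0) h) _.
have K0 : 0 < `|a| + `|b| + 1 by rewrite ltr_wpDl // addr_ge0.
have : d < r / (2 * (`|a| + `|b| + 1)).
  by near: d; apply: nbhs_right_lt; rewrite divr_gt0 // mulr_gt0.
rewrite ltr_pdivlMr ?mulr_gt0 //; case: h => h1 h2.
move: K0 h1 h2; move: (`|a| + _ + _) `|x - x0| `|y - y0| => K X Y K0 h1 h2 h3; nra.
Unshelve. all: by end_near. Qed.

Lemma eq_sdiff g h x0 y0 a b :
  (\forall d \near 0^'+, forall x y, box x0 y0 d x y -> g x y = h x y) ->
  sdiff g x0 y0 a b -> sdiff h x0 y0 a b.
Proof.
move=> E H e e0; apply: filterS2 E (H e e0) => d E {}H x y x' y' h1 h2.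
by rewrite -!E //; apply: H.
Qed.

Lemma sdiff_cst c x0 y0 : sdiff (fun _ _ => c) x0 y0 0 0.
Proof.
move=> e e0; apply: (right0_le ltr01) => d _ x y x' y' _ _.
by rewrite subrr !mul0r addr0 subrr normr0 mulr_ge0 ?addr_ge0 // ltW.
Qed.

Lemma sdiff_fst x0 y0 : sdiff (fun x _ => x) x0 y0 1 0.
Proof.
move=> e e0; apply: (right0_le ltr01) => d _ x y x' y' _ _.
by rewrite mul1r mul0r addr0 subrr normr0 mulr_ge0 ?addr_ge0 // ltW.
Qed.

Lemma sdiff_snd x0 y0 : sdiff (fun _ y => y) x0 y0 0 1.
Proof.
move=> e e0; apply: (right0_le ltr01) => d _ x y x' y' _ _.
by rewrite mul1r mul0r add0r subrr normr0 mulr_ge0 ?addr_ge0 // ltW.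
Qed.

Lemma sdiff_comp f g h x0 y0 A B a b a' b' :
  sdiff f (g x0 y0) (h x0 y0) A B -> sdiff g x0 y0 a b -> sdiff h x0 y0 a' b' ->
  sdiff (fun x y => f (g x y) (h x y)) x0 y0 (A * a + B * a') (A * b + B * b').
Proof.
move=> Hf Hg Hh e e0.
pose K : R := (`|a| + `|b| + 1) + (`|a'| + `|b'| + 1).
have K0 : 0 < K by rewrite addr_gt0 // ltr_wpDl ?addr_ge0.
have eK : 0 < e / (2 * K) by rewrite divr_gt0 // mulr_gt0.
have [r r0 {}Hf] := right0_ex (Hf _ eK).
pose e1 := e / (2 * (`|A| + `|B| + 1)).
have M0 : 0 < `|A| + `|B| + 1 by rewrite ltr_wpDl ?addr_ge0.
have e10 : 0 < e1 by rewrite divr_gt0 // mulr_gt0.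
near=> d => x y x' y' h1 h2.
have Cg : forall x y, box x0 y0 d x y -> `|g x y - g x0 y0| < r.
  by near: d; exact: sdiff_cont Hg r0.
have Ch : forall x y, box x0 y0 d x y -> `|h x y - h x0 y0| < r.
  by near: d; exact: sdiff_cont Hh r0.
have Lg : forall x y x' y', box x0 y0 d x y -> box x0 y0 d x' y' ->
  `|g x' y' - g x y| <= (`|a| + `|b| + 1) * (`|x' - x| + `|y' - y|).
  by near: d; exact: sdiff_lip.
have Lh : forall x y x' y', box x0 y0 d x y -> box x0 y0 d x' y' ->
  `|h x' y' - h x y| <= (`|a'| + `|b'| + 1) * (`|x' - x| + `|y' - y|).
  by near: d; exact: sdiff_lip.
have Dg : forall x y x' y', box x0 y0 d x y -> box x0 y0 d x' y' ->
  `|g x' y' - g x y - (a * (x' - x) + b * (y' - y))| <= e1 * (`|x' - x| + `|y' - y|).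
  by near: d; exact: Hg.
have Dh : forall x y x' y', box x0 y0 d x y -> box x0 y0 d x' y' ->
  `|h x' y' - h x y - (a' * (x' - x) + b' * (y' - y))| <= e1 * (`|x' - x| + `|y' - y|).
  by near: d; exact: Hh.
have := Hf (g x y) (h x y) (g x' y') (h x' y')
  (conj (Cg _ _ h1) (Ch _ _ h1)) (conj (Cg _ _ h2) (Ch _ _ h2)).
have := Lg _ _ _ _ h1 h2; have := Lh _ _ _ _ h1 h2.
have := Dg _ _ _ _ h1 h2; have := Dh _ _ _ _ h1 h2.
set dg := g x' y' - _; set dh := h x' y' - _; set df := f _ _ - f _ _.
set X := x' - x; set Y := y' - y.
move=> dh1 dg1 lh lg df1.
have -> : df - ((A * a + B * a') * X + (A * b + B * b') * Y) =
  (df - (A * dg + B * dh)) + A * (dg - (a * X + b * Y)) + B * (dh - (a' * X + b' * Y)).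
  by ring.
apply: le_trans (ler_normD _ _) _; rewrite normrM.
apply: le_trans (lerD (ler_normD _ _) (lexx _)) _; rewrite normrM.
have S0 : 0 <= `|X| + `|Y| by rewrite addr_ge0.
have T1 : `|df - (A * dg + B * dh)| <= e / 2 * (`|X| + `|Y|).
  apply: le_trans df1 _.
  have -> : e / 2 * (`|X| + `|Y|) = e / (2 * K) * (K * (`|X| + `|Y|)).
    by field; rewrite gt_eqF.
  by rewrite ler_wpM2l ?divr_ge0 ?mulr_ge0 ?(ltW e0) ?(ltW K0) // [K * _]mulrDl lerD.
have T2 : `|A| * `|dg - (a * X + b * Y)| + `|B| * `|dh - (a' * X + b' * Y)|
   <= e / 2 * (`|X| + `|Y|).
  have -> : e / 2 * (`|X| + `|Y|) = (`|A| + `|B| + 1) * (e1 * (`|X| + `|Y|)).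
    by rewrite /e1; field; rewrite gt_eqF.
  have E0 : 0 <= e1 * (`|X| + `|Y|) by rewrite mulr_ge0 // ltW.
  have := ler_wpM2l (normr_ge0 A) dg1; have := ler_wpM2l (normr_ge0 B) dh1.
  by move: E0; move: (e1 * _) `|A| `|B| (`|dg - _|) (`|dh - _|); clear => T A1 B1 u v; lra.
by move: T1 T2; clear; lra.
Unshelve. all: by end_near. Qed.

Lemma sdiff_add x0 y0 : sdiff (fun x y => x + y) x0 y0 1 1.
Proof.
move=> e e0; apply: (right0_le ltr01) => d _ x y x' y' _ _.
rewrite (_ : _ - _ - _ = 0) ?normr0 ?mulr_ge0 ?addr_ge0 ?(ltW e0) //; ring.
Qed.

Lemma sdiff_mul x0 y0 : sdiff (fun x y => x * y) x0 y0 y0 x0.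
Proof.
move=> e e0; apply: (right0_le e0) => d /andP[d0 de] x y x' y' [h1 h2] [h3 h4].
have -> : x' * y' - x * y - (y0 * (x' - x) + x0 * (y' - y)) =
  (x' - x) * (y' - y0) + (x - x0) * (y' - y) by ring.
rewrite [e * _]mulrDr; apply: le_trans (ler_normD _ _) _; rewrite !normrM lerD //.
  by rewrite mulrC ler_wpM2r // ltW // (lt_le_trans h4).
by rewrite ler_wpM2r // ltW // (lt_le_trans h1).
Qed.

Lemma sdiff_inv x0 y0 : x0 != 0 -> sdiff (fun x _ => x^-1) x0 y0 (- x0 ^- 2) 0.
Proof.
move=> x00 e e0.
have n0 : 0 < `|x0| by rewrite normr_gt0.
have M0 : 0 < `|x0| / 2 by rewrite divr_gt0.
have E0 : 0 < e * `|x0| ^+ 3 / 12 by rewrite divr_gt0 // mulr_gt0 // exprn_gt0.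
near=> d => x y x' y' [h1 h2] [h3 h4].
have d1 : d < `|x0| / 2 by near: d; exact: nbhs_right_lt.
have d2 : d < e * `|x0| ^+ 3 / 12 by near: d; exact: nbhs_right_lt.
have B1 u : `|u - x0| < d -> `|x0| / 2 <= `|u|.
  by move=> h; have := ler_normD (x0 - u) u; rewrite subrK distrC; lra.
have B2 u : `|u - x0| < d -> u != 0.
  by move=> /B1 h; rewrite -normr_gt0; lra.
have -> : x'^-1 - x^-1 - (- x0 ^- 2 * (x' - x) + 0 * (y' - y)) =
  (x' - x) * ((x * (x' - x0) + x0 * (x - x0)) / (x0 ^+ 2 * (x * x'))).
  by field; rewrite x00 !B2.
rewrite normrM mulrC; apply: (@le_trans _ _ (e * `|x' - x|)); last first.
  by rewrite ler_wpM2l ?(ltW e0) // lerDl normr_ge0.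
rewrite ler_wpM2r // normrM normfV ler_pdivrMr; last first.
  by rewrite normr_gt0 !mulf_neq0 ?expf_neq0 ?(B2 _ h1) ?(B2 _ h3).
apply: le_trans (ler_normD _ _) _; rewrite !normrM.
have := B1 _ h1; have := B1 _ h3.
have : `|x| <= 2 * `|x0|.
  by have := ler_normD (x - x0) x0; rewrite subrK; lra.
move: h1 h3 d1 d2 n0 (normr_ge0 (x' - x0)) (normr_ge0 (x - x0)).
move: `|x| `|x'| `|x0| `|x' - x0| `|x - x0| => a b c u v hv hu dc dE c0 u0 v0 ac bc' ac'.
have l1 : a * u + c * v <= 3 * c * d.
  have : a * u <= 2 * c * d by apply: ler_pM => //; lra.
  have : c * v <= c * d by rewrite ler_wpM2l // ltW.
  by lra.
have l2 : 3 * c * d <= 3 * c * (e * c ^+ 3 / 12) by rewrite ler_wpM2l // ?ltW //; lra.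
have l3 : c ^+ 2 / 4 <= a * b.
  have -> : c ^+ 2 / 4 = c / 2 * (c / 2) by field.
  by apply: ler_pM => //; lra.
have l4 : e * c ^+ 2 * (c ^+ 2 / 4) <= e * c ^+ 2 * (a * b).
  by rewrite ler_wpM2l // mulr_ge0 // ?(ltW e0) // sqr_ge0.
have c4 : 0 <= e * c ^+ 4 by rewrite mulr_ge0 // ?(ltW e0) // exprn_ge0 // ltW.
by move: l1 l2 l4 c4; clear; lra.
Unshelve. all: by end_near. Qed.

Lemma sdiffD g h x0 y0 a b a' b' : sdiff g x0 y0 a b -> sdiff h x0 y0 a' b' ->
  sdiff (fun x y => g x y + h x y) x0 y0 (a + a') (b + b').
Proof.
move=> Hg Hh; have := sdiff_comp (@sdiff_add _ _) Hg Hh.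
by rewrite !mul1r.
Qed.

Lemma sdiffM g h x0 y0 a b a' b' : sdiff g x0 y0 a b -> sdiff h x0 y0 a' b' ->
  sdiff (fun x y => g x y * h x y) x0 y0 (h x0 y0 * a + g x0 y0 * a')
     (h x0 y0 * b + g x0 y0 * b').
Proof. by move=> Hg Hh; exact: (sdiff_comp (@sdiff_mul _ _) Hg Hh). Qed.

Lemma sdiffZ k g x0 y0 a b : sdiff g x0 y0 a b ->
  sdiff (fun x y => k * g x y) x0 y0 (k * a) (k * b).
Proof.
move=> Hg; have := sdiffM (sdiff_cst k x0 y0) Hg.
by rewrite !mulr0 !add0r.
Qed.

Lemma sdiff_sum (I : Type) (r : seq I) (P : pred I) (g gx gy : I -> R -> R -> R) x0 y0 :
  (forall i, P i -> sdiff (g i) x0 y0 (gx i x0 y0) (gy i x0 y0)) ->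
  sdiff (fun x y => \sum_(i <- r | P i) g i x y) x0 y0
    (\sum_(i <- r | P i) gx i x0 y0) (\sum_(i <- r | P i) gy i x0 y0).
Proof.
move=> H; elim: r => [|i r IH].
  have := sdiff_cst 0 x0 y0; rewrite !big_nil; apply: eq_sdiff.
  by apply: (right0_le ltr01) => *; rewrite big_nil.
rewrite !big_cons; case: ifP => Pi.
  have := sdiffD (H i Pi) IH; apply: eq_sdiff.
  by apply: (right0_le ltr01) => *; rewrite big_cons Pi.
move: IH; apply: eq_sdiff.
by apply: (right0_le ltr01) => *; rewrite big_cons Pi.
Qed.

Lemma sdiff_swap g x0 y0 a b : sdiff g y0 x0 a b -> sdiff (fun x y => g y x) x0 y0 b a.
Proof.
move=> H; have := sdiff_comp (H : sdiff g ((fun _ y => y) x0 y0) ((fun x _ => x) x0 y0) a b)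
  (@sdiff_snd _ _) (@sdiff_fst _ _).
by rewrite !mulr1 !mulr0 addr0 add0r.
Qed.

Lemma sdiff_rot1 g x0 y0 a b : sdiff g (1 - y0) x0 a b ->
  sdiff (rot1 g) x0 y0 b (- a).
Proof.
move=> H.
have H1 := sdiffD (sdiff_cst 1 x0 y0) (sdiffZ (-1) (@sdiff_snd x0 y0)).
have := sdiff_comp (_ : sdiff g _ _ a b) H1 (@sdiff_fst _ _).
rewrite /= !mulN1r => /(_ H).
rewrite !(oppr0, addr0, add0r, mulr0, mulr1, mulrN1); apply: eq_sdiff.
by apply: (right0_le ltr01) => d _ x y _; rewrite /rot1 mulN1r.
Qed.

End StrictDiff.

(*FILE C*)
Section Der01.
Variable R : realType.
Implicit Types (x y d e : R).

Lemma within01_proper x : in01 x -> ProperFilter (within `[0, 1] x^').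
Proof.
move=> /andP[x0 x1]; split; last exact: within_filter.
rewrite /within /dnbhs /within /= => /nbhs_ballP[r /= r0 H].
pose s := Num.min (r / 2) (1 / 2).
have s0 : 0 < s by rewrite lt_min !divr_gt0.
have s1 : s <= 1 / 2 by rewrite ge_min lexx orbT.
have sr : s < r by rewrite gt_min (_ : r / 2 < r) //; lra.
have [h|h] := leP x (1 / 2).
  apply: (H (x + s)); rewrite /ball /= ?in_itv /=.
  - by rewrite opprD addNKr normrN gtr0_norm.
  - by apply/eqP; lra.
  - by apply/andP; split; lra.
apply: (H (x - s)); rewrite /ball /= ?in_itv /=.
- by rewrite opprB addrC subrK gtr0_norm.
- by apply/eqP; lra.
- by apply/andP; split; lra.
Qed.

Lemma der01_lim (V : normedModType R) (h : R -> V) x (d : V) : in01 x ->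
  (forall e, 0 < e -> \forall r \near 0^'+, forall t, in01 t -> `|t - x| < r ->
     `|h t - h x - (t - x) *: d| <= e * `|t - x|) ->
  der01 h x = d.
Proof.
move=> x01 H; have P := within01_proper x01.
apply: cvg_lim; first exact: norm_hausdorff.
apply/cvgrPdist_le => e e0.
have [r r0 {}H] := right0_ex (H e e0).
rewrite near_withinE /dnbhs near_withinE.
apply/nbhs_ballP; exists r => //= t; rewrite /ball /= => tr nxt.
rewrite in_itv /= => t01.
have tx : t - x != 0 by rewrite subr_eq0.
rewrite -(ler_pM2l (_ : 0 < `|t - x|)) ?normr_gt0 // -normrZ scalerBr scalerA.
rewrite divff // scale1r distrC [_ * e]mulrC; apply: H => //.
by rewrite distrC.
Qed.

Lemma d1_sdiff (h g : R -> R -> R) x y a b : in01 x ->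
  (\forall r \near 0^'+, forall t, in01 t -> `|t - x| < r -> h t y = g t y) ->
  sdiff g x y a b -> d1 h x y = a.
Proof.
move=> x01 E H; apply: der01_lim => // e e0.
have := H e e0; move: E; apply: filterS2 => r E {}H t t01 tr.
have r0 : 0 < r by apply: le_lt_trans tr.
rewrite !E ?subrr ?normr0 //.
have := H x y t y (box_center x y r0).
by rewrite !subrr mulr0 addr0 normr0 addr0 [a * _]mulrC; apply; split; rewrite ?subrr ?normr0.
Qed.

Lemma d2_sdiff (h g : R -> R -> R) x y a b : in01 y ->
  (\forall r \near 0^'+, forall t, in01 t -> `|t - y| < r -> h x t = g x t) ->
  sdiff g x y a b -> d2 h x y = b.
Proof.
by move=> y01 E H; apply: (@d1_sdiff (fun x y => h y x) (fun x y => g y x) y x b a) => //;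
  apply: sdiff_swap.
Qed.

Definition row2 (a b : R) : 'rV[R]_2 := \row_c (if c == 0 then a else b).

Lemma row2E (z : 'rV[R]_2) : z = row2 (z 0 0) (z 0 1).
Proof.
apply/rowP => c; rewrite !mxE; case: eqVneq => [->//|].
by case: c => -[|[|c]] //= H _; congr (z _ _); apply/val_inj.
Qed.

Lemma row2_0 a b : row2 a b 0 0 = a. Proof. by rewrite mxE. Qed.
Lemma row2_1 a b : row2 a b 0 1 = b. Proof. by rewrite mxE. Qed.

Lemma row2_norm (z : 'rV[R]_2) r : 0 <= r ->
  (`|z| <= r) = (`|z 0 0| <= r) && (`|z 0 1| <= r).
Proof.
have nE : `|z| = \big[Num.max/0]_ij `|z ij.1 ij.2| := mx_normrE z.
move=> r0; apply/idP/andP => [h|[h0 h1]].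
  by split; apply: le_trans h; rewrite nE;
    [apply: (le_bigmax _ _ (0, 0))|apply: (le_bigmax _ _ (0, 1))].
rewrite nE; apply/bigmax_leP; split => // -[i j] _ /=.
rewrite ord1; case: j => -[|[|j]] //= H.
  by apply: le_trans h0; rewrite le_eqVlt; apply/orP; left; apply/eqP; congr (`|z _ _|); exact/val_inj.
by apply: le_trans h1; rewrite le_eqVlt; apply/orP; left; apply/eqP; congr (`|z _ _|); exact/val_inj.
Qed.

Lemma row2_normlt (z : 'rV[R]_2) r : 0 < r ->
  (`|z| < r) = (`|z 0 0| < r) && (`|z 0 1| < r).
Proof.
move=> r0; apply/idP/andP => [h|[h0 h1]].
  have := lexx `|z|; rewrite row2_norm // => /andP[a b].
  by split; [apply: le_lt_trans a h|apply: le_lt_trans b h].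
apply: (@le_lt_trans _ _ (Num.max `|z 0 0| `|z 0 1|)).
  by rewrite row2_norm ?le_max ?normr_ge0 // !lexx orbT.
by rewrite gt_max h0.
Qed.

Lemma near_row2 (z : 'rV[R]_2) (P : 'rV[R]_2 -> Prop) :
  (\forall z' \near z, P z') <->
  (\forall d \near 0^'+, forall a b, box (z 0 0) (z 0 1) d a b -> P (row2 a b)).
Proof.
split=> [/nbhs_ballP[r /= r0 H]|H].
  apply: (right0_le r0) => d /andP[d0 dr] a b [h1 h2]; apply: H.
  rewrite mx_norm_ball /ball_ /= row2_normlt // !mxE /=.
  by rewrite distrC (lt_le_trans h1) // distrC (lt_le_trans h2).
have [d d0 {}H] := right0_ex H.
apply/nbhs_ballP; exists d => //= z'; rewrite mx_norm_ball /ball_ /= row2_normlt // !mxE.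
move=> /andP[h1 h2]; rewrite [z']row2E; apply: H.
by split; rewrite distrC.
Qed.

Lemma d1_row (h : R -> R -> 'rV[R]_2) (g0 g1 : R -> R -> R) x y a0 b0 a1 b1 : in01 x ->
  (\forall r \near 0^'+, forall t, in01 t -> `|t - x| < r ->
    h t y = row2 (g0 t y) (g1 t y)) ->
  sdiff g0 x y a0 b0 -> sdiff g1 x y a1 b1 -> d1 h x y = row2 a0 a1.
Proof.
move=> x01 E H0 H1; apply: der01_lim => // e e0.
have := H1 e e0; have := H0 e e0; move: E; apply: filterS3 => r E {}H0 {}H1 t t01 tr.
have r0 : 0 < r by apply: le_lt_trans tr.
rewrite !E ?subrr ?normr0 //.
rewrite row2_norm ?mulr_ge0 // ?(ltW e0) // !mxE /=.
have bt : box x y r t y by split; rewrite ?subrr ?normr0.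
have := H0 x y t y (box_center x y r0) bt; have := H1 x y t y (box_center x y r0) bt.
by rewrite !subrr !mulr0 !addr0 normr0 !addr0 ![_ * (t - x)]mulrC => -> ->.
Qed.

Lemma sdiff_grad_cont (g : R -> R -> R) x y a b e : sdiff g x y a b -> 0 < e ->
  \forall d \near 0^'+, forall x' y' a' b', box x y d x' y' ->
    sdiff g x' y' a' b' -> `|a' - a| <= e /\ `|b' - b| <= e.
Proof.
move=> HH e0; have e2 : 0 < e / 2 by rewrite divr_gt0.
near=> d => x' y' a' b' q H'.
have H : forall x1 y1 x2 y2, box x y d x1 y1 -> box x y d x2 y2 ->
  `|g x2 y2 - g x1 y1 - (a * (x2 - x1) + b * (y2 - y1))| <= e / 2 * (`|x2 - x1| + `|y2 - y1|).
  by near: d; exact: HH.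
have d0 : 0 < d by near: d; exact: nbhs_right_gt.
have [r r0 {}H'] := right0_ex (H' _ e2).
have [s [s0 [b1 b2]] sr] : exists2 s, 0 < s /\ (box x y d (x' + s) y' /\ box x y d x' (y' + s)) & s < r.
  have : \forall s \near 0^'+, 0 < s /\ (box x y d (x' + s) y' /\ box x y d x' (y' + s)) /\ s < r.
    case: (q) => q1 q2; near=> s; split; first by near: s; exact: nbhs_right_gt.
    split; last by near: s; exact: nbhs_right_lt.
    have s0 : 0 < s by near: s; exact: nbhs_right_gt.
    split; split => //.
      rewrite addrAC (le_lt_trans (ler_normD _ _)) // (gtr0_norm s0) -ltrBrDl.
      by near: s; apply: nbhs_right_lt; rewrite subr_gt0.
    rewrite addrAC (le_lt_trans (ler_normD _ _)) // (gtr0_norm s0) -ltrBrDl.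
    by near: s; apply: nbhs_right_lt; rewrite subr_gt0.
  by move=> /right0_ex[s s0 [h1 [h2 h3]]]; exists s.
have s1 : `|s| = s by rewrite gtr0_norm.
have q0 := box_center x' y' r0.
have q1 : box x' y' r (x' + s) y' by split; rewrite ?subrr ?normr0 // addrC addKr s1.
have q2 : box x' y' r x' (y' + s) by split; rewrite ?subrr ?normr0 // addrC addKr s1.
have aux A B (D : R) : `|D - A * s| <= e / 2 * s -> `|D - B * s| <= e / 2 * s -> `|A - B| <= e.
  move=> h1 h2; rewrite -(ler_pM2r s0) -{1}s1 -normrM mulrBl.
  by rewrite -[A * s - _](subrKA D) [e](splitr) mulrDl (le_trans (ler_normD _ _)) // addrC lerD // distrC.
split.
  have := H' _ _ _ _ q0 q1; have := H _ _ _ _ q b1.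
  by rewrite subrr normr0 !mulr0 !addr0 [x' + s]addrC addrK s1 => h1 h2; exact: aux h2 h1.
have := H' _ _ _ _ q0 q2; have := H _ _ _ _ q b2.
by rewrite subrr normr0 !mulr0 !add0r [y' + s]addrC addrK s1 => h1 h2; exact: aux h2 h1.
Unshelve. all: by end_near. Qed.

Lemma sdiff_uniq (g : R -> R -> R) x y a b a' b' :
  sdiff g x y a b -> sdiff g x y a' b' -> a = a' /\ b = b'.
Proof.
move=> H H'.
have K e : 0 < e -> `|a' - a| <= e /\ `|b' - b| <= e.
  move=> e0; have [d d0 h] := right0_ex (sdiff_grad_cont H e0).
  exact: h (box_center _ _ d0) H'.
by split; apply/esym/eqP; rewrite -subr_eq0 -normr_le0; apply/ler_addgt0Pl => e e0;
   rewrite addr0; case: (K e e0).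
Qed.

Lemma sdiff_LB (F1 F2 : R -> R -> R) x0 y0 a1 b1 a2 b2 :
  sdiff F1 x0 y0 a1 b1 -> sdiff F2 x0 y0 a2 b2 -> a1 * b2 - b1 * a2 != 0 ->
  exists2 C, 0 < C & \forall d \near 0^'+, forall x y x' y',
    box x0 y0 d x y -> box x0 y0 d x' y' ->
    `|x' - x| + `|y' - y| <= C * (`|F1 x' y' - F1 x y| + `|F2 x' y' - F2 x y|).
Proof.
move=> H1 H2 J0; set J := a1 * b2 - _ in J0 *.
pose M : R := (`|a1| + `|b1| + `|a2| + `|b2|) / `|J| + 1.
have M0 : 0 < M by rewrite ltr_wpDl // divr_ge0 // !addr_ge0.
exists (2 * M); first by rewrite mulr_gt0.
have e0 : 0 < (4 * M)^-1 by rewrite invr_gt0 mulr_gt0.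
apply: filterS2 (H1 _ e0) (H2 _ e0) => d {}H1 {}H2 x y x' y' p q.
have := H1 _ _ _ _ p q; have := H2 _ _ _ _ p q.
set X := x' - x; set Y := y' - y; set f1 := F1 x' y' - _; set f2 := F2 x' y' - _.
set r1 := f1 - _; set r2 := f2 - _ => h2 h1.
have EX : X = (b2 * (f1 - r1) - b1 * (f2 - r2)) / J.
  by apply/eqP; rewrite eq_sym (can2_eq (mulfVK J0) (mulfK J0)); apply/eqP; rewrite /r1 /r2 /J; ring.
have EY : Y = (a1 * (f2 - r2) - a2 * (f1 - r1)) / J.
  by apply/eqP; rewrite eq_sym (can2_eq (mulfVK J0) (mulfK J0)); apply/eqP; rewrite /r1 /r2 /J; ring.
have nM A B u v : `|(A * u - B * v) / J| <= (`|A| * `|u| + `|B| * `|v|) / `|J|.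
  rewrite normrM normfV ler_wpM2r ?invr_ge0 // -!normrM.
  by rewrite (le_trans (ler_normB _ _)).
have n1 := ler_normB f1 r1; have n2 := ler_normB f2 r2.
have nX := nM b2 b1 (f1 - r1) (f2 - r2); have nY := nM a1 a2 (f2 - r2) (f1 - r1).
rewrite -EX in nX; rewrite -EY in nY.
have S : `|X| + `|Y| <= M * (`|f1 - r1| + `|f2 - r2|).
  apply: (@le_trans _ _ ((M - 1) * (`|f1 - r1| + `|f2 - r2|))); last first.
    by rewrite ler_wpM2r ?addr_ge0 // gerBl.
  apply: le_trans (lerD nX nY) _; rewrite /M addrK -mulrDl mulrAC ler_wpM2r ?invr_ge0 //.
  have := normr_ge0 a1; have := normr_ge0 a2; have := normr_ge0 b1; have := normr_ge0 b2.
  have := normr_ge0 (f1 - r1); have := normr_ge0 (f2 - r2).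
  move: `|a1| `|a2| `|b1| `|b2| `|f1 - r1| `|f2 - r2| => A A' B B' u v u0 v0 hB' hB hA' hA.
  have := mulr_ge0 hA u0; have := mulr_ge0 hA' u0; have := mulr_ge0 hB u0; have := mulr_ge0 hB' u0.
  have := mulr_ge0 hA v0; have := mulr_ge0 hA' v0; have := mulr_ge0 hB v0; have := mulr_ge0 hB' v0.
  by lra.
have S2 : `|X| + `|Y| <= M * (`|f1| + `|f2|) + 2^-1 * (`|X| + `|Y|).
  apply: le_trans S _.
  have -> : 2^-1 * (`|X| + `|Y|) = M * (2 * ((4 * M)^-1 * (`|X| + `|Y|))).
    by field; rewrite gt_eqF.
  rewrite -mulrDr ler_wpM2l ?(ltW M0) //.
  by move: n1 n2 h1 h2; clear; lra.
by move: S2; clear; lra.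
Qed.

Definition fdiff (f : 'rV[R]_2 -> R) (z : 'rV[R]_2) a b := forall e, 0 < e ->
  \forall d \near 0^'+, forall u v, box (z 0 0) (z 0 1) d u v ->
  `|f (row2 u v) - f z - (a * (u - z 0 0) + b * (v - z 0 1))| <=
    e * (`|u - z 0 0| + `|v - z 0 1|).

Lemma sdiff_fdiff (f : 'rV[R]_2 -> R) (z : 'rV[R]_2) a b :
  sdiff (fun u v => f (row2 u v)) (z 0 0) (z 0 1) a b -> fdiff f z a b.
Proof.
move=> H e e0; have [d0 d0_gt0 H0] := right0_ex (H e e0).
apply: (right0_le d0_gt0) => d /andP[dg dle] u v h.
have := H0 _ _ _ _ (box_center (z 0 0) (z 0 1) d0_gt0) (box_le dle h).
by rewrite -row2E.
Qed.

Lemma fdiff_cont (f : 'rV[R]_2 -> R) (z : 'rV[R]_2) a b : fdiff f z a b -> {for z, continuous f}.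
Proof.
move=> HH; apply/(@cvgrPdist_le R R _ (nbhs z) (nbhs_filter z)) => e e0.
apply/near_row2; near=> d => u v h.
have d0 : 0 < d by near: d; exact: nbhs_right_gt.
have K0 : forall u v, box (z 0 0) (z 0 1) d u v ->
  `|f (row2 u v) - f z - (a * (u - z 0 0) + b * (v - z 0 1))| <=
    1 * (`|u - z 0 0| + `|v - z 0 1|) by near: d; exact: HH.
have {K0}K := K0 u v h; rewrite distrC; move: K; set D := f _ - f z => K.
have : `|a * (u - z 0 0) + b * (v - z 0 1)| <= `|a| * `|u - z 0 0| + `|b| * `|v - z 0 1|.
  by rewrite -!normrM ler_normD.
have : (`|a| + `|b| + 2) * d < e.
  rewrite mulrC -ltr_pdivlMr ?ltr_wpDl ?addr_ge0 //; near: d; apply: nbhs_right_lt.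
  by rewrite divr_gt0 // ltr_wpDl ?addr_ge0.
have := ler_normD (D - (a * (u - z 0 0) + b * (v - z 0 1))) (a * (u - z 0 0) + b * (v - z 0 1)).
rewrite subrK; case: h => h1 h2 q1 q2 q3.
have := ler_wpM2l (normr_ge0 a) (ltW h1); have := ler_wpM2l (normr_ge0 b) (ltW h2).
by move: K h1 h2 q1 q2 q3; clear; lra.
Unshelve. all: by end_near. Qed.

Lemma fdiff_derive (f : 'rV[R]_2 -> R) (z : 'rV[R]_2) a b (c : 'I_2) : fdiff f z a b ->
  is_derive z (delta_mx 0 c) f (if c == 0 then a else b).
Proof.
move=> H.
have C : (fun h => h^-1 *: ((f \o shift z) (h *: (delta_mx 0 c : 'rV[R]_2)) - f z)) @ 0^' -->
   (if c == 0 then a else b).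
  apply/cvgrPdist_le => e e0; have [d d0 {}H] := right0_ex (H e e0).
  rewrite near_withinE; apply/nbhs_ballP; exists d => //= h.
  rewrite /ball /= sub0r normrN => hd h0.
  rewrite -(ler_pM2l (_ : 0 < `|h|)) ?normr_gt0 // -normrM mulrBr.
  rewrite -[h^-1 *: _]/(h^-1 * _) mulrA divff // mul1r distrC.
  have -> : h *: delta_mx 0 c + z = row2 (z 0 0 + (if c == 0 then h else 0))
     (z 0 1 + (if c == 0 then 0 else h)).
    rewrite [LHS]row2E; congr row2; rewrite !mxE eqxx /= addrC; congr (_ + _).
      by case: eqVneq; rewrite ?mulr1 ?mulr0.
    by case: (c) => -[|[|k]] //= ?; rewrite ?mulr1 ?mulr0.
  have := H (z 0 0 + (if c == 0 then h else 0)) (z 0 1 + (if c == 0 then 0 else h)).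
  rewrite [z 0 0 + _]addrC [z 0 1 + _]addrC !addrK; case: ifP => _.
    rewrite mulr0 normr0 !addr0 [a * h]mulrC [e * _]mulrC; apply.
    by split; rewrite addrK ?normr0.
  rewrite mulr0 normr0 !add0r [b * h]mulrC [e * _]mulrC; apply.
  by split; rewrite ?addrK ?subrr ?normr0.
by split; [apply/cvg_ex; eexists; exact: C|apply: cvg_lim].
Qed.

Lemma MVT_affine (f df : R -> R) x x' a e :
  (forall t, Num.min x x' <= t <= Num.max x x' -> is_derive t 1 f (df t) /\ `|df t - a| <= e) ->
  `|f x' - f x - a * (x' - x)| <= e * `|x' - x|.
Proof.
wlog xx : x x' / x <= x' => [hw H|].
  have [xx|/ltW xx] := leP x x'; first exact: hw.
  have := hw _ _ xx; rewrite minC maxC => /(_ H).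
  by rewrite -normrN [`|x' - x|]distrC; congr (`|_| <= _); ring.
rewrite (min_idPl xx) (max_idPr xx) => H.
have [||c] := @MVT_segment _ f df x x' xx.
- by move=> t; rewrite in_itv /= => /andP[/ltW h1 /ltW h2]; apply: (H t _).1; rewrite h1.
- apply: derivable_within_continuous => t; rewrite in_itv /= => h.
  by case: (H t h) => -[].
rewrite in_itv /= => /H[_ h] ->.
by rewrite -mulrBl normrM ler_wpM2r.
Qed.

End Der01.

(*FILE D*)
Section Smooth.
Variable R : realType.
Implicit Types (x y d e : R).
Local Notation F2 g := (fun u v => g (row2 u v)).

Lemma is_derive_row2 (g : 'rV[R]_2 -> R) (c : 'I_2) x y d :
  is_derive (row2 x y) (delta_mx 0 c) g d ->
  is_derive (if c == 0 then x else y) 1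
    (fun t => if c == 0 then g (row2 t y) else g (row2 x t)) d.
Proof.
move=> [h1 h2].
have E : (fun h : R => h^-1 *: (((fun t => if c == 0 then g (row2 t y) else g (row2 x t))
     \o shift (if c == 0 then x else y)) (h *: (1 : R)) -
     (fun t => if c == 0 then g (row2 t y) else g (row2 x t)) (if c == 0 then x else y))) =
   (fun h => h^-1 *: ((g \o shift (row2 x y)) (h *: (delta_mx 0 c : 'rV[R]_2)) - g (row2 x y))).
  apply/funext => h /=; congr (_ *: (_ - _)); last by case: (c == 0).
  rewrite [h *: delta_mx _ _ + _]row2E !mxE /= ?eqxx /= -[h *: 1]/(h * 1) mulr1.
  case: (eqVneq c 0) => [->|]; first by rewrite /= mulr1 mulr0 add0r.
  by case: (c) => -[|[|k]] //= ? _; rewrite mulr1 mulr0 add0r.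
by split; rewrite /derivable /derive E.
Qed.

Lemma sdiff_is_derive (g : R -> R -> R) x y a b : sdiff g x y a b ->
  is_derive x 1 (fun t => g t y) a /\ is_derive y 1 (g x) b.
Proof.
move=> H; pose f (z : 'rV[R]_2) := g (z 0 0) (z 0 1).
have Hf : fdiff f (row2 x y) a b.
  apply: sdiff_fdiff; rewrite row2_0 row2_1; apply: eq_sdiff H.
  by apply: (right0_le ltr01) => *; rewrite /f row2_0 row2_1.
split.
  have := is_derive_row2 (fdiff_derive 0 Hf); rewrite eqxx.
  by apply: (fun E X => eq_rect _ (fun h => is_derive x 1 h a) X _ E);
    apply/funext => t; rewrite /f row2_0 row2_1.
have := is_derive_row2 (fdiff_derive 1 Hf) => /=.
by apply: (fun E X => eq_rect _ (fun h => is_derive y 1 h b) X _ E);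
  apply/funext => t; rewrite /f row2_0 row2_1.
Qed.

Lemma open_box (U : set 'rV[R]_2) z : open U -> U z ->
  \forall d \near 0^'+, forall u v, box (z 0 0) (z 0 1) d u v -> U (row2 u v).
Proof. by move=> oU Uz; apply/near_row2; apply: open_nbhs_nbhs. Qed.

Lemma Ck1_sdiff (U : set 'rV[R]_2) g z : open U -> U z -> Ck 1 U g ->
  sdiff (F2 g) (z 0 0) (z 0 1) (pderiv 0 g z) (pderiv 1 g z).
Proof.
move=> oU Uz H e e0.
have cont c : \forall d \near 0^'+, forall u v, box (z 0 0) (z 0 1) d u v ->
   `|pderiv c g (row2 u v) - pderiv c g z| <= e.
  have [/= C _] := H [:: c] isT z Uz.
  have := (@cvgrPdist_le R R _ (nbhs z) (nbhs_filter z) (pderiv c g) (pderiv c g z)).1 C e e0.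
  move=> /near_row2; apply: filterS => d K u v h.
  by rewrite distrC; apply: K.
have dg c z' : U z' -> is_derive z' (delta_mx 0 c) g (pderiv c g z').
  by move=> Uz'; have [_ /(_ isT c)] := H [::] isT z' Uz'; exact: derivableP.
apply: filterS3 (open_box oU Uz) (cont 0) (cont 1) => d Ud C0 C1 x y x' y' p q.
have btw (s t u c : R) : `|s - c| < d -> `|t - c| < d -> Num.min s t <= u <= Num.max s t ->
   `|u - c| < d.
  rewrite !ltr_norml => /andP[a1 a2] /andP[b1 b2] /andP[].
  rewrite ge_min le_max => /orP h1 /orP h2; apply/andP.
  by case: h1 => h1; case: h2 => h2; split; lra.
have M1 := @MVT_affine R (fun t => g (row2 t y')) (fun t => pderiv 0 g (row2 t y'))
  x x' (pderiv 0 g z) e.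
have M2 := @MVT_affine R (fun t => g (row2 x t)) (fun t => pderiv 1 g (row2 x t))
  y y' (pderiv 1 g z) e.
have {}M1 : `|g (row2 x' y') - g (row2 x y') - pderiv 0 g z * (x' - x)| <= e * `|x' - x|.
  apply: M1 => t ht; have bt : box (z 0 0) (z 0 1) d t y'.
    by case: p q => p1 p2 [q1 q2]; split=> //; apply: btw ht.
  by split; [apply: (is_derive_row2 (c := 0) (dg 0 _ (Ud _ _ bt)))|exact: C0].
have {}M2 : `|g (row2 x y') - g (row2 x y) - pderiv 1 g z * (y' - y)| <= e * `|y' - y|.
  apply: M2 => t ht; have bt : box (z 0 0) (z 0 1) d x t.
    by case: p q => p1 p2 [q1 q2]; split=> //; apply: btw ht.
  by split; [apply: (is_derive_row2 (c := 1) (dg 1 _ (Ud _ _ bt)))|exact: C1].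
rewrite [e * _]mulrDr; apply: le_trans (lerD M1 M2); apply: le_trans (ler_normD _ _).
move: (g _) (g _) (g _) (pderiv 0 g z) (pderiv 1 g z) => g1 g2 g3 p0 p1.
by rewrite le_eqVlt; apply/orP; left; apply/eqP; congr (`|_|); ring.
Qed.

Lemma pderivs_cat s s' (g : 'rV[R]_2 -> R) : pderivs (s ++ s') g = pderivs s (pderivs s' g).
Proof. by rewrite /pderivs foldr_cat. Qed.

Lemma smooth_on_pderivs (U : set 'rV[R]_2) g s : smooth_on U g -> smooth_on U (pderivs s g).
Proof.
move=> H k s' ks z Uz; rewrite -pderivs_cat.
have := H (k + size s)%N (s' ++ s); rewrite size_cat leq_add2r ltn_add2r.
by move=> /(_ ks z Uz).
Qed.

Lemma smooth_sdiff (U : set 'rV[R]_2) g z : open U -> U z -> smooth_on U g ->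
  sdiff (F2 g) (z 0 0) (z 0 1) (pderiv 0 g z) (pderiv 1 g z).
Proof. by move=> oU Uz H; apply: (Ck1_sdiff oU Uz (H 1%N)). Qed.

Lemma mixed_sdiff_eq (f f0 f1 : R -> R -> R) x y p q r s :
  (\forall d \near 0^'+, forall u v, box x y d u v ->
     is_derive u 1 (fun t => f t v) (f0 u v) /\ is_derive v 1 (f u) (f1 u v)) ->
  sdiff f0 x y p q -> sdiff f1 x y r s -> q = r.
Proof.
move=> Hd H0 H1; apply/esym/eqP.
rewrite -subr_eq0 -normr_le0; apply/ler_addgt0Pl => e e0; rewrite addr0.
have e2 : 0 < e / 2 by rewrite divr_gt0.
have [d d0 [dg [K0 K1]]] := right0_ex (filterI Hd (filterI (H0 _ e2) (H1 _ e2))).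
pose h := d / 2; have h0 : 0 < h by rewrite divr_gt0.
have hd : h < d by rewrite /h; lra.
have near0 t c : c <= t <= c + h -> `|t - c| < d.
  by move=> /andP[t1 t2]; rewrite ger0_norm ?subr_ge0 //; lra.
have xh : Num.min x (x + h) = x /\ Num.max x (x + h) = x + h.
  by rewrite (min_idPl _) ?(max_idPr _) // lerDl ltW.
have yh : Num.min y (y + h) = y /\ Num.max y (y + h) = y + h.
  by rewrite (min_idPl _) ?(max_idPr _) // lerDl ltW.
have self (c : R) : `|c - c| < d by rewrite subrr normr0.
have selfh (c : R) : `|c + h - c| < d by apply: near0; rewrite lexx lerDl ltW.
have M0 := @MVT_affine R (fun t => f t (y + h) - f t y)
  (fun t => f0 t (y + h) - f0 t y) x (x + h) (q * h) (e / 2 * h).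
have M1 := @MVT_affine R (fun t => f (x + h) t - f x t)
  (fun t => f1 (x + h) t - f1 x t) y (y + h) (r * h) (e / 2 * h).
have hE (c : R) : c + h - c = h by rewrite addrC addKr.
have {}M0 : `|f (x + h) (y + h) - f (x + h) y - (f x (y + h) - f x y)
   - q * h * h| <= e / 2 * h * h.
  move: M0; rewrite (hE x) (gtr0_norm h0); apply; rewrite xh.1 xh.2 => t ht; split.
    by apply: is_deriveB; [case: (dg t (y + h))|case: (dg t y)] => //; split=> //; apply: near0.
  have := K0 t y t (y + h); rewrite (hE y) [t - t]subrr mulr0 add0r normr0 add0r (gtr0_norm h0).
  by apply; split => //; apply: near0.
have {}M1 : `|f (x + h) (y + h) - f x (y + h) - (f (x + h) y - f x y)
   - r * h * h| <= e / 2 * h * h.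
  move: M1; rewrite (hE y) (gtr0_norm h0); apply; rewrite yh.1 yh.2 => t ht; split.
    by apply: is_deriveB; [case: (dg (x + h) t)|case: (dg x t)] => //; split=> //; apply: near0.
  have := K1 x t (x + h) t; rewrite (hE x) [t - t]subrr mulr0 addr0 normr0 addr0 (gtr0_norm h0).
  by apply; split => //; apply: near0.
rewrite -(ler_pM2r (mulr_gt0 h0 h0)) -{1}(gtr0_norm (mulr_gt0 h0 h0)) -normrM.
set D := f _ _ - f _ _ - _ in M0.
have {}M1 : `|D - r * h * h| <= e / 2 * h * h.
  by move: M1; congr (`|_| <= _); rewrite /D; ring.
have -> : (r - q) * (h * h) = (D - q * h * h) - (D - r * h * h) by ring.
have -> : e * (h * h) = e / 2 * h * h + e / 2 * h * h by field.
by apply: le_trans (ler_normB _ _) _; rewrite lerD.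
Qed.

Lemma schwarz (U : set 'rV[R]_2) g z : open U -> U z -> smooth_on U g ->
  pderiv 0 (pderiv 1 g) z = pderiv 1 (pderiv 0 g) z.
Proof.
move=> oU Uz H; apply/esym.
have H0 := smooth_sdiff oU Uz (smooth_on_pderivs [:: 0] H).
have H1 := smooth_sdiff oU Uz (smooth_on_pderivs [:: 1] H).
apply: (mixed_sdiff_eq (f := F2 g)) H0 H1.
apply: filterS (open_box oU Uz) => d Ud u v b.
by have := sdiff_is_derive (smooth_sdiff oU (Ud _ _ b) H); rewrite row2_0 row2_1.
Qed.

End Smooth.

(*FILE E*)
Section Rect.
Variables (R : realType) (xl xr yl yr : R).
Implicit Types (x y d e r : R).

Definition rect x y := xl <= x <= xr /\ yl <= y <= yr.

Lemma nbhs_box x y r : 0 < r -> nbhs ((x, y) : R * R) [set u | box x y r u.1 u.2].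
Proof.
move=> r0; apply/nbhs_ballP; exists r => //= u [h1 h2].
by split; rewrite distrC.
Qed.

Lemma rect_cover (P : R -> R -> R -> Prop) :
  (forall x y, rect x y -> exists2 r0, 0 < r0 & forall r x' y', 0 < r <= r0 ->
     rect x' y' -> box x y r0 x' y' -> P r x' y') ->
  \forall r \near 0^'+, forall x y, rect x y -> P r x y.
Proof.
move=> H.
have C : compact (`[xl, xr] `*` `[yl, yr] : set (R * R)).
  by apply: compact_setX; apply: segment_compact.
have K := (compact_near_coveringP _).1 C R (0 : R)^'+ (fun r u => rect u.1 u.2 -> P r u.1 u.2) _.
have {}K : \forall r \near (0 : R)^'+, (`[xl, xr] `*` `[yl, yr] : set (R * R)) `<=`
    (fun u => rect u.1 u.2 -> P r u.1 u.2).
  apply: K => -[x y] /= [hx hy].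
  have [|r0 r00 K] := H x y; first by move: hx hy; rewrite /= !in_itv.
  exists ([set u | box x y r0 u.1 u.2], [set r | 0 < r <= r0]).
    split; first exact: nbhs_box.
    by apply: (right0_le r00).
  by move=> [u r] /= [h1 h2] h3; apply: K.
apply: filterS K => r K x y h; apply: (K (x, y)).
  by case: (h); split; rewrite /= in_itv.
exact: h.
Qed.

Definition cont2 (g : R -> R -> R) := forall x y e, 0 < e ->
  \forall d \near 0^'+, forall x' y', box x y d x' y' -> `|g x' y' - g x y| < e.

Lemma rect_min (g : R -> R -> R) : cont2 g -> xl <= xr -> yl <= yr ->
  exists x y, rect x y /\ forall x' y', rect x' y' -> g x y <= g x' y'.
Proof.
move=> cg hx hy.
have C : compact (`[xl, xr] `*` `[yl, yr] : set (R * R)).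
  by apply: compact_setX; apply: segment_compact.
have cont : continuous (fun u : R * R => g u.1 u.2).
  move=> [x y]; apply/cvgrPdist_le => e e0 /=.
  have [d d0 K] := right0_ex (cg x y e e0).
  apply: filterS (nbhs_box x y d0) => u /= h.
  by rewrite distrC ltW // K.
have [||[x y] hxy K] := @compact_EVT_min _ R (fun u : R * R => g u.1 u.2) _ _ C.
- by exists (xl, yl); split; rewrite /= in_itv /= lexx.
- exact: continuous_subspaceT.
exists x, y; split.
  by move: hxy; rewrite inE => -[]; rewrite /= !in_itv.
move=> x' y' [h1 h2]; apply: (K (x', y')).
by rewrite inE; split; rewrite /= in_itv.
Qed.

Lemma rect_fiber (F1 F2 : R -> R -> R) (z1 z2 : R) (Q : R -> R -> Prop) :
  cont2 F1 -> cont2 F2 ->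
  (forall x y, rect x y -> F1 x y = z1 -> F2 x y = z2 ->
    \forall r \near 0^'+, forall x' y', rect x' y' -> box x y r x' y' -> Q x' y') ->
  \forall r \near 0^'+, forall x y, rect x y -> box z1 z2 r (F1 x y) (F2 x y) -> Q x y.
Proof.
move=> c1 c2 H.
apply: (rect_cover (P := fun r x y => box z1 z2 r (F1 x y) (F2 x y) -> Q x y)).
move=> x y xy.
have sep (F : R -> R -> R) z : cont2 F -> F x y != z -> exists2 r0, 0 < r0 & forall r x' y',
    0 < r <= r0 -> box x y r0 x' y' -> `|F x' y' - z| < r -> False.
  move=> cF nz; have e0 : 0 < `|F x y - z| / 2 by rewrite divr_gt0 // normr_gt0 subr_eq0.
  have [d d0 K] := right0_ex (cF x y _ e0).
  exists (Num.min d (`|F x y - z| / 2)); first by rewrite lt_min d0.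
  move=> r x' y' /andP[_]; rewrite le_min => /andP[rd re] b hr.
  have := K x' y' (box_le _ b); rewrite ge_min lexx => /(_ isT) h1.
  have := ler_normD (F x y - F x' y') (F x' y' - z); rewrite subrKA.
  by rewrite distrC in h1; lra.
have [E1|n1] := eqVneq (F1 x y) z1; last first.
  have [r0 r00 K] := sep F1 z1 c1 n1; exists r0 => // r x' y' hr _ b [b1 _].
  by case: (K _ _ _ hr b b1).
have [E2|n2] := eqVneq (F2 x y) z2; last first.
  have [r0 r00 K] := sep F2 z2 c2 n2; exists r0 => // r x' y' hr _ b [_ b2].
  by case: (K _ _ _ hr b b2).
have [r0 r00 K] := right0_ex (H x y xy E1 E2).
by exists r0 => // r x' y' _ xy' b _; apply: K.
Qed.

End Rect.

Section Nearest.
Variable R : realType.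
Implicit Types (x y d e r : R) (K : R -> R -> Prop).

Definition tangent K (m1 m2 v1 v2 : R) := forall e, 0 < e ->
  exists2 t, 0 < t <= e & exists m1' m2', [/\ K m1' m2',
    `|m1' - m1 - t * v1| <= e * t & `|m2' - m2 - t * v2| <= e * t].

Definition nearest K q1 q2 m1 m2 := K m1 m2 /\
  forall m1' m2', K m1' m2' ->
    (q1 - m1) ^+ 2 + (q2 - m2) ^+ 2 <= (q1 - m1') ^+ 2 + (q2 - m2') ^+ 2.

Definition has_nearest K := forall q1 q2, exists m1 m2, nearest K q1 q2 m1 m2.

Lemma nearest_tangent K q1 q2 m1 m2 v1 v2 : nearest K q1 q2 m1 m2 ->
  tangent K m1 m2 v1 v2 -> (q1 - m1) * v1 + (q2 - m2) * v2 <= 0.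
Proof.
move=> [_ H] T; rewrite leNgt; apply/negP => s0.
set a := q1 - m1 in H s0; set b := q2 - m2 in H s0; set s := a * v1 + _ in s0.
pose M : R := 2 * (`|a| + `|b|) + 2 * (`|v1| + `|v2| + 2) ^+ 2 + 1.
have M0 : 0 < M by rewrite ltr_wpDl // addr_ge0 // mulr_ge0 // ?addr_ge0 ?sqr_ge0.
pose e := Num.min 1 (s / M).
have e0 : 0 < e by rewrite lt_min ltr01 divr_gt0.
have e1 : e <= 1 by rewrite ge_min lexx.
have eM : e * M <= s by rewrite -ler_pdivlMr // ge_min lexx orbT.
have [t /andP[t0 te] [m1' [m2' [Km h1 h2]]]] := T e e0.
have := H _ _ Km; set w1 := m1' - m1 - _ in h1; set w2 := m2' - m2 - _ in h2.
have -> : q1 - m1' = a - t * v1 - w1 by rewrite /w1 /a; ring.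
have -> : q2 - m2' = b - t * v2 - w2 by rewrite /w2 /b; ring.
have B1 : `|t * v1 + w1| <= t * (`|v1| + `|v2| + 2).
  apply: le_trans (ler_normD _ _) _; rewrite normrM (gtr0_norm t0).
  have := ler_pM (ltW e0) (ltW t0) e1 (lexx t); have := normr_ge0 v2; nra.
have B2 : `|t * v2 + w2| <= t * (`|v1| + `|v2| + 2).
  apply: le_trans (ler_normD _ _) _; rewrite normrM (gtr0_norm t0).
  have := ler_pM (ltW e0) (ltW t0) e1 (lexx t); have := normr_ge0 v1; nra.
have sq (u c : R) : `|u| <= c -> u ^+ 2 <= c ^+ 2.
  by move=> h; rewrite -(real_normK (num_real u)) ler_sqr ?nnegrE // (le_trans _ h).
have S1 := sq _ _ B1; have S2 := sq _ _ B2.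
have P1 : - (a * w1) <= `|a| * (e * t).
  by rewrite -mulrN (le_trans (ler_norm _)) // normrM normrN ler_wpM2l.
have P2 : - (b * w2) <= `|b| * (e * t).
  by rewrite -mulrN (le_trans (ler_norm _)) // normrM normrN ler_wpM2l.
set V := `|v1| + `|v2| + 2 in S1 S2.
move=> X.
have {}X : 2 * (t * s) <= - 2 * (a * w1) - 2 * (b * w2) + (t * v1 + w1) ^+ 2 + (t * v2 + w2) ^+ 2.
  by move: X; rewrite /s; clear; lra.
have Q : 2 * (t * s) <= t * (2 * (`|a| + `|b|) * e + 2 * t * V ^+ 2).
  by move: X P1 P2 S1 S2; clear; nra.
have Q2 : t * (2 * (`|a| + `|b|) * e + 2 * t * V ^+ 2) <= t * s.
  rewrite ler_wpM2l ?(ltW t0) //; apply: le_trans eM.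
  have : t * V ^+ 2 <= e * V ^+ 2 by rewrite ler_wpM2r ?sqr_ge0.
  by rewrite /M -/V; move: e0; clear; nra.
have : 0 < t * s by rewrite mulr_gt0.
by move: Q Q2; clear; lra.
Qed.

Lemma tangent_interior K z1 z2 : has_nearest K -> K z1 z2 ->
  (\forall r \near 0^'+, forall m1 m2, K m1 m2 -> box z1 z2 r m1 m2 ->
     forall v1 v2, tangent K m1 m2 v1 v2) ->
  \forall r \near 0^'+, forall q1 q2, box z1 z2 r q1 q2 -> K q1 q2.
Proof.
move=> N Kz /right0_ex[r r0 T]; near=> d => q1 q2 [b1 b2].
have [m1 [m2 nm]] := N q1 q2; have [Km M] := nm.
have dr : d < r / 4 by near: d; apply: nbhs_right_lt; rewrite divr_gt0.
have d0 : 0 < d by near: d; exact: nbhs_right_gt.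
have Mz := M _ _ Kz.
have sq2 (u : R) : `|u| < d -> u ^+ 2 < d ^+ 2.
  by move=> h; rewrite -[u ^+ 2]real_normK ?num_real // ltrXn2r // nnegrE.
have s1 := sq2 _ b1; have s2 := sq2 _ b2.
have small (u v : R) : u ^+ 2 + v ^+ 2 <= (q1 - z1) ^+ 2 + (q2 - z2) ^+ 2 -> `|u| < 2 * d.
  move=> h; rewrite -ltr_sqr ?nnegrE //; last by rewrite mulr_ge0 // ltW.
  by rewrite real_normK ?num_real //; have := sqr_ge0 v; nra.
have c1 := small _ _ Mz; rewrite addrC in Mz; have c2 := small _ _ Mz.
have bm : box z1 z2 r m1 m2.
  have tri (q z m : R) : `|q - z| < d -> `|q - m| < 2 * d -> `|m - z| < r.
    move=> h1 h2; have := ler_normD (m - q) (q - z); rewrite subrKA [`|m - q|]distrC; lra.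
  by split; [apply: tri c1|apply: tri c2].
have := nearest_tangent nm (T _ _ Km bm (q1 - m1) (q2 - m2)).
rewrite -!expr2 => h.
have u1 : (q1 - m1) ^+ 2 = 0 by have := sqr_ge0 (q1 - m1); have := sqr_ge0 (q2 - m2); lra.
have u2 : (q2 - m2) ^+ 2 = 0 by have := sqr_ge0 (q1 - m1); have := sqr_ge0 (q2 - m2); lra.
move/eqP: u1; move/eqP: u2; rewrite !expf_eq0 /= !subr_eq0 => /eqP -> /eqP ->.
exact: Km.
Unshelve. all: by end_near. Qed.

Lemma tangentW K K' m1 m2 v1 v2 : (forall x y, K x y -> K' x y) ->
  tangent K m1 m2 v1 v2 -> tangent K' m1 m2 v1 v2.
Proof.
move=> KK T e e0; have [t ht [m1' [m2' [h1 h2 h3]]]] := T e e0.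
by exists t => //; exists m1', m2'; split => //; apply: KK.
Qed.

Lemma has_nearestU K K' : has_nearest K -> has_nearest K' ->
  has_nearest (fun x y => K x y \/ K' x y).
Proof.
move=> N N' q1 q2; have [m1 [m2 [Km H]]] := N q1 q2; have [n1 [n2 [Kn H']]] := N' q1 q2.
have [h|h] := leP ((q1 - m1) ^+ 2 + (q2 - m2) ^+ 2) ((q1 - n1) ^+ 2 + (q2 - n2) ^+ 2).
  by exists m1, m2; split; [left|move=> a b [/H//|/H']; apply: le_trans].
by exists n1, n2; split; [right|move=> a b [/H|/H'//]; apply: le_trans; apply: ltW].
Qed.

End Nearest.

(*FILE F*)
Section C1fun.
Variable R : realType.
Implicit Types (g h : R -> R -> R).

Definition C1fun g gx gy := forall x y, sdiff g x y (gx x y) (gy x y).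

Lemma cont2P g : cont2 g <-> continuous (fun u : R * R => g u.1 u.2).
Proof.
split=> [cg [x y]|cg x y e e0].
  apply/cvgrPdist_lt => e e0 /=.
  have [d d0 K] := right0_ex (cg x y e e0).
  apply: filterS (nbhs_box x y d0) => u /= h.
  by rewrite distrC K.
have := cg (x, y) => /cvgrPdist_lt/(_ e e0)/nbhs_ballP[d /= d0 K].
apply: (right0_le d0) => d' /andP[d'0 dd] x' y' h.
rewrite distrC; apply: (K (x', y')).
by case: (box_le dd h); split; rewrite /ball /= distrC.
Qed.

Lemma cont2D g h : cont2 g -> cont2 h -> cont2 (fun x y => g x y + h x y).
Proof. by move=> /cont2P cg /cont2P ch; apply/cont2P => u; apply: cvgD; [exact: cg|exact: ch]. Qed.

Lemma cont2M g h : cont2 g -> cont2 h -> cont2 (fun x y => g x y * h x y).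
Proof. by move=> /cont2P cg /cont2P ch; apply/cont2P => u; apply: cvgM; [exact: cg|exact: ch]. Qed.

Lemma cont2N g : cont2 g -> cont2 (fun x y => - g x y).
Proof. by move=> /cont2P cg; apply/cont2P => u; apply: cvgN; exact: cg. Qed.

Lemma cont2C (c : R) : cont2 (fun _ _ => c).
Proof. by apply/cont2P => u; exact: cvg_cst. Qed.

Lemma cont2_gt0 g x y : cont2 g -> 0 < g x y ->
  \forall d \near 0^'+, forall x' y', box x y d x' y' -> 0 < g x' y'.
Proof.
move=> cg g0; apply: filterS (cg x y _ g0) => d H x' y' /H.
by rewrite ltr_norml => /andP[]; lra.
Qed.

Lemma C1_cont2 g gx gy : C1fun g gx gy -> [/\ cont2 g, cont2 gx & cont2 gy].
Proof.
move=> H; split=> x y e e0; first exact: sdiff_cont (H x y) e0.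
  have e2 : 0 < e / 2 by rewrite divr_gt0.
  apply: filterS (sdiff_grad_cont (H x y) e2) => d K x' y' b.
  by have [h _] := K _ _ _ _ b (H x' y'); apply: le_lt_trans h _; lra.
have e2 : 0 < e / 2 by rewrite divr_gt0.
apply: filterS (sdiff_grad_cont (H x y) e2) => d K x' y' b.
by have [_ h] := K _ _ _ _ b (H x' y'); apply: le_lt_trans h _; lra.
Qed.

End C1fun.

Section PatchMap.
Variables (R : realType) (F1 F1x F1y F2 F2x F2y : R -> R -> R).
Hypotheses (C1 : C1fun F1 F1x F1y) (C2 : C1fun F2 F2x F2y).
Local Notation J := (fun x y => F1x x y * F2y x y - F1y x y * F2x x y).

Lemma jac_cont2 : cont2 J.
Proof.
have [_ a b] := C1_cont2 C1; have [_ c d] := C1_cont2 C2.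
by apply: cont2D; [|apply: cont2N]; apply: cont2M.
Qed.

Lemma chart_strict h x y hx hy w1 w2 : sdiff h x y hx hy -> J x y != 0 ->
  hx = w1 * F1x x y + w2 * F2x x y -> hy = w1 * F1y x y + w2 * F2y x y ->
  forall e, 0 < e -> \forall d \near 0^'+, forall a b a' b',
    box x y d a b -> box x y d a' b' ->
    `|h a' b' - h a b - (w1 * (F1 a' b' - F1 a b) + w2 * (F2 a' b' - F2 a b))| <=
      e * (`|F1 a' b' - F1 a b| + `|F2 a' b' - F2 a b|).
Proof.
move=> H J0 E1 E2 e e0; rewrite {}E1 {}E2 in H.
have [C C0 L] := sdiff_LB (C1 x y) (C2 x y) J0.
have D : sdiff (fun a b => h a b + (-1) * (w1 * F1 a b + w2 * F2 a b)) x y 0 0.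
  have := sdiffD H (sdiffZ (-1) (sdiffD (sdiffZ w1 (C1 x y)) (sdiffZ w2 (C2 x y)))).
  by rewrite !mulN1r !subrr.
have eC : 0 < e / C by rewrite divr_gt0.
apply: filterS2 (D _ eC) L => d {}D {}L a b a' b' p q.
have := D _ _ _ _ p q; have := L _ _ _ _ p q.
rewrite !mul0r addr0 subr0 => l1; have := ler_wpM2l (ltW eC) l1.
rewrite mulrA divfK ?gt_eqF // => l2 l3; apply: le_trans (le_trans l3 l2).
by rewrite le_eqVlt; apply/orP; left; apply/eqP; congr (`|_|); ring.
Qed.

Lemma chart_gradient x y hx hy : J x y != 0 -> exists w1 w2,
  hx = w1 * F1x x y + w2 * F2x x y /\ hy = w1 * F1y x y + w2 * F2y x y.
Proof.
move=> J0; exists ((hx * F2y x y - hy * F2x x y) / J x y), ((hy * F1x x y - hx * F1y x y) / J x y).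
by split; field.
Qed.

Section OnRect.
Variables xl xr yl yr : R.
Hypotheses (hx : xl <= xr) (hy : yl <= yr).
Local Notation rect := (rect xl xr yl yr).

Definition rimage (a b : R) := exists x y, [/\ rect x y, a = F1 x y & b = F2 x y].

Lemma rimage_nearest : has_nearest rimage.
Proof.
move=> q1 q2.
have [c1 _ _] := C1_cont2 C1; have [c2 _ _] := C1_cont2 C2.
have sq (q : R) (F : R -> R -> R) : cont2 F -> cont2 (fun x y => (q - F x y) ^+ 2).
  move=> cF; have H : cont2 (fun x y => q - F x y) by apply: cont2D; [exact: cont2C|exact: cont2N].
  exact: cont2M.
have [x [y [hxy K]]] := rect_min (cont2D (sq q1 _ c1) (sq q2 _ c2)) hx hy.
exists (F1 x y), (F2 x y); split; first by exists x, y.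
by move=> _ _ [x' [y' [/K h -> ->]]].
Qed.

Lemma rimage_tangent x y dx dy : rect x y ->
  (\forall t \near 0^'+, rect (x + t * dx) (y + t * dy)) ->
  tangent rimage (F1 x y) (F2 x y) (F1x x y * dx + F1y x y * dy) (F2x x y * dx + F2y x y * dy).
Proof.
move=> xy T e e0.
pose M : R := `|dx| + `|dy| + 1; have M0 : 0 < M by rewrite ltr_wpDl ?addr_ge0.
have eM : 0 < e / M by rewrite divr_gt0.
have [d d0 [K1 K2]] := right0_ex (filterI (C1 x y eM) (C2 x y eM)).
have : \forall t \near 0^'+, rect (x + t * dx) (y + t * dy) /\ t <= e /\ t < d / M.
  near=> t; split; first by near: t.
  split; first by near: t; exact: nbhs_right_le.
  by near: t; apply: nbhs_right_lt; rewrite divr_gt0.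
move=> /right0_ex[t t0 [rt [te td]]]; exists t; first by rewrite t0.
exists (F1 (x + t * dx) (y + t * dy)), (F2 (x + t * dx) (y + t * dy)).
have tM : t * M < d by rewrite -ltr_pdivlMr.
have n1 := normr_ge0 dx; have n2 := normr_ge0 dy.
have b : box x y d (x + t * dx) (y + t * dy).
  split; rewrite addrC addKr normrM (gtr0_norm t0); apply: le_lt_trans tM;
  by rewrite ler_wpM2l ?(ltW t0) // /M; lra.
have := K1 _ _ _ _ (box_center x y d0) b; have := K2 _ _ _ _ (box_center x y d0) b.
rewrite ![_ + t * _ - _]addrC !addKr !normrM (gtr0_norm t0).
have S : e / M * (t * `|dx| + t * `|dy|) <= e * t.
  have -> : e * t = e / M * (t * M) by field; rewrite gt_eqF.
  by rewrite ler_wpM2l ?(ltW eM) // -mulrDr ler_wpM2l ?(ltW t0) // /M lerDl.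
move=> h2 h1; split; first by exists (x + t * dx), (y + t * dy).
  apply: le_trans (le_trans h1 S).
  by rewrite le_eqVlt; apply/orP; left; apply/eqP; congr (`|_|); ring.
apply: le_trans (le_trans h2 S).
by rewrite le_eqVlt; apply/orP; left; apply/eqP; congr (`|_|); ring.
Unshelve. all: by end_near. Qed.

Definition rect_int x y := xl < x < xr /\ yl < y < yr.

Lemma rect_int_rect x y : rect_int x y -> rect x y.
Proof. by move=> [/andP[/ltW a /ltW b] /andP[/ltW c /ltW d]]; split; apply/andP. Qed.

Lemma rect_int_box x y : rect_int x y ->
  \forall d \near 0^'+, forall x' y', box x y d x' y' -> rect_int x' y'.
Proof.
move=> [/andP[a b] /andP[c d]]; near=> r => x' y' [].
have r1 : r < x - xl by near: r; apply: nbhs_right_lt; rewrite subr_gt0.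
have r2 : r < xr - x by near: r; apply: nbhs_right_lt; rewrite subr_gt0.
have r3 : r < y - yl by near: r; apply: nbhs_right_lt; rewrite subr_gt0.
have r4 : r < yr - y by near: r; apply: nbhs_right_lt; rewrite subr_gt0.
by rewrite !ltr_norml => /andP[? ?] /andP[? ?]; split; apply/andP; split; lra.
Unshelve. all: by end_near. Qed.

Lemma rimage_full_tangent x y v1 v2 : rect_int x y -> J x y != 0 ->
  tangent rimage (F1 x y) (F2 x y) v1 v2.
Proof.
move=> ri J0.
have [dx [dy [-> ->]]] : exists dx dy, v1 = F1x x y * dx + F1y x y * dy /\
    v2 = F2x x y * dx + F2y x y * dy.
  exists ((v1 * F2y x y - v2 * F1y x y) / J x y), ((v2 * F1x x y - v1 * F2x x y) / J x y).
  by split; field.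
apply: rimage_tangent; first exact: rect_int_rect.
have [d d0 K] := right0_ex (rect_int_box ri).
pose M : R := `|dx| + `|dy| + 1; have M0 : 0 < M by rewrite ltr_wpDl ?addr_ge0.
near=> t; apply/rect_int_rect/K.
have t0 : 0 < t by near: t; exact: nbhs_right_gt.
have tM : t * M < d by rewrite -ltr_pdivlMr //; near: t; apply: nbhs_right_lt; rewrite divr_gt0.
have n1 := normr_ge0 dx; have n2 := normr_ge0 dy.
by split; rewrite addrC addKr normrM (gtr0_norm t0); apply: le_lt_trans tM;
  rewrite ler_wpM2l ?(ltW t0) // /M; lra.
Unshelve. all: by end_near. Qed.

Hypothesis inj : forall x y x' y', rect x y -> rect x' y' ->
  F1 x y = F1 x' y' -> F2 x y = F2 x' y' -> x = x' /\ y = y'.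

Lemma rimage_near x y (Q : R -> R -> Prop) : rect x y ->
  (\forall r \near 0^'+, forall x' y', rect x' y' -> box x y r x' y' -> Q x' y') ->
  \forall r \near 0^'+, forall x' y', rect x' y' ->
    box (F1 x y) (F2 x y) r (F1 x' y') (F2 x' y') -> Q x' y'.
Proof.
move=> xy H; have [c1 _ _] := C1_cont2 C1; have [c2 _ _] := C1_cont2 C2.
apply: rect_fiber => // x' y' xy' E1 E2.
by have [-> ->] := inj xy' xy E1 E2.
Qed.

Hypothesis J0 : forall x y, rect_int x y -> J x y != 0.

Lemma rimage_open x y (Q : R -> R -> Prop) : rect_int x y ->
  (\forall r \near 0^'+, forall x' y', rect x' y' -> box x y r x' y' -> Q x' y') ->
  \forall r \near 0^'+, forall a b, box (F1 x y) (F2 x y) r a b ->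
    exists x' y', [/\ rect x' y', Q x' y', a = F1 x' y' & b = F2 x' y'].
Proof.
move=> ri HQ; have rr := rect_int_rect ri.
have T : \forall r \near 0^'+, forall m1 m2, rimage m1 m2 -> box (F1 x y) (F2 x y) r m1 m2 ->
     forall v1 v2, tangent rimage m1 m2 v1 v2.
  have : \forall r \near 0^'+, forall x' y', rect x' y' ->
     box (F1 x y) (F2 x y) r (F1 x' y') (F2 x' y') -> rect_int x' y'.
    apply: rimage_near => //; apply: filterS (rect_int_box ri) => r K x' y' _; exact: K.
  apply: filterS => r K m1 m2 [x' [y' [r' -> ->]]] b v1 v2.
  by have ri' := K _ _ r' b; apply: rimage_full_tangent => //; exact: J0.
have Kz : rimage (F1 x y) (F2 x y) by exists x, y.
apply: filterS2 (tangent_interior rimage_nearest Kz T) (rimage_near rr HQ).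
move=> r K1 K2 a b hb; have [x' [y' [r' E1 E2]]] := K1 _ _ hb.
by exists x', y'; split => //; apply: K2 => //; rewrite -E1 -E2.
Qed.

Lemma chart_sdiff (f h : R -> R -> R) x y hx' hy' w1 w2 : rect_int x y ->
  (forall x y, rect_int x y -> f (F1 x y) (F2 x y) = h x y) ->
  sdiff h x y hx' hy' ->
  hx' = w1 * F1x x y + w2 * F2x x y -> hy' = w1 * F1y x y + w2 * F2y x y ->
  sdiff f (F1 x y) (F2 x y) w1 w2.
Proof.
move=> ri fh H E1 E2 e e0.
have [d d0 [S I]] := right0_ex (filterI (chart_strict H (J0 ri) E1 E2 e0) (rect_int_box ri)).
have : \forall r \near 0^'+, forall a b, box (F1 x y) (F2 x y) r a b ->
    exists x' y', [/\ rect x' y', box x y d x' y', a = F1 x' y' & b = F2 x' y'].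
  apply: rimage_open => //; apply: (right0_le d0) => r /andP[_ rd] x' y' _.
  exact: box_le.
apply: filterS => r K a b a' b' /K[u [v [_ p -> ->]]] /K[u' [v' [_ q -> ->]]].
by rewrite !fh; [apply: S|apply: I|apply: I].
Qed.

End OnRect.

Section Enlarge.
Variables xl xr yl yr : R.
Hypotheses (hx : xl <= xr) (hy : yl <= yr).
Local Notation rct := (rect xl xr yl yr).
Hypothesis inj : forall x y x' y', rct x y -> rct x' y' ->
  F1 x y = F1 x' y' -> F2 x y = F2 x' y' -> x = x' /\ y = y'.
Hypothesis J0 : forall x y, rct x y -> 0 < J x y.

Lemma inj_pair x y a b : rct x y -> rct a b ->
  \forall r \near 0^'+, forall x' y' a' b', box x y r x' y' -> box a b r a' b' ->
    F1 x' y' = F1 a' b' -> F2 x' y' = F2 a' b' -> x' = a' /\ y' = b'.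
Proof.
move=> xy ab.
have sep (F : R -> R -> R) : cont2 F -> F x y != F a b ->
    \forall r \near 0^'+, forall x' y' a' b', box x y r x' y' -> box a b r a' b' ->
    F x' y' = F a' b' -> False.
  move=> cF n; have e0 : 0 < `|F x y - F a b| / 2 by rewrite divr_gt0 // normr_gt0 subr_eq0.
  apply: filterS2 (cF x y _ e0) (cF a b _ e0) => r H1 H2 x' y' a' b' /H1 h1 /H2 h2 E.
  rewrite E in h1; have := ler_normD (F x y - F a' b') (F a' b' - F a b); rewrite subrKA.
  by rewrite distrC in h1; lra.
have [c1 _ _] := C1_cont2 C1; have [c2 _ _] := C1_cont2 C2.
have [E1|n1] := eqVneq (F1 x y) (F1 a b); last first.
  by apply: filterS (sep _ c1 n1) => r H x' y' a' b' p q E; case: (H _ _ _ _ p q E).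
have [E2|n2] := eqVneq (F2 x y) (F2 a b); last first.
  by apply: filterS (sep _ c2 n2) => r H x' y' a' b' p q _ E; case: (H _ _ _ _ p q E).
have [<- <-] := inj xy ab E1 E2.
have [C C0 L] := sdiff_LB (C1 x y) (C2 x y) (lt0r_neq0 (J0 xy)).
apply: filterS L => r K x' y' a' b' p q e1 e2; have := K _ _ _ _ p q.
rewrite e1 e2 !subrr !normr0 addr0 mulr0 => h.
have := normr_ge0 (a' - x'); have := normr_ge0 (b' - y') => h1 h2.
have /eqP : `|a' - x'| = 0 by lra.
have /eqP : `|b' - y'| = 0 by lra.
by rewrite !normr_eq0 !subr_eq0 => /eqP -> /eqP ->.
Qed.

Lemma enlarge : exists2 d, 0 < d &
  (forall x y x' y', rect (xl - d) (xr + d) (yl - d) (yr + d) x y ->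
     rect (xl - d) (xr + d) (yl - d) (yr + d) x' y' ->
     F1 x y = F1 x' y' -> F2 x y = F2 x' y' -> x = x' /\ y = y') /\
  (forall x y, rect (xl - d) (xr + d) (yl - d) (yr + d) x y -> 0 < J x y).
Proof.
have HJ : \forall r \near 0^'+, forall x y, rct x y -> forall x' y', box x y r x' y' -> 0 < J x' y'.
  apply: (rect_cover (P := fun r x y => forall x' y', box x y r x' y' -> 0 < J x' y')).
  move=> x y xy; have [d d0 K] := right0_ex (cont2_gt0 jac_cont2 (J0 xy)).
  exists (d / 2); first by rewrite divr_gt0.
  move=> r x' y' /andP[_ rd] _ [b1 b2] x'' y'' [b3 b4]; apply: K.
  split.
    by have := ler_normD (x'' - x') (x' - x); rewrite subrKA; lra.
  by have := ler_normD (y'' - y') (y' - y); rewrite subrKA; lra.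
have HI : \forall r \near 0^'+, forall x y, rct x y -> forall a b, rct a b ->
   forall x' y' a' b', box x y r x' y' -> box a b r a' b' ->
    F1 x' y' = F1 a' b' -> F2 x' y' = F2 a' b' -> x' = a' /\ y' = b'.
  apply: (rect_cover (P := fun r x y => forall a b, rct a b ->
     forall x' y' a' b', box x y r x' y' -> box a b r a' b' ->
    F1 x' y' = F1 a' b' -> F2 x' y' = F2 a' b' -> x' = a' /\ y' = b')).
  move=> x y xy.
  have : \forall r \near 0^'+, forall a b, rct a b -> forall x' y' a' b', box x y r x' y' ->
      box a b r a' b' ->
    F1 x' y' = F1 a' b' -> F2 x' y' = F2 a' b' -> x' = a' /\ y' = b'.
    apply: (rect_cover (P := fun r a b => forall x' y' a' b', box x y r x' y' -> box a b r a' b' ->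
     F1 x' y' = F1 a' b' -> F2 x' y' = F2 a' b' -> x' = a' /\ y' = b')).
    move=> a b ab; have [d d0 K] := right0_ex (inj_pair xy ab).
    exists (d / 2); first by rewrite divr_gt0.
    move=> r a1 b1 /andP[_ rd] _ [p1 p2] x' y' a' b' hb [q1 q2]; apply: K.
      by apply: box_le hb; lra.
    split.
      by have := ler_normD (a' - a1) (a1 - a); rewrite subrKA; lra.
    by have := ler_normD (b' - b1) (b1 - b); rewrite subrKA; lra.
  move=> /right0_ex[d d0 K].
  exists (d / 2); first by rewrite divr_gt0.
  move=> r x1 y1 /andP[_ rd] _ [p1 p2] a b ab x' y' a' b' [q1 q2] hb; apply: (K a b ab).
    split.
      by have := ler_normD (x' - x1) (x1 - x); rewrite subrKA; lra.
    by have := ler_normD (y' - y1) (y1 - y); rewrite subrKA; lra.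
  by apply: box_le hb; lra.
have [r r0 [{}HJ {}HI]] := right0_ex (filterI HJ HI).
exists (r / 2); first by rewrite divr_gt0.
have r2 : 0 < r / 2 by rewrite divr_gt0.
have rr : r / 2 < r by lra.
have clamp1 (l u x : R) : l <= u -> l - r / 2 <= x <= u + r / 2 ->
    exists2 x', l <= x' <= u & `|x - x'| < r.
  move=> lu /andP[h1 h2]; have [h|h] := ltP x l.
    by exists l; rewrite ?lexx // distrC ger0_norm ?subr_ge0 ?ltW //; lra.
  have [h'|h'] := ltP u x; last by exists x; rewrite ?h // subrr normr0.
  by exists u; rewrite ?lexx ?lu // ger0_norm ?subr_ge0 ?ltW //; lra.
have clamp x y : rect (xl - r / 2) (xr + r / 2) (yl - r / 2) (yr + r / 2) x y ->
    exists x' y', rct x' y' /\ box x' y' r x y.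
  move=> [h1 h2]; have [x' ? ?] := clamp1 _ _ _ hx h1.
  by have [y' ? ?] := clamp1 _ _ _ hy h2; exists x', y'.
split=> [x y x' y' /clamp[a [b [h1 h2]]] /clamp[a' [b' [h3 h4]]]|x y /clamp[a [b [h1 h2]]]].
  exact: (HI _ _ h1 _ _ h3).
exact: (HJ _ _ h1).
Qed.

End Enlarge.

End PatchMap.

(*FILE G*)
Section Sk.
Variables (R : realType) (D : R -> R -> Prop).
Implicit Types g h : R -> R -> R.

Fixpoint Sk (k : nat) g : Prop :=
  if k is k'.+1 then exists gx gy,
    [/\ forall x y, D x y -> sdiff g x y (gx x y) (gy x y), Sk k' gx & Sk k' gy]
  else True.

Lemma SkW k g : Sk k.+1 g -> Sk k g.
Proof.
elim: k g => [//|k IH] g [gx [gy [h1 h2 h3]]].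
by exists gx, gy; split => //; apply: IH.
Qed.

Lemma SkD k g h : Sk k g -> Sk k h -> Sk k (fun x y => g x y + h x y).
Proof.
elim: k g h => [//|k IH] g h [gx [gy [h1 h2 h3]]] [hx [hy [h1' h2' h3']]].
exists (fun x y => gx x y + hx x y), (fun x y => gy x y + hy x y); split; try exact: IH.
by move=> x y d; apply: sdiffD; [exact: h1|exact: h1'].
Qed.

Lemma SkM k g h : Sk k g -> Sk k h -> Sk k (fun x y => g x y * h x y).
Proof.
elim: k g h => [//|k IH] g h Sg Sh; have := SkW Sg; have := SkW Sh.
move: Sg Sh => [gx [gy [h1 h2 h3]]] [hx [hy [h1' h2' h3']]] Sh Sg.
exists (fun x y => h x y * gx x y + g x y * hx x y),
  (fun x y => h x y * gy x y + g x y * hy x y).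
split; try by apply: SkD; apply: IH.
by move=> x y d; apply: sdiffM; [exact: h1|exact: h1'].
Qed.

Lemma SkC k (c : R) : Sk k (fun _ _ => c).
Proof.
elim: k c => [//|k IH] c; exists (fun _ _ => 0), (fun _ _ => 0); split=> //.
by move=> x y _; exact: sdiff_cst.
Qed.

Lemma SkN k g : Sk k g -> Sk k (fun x y => - g x y).
Proof.
elim: k g => [//|k IH] g [gx [gy [h1 h2 h3]]].
exists (fun x y => - gx x y), (fun x y => - gy x y); split; try exact: IH.
move=> x y d; have := sdiffZ (-1) (h1 x y d); rewrite !mulN1r.
by apply: eq_sdiff; apply: (right0_le ltr01) => *; rewrite mulN1r.
Qed.

Lemma SkV k g : (forall x y, D x y -> g x y != 0) -> Sk k g -> Sk k (fun x y => (g x y)^-1).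
Proof.
move=> g0; elim: k => [//|k IH] Sg; have := SkW Sg; move: Sg => [gx [gy [h1 h2 h3]]] Sg.
have SV := IH Sg.
exists (fun x y => - ((g x y)^-1 * (g x y)^-1 * gx x y)),
       (fun x y => - ((g x y)^-1 * (g x y)^-1 * gy x y)).
split; try by apply: SkN; apply: SkM => //; exact: SkM.
move=> x y d.
have := sdiff_comp (sdiff_inv (0 : R) (g0 x y d)) (h1 x y d) (sdiff_cst 0 x y).
by rewrite !mul0r !addr0 !mulNr expr2 invfM.
Qed.

End Sk.

Section Bpoly.
Variable R : realType.
Implicit Types (g h : R -> R -> R) (s : seq ({poly R} * {poly R})).

Definition bpoly g := exists s, forall x y, g x y = \sum_(k <- s) k.1.[x] * k.2.[y].

Lemma bpoly_mono (u w : {poly R}) : bpoly (fun x y => u.[x] * w.[y]).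
Proof. by exists [:: (u, w)] => x y; rewrite big_seq1. Qed.

Lemma bpolyD g h : bpoly g -> bpoly h -> bpoly (fun x y => g x y + h x y).
Proof. by move=> [s H] [t K]; exists (s ++ t) => x y; rewrite big_cat H K. Qed.

Lemma bpoly0 : bpoly (fun _ _ => 0).
Proof. by exists [::] => x y; rewrite big_nil. Qed.

Lemma bpolyZ (c : R) g : bpoly g -> bpoly (fun x y => c * g x y).
Proof.
move=> [s H]; exists [seq (c *: k.1, k.2) | k <- s] => x y.
by rewrite big_map H mulr_sumr; apply: eq_bigr => k _; rewrite hornerZ mulrA.
Qed.

Lemma bpoly_swap g : bpoly g -> bpoly (fun x y => g y x).
Proof.
move=> [s H]; exists [seq (k.2, k.1) | k <- s] => x y.
by rewrite big_map H; apply: eq_bigr => k _; rewrite mulrC.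
Qed.

Lemma bpoly_rot1 g : bpoly g -> bpoly (rot1 g).
Proof.
move=> [s H]; exists [seq (k.2, k.1 \Po (1 - 'X)) | k <- s] => x y.
rewrite /rot1 big_map H; apply: eq_bigr => k _.
by rewrite mulrC horner_comp !hornerE.
Qed.

Lemma eq_bpoly g h : (forall x y, g x y = h x y) -> bpoly g -> bpoly h.
Proof. by move=> E [s H]; exists s => x y; rewrite -E. Qed.

Lemma sdiff_poly (u : {poly R}) x y : sdiff (fun x _ => u.[x]) x y u^`().[x] 0.
Proof.
elim/poly_ind: u => [|u c IH].
  have := sdiff_cst (0 : R) x y; rewrite deriv0 horner0; apply: eq_sdiff.
  by apply: (right0_le ltr01) => *; rewrite horner0.
have := sdiffD (sdiffM IH (sdiff_fst x y)) (sdiff_cst c x y).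
rewrite derivMXaddC hornerD hornerMX !mulr0 !addr0 !mulr1 addrC [u^`().[x] * x]mulrC.
by apply: eq_sdiff; apply: (right0_le ltr01) => *; rewrite hornerMXaddC.
Qed.

Lemma bpoly_C1 g : bpoly g -> exists gx gy, [/\ bpoly gx, bpoly gy & C1fun g gx gy].
Proof.
move=> [s H].
exists (fun x y => \sum_(k <- s) k.1^`().[x] * k.2.[y]),
       (fun x y => \sum_(k <- s) k.1.[x] * k.2^`().[y]); split.
- by exists [seq (k.1^`(), k.2) | k <- s] => x y; rewrite big_map.
- by exists [seq (k.1, k.2^`()) | k <- s] => x y; rewrite big_map.
move=> x y; have := @sdiff_sum R _ s xpredT (fun k x y => k.1.[x] * k.2.[y])
  (fun k x y => k.1^`().[x] * k.2.[y]) (fun k x y => k.1.[x] * k.2^`().[y]) x y.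
move=> /(_ _)/(_ _)-K; apply: eq_sdiff (K _).
  by apply: (right0_le ltr01) => *; rewrite H.
move=> k _; have := sdiffM (sdiff_poly k.1 x y) (sdiff_swap (sdiff_poly k.2 y x)).
by rewrite !mulr0 addr0 add0r mulrC.
Qed.

Lemma bpoly_Sk (D : R -> R -> Prop) k g : bpoly g -> Sk D k g.
Proof.
elim: k g => [//|k IH] g /bpoly_C1[gx [gy [h1 h2 h3]]].
by exists gx, gy; split; [move=> x y _; exact: h3|exact: IH|exact: IH].
Qed.

End Bpoly.

Section SmoothExt.
Variables (R : realType) (G1 G1x G1y G2 G2x G2y : R -> R -> R).
Hypotheses (C1 : C1fun G1 G1x G1y) (C2 : C1fun G2 G2x G2y).
Variables xl xr yl yr : R.
Hypotheses (hx : xl <= xr) (hy : yl <= yr).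
Local Notation rct := (rect xl xr yl yr).
Local Notation rin := (rect_int xl xr yl yr).
Local Notation J := (fun x y => G1x x y * G2y x y - G1y x y * G2x x y).
Hypothesis S1 : forall k, [/\ Sk rin k G1x, Sk rin k G1y, Sk rin k G2x & Sk rin k G2y].
Hypothesis inj : forall x y x' y', rct x y -> rct x' y' ->
  G1 x y = G1 x' y' -> G2 x y = G2 x' y' -> x = x' /\ y = y'.
Hypothesis J0 : forall x y, rin x y -> J x y != 0.

Definition int_image : set 'rV[R]_2 :=
  [set z | exists x y, rin x y /\ z = row2 (G1 x y) (G2 x y)].

Lemma open_int_image : open int_image.
Proof.
rewrite openE => z [x [y [ri ->]]]; apply/near_row2; rewrite row2_0 row2_1.
have ri' : \forall r \near 0^'+, forall x' y', rct x' y' -> box x y r x' y' -> rin x' y'.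
  by apply: filterS (rect_int_box ri) => r K x' y' _; exact: K.
have := rimage_open C1 C2 hx hy inj J0 ri ri'.
apply: filterS => r K a b /K[x' [y' [_ h -> ->]]].
by exists x', y'.
Qed.

Lemma pderiv_int_image (f : 'rV[R]_2 -> R) h m :
  (forall x y, rin x y -> f (row2 (G1 x y) (G2 x y)) = h x y) -> Sk rin m.+1 h ->
  (forall x y, rin x y -> exists a b, sdiff (fun a b => f (row2 a b)) (G1 x y) (G2 x y) a b) /\
  forall c : 'I_2, exists h', Sk rin m h' /\
    forall x y, rin x y -> pderiv c f (row2 (G1 x y) (G2 x y)) = h' x y.
Proof.
move=> fh [h_x [h_y [Sh Sx Sy]]].
pose w1 x y := (h_x x y * G2y x y + - (h_y x y * G2x x y)) * (J x y)^-1.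
pose w2 x y := (h_y x y * G1x x y + - (h_x x y * G1y x y)) * (J x y)^-1.
have SD x y : rin x y -> sdiff (fun a b => f (row2 a b)) (G1 x y) (G2 x y) (w1 x y) (w2 x y).
  move=> ri; apply: (chart_sdiff C1 C2 hx hy inj J0 (h := h) ri fh (Sh x y ri)).
    by rewrite /w1 /w2; field; exact: J0.
  by rewrite /w1 /w2; field; exact: J0.
split; first by move=> x y ri; exists (w1 x y), (w2 x y); exact: SD.
have [Sk1 Sk2 Sk3 Sk4] := S1 m.
have SJ : Sk rin m (fun x y => (J x y)^-1).
  by apply: SkV => //; apply: SkD; [|apply: SkN]; apply: SkM.
move=> c; exists (fun x y => if c == 0 then w1 x y else w2 x y); split.
  by case: (c == 0); apply: SkM => //; (apply: SkD; [exact: SkM|apply: SkN; exact: SkM]).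
move=> x y ri.
have fd : fdiff f (row2 (G1 x y) (G2 x y)) (w1 x y) (w2 x y).
  by apply: sdiff_fdiff; rewrite row2_0 row2_1; exact: SD.
by case: (fdiff_derive c fd).
Qed.

Lemma pderivs_int_image (f : 'rV[R]_2 -> R) h s m :
  (forall x y, rin x y -> f (row2 (G1 x y) (G2 x y)) = h x y) -> Sk rin (size s + m) h ->
  exists h', Sk rin m h' /\
    forall x y, rin x y -> pderivs s f (row2 (G1 x y) (G2 x y)) = h' x y.
Proof.
move=> fh; elim: s m => [|c s IH] m /= Sh; first by exists h.
have [h' [Sh' fh']] := IH m.+1 ltac:(by rewrite addnS).
by have [_ /(_ c)] := pderiv_int_image fh' Sh'.
Qed.

Lemma smooth_int_image (f : 'rV[R]_2 -> R) h :
  (forall x y, rin x y -> f (row2 (G1 x y) (G2 x y)) = h x y) -> (forall k, Sk rin k h) ->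
  smooth_on int_image f.
Proof.
move=> fh Sh k s _ z [x [y [ri ->]]].
have [h' [Sh' fh']] := pderivs_int_image (s := s) (m := 1) fh (Sh _).
have [/(_ x y ri)[a [b H]] _] := pderiv_int_image fh' Sh'.
have fd : fdiff (pderivs s f) (row2 (G1 x y) (G2 x y)) a b.
  by apply: sdiff_fdiff; rewrite row2_0 row2_1.
by split; [exact: fdiff_cont fd|move=> _ c; case: (fdiff_derive c fd)].
Qed.

End SmoothExt.

Lemma cell_extension (R : realType) (G1 G1x G1y G2 G2x G2y h : R -> R -> R) xl xr yl yr :
  bpoly G1 -> bpoly G2 -> bpoly h -> C1fun G1 G1x G1y -> C1fun G2 G2x G2y ->
  xl <= xr -> yl <= yr ->
  (forall x y x' y', rect xl xr yl yr x y -> rect xl xr yl yr x' y' ->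
     G1 x y = G1 x' y' -> G2 x y = G2 x' y' -> x = x' /\ y = y') ->
  (forall x y, rect xl xr yl yr x y -> 0 < G1x x y * G2y x y - G1y x y * G2x x y) ->
  exists (U : set 'rV[R]_2) (f : 'rV[R]_2 -> R), [/\ open U, smooth_on U f &
    forall x y, rect xl xr yl yr x y ->
      U (row2 (G1 x y) (G2 x y)) /\ f (row2 (G1 x y) (G2 x y)) = h x y].
Proof.
move=> B1 B2 Bh C1 C2 hx hy inj J0.
have [d d0 [inj' J0']] := enlarge C1 C2 hx hy inj J0.
set xl' := xl - d in inj' J0'; set xr' := xr + d in inj' J0'.
set yl' := yl - d in inj' J0'; set yr' := yr + d in inj' J0'.
have hx' : xl' <= xr' by rewrite /xl' /xr'; lra.
have hy' : yl' <= yr' by rewrite /yl' /yr'; lra.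
have Jr x y : rect_int xl' xr' yl' yr' x y -> G1x x y * G2y x y - G1y x y * G2x x y != 0.
  by move=> /rect_int_rect ri; rewrite gt_eqF // J0'.
have [g1x [g1y [b1 b2 c1]]] := bpoly_C1 B1; have [g2x [g2y [b3 b4 c2]]] := bpoly_C1 B2.
have E1 x y : g1x x y = G1x x y /\ g1y x y = G1y x y by exact: sdiff_uniq (c1 x y) (C1 x y).
have E2 x y : g2x x y = G2x x y /\ g2y x y = G2y x y by exact: sdiff_uniq (c2 x y) (C2 x y).
have S1 k : [/\ Sk (rect_int xl' xr' yl' yr') k G1x, Sk (rect_int xl' xr' yl' yr') k G1y,
   Sk (rect_int xl' xr' yl' yr') k G2x & Sk (rect_int xl' xr' yl' yr') k G2y].
  split; apply: bpoly_Sk.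
  - by apply: eq_bpoly b1 => x y; case: (E1 x y).
  - by apply: eq_bpoly b2 => x y; case: (E1 x y).
  - by apply: eq_bpoly b3 => x y; case: (E2 x y).
  - by apply: eq_bpoly b4 => x y; case: (E2 x y).
pose inv (z : 'rV[R]_2) := xget ((0, 0) : R * R)
  [set u | rect xl' xr' yl' yr' u.1 u.2 /\ z = row2 (G1 u.1 u.2) (G2 u.1 u.2)].
pose f z := h (inv z).1 (inv z).2.
have fh x y : rect xl' xr' yl' yr' x y -> f (row2 (G1 x y) (G2 x y)) = h x y.
  move=> r; have [] : [set u : R * R| rect xl' xr' yl' yr' u.1 u.2 /\
      row2 (G1 x y) (G2 x y) = row2 (G1 u.1 u.2) (G2 u.1 u.2)] (inv (row2 (G1 x y) (G2 x y))).
    by apply: xgetPex; exists (x, y).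
  rewrite /f; case: (inv _) => [a b] /= r' /rowP E.
  have e1 : G1 x y = G1 a b by have := E 0; rewrite !mxE.
  have e2 : G2 x y = G2 a b by have := E 1; rewrite !mxE.
  by have [-> ->] := inj' _ _ _ _ r r' e1 e2.
have inc x y : rect xl xr yl yr x y -> rect_int xl' xr' yl' yr' x y.
  by move=> [/andP[? ?] /andP[? ?]]; rewrite /xl' /xr' /yl' /yr'; split; apply/andP; split; lra.
exists (int_image G1 G2 xl' xr' yl' yr'), f; split.
- apply: (open_int_image C1 C2 hx' hy' inj' Jr).
- apply: (smooth_int_image C1 C2 hx' hy' S1 inj' Jr (h := h)).
    by move=> x y /rect_int_rect; exact: fh.
  by move=> k; exact: bpoly_Sk.
- move=> x y /inc r; split; first by exists x, y.
  by apply: fh; exact: rect_int_rect.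
Qed.

(*FILE H*)
Section Spl.
Variables (R : realType).
Implicit Types (u w : R -> R) (P : {poly R}) (x y d : R).

Lemma sdiff_eq (g : R -> R -> R) x y a b a' b' : sdiff g x y a b -> a = a' -> b = b' ->
  sdiff g x y a' b'.
Proof. by move=> H <- <-. Qed.

Lemma eq_sdiffT (g h : R -> R -> R) x y a b : (forall x y, g x y = h x y) ->
  sdiff g x y a b -> sdiff h x y a b.
Proof. by move=> E; apply: eq_sdiff; apply: (right0_le ltr01) => *; rewrite E. Qed.

Definition sd u x d := forall y, sdiff (fun a _ => u a) x y d 0.

Lemma der01_sd u w x d : in01 x ->
  (\forall r \near 0^'+, forall t, in01 t -> `|t - x| < r -> u t = w t) ->
  sd w x d -> der01 u x = d.
Proof. by move=> x01 E H; apply: (@d1_sdiff _ (fun a _ => u a) _ x 0 d 0 x01 E (H 0)). Qed.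

Lemma sd_poly P x : sd (horner P) x P^`().[x].
Proof. by move=> y; apply: sdiff_poly. Qed.

Definition pos x : R := Num.max x 0.

Lemma pos_ge0 x : 0 <= pos x. Proof. by rewrite le_max lexx orbT. Qed.

Lemma pos_lip x y : `|pos x - pos y| <= `|x - y|.
Proof.
rewrite /pos; case: (leP x 0) => hx; case: (leP y 0) => hy; rewrite ?subr0 ?subrr ?normr0 //.
  by rewrite sub0r normrN (ger0_norm (ltW hy)) distrC ger0_norm; lra.
by rewrite (ger0_norm (ltW hx)) ger0_norm; lra.
Qed.

Lemma sd_pos2 c x : sd (fun x => pos (x - c) ^+ 2) x (2 * pos (x - c)).
Proof.
move=> y e e0; have e2 : 0 < e / 4 by rewrite divr_gt0.
apply: (right0_le e2) => d /andP[d0 de] a b a' b' [h1 _] [h2 _].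
have -> : pos (a' - c) ^+ 2 - pos (a - c) ^+ 2 - (2 * pos (x - c) * (a' - a) + 0 * (b' - b)) =
   (pos (a' - c) ^+ 2 - pos (a - c) ^+ 2 - 2 * pos (a - c) * (a' - a)) +
   2 * (pos (a - c) - pos (x - c)) * (a' - a) by ring.
have H1 : `|pos (a' - c) ^+ 2 - pos (a - c) ^+ 2 - 2 * pos (a - c) * (a' - a)| <= `|a' - a| ^+ 2.
  rewrite real_normK ?num_real // (_ : a' - a = (a' - c) - (a - c)); last by ring.
  rewrite /pos; move: (a' - c) (a - c) => A' A.
  case: (leP A 0) => hA; case: (leP A' 0) => hA'; rewrite ler_norml.
  - by have := sqr_ge0 (A' - A); rewrite expr0n /= !mulr0 !mul0r !subr0 oppr_le0 => ->.
  - by have := mulr_le0_ge0 hA (ltW hA'); rewrite mulr0 mul0r => h; apply/andP; split; nra.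
  - by have := mulr_ge0_le0 (ltW hA) hA'; rewrite expr0n /= => h; apply/andP; split; nra.
  by have := sqr_ge0 (A' - A) => h; apply/andP; split; lra.
have H2 := pos_lip (a - c) (x - c); rewrite (_ : a - c - (x - c) = a - x) in H2; last by ring.
have H3 : `|a' - a| < 2 * d.
  by have := ler_normD (a' - x) (x - a); rewrite subrKA [`|x - a|]distrC; lra.
apply: le_trans (ler_normD _ _) _; rewrite !normrM ger0_norm //.
have := normr_ge0 (a' - a); have := normr_ge0 (b' - b).
move: H1 H2 H3 h1; move: `|_ - 2 * _ * _| `|a' - a| `|b' - b| `|a - x| `|pos _ - _| => A X Y Z W.
move=> H1 H2 H3 h1 Y0 X0.
have l1 : X ^+ 2 <= 2 * d * X by rewrite expr2 ler_wpM2r // ltW.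
have l2 : 2 * W * X <= 2 * d * X by rewrite ler_wpM2r //; lra.
have l3 : 4 * d * X <= e * X by rewrite ler_wpM2r //; lra.
have l4 : 0 <= e * Y by rewrite mulr_ge0 // ltW.
by lra.
Qed.

Lemma sdD u w x a b : sd u x a -> sd w x b -> sd (fun x => u x + w x) x (a + b).
Proof. by move=> H K y; have := sdiffD (H y) (K y); rewrite addr0. Qed.

Lemma sdM u w x a b : sd u x a -> sd w x b -> sd (fun x => u x * w x) x (w x * a + u x * b).
Proof. by move=> H K y; have := sdiffM (H y) (K y); rewrite !mulr0 addr0. Qed.

Lemma sd_sum (I : Type) (s : seq I) (p : pred I) (u w : I -> R -> R) x :
  (forall i, p i -> sd (u i) x (w i x)) ->
  sd (fun x => \sum_(i <- s | p i) u i x) x (\sum_(i <- s | p i) w i x).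
Proof.
move=> H y.
have := @sdiff_sum R I s p (fun i a _ => u i a) (fun i a _ => w i a) (fun _ _ _ => 0) x y.
by rewrite big1_eq; apply => i pi; exact: H.
Qed.

Lemma sd_comp_rev u x d : sd u (1 - x) d -> sd (fun x => u (1 - x)) x (- d).
Proof.
move=> H y; have K : sdiff (rot1 (fun a _ => u a)) y x 0 (- d) by apply: sdiff_rot1.
exact: (sdiff_swap K).
Qed.

Variable n : nat.
Hypothesis n0 : (0 < n)%N.

Definition cell (a : nat) x := a%:R / n%:R <= x <= a.+1%:R / n%:R.

Lemma cell_ex x : in01 x -> exists2 a, (a < n)%N & cell a x.
Proof.
have n0' : 0 < n%:R :> R by rewrite ltr0n.
move=> /andP[x0 x1].
have H k : (0 < k)%N -> x <= k%:R / n%:R -> exists2 a, (a < k)%N & cell a x.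
  elim: k => [//|k IH] _ h; have [h'|h'] := leP x (k%:R / n%:R).
    case: k IH h h' => [|k] IH h h'; last by have [a ak] := IH isT h'; exists a => //; apply: ltnW.
    by exists 0%N => //; rewrite /cell mul0r x0.
  by exists k => //; rewrite /cell h ltW.
by apply: H => //; rewrite divff // gt_eqF.
Qed.

Lemma cell_in01 a x : (a < n)%N -> cell a x -> in01 x.
Proof.
have n0' : 0 < n%:R :> R by rewrite ltr0n.
move=> an /andP[h1 h2]; apply/andP; split.
  by apply: le_trans h1; rewrite divr_ge0.
by apply: le_trans h2 _; rewrite ler_pdivrMr // mul1r ler_nat.
Qed.

Definition pwpoly u := forall a, (a < n)%N -> exists P, forall x, cell a x -> u x = P.[x].

Definition spl u := exists U U', [/\ forall x, sd U x (U' x), pwpoly U &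
  forall x, in01 x -> u x = U x].

Lemma spl_pwpoly u : spl u -> pwpoly u.
Proof.
move=> [U [U' [_ H E]]] a an; have [P HP] := H a an; exists P => x hx.
by rewrite E ?HP //; exact: cell_in01 an hx.
Qed.

Lemma der01_spl u (U U' : R -> R) x : (forall x, sd U x (U' x)) -> (forall x, in01 x -> u x = U x) ->
  in01 x -> der01 u x = U' x.
Proof.
move=> H E x01; apply: der01_sd (H x) => //.
by apply: (right0_le ltr01) => d _ t t01 _; exact: E.
Qed.

Lemma splD u w : spl u -> spl w -> spl (fun x => u x + w x).
Proof.
move=> [U [U' [H1 H2 H3]]] [W [W' [K1 K2 K3]]].
exists (fun x => U x + W x), (fun x => U' x + W' x); split.
- by move=> x; apply: sdD.
- move=> a an; have [P HP] := H2 a an; have [Q HQ] := K2 a an.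
  by exists (P + Q) => x hx; rewrite hornerD HP // HQ.
- by move=> x hx; rewrite H3 // K3.
Qed.

Lemma spl_polyM P u : spl u -> spl (fun x => P.[x] * u x).
Proof.
move=> [U [U' [H1 H2 H3]]].
exists (fun x => P.[x] * U x), (fun x => U x * P^`().[x] + P.[x] * U' x); split.
- by move=> x; apply: sdM => //; exact: sd_poly.
- move=> a an; have [Q HQ] := H2 a an.
  by exists (P * Q) => x hx; rewrite hornerM HQ.
- by move=> x hx; rewrite H3.
Qed.

Lemma eq_spl u w : (forall x, in01 x -> u x = w x) -> spl u -> spl w.
Proof.
move=> E [U [U' [H1 H2 H3]]]; exists U, U'; split => // x hx.
by rewrite -E ?H3.
Qed.

Lemma splZ c u : spl u -> spl (fun x => c * u x).
Proof. by move=> /(spl_polyM c%:P); apply: eq_spl => x _; rewrite hornerC. Qed.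

Lemma spl_poly P : spl (fun x => P.[x]).
Proof.
exists (horner P), (horner P^`()); split => //; first exact: sd_poly.
by move=> a _; exists P.
Qed.

Lemma spl_sum (I : Type) (s : seq I) (p : pred I) (u : I -> R -> R) :
  (forall i, p i -> spl (u i)) -> spl (fun x => \sum_(i <- s | p i) u i x).
Proof.
move=> H; elim: s => [|i s IH].
  by apply: eq_spl (spl_poly 0) => x _; rewrite big_nil horner0.
have [pi|pi] := boolP (p i).
  by apply: eq_spl (splD (H i pi) IH) => x _; rewrite big_cons pi.
by apply: eq_spl IH => x _; rewrite big_cons (negbTE pi).
Qed.

Definition kn (b : nat) : R := b.+1%:R / n%:R.

Definition trunc e P (Q : nat -> {poly R}) x :=
  P.[x] + \sum_(b < n.-1) pos (x - kn b) ^+ e * (Q b).[x].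

Lemma trunc_cell e P Q a x : (0 < e)%N -> (a < n)%N -> cell a x ->
  trunc e P Q x = (P + \sum_(b < n.-1 | (b < a)%N) ('X - (kn b)%:P) ^+ e * Q b).[x].
Proof.
have n0' : 0 < n%:R :> R by rewrite ltr0n.
move=> e0 an /andP[h1 h2]; rewrite /trunc hornerD horner_sum; congr (_ + _).
rewrite [RHS]big_mkcond /=; apply: eq_bigr => b _.
case: ltnP => ba.
  rewrite hornerM horner_exp hornerXsubC /pos max_l //.
  rewrite subr_ge0; apply: le_trans h1; rewrite /kn ler_pM2r ?invr_gt0 // ler_nat //.
rewrite /pos max_r ?expr0n ?gtn_eqF ?mul0r //.
by rewrite subr_le0; apply: le_trans h2 _; rewrite /kn ler_pM2r ?invr_gt0 // ler_nat.
Qed.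

Lemma sd_trunc2 P Q x : sd (trunc 2 P Q) x (P^`().[x] +
  \sum_(b < n.-1) ((Q b).[x] * (2 * pos (x - kn b)) + pos (x - kn b) ^+ 2 * (Q b)^`().[x])).
Proof.
apply: sdD; first exact: sd_poly.
pose u (b : 'I_n.-1) x := pos (x - kn b) ^+ 2 * (Q b).[x].
pose w (b : 'I_n.-1) x := (Q b).[x] * (2 * pos (x - kn b)) + pos (x - kn b) ^+ 2 * (Q b)^`().[x].
apply: (@sd_sum _ _ _ u w) => b _.
by apply: sdM; [exact: sd_pos2|exact: sd_poly].
Qed.

Lemma spl_trunc2 P Q : spl (trunc 2 P Q).
Proof.
eexists; eexists; split; [exact: sd_trunc2| |by []].
by move=> a an; eexists => x hx; apply: (trunc_cell _ _ _ an hx).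
Qed.

Lemma trunc3E P Q x : trunc 3 P Q x = trunc 2 P (fun b => ('X - (kn b)%:P) * Q b) x.
Proof.
congr (_ + _); apply: eq_bigr => b _; rewrite hornerM hornerXsubC mulrA; congr (_ * _).
by rewrite exprSr /pos; case: leP => h //; rewrite expr0n /= !mul0r.
Qed.

Lemma der01_trunc3 P Q x : in01 x ->
  der01 (trunc 3 P Q) x = trunc 2 P^`() (fun b => 3 *: Q b + ('X - (kn b)%:P) * (Q b)^`()) x.
Proof.
move=> x01; rewrite (der01_spl (sd_trunc2 P (fun b => ('X - (kn b)%:P) * Q b))) //; last first.
  by move=> y _; exact: trunc3E.
congr (_ + _); apply: eq_bigr => b _.
rewrite derivM derivXsubC mul1r !(hornerM, hornerD, hornerZ, hornerN, hornerX, hornerC).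
set X := pos _; set q := (Q b).[x]; set q' := _^`().[x].
have E : X * (x - kn b) = X ^+ 2.
  by rewrite /X /pos expr2; case: leP => h //; rewrite !mul0r.
transitivity (2 * q * (X * (x - kn b)) + X ^+ 2 * (q + (x - kn b) * q')); first by ring.
by rewrite E; ring.
Qed.

End Spl.

(*FILE I*)
Section Ord.
Variable R : realType.
Implicit Types (u w : R -> R) (P : {poly R}).

Definition ord0 k u := exists P d, 0 < d <= 1 /\ forall x, 0 <= x < d -> u x = x ^+ k * P.[x].

Definition ord1 k u := ord0 k (fun x => u (1 - x)).

Lemma ord0W k k' u : (k' <= k)%N -> ord0 k u -> ord0 k' u.
Proof.
move=> kk [P [d [hd H]]]; exists ('X^(k - k') * P), d; split => // x hx.
by rewrite hornerM hornerXn mulrA -exprD subnKC // H.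
Qed.

Lemma ord0D k u w : ord0 k u -> ord0 k w -> ord0 k (fun x => u x + w x).
Proof.
move=> [P [d [/andP[d0 d1] H]]] [Q [d' [/andP[d'0 d'1] K]]].
exists (P + Q), (Num.min d d'); split; first by rewrite lt_min d0 d'0 ge_min d1.
by move=> x /andP[x0]; rewrite lt_min hornerD mulrDr => /andP[xd xd']; rewrite H ?x0 // K ?x0.
Qed.

Lemma ord0M k k' u w : ord0 k u -> ord0 k' w -> ord0 (k + k') (fun x => u x * w x).
Proof.
move=> [P [d [/andP[d0 d1] H]]] [Q [d' [/andP[d'0 d'1] K]]].
exists (P * Q), (Num.min d d'); split; first by rewrite lt_min d0 d'0 ge_min d1.
move=> x /andP[x0]; rewrite lt_min hornerM => /andP[xd xd']; rewrite H ?x0 // K ?x0 // exprD.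
by ring.
Qed.

Lemma ord0_poly P : ord0 0 (horner P).
Proof. by exists P, 1; split; [rewrite ltr01 lexx|move=> x _; rewrite mul1r]. Qed.

Lemma ord0_cst k : ord0 k (fun _ => 0 : R).
Proof. by exists 0, 1; split; [rewrite ltr01 lexx|move=> x _; rewrite horner0 mulr0]. Qed.

Lemma eq_ord0 k u w : (forall x, in01 x -> u x = w x) -> ord0 k u -> ord0 k w.
Proof.
move=> E [P [d [/andP[d0 d1] H]]]; exists P, d; split; first by rewrite d0.
move=> x /andP[x0 xd]; rewrite -E ?H ?x0 //.
by apply/andP; split => //; apply: le_trans (ltW xd) d1.
Qed.

Lemma ord0_der k u : ord0 k.+1 u -> ord0 k (der01 u).
Proof.
move=> [P [d [/andP[d0 d1] H]]]; exists (k.+1%:R *: P + 'X * P^`()), d.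
split; first by rewrite d0.
move=> x /andP[x0 xd].
have x01 : in01 x by rewrite /in01 x0 (le_trans (ltW xd) d1).
rewrite (@der01_sd R u (horner ('X^(k.+1) * P)) x ('X^(k.+1) * P)^`().[x]) //.
- rewrite derivM derivXn /= !(hornerD, hornerM, hornerMn, hornerZ, hornerXn, hornerX) exprSr -mulr_natr.
  by ring.
- near=> r => t /andP[t0 _] htr; rewrite hornerM hornerXn H // t0 /=.
  have : r < d - x by near: r; apply: nbhs_right_lt; rewrite subr_gt0.
  by move: htr; rewrite ltr_norml => /andP[]; lra.
- exact: sd_poly.
Unshelve. all: by end_near. Qed.

Lemma ord0_iter_der k i u : ord0 k u -> (i < k)%N -> iter i (@der01 R R) u 0 = 0.
Proof.
elim: i k u => [|i IH] [|k] u //=.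
  by move=> [P [d [/andP[d0 d1] H]]] _; rewrite H ?lexx // expr0n mul0r.
move=> /ord0_der H ik; rewrite -[RHS](IH k (der01 u)) //.
by rewrite -iterS iterSr.
Qed.

Lemma ord0_val k u : ord0 k u -> (0 < k)%N -> u 0 = 0.
Proof. by move=> H k0; apply: (ord0_iter_der (i := 0) H). Qed.

Lemma ord0_der_val k u : ord0 k u -> (1 < k)%N -> der01 u 0 = 0.
Proof. by move=> H k0; apply: (ord0_iter_der (i := 1) H). Qed.

Lemma der01_ext (V : normedModType R) (u w : R -> V) x :
  (forall y, in01 y -> u y = w y) -> in01 x -> der01 u x = der01 w x.
Proof.
move=> E x01; rewrite /der01; congr (lim _); rewrite (E x x01).
apply/funext => A; apply/propext.
have FF : Filter (within `[0, 1] x^') by apply: within_filter.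
have D : within `[0, 1] x^' [set y | (y - x)^-1 *: (u y - w x) = (y - x)^-1 *: (w y - w x)].
  by apply: (@filterE _ x^') => y; rewrite /= in_itv /= => /E ->.
split => h.
  by apply: (@filterS2 _ _ FF _ _ _ _ h D) => y /= h' <-.
by apply: (@filterS2 _ _ FF _ _ _ _ h D) => y /= h' ->.
Qed.

End Ord.

Section BsplineFacts.
Variables (R : realType) (p r n : nat).
Hypotheses (rp : (r < p)%N) (n0 : (0 < n)%N).
Local Notation m := (p - r)%N.
Local Notation t := (knot R p m n).
Local Notation pc a j := (bpiece t (p + a * m) p j).

Let m0 : (0 < m)%N. Proof. by rewrite subn_gt0. Qed.
Let n0' : 0 < n%:R :> R. Proof. by rewrite ltr0n. Qed.

Let mono i j : (i <= j)%N -> t i <= t j. Proof. exact: knot_mono. Qed.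
Let le1 i : t i <= 1. Proof. exact: knot_le1. Qed.

Lemma knot_lt a : (a < n)%N -> t (p + a * m) < t (p + a * m).+1.
Proof.
move=> an; rewrite knot_span0 ?(ltnW an) // knot_spanS //.
by rewrite ltr_pM2r ?invr_gt0 // ltr_nat.
Qed.

Lemma bsplineE j x : bspline p r n j x = cox_de_boor t p j x.
Proof. by rewrite /bspline; congr cox_de_boor; apply/funext => k; rewrite nth_knots. Qed.

Lemma bspline_cell a j x : (a < n)%N -> cell n a x -> bspline p r n j x = (pc a j).[x].
Proof.
move=> an /andP[h1 h2]; rewrite bsplineE.
have [h|h] := ltP x (a.+1%:R / n%:R).
  apply: (cox_de_boor_piece mono le1); left.
  by rewrite knot_span0 ?(ltnW an) // knot_spanS // h1 h.
have {h2 h} -> : x = a.+1%:R / n%:R by apply/le_anti; rewrite h2 h.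
have [E|an'] := eqVneq a.+1 n.
  rewrite E divff ?gt_eqF //; apply: (cox_de_boor_piece mono le1); right.
  have t1 : t (p + a * m).+1 = 1 by rewrite knot_spanS // E divff ?gt_eqF.
  by split => //; rewrite -[ltRHS]t1 knot_lt.
have {}an' : (a.+1 < n)%N by rewrite ltn_neqAle an' an.
rewrite (cox_de_boor_piece mono le1 (k := p + a.+1 * m)); last first.
  left; rewrite knot_span0 ?(ltnW an') // knot_spanS // lexx /=.
  by rewrite ltr_pM2r ?invr_gt0 // ltr_nat.
have E : (p + a.+1 * m = p + a * m + m)%N by rewrite mulSn addnCA addnC.
have -> : a.+1%:R / n%:R = t (p + a * m + m)%N by rewrite -E knot_span0 // ltnW.
rewrite E bpiece_cont //.
- by rewrite m0 leq_subr.
- exact: knot_lt.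
- by rewrite -E knot_span0 ?(ltnW an') // knot_spanS.
- by rewrite -E knot_lt.
Qed.

Lemma pc_jump a j : (a.+1 < n)%N -> ('X - (kn R n a)%:P) ^+ r.+1 %| pc a.+1 j - pc a j.
Proof.
move=> an'; have an := ltnW an'.
have E : (p + a.+1 * m = p + a * m + m)%N by rewrite mulSn addnCA addnC.
have s0 : t (p + a.+1 * m) = kn R n a by rewrite knot_span0 // ltnW.
have s1 : t (p + a * m).+1 = kn R n a by rewrite knot_spanS.
have := @bpiece_jump R t mono (p + a * m) m p j.
rewrite -E s0 s1 subKn ?(ltnW rp) // -s0; apply; rewrite ?m0 ?leq_subr //.
  by rewrite s0 -s1 knot_lt.
exact: knot_lt.
Qed.

Lemma bspline_trunc e j : (0 < e <= r.+1)%N ->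
  exists Q, forall x, in01 x -> bspline p r n j x = trunc n e (pc 0 j) Q x.
Proof.
move=> /andP[e0 er]; exists (fun b => (pc b.+1 j - pc b j) %/ ('X - (kn R n b)%:P) ^+ e).
move=> x x01; have [a an ax] := cell_ex n0 x01.
rewrite (@trunc_cell _ _ n0 e _ _ a) // (bspline_cell _ an ax); congr horner.
have an1 : (a <= n.-1)%N by rewrite -ltnS prednK.
rewrite -(big_ord_widen_cond n.-1 xpredT (fun b => ('X - (kn R n b)%:P) ^+ e *
   ((pc b.+1 j - pc b j) %/ ('X - (kn R n b)%:P) ^+ e)) an1).
rewrite (eq_bigr (fun b : 'I_a => pc b.+1 j - pc b j)); last first.
  move=> b _; rewrite mulrC divpK //; apply: dvdp_trans (pc_jump _ _).
    by rewrite dvdp_exp2l.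
  by apply: leq_trans an; rewrite ltnS.
rewrite -(big_mkord xpredT (fun b => pc b.+1 j - pc b j)) telescope_sumr //.
by rewrite mul0n addn0 addrC subrK.
Qed.

Lemma spl_bspline j : (0 < r)%N -> spl n (bspline p r n j : R -> R).
Proof.
move=> r0; have [|Q H] := @bspline_trunc 2 j; first by rewrite ltnS.
by apply: eq_spl (spl_trunc2 n0 (pc 0 j) Q) => x /H.
Qed.

Lemma spl_der_bspline j : (1 < r)%N -> spl n (der01 (bspline p r n j) : R -> R).
Proof.
move=> r0; have [|Q H] := @bspline_trunc 3 j; first by rewrite ltnS.
apply: eq_spl (spl_trunc2 n0 (pc 0 j)^`()
  (fun b => 3 *: Q b + ('X - (kn R n b)%:P) * (Q b)^`())) => x x01.
by rewrite (der01_ext H x01) -der01_trunc3.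
Qed.

Lemma ninv01 : 0 < (n%:R^-1 : R) <= 1.
Proof. by rewrite invr_gt0 n0' invf_le1 // ler1n. Qed.

Lemma ord0_bspline j : ord0 j (bspline p r n j : R -> R).
Proof.
have := @bpiece_first R t p p j (@knot_first R p m n) (leqnn p).
rewrite subnn subn0 => /dvdpP[P E].
exists P, n%:R^-1; split; first exact: ninv01.
move=> x /andP[x0 xn]; rewrite (@bspline_cell 0) //; last by rewrite /cell mul0r x0 mul1r ltW.
by rewrite mul0n addn0 E hornerM hornerXn mulrC.
Qed.

Lemma ord1_bspline j : ord1 (p + n.-1 * m - j) (bspline p r n j : R -> R).
Proof.
set K := (p + n.-1 * m)%N.
have := @bpiece_last R t K p j (@knot_last R p m n m0 n0).
move=> /dvdpP[P E].
exists (((-1) ^+ (K - j)) *: (P \Po (1 - 'X))), n%:R^-1; split; first exact: ninv01.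
move=> x /andP[x0 xn].
have nn : (n.-1 < n)%N by rewrite prednK.
have cx : cell n n.-1 (1 - x).
  rewrite /cell prednK // divff ?gt_eqF //; apply/andP; split; last by rewrite gerBl.
  by rewrite -subn1 natrB // mulrBl divff ?gt_eqF // mul1r lerD2l lerN2 ltW.
rewrite (bspline_cell _ nn cx) -/K E hornerM hornerZ horner_comp horner_exp.
rewrite !(hornerD, hornerN, hornerX, hornerC).
have -> : 1 - x - 1 = -1 * x by ring.
by rewrite exprMn; ring.
Qed.

Lemma bspline_0 j : bspline p r n j 0 = (j == 0%N)%:R :> R.
Proof.
rewrite (@bspline_cell 0) //; last by rewrite /cell mul0r lexx mul1r invr_ge0 ltW.
have := @bpiece_right R t mono 0 p p j (leqnn p).
rewrite !add0n mul0n addn0 subnn [t p]knot_first //; apply.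
  by rewrite knot_first // (leq_ltn_trans _ rp).
by have := knot_lt n0; rewrite mul0n addn0 [t p]knot_first.
Qed.

Lemma der_bspline_0 j : der01 (bspline p r n j) 0 =
  p%:R * n%:R * ((j == 1%N)%:R - (j == 0%N)%:R) :> R.
Proof.
rewrite (@der01_sd R _ (horner (pc 0 j)) 0 (pc 0 j)^`().[0]) //; last 2 first.
- apply: (@right0_le R _ n%:R^-1); first by rewrite invr_gt0.
  move=> d /andP[d0 dn] x /andP[x0 x1]; rewrite subr0 ger0_norm // => xd.
  by rewrite (@bspline_cell 0) // /cell mul0r x0 mul1r (le_trans (ltW xd)).
- exact: sd_poly.
have p0 : (0 < p)%N by exact: leq_ltn_trans rp.
have R1 i : (bpiece t p p.-1 i).[0] = (i == 1%N)%:R.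
  have := @bpiece_right R t mono 0 p p.-1 i (leq_pred p).
  rewrite !add0n [t p]knot_first // (_ : (p - p.-1 = 1)%N); last by lia.
  apply; first by rewrite knot_first.
  by have := knot_lt n0; rewrite mul0n addn0 [t p]knot_first.
have := @deriv_bpiece R t mono p p.-1 j; rewrite prednK // mul0n addn0 => ->.
rewrite hornerZ hornerD hornerN !hornerZ !R1.
have tp : t p.+1 = n%:R^-1 by have := @knot_spanS R p m n m0 n0 0%N n0; rewrite mul0n addn0 mul1r.
case: j => [|[|j]] /=; rewrite ?mulr0 ?subr0 ?mulr1 ?sub0r ?mulr1n ?mulr0n.
- by rewrite add1n tp knot_first // subr0 invrK; ring.
- by rewrite add1n tp knot_first // subr0 invrK; ring.
- by ring.
by rewrite /in01 lexx ler01.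
Qed.

End BsplineFacts.

(*FILE J*)
Section Spl2.
Variables (R : realType) (n : nat).
Hypothesis n0 : (0 < n)%N.
Implicit Types (g h : R -> R -> R) (u w : R -> R) (x y : R).

Definition eqsq (T : Type) (g h : R -> R -> T) := forall x y, in01 x -> in01 y -> g x y = h x y.

Definition pwbpoly g := forall a b, (a < n)%N -> (b < n)%N -> exists P, bpoly P /\
  forall x y, cell n a x -> cell n b y -> g x y = P x y.

Definition spl2 g := pwbpoly g /\ exists G Gx Gy, C1fun G Gx Gy /\ eqsq g G.

Lemma in01_rev x : in01 x -> in01 (1 - x).
Proof. by move=> /andP[h1 h2]; apply/andP; split; lra. Qed.

Lemma in01_0 : in01 (0 : R). Proof. by rewrite /in01 lexx ler01. Qed.
Lemma in01_1 : in01 (1 : R). Proof. by rewrite /in01 lexx ler01. Qed.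

Lemma cell_rev a x : (a < n)%N -> cell n a x -> cell n (n.-1 - a) (1 - x).
Proof.
have n0' : 0 < n%:R :> R by rewrite ltr0n.
move=> an /andP[h1 h2].
have E : (n.-1 - a)%N%:R = n%:R - 1 - a%:R :> R.
  by rewrite natrB; [rewrite -subn1 natrB|lia].
have E2 : (n.-1 - a).+1%:R = n%:R - a%:R :> R by rewrite -natr1 E; ring.
move: h1 h2; rewrite /cell E2 E -natr1 !ler_pdivrMr // !ler_pdivlMr // => h1 h2.
by apply/andP; split; lra.
Qed.

Lemma eq_spl2 g h : eqsq g h -> spl2 g -> spl2 h.
Proof.
move=> E [H [G [Gx [Gy [H1 H2]]]]]; split.
  move=> a b an bn; have [P [bP HP]] := H a b an bn; exists P; split => // x y hx hy.
  by rewrite -E ?HP //; [exact: cell_in01 an hx|exact: cell_in01 bn hy].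
by exists G, Gx, Gy; split => // x y hx hy; rewrite -E ?H2.
Qed.

Lemma spl2_tensor u w : spl n u -> spl n w -> spl2 (fun x y => u x * w y).
Proof.
move=> su sw; split.
  move=> a b an bn; have [P HP] := spl_pwpoly n0 su an; have [Q HQ] := spl_pwpoly n0 sw bn.
  exists (fun x y => P.[x] * Q.[y]); split; first exact: bpoly_mono.
  by move=> x y hx hy; rewrite HP // HQ.
move: su sw => [U [U' [H1 _ H3]]] [W [W' [K1 _ K3]]].
exists (fun x y => U x * W y), (fun x y => U' x * W y), (fun x y => U x * W' y); split.
  move=> x y; have := sdiffM (H1 x y) (sdiff_swap (K1 y x)).
  by rewrite !mulr0 addr0 add0r mulrC.
by move=> x y hx hy; rewrite H3 // K3.
Qed.

Lemma spl2D g h : spl2 g -> spl2 h -> spl2 (fun x y => g x y + h x y).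
Proof.
move=> [H1 [G [Gx [Gy [H2 H3]]]]] [K1 [K [Kx [Ky [K2 K3]]]]]; split.
  move=> a b an bn; have [P [bP HP]] := H1 a b an bn; have [Q [bQ HQ]] := K1 a b an bn.
  exists (fun x y => P x y + Q x y); split; first exact: bpolyD.
  by move=> x y hx hy; rewrite HP // HQ.
exists (fun x y => G x y + K x y), (fun x y => Gx x y + Kx x y), (fun x y => Gy x y + Ky x y).
split; first by move=> x y; apply: sdiffD.
by move=> x y hx hy; rewrite H3 // K3.
Qed.

Lemma spl2Z c g : spl2 g -> spl2 (fun x y => c * g x y).
Proof.
move=> [H1 [G [Gx [Gy [H2 H3]]]]]; split.
  move=> a b an bn; have [P [bP HP]] := H1 a b an bn.
  exists (fun x y => c * P x y); split; first exact: bpolyZ.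
  by move=> x y hx hy; rewrite HP.
exists (fun x y => c * G x y), (fun x y => c * Gx x y), (fun x y => c * Gy x y).
split; first by move=> x y; apply: sdiffZ.
by move=> x y hx hy; rewrite H3.
Qed.

Lemma spl2_0 : spl2 (fun _ _ => 0).
Proof.
split; first by move=> a b _ _; exists (fun _ _ => 0); split => //; exact: bpoly0.
by exists (fun _ _ => 0), (fun _ _ => 0), (fun _ _ => 0); split => // x y; exact: sdiff_cst.
Qed.

Lemma spl2_rot1 g : spl2 g -> spl2 (rot1 g).
Proof.
move=> [H1 [G [Gx [Gy [H2 H3]]]]]; split.
  move=> a b an bn; have bn' : (n.-1 - b < n)%N by lia.
  have [P [bP HP]] := H1 _ a bn' an; exists (rot1 P); split; first exact: bpoly_rot1.
  by move=> x y hx hy; rewrite /rot1 HP //; exact: cell_rev.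
exists (rot1 G), (fun x y => Gy (1 - y) x), (fun x y => - Gx (1 - y) x).
split; first by move=> x y; apply: sdiff_rot1.
by move=> x y hx hy; rewrite /rot1 H3 //; exact: in01_rev.
Qed.

Lemma spl2_swap g : spl2 g -> spl2 (swap_args g).
Proof.
move=> [H1 [G [Gx [Gy [H2 H3]]]]]; split.
  move=> a b an bn; have [P [bP HP]] := H1 b a bn an.
  exists (fun x y => P y x); split; first exact: bpoly_swap.
  by move=> x y hx hy; rewrite /swap_args HP.
exists (fun x y => G y x), (fun x y => Gy y x), (fun x y => Gx y x).
split; first by move=> x y; apply: sdiff_swap.
by move=> x y hx hy; rewrite /swap_args H3.
Qed.

Lemma spl2_rotate (k : 'Z_4) g : spl2 g -> spl2 (rotate k g).
Proof.
rewrite /rotate; elim: (nat_of_ord k) => [//|j IH] H /=; apply: spl2_rot1; exact: IH.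
Qed.

Lemma d1_C1 g G Gx Gy x y : C1fun G Gx Gy -> eqsq g G -> in01 x -> in01 y -> d1 g x y = Gx x y.
Proof.
move=> H E hx hy; apply: (d1_sdiff (g := G)) (H x y) => //.
by apply: (right0_le ltr01) => d _ t ht _; exact: E.
Qed.

Lemma d2_C1 g G Gx Gy x y : C1fun G Gx Gy -> eqsq g G -> in01 x -> in01 y -> d2 g x y = Gy x y.
Proof.
move=> H E hx hy; apply: (d2_sdiff (g := G)) (H x y) => //.
by apply: (right0_le ltr01) => d _ t ht _; exact: E.
Qed.

Lemma d1_eqsq (V : normedModType R) (g h : R -> R -> V) : eqsq g h -> eqsq (d1 g) (d1 h).
Proof. by move=> E x y hx hy; apply: der01_ext => // t ht; exact: E. Qed.

Lemma d2_eqsq (V : normedModType R) (g h : R -> R -> V) : eqsq g h -> eqsq (d2 g) (d2 h).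
Proof. by move=> E x y hx hy; apply: der01_ext => // t ht; exact: E. Qed.

Lemma d1D g h : spl2 g -> spl2 h ->
  eqsq (d1 (fun x y => g x y + h x y)) (fun x y => d1 g x y + d1 h x y).
Proof.
move=> [_ [G [Gx [Gy [H2 H3]]]]] [_ [K [Kx [Ky [K2 K3]]]]] x y hx hy.
rewrite (d1_C1 H2 H3) // (d1_C1 K2 K3) //.
apply: (@d1_C1 _ (fun x y => G x y + K x y) (fun x y => Gx x y + Kx x y)
  (fun x y => Gy x y + Ky x y)) => //; first by move=> a b; apply: sdiffD.
by move=> a b ha hb; rewrite H3 // K3.
Qed.

Lemma d2D g h : spl2 g -> spl2 h ->
  eqsq (d2 (fun x y => g x y + h x y)) (fun x y => d2 g x y + d2 h x y).
Proof.
by move=> sg sh x y hx hy; apply: (d1D (spl2_swap sg) (spl2_swap sh)).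
Qed.

Lemma d1Z c g : spl2 g -> eqsq (d1 (fun x y => c * g x y)) (fun x y => c * d1 g x y).
Proof.
move=> [_ [G [Gx [Gy [H2 H3]]]]] x y hx hy; rewrite (d1_C1 H2 H3) //.
apply: (@d1_C1 _ (fun x y => c * G x y) (fun x y => c * Gx x y) (fun x y => c * Gy x y)) => //.
  by move=> a b; apply: sdiffZ.
by move=> a b ha hb; rewrite H3.
Qed.

Lemma d2Z c g : spl2 g -> eqsq (d2 (fun x y => c * g x y)) (fun x y => c * d2 g x y).
Proof. by move=> sg x y hx hy; apply: (d1Z c (spl2_swap sg)). Qed.

Lemma d1_cst0 : eqsq (d1 (fun _ _ => 0 : R)) (fun _ _ => 0 : R).
Proof. by move=> x y hx hy; apply: (d1_sdiff _ _ (sdiff_cst 0 x y)) => //; apply: (right0_le ltr01). Qed.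

Lemma d2_cst0 : eqsq (d2 (fun _ _ => 0 : R)) (fun _ _ => 0 : R).
Proof. by move=> x y hx hy; apply: (d2_sdiff _ _ (sdiff_cst 0 x y)) => //; apply: (right0_le ltr01). Qed.

Lemma d1_tensor u w : spl n u -> spl n w ->
  eqsq (d1 (fun x y => u x * w y)) (fun x y => der01 u x * w y).
Proof.
move=> [U [U' [H1 _ H3]]] _ x y hx hy.
rewrite (der01_spl H1 H3 hx).
have K := sdiffM (H1 x y) (sdiff_cst (w y) x y).
rewrite [LHS](d1_sdiff (g := fun x _ => U x * w y) _ _ K) ?mulr0 ?addr0 1?mulrC //.
by apply: (right0_le ltr01) => d _ t ht _; rewrite H3.
Qed.

Lemma d2_tensor u w : spl n u -> spl n w ->
  eqsq (d2 (fun x y => u x * w y)) (fun x y => u x * der01 w y).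
Proof.
move=> su sw x y hx hy; rewrite mulrC -(d1_tensor sw su hy hx).
by rewrite /d2 /d1; apply: der01_ext => // t _; rewrite mulrC.
Qed.

Lemma d1_rot1 g : spl2 g -> eqsq (d1 (rot1 g)) (fun x y => d2 g (1 - y) x).
Proof. by move=> sg x y hx hy. Qed.

Lemma d2_rot1 g : spl2 g -> eqsq (d2 (rot1 g)) (fun x y => - d1 g (1 - y) x).
Proof.
move=> [_ [G [Gx [Gy [H2 H3]]]]] x y hx hy; rewrite (d1_C1 H2 H3) //; last exact: in01_rev.
apply: (@d2_C1 _ (rot1 G) (fun x y => Gy (1 - y) x) (fun x y => - Gx (1 - y) x)) => //.
  by move=> a b; apply: sdiff_rot1.
by move=> a b ha hb; rewrite /rot1 H3 //; exact: in01_rev.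
Qed.

Lemma spl2_sum (I : Type) (s : seq I) (p : pred I) (g : I -> R -> R -> R) :
  (forall i, p i -> spl2 (g i)) -> spl2 (fun x y => \sum_(i <- s | p i) g i x y).
Proof.
move=> H; elim: s => [|i s IH].
  by apply: eq_spl2 spl2_0 => x y _ _; rewrite big_nil.
have [pi|pi] := boolP (p i).
  by apply: eq_spl2 (spl2D (H i pi) IH) => x y _ _; rewrite big_cons pi.
by apply: eq_spl2 IH => x y _ _; rewrite big_cons (negbTE pi).
Qed.

End Spl2.

Section Jets.
Variables (R : realType) (n : nat).
Hypothesis n0 : (0 < n)%N.
Implicit Types (g h : R -> R -> R) (u w : R -> R) (s : seq ({poly R} * {poly R})).

Definition ev s (x y : R) := \sum_(k <- s) k.1.[x] * k.2.[y].
Definition dxs s := [seq (k.1^`(), k.2) | k <- s].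
Definition dys s := [seq (k.1, k.2^`()) | k <- s].

Definition loc g s := exists2 d, 0 < d <= 1 & forall x y, 0 <= x < d -> 0 <= y < d -> g x y = ev s x y.

Lemma sdiff_ev s x y : sdiff (ev s) x y (ev (dxs s) x y) (ev (dys s) x y).
Proof.
rewrite /ev !big_map; have := @sdiff_sum R _ s xpredT (fun k x y => k.1.[x] * k.2.[y])
  (fun k x y => k.1^`().[x] * k.2.[y]) (fun k x y => k.1.[x] * k.2^`().[y]) x y.
apply=> k _; have := sdiffM (sdiff_poly k.1 x y) (sdiff_swap (sdiff_poly k.2 y x)).
by rewrite !mulr0 addr0 add0r mulrC.
Qed.

Lemma near_lt (x d : R) : 0 <= x < d ->
  \forall r \near 0^'+, forall t, in01 t -> `|t - x| < r -> 0 <= t < d.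
Proof.
move=> /andP[x0 xd]; near=> r => t /andP[t0 _] htr; rewrite t0 /=.
have : r < d - x by near: r; apply: nbhs_right_lt; rewrite subr_gt0.
by move: htr; rewrite ltr_norml => /andP[]; lra.
Unshelve. all: by end_near. Qed.

Lemma lt_in01 (x d : R) : d <= 1 -> 0 <= x < d -> in01 x.
Proof. by move=> d1 /andP[x0 xd]; rewrite /in01 x0 (le_trans (ltW xd)). Qed.

Lemma loc_d1 g s : loc g s -> loc (d1 g) (dxs s).
Proof.
move=> [d hd H]; exists d => // x y hx hy; have /andP[_ d1] := hd.
apply: (d1_sdiff (g := ev s)) (sdiff_ev s x y); first exact: lt_in01 hx.
by apply: filterS (near_lt hx) => r K t t01 /(K t t01) ht; apply: H.
Qed.

Lemma loc_d2 g s : loc g s -> loc (d2 g) (dys s).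
Proof.
move=> [d hd H]; exists d => // x y hx hy; have /andP[_ d1] := hd.
apply: (d2_sdiff (g := ev s)) (sdiff_ev s x y); first exact: lt_in01 hy.
by apply: filterS (near_lt hy) => r K t t01 /(K t t01) ht; apply: H.
Qed.

Lemma loc_mixed g s m1 m2 : loc g s ->
  mixed_der00 m1 m2 g = ev (iter m1 dxs (iter m2 dys s)) 0 0.
Proof.
move=> H; rewrite /mixed_der00.
have : loc (iter m1 (@d1 R R) (iter m2 (@d2 R R) g)) (iter m1 dxs (iter m2 dys s)).
  elim: m1 => [|m1 IH] /=; last exact: loc_d1.
  by elim: m2 => [//|m2 IH] /=; exact: loc_d2.
by move=> [d /andP[d0 _] E]; apply: E; rewrite lexx d0.
Qed.

Lemma locD g h s t : loc g s -> loc h t -> loc (fun x y => g x y + h x y) (s ++ t).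
Proof.
move=> [d /andP[d0 d1] H] [d' /andP[d'0 d'1] K]; exists (Num.min d d').
  by rewrite lt_min d0 d'0 ge_min d1.
move=> x y /andP[x0]; rewrite lt_min => /andP[x1 x2] /andP[y0]; rewrite lt_min => /andP[y1 y2].
by rewrite /ev big_cat /= H ?K ?x0 ?y0.
Qed.

Lemma locZ c g s : loc g s -> loc (fun x y => c * g x y) [seq (c *: k.1, k.2) | k <- s].
Proof.
move=> [d hd H]; exists d => // x y hx hy; rewrite H // /ev big_map mulr_sumr.
by apply: eq_bigr => k _; rewrite hornerZ mulrA.
Qed.

Lemma loc_pwbpoly g : pwbpoly n g -> exists s, loc g s.
Proof.
move=> H; have [P [[s HP] HQ]] := H 0%N 0%N n0 n0; exists s.
have n0' : 0 < n%:R :> R by rewrite ltr0n.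
exists n%:R^-1; first by rewrite invr_gt0 n0' invf_le1 // ler1n.
move=> x y /andP[x0 x1] /andP[y0 y1]; rewrite HQ ?HP // /cell mul0r mul1r.
  by rewrite x0 ltW.
by rewrite y0 ltW.
Qed.

Lemma mixedD m1 m2 g h : spl2 n g -> spl2 n h ->
  mixed_der00 m1 m2 (fun x y => g x y + h x y) = mixed_der00 m1 m2 g + mixed_der00 m1 m2 h.
Proof.
move=> [/loc_pwbpoly[s Hs] _] [/loc_pwbpoly[t Ht] _].
rewrite (loc_mixed m1 m2 (locD Hs Ht)) (loc_mixed m1 m2 Hs) (loc_mixed m1 m2 Ht).
have -> : iter m1 dxs (iter m2 dys (s ++ t)) = iter m1 dxs (iter m2 dys s) ++ iter m1 dxs (iter m2 dys t).
  have E2 : iter m2 dys (s ++ t) = iter m2 dys s ++ iter m2 dys t.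
    by elim: m2 => [//|m2 IH] /=; rewrite IH /dys map_cat.
  rewrite E2; elim: m1 => [//|m1 IH] /=; by rewrite IH /dxs map_cat.
by rewrite /ev big_cat.
Qed.

Lemma iter_pair m1 m2 (f1 f2 : {poly R}) :
  iter m1 dxs (iter m2 dys [:: (f1, f2)]) = [:: (iter m1 (@deriv R) f1, iter m2 (@deriv R) f2)].
Proof.
have -> : iter m2 dys [:: (f1, f2)] = [:: (f1, iter m2 (@deriv R) f2)].
  by elim: m2 => [//|m2 IH] /=; rewrite IH.
by elim: m1 => [//|m1 IH] /=; rewrite IH.
Qed.

Lemma mixedZ m1 m2 c g : spl2 n g ->
  mixed_der00 m1 m2 (fun x y => c * g x y) = c * mixed_der00 m1 m2 g.
Proof.
move=> [/loc_pwbpoly[s Hs] _].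
rewrite (loc_mixed m1 m2 (locZ c Hs)) (loc_mixed m1 m2 Hs) /ev mulr_sumr.
have -> : iter m1 dxs (iter m2 dys [seq (c *: k.1, k.2) | k <- s]) =
   [seq (c *: k.1, k.2) | k <- iter m1 dxs (iter m2 dys s)].
  have E2 : iter m2 dys [seq (c *: k.1, k.2) | k <- s] = [seq (c *: k.1, k.2) | k <- iter m2 dys s].
    by elim: m2 => [//|m2 IH] /=; rewrite IH /dys -!map_comp.
  rewrite E2; elim: m1 => [//|m1 IH] /=; rewrite IH /dxs -!map_comp.
  by apply: eq_map => k /=; rewrite derivZ.
by rewrite big_map; apply: eq_bigr => k _; rewrite hornerZ mulrA.
Qed.

Lemma iter_der01_poly u (P : {poly R}) d m : 0 < d <= 1 -> (forall x, 0 <= x < d -> u x = P.[x]) ->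
  iter m (@der01 R R) u 0 = (iter m (@deriv R) P).[0].
Proof.
move=> hd H; have /andP[d0 d1] := hd.
have : forall x, 0 <= x < d -> iter m (@der01 R R) u x = (iter m (@deriv R) P).[x].
  elim: m => [//|m IH] x hx /=.
  apply: (der01_sd (w := horner (iter m (@deriv R) P))); first exact: lt_in01 hx.
    by apply: filterS (near_lt hx) => r K t t01 /(K t t01) ht; apply: IH.
  exact: sd_poly.
by apply; rewrite lexx.
Qed.

Lemma mixed_tensor m1 m2 u w : pwpoly n u -> pwpoly n w ->
  mixed_der00 m1 m2 (fun x y => u x * w y) = iter m1 (@der01 R R) u 0 * iter m2 (@der01 R R) w 0.
Proof.
have n0' : 0 < n%:R :> R by rewrite ltr0n.
have hd : 0 < (n%:R^-1 : R) <= 1 by rewrite invr_gt0 n0' invf_le1 // ler1n.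
move=> /(_ 0%N n0)[P HP] /(_ 0%N n0)[Q HQ].
have {}HP x : 0 <= x < n%:R^-1 -> u x = P.[x].
  by move=> /andP[x0 x1]; rewrite HP // /cell mul0r mul1r x0 ltW.
have {}HQ x : 0 <= x < n%:R^-1 -> w x = Q.[x].
  by move=> /andP[x0 x1]; rewrite HQ // /cell mul0r mul1r x0 ltW.
rewrite (iter_der01_poly m1 hd HP) (iter_der01_poly m2 hd HQ).
rewrite (@loc_mixed _ [:: (P, Q)]) ?iter_pair /ev ?big_seq1 //.
by exists n%:R^-1 => // x y hx hy; rewrite /ev big_seq1 HP // HQ.
Qed.

Lemma eq_mixed m1 m2 g h : eqsq g h -> mixed_der00 m1 m2 g = mixed_der00 m1 m2 h.
Proof.
move=> E; rewrite /mixed_der00.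
have : eqsq (iter m1 (@d1 R R) (iter m2 (@d2 R R) g)) (iter m1 (@d1 R R) (iter m2 (@d2 R R) h)).
  elim: m1 => [|m1 IH] /=; last exact: d1_eqsq.
  by elim: m2 => [//|m2 IH] /=; exact: d2_eqsq.
by apply; exact: in01_0.
Qed.

Lemma mixed_sum m1 m2 (I : Type) (s : seq I) (p : pred I) (g : I -> R -> R -> R) :
  (forall i, p i -> spl2 n (g i)) ->
  mixed_der00 m1 m2 (fun x y => \sum_(i <- s | p i) g i x y) =
  \sum_(i <- s | p i) mixed_der00 m1 m2 (g i).
Proof.
move=> H; elim: s => [|i s IH].
  rewrite big_nil (eq_mixed _ _ (h := fun _ _ => 0)); last by move=> x y _ _; rewrite big_nil.
  rewrite (@loc_mixed _ [::]); last first.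
    by exists 1; rewrite ?ltr01 ?lexx // => x y _ _; rewrite /ev big_nil.
  have -> : iter m1 dxs (iter m2 dys [::]) = [::].
    have -> : iter m2 dys [::] = [::] by elim: m2 => [//|m2 IH] /=; rewrite IH.
    by elim: m1 => [//|m1 IH] /=; rewrite IH.
  by rewrite /ev big_nil.
rewrite big_cons; case: ifP => pi.
  rewrite -IH -mixedD //; [|exact: H|exact: spl2_sum].
  by apply: eq_mixed => x y _ _; rewrite big_cons pi.
by rewrite -IH; apply: eq_mixed => x y _ _; rewrite big_cons pi.
Qed.

End Jets.

(*FILE K*)
Section Rotation.
Variable R : realType.
Implicit Types (x y : R).

Definition det2 (a b : 'rV[R]_2) : R := a 0 0 * b 0 1 - a 0 1 * b 0 0.

Lemma det_row_mx2 (a b : 'rV[R]_2) : \det (row_mx a^T b^T : 'M[R]_2) = det2 a b.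
Proof.
set M := (X in \det X).
have M0 i : M i 0 = a 0 i.
  by rewrite /M (_ : 0 = lshift 1 (0 : 'I_1) :> 'I_2) ?row_mxEl ?mxE //; exact/val_inj.
have M1 i : M i 1 = b 0 i.
  by rewrite /M (_ : 1 = rshift 1 (0 : 'I_1) :> 'I_2) ?row_mxEr ?mxE //; exact/val_inj.
clearbody M; rewrite (expand_det_row _ 0) !big_ord_recl big_ord0 addr0 /cofactor !det_mx11 !mxE.
rewrite (_ : lift 0 0 = 1 :> 'I_2); last exact/val_inj.
rewrite (_ : lift 1 0 = 0 :> 'I_2); last exact/val_inj.
by rewrite !M0 !M1 /det2 /= !addn0 expr0 expr1 mul1r mulN1r mulrN [b 0 0 * _]mulrC.
Qed.

Lemma rot1_4 (T : Type) (g : R -> R -> T) x y : rot1 (rot1 (rot1 (rot1 g))) x y = g x y.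
Proof. by rewrite /rot1 !subKr. Qed.

Lemma iter_rot1_mod (T : Type) (g : R -> R -> T) k x y :
  iter (k %% 4) (@rot1 R T) g x y = iter k (@rot1 R T) g x y.
Proof.
rewrite [in RHS](divn_eq k 4) addnC.
elim: (k %/ 4)%N g x y => [|q IH] g x y; first by rewrite addn0.
rewrite mulSn addnCA iterD /= -[RHS]/(rot1 (rot1 (rot1 (rot1 (iter (k %% 4 + q * 4) (@rot1 R T) g)))) x y).
by rewrite rot1_4.
Qed.

Lemma rotateD (T : Type) (g : R -> R -> T) (k l : 'Z_4) x y :
  rotate (k + l) g x y = rotate k (rotate l g) x y.
Proof. by rewrite /rotate -iterD -[RHS]iter_rot1_mod. Qed.

Lemma rotate0 (T : Type) (g : R -> R -> T) x y : rotate (0 : 'Z_4) g x y = g x y.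
Proof. by []. Qed.

Lemma rotateK (T : Type) (g : R -> R -> T) (k : 'Z_4) x y : rotate k (rotate (- k) g) x y = g x y.
Proof. by rewrite -rotateD addrN. Qed.

Lemma Z4P (k : 'Z_4) : [\/ k = 0, k = 1, k = 2 | k = 3].
Proof.
case: k => -[|[|[|[|k]]]] // h; [constructor 1|constructor 2|constructor 3|constructor 4];
exact/val_inj.
Qed.

Lemma rotate1E (T : Type) (g : R -> R -> T) x y : rotate (1 : 'Z_4) g x y = g (1 - y) x.
Proof. by []. Qed.
Lemma rotate2E (T : Type) (g : R -> R -> T) x y : rotate (2 : 'Z_4) g x y = g (1 - x) (1 - y).
Proof. by []. Qed.
Lemma rotate3E (T : Type) (g : R -> R -> T) x y : rotate (3 : 'Z_4) g x y = g y (1 - x).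
Proof. by rewrite /rotate /= /rot1 subKr. Qed.

Lemma rotate_comp (S T : Type) (f : S -> T) (g : R -> R -> S) (k : 'Z_4) x y :
  rotate k (fun x y => f (g x y)) x y = f (rotate k g x y).
Proof. by rewrite /rotate; elim: (nat_of_ord k) x y => [//|j IH] x y /=; rewrite /rot1 IH. Qed.

Lemma eqsq_rotate (T : Type) (g h : R -> R -> T) (k : 'Z_4) : eqsq g h -> eqsq (rotate k g) (rotate k h).
Proof.
move=> E; rewrite /rotate; elim: (nat_of_ord k) => [//|j IH] x y hx hy /=.
by rewrite /rot1 IH //; apply: in01_rev.
Qed.

Lemma rotate_param (k : 'Z_4) x y : in01 x -> in01 y -> exists x' y',
  [/\ in01 x', in01 y', forall (T : Type) (g : R -> R -> T), rotate k g x y = g x' y' &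
      forall (T : Type) (g : R -> R -> T), rotate (- k) g x' y' = g x y].
Proof.
move=> hx hy.
suff [x' [y' [h1 h2 h3]]] : exists x' y', [/\ in01 x', in01 y' &
    forall (T : Type) (g : R -> R -> T), rotate k g x y = g x' y'].
  by exists x', y'; split => // T g; rewrite -h3 rotateK.
have rx := in01_rev hx; have ry := in01_rev hy.
case: (Z4P k) => ->.
- by exists x, y.
- by exists (1 - y), x.
- by exists (1 - x), (1 - y).
- by exists y, (1 - x); split => // T g; rewrite rotate3E.
Qed.

Lemma rotate_param_int (k : 'Z_4) x y : 0 < x < 1 -> 0 < y < 1 -> exists x' y',
  [/\ 0 < x' < 1, 0 < y' < 1 & forall (T : Type) (g : R -> R -> T), rotate k g x y = g x' y'].
Proof.
move=> hx hy.
have rv (t : R) : 0 < t < 1 -> 0 < 1 - t < 1 by move=> /andP[h1 h2]; apply/andP; split; lra.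
have rx := rv _ hx; have ry := rv _ hy.
case: (Z4P k) => ->.
- by exists x, y.
- by exists (1 - y), x.
- by exists (1 - x), (1 - y).
- by exists y, (1 - x); split => // T g; rewrite rotate3E.
Qed.

End Rotation.

Section Ext.
Variables (R : realType) (p r n : nat) (D : multipatch R).
Hypotheses (r0 : (0 < r)%N) (rp : (r < p)%N) (n0 : (0 < n)%N) (hD : is_multipatch p r n D).

Lemma spl2_geo (i : patchI D) c : spl2 n (fun x y => geo i x y 0 c).
Proof.
have [Cf HC] := geo_spline hD i c.
apply: (@eq_spl2 R n n0 (fun x y => \sum_(j1 < dimS p r n) \sum_(j2 < dimS p r n)
    Cf j1 j2 * (bspline p r n j1 x * bspline p r n j2 y))).
  by move=> x y hx hy; rewrite HC.
apply: spl2_sum => // j1 _; apply: spl2_sum => // j2 _; apply: spl2Z => //.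
by apply: spl2_tensor => //; apply: spl_bspline.
Qed.

Lemma spl2_geoS (s : side D) c : spl2 n (fun x y => geoS s x y 0 c).
Proof.
apply: (eq_spl2 n0) (spl2_rotate n0 s.2 (spl2_geo s.1 c)) => x y _ _.
by rewrite (rotate_comp (fun z : 'rV[R]_2 => z 0 c)).
Qed.

Definition patch_ext (s : side D) F1 F1x F1y F2 F2x F2y :=
  [/\ C1fun F1 F1x F1y, C1fun F2 F2x F2y, eqsq (geoS s) (fun x y => row2 (F1 x y) (F2 x y)),
   eqsq (d1 (geoS s)) (fun x y => row2 (F1x x y) (F2x x y)) &
   eqsq (d2 (geoS s)) (fun x y => row2 (F1y x y) (F2y x y))].

Lemma patch_ext_ex s : exists F1 F1x F1y F2 F2x F2y, patch_ext s F1 F1x F1y F2 F2x F2y.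
Proof.
have [_ [F1 [F1x [F1y [C1 E1]]]]] := spl2_geoS s 0.
have [_ [F2 [F2x [F2y [C2 E2]]]]] := spl2_geoS s 1.
exists F1, F1x, F1y, F2, F2x, F2y.
have E : eqsq (geoS s) (fun x y => row2 (F1 x y) (F2 x y)).
  by move=> x y hx hy; rewrite [LHS]row2E E1 ?E2.
split=> // x y hx hy.
  apply: (d1_row (g0 := F1) (g1 := F2)) (C1 x y) (C2 x y) => //.
  by apply: (right0_le ltr01) => d _ t ht _; exact: E.
apply: (d1_row (h := fun x y => geoS s y x) (g0 := fun x y => F1 y x) (g1 := fun x y => F2 y x)) => //.
- by apply: (right0_le ltr01) => d _ t ht _; exact: E.
- exact: sdiff_swap (C1 x y).
- exact: sdiff_swap (C2 x y).
Qed.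

Lemma geoS_param (s : side D) x y : in01 x -> in01 y -> exists x' y',
  [/\ in01 x', in01 y', geoS s x y = geo s.1 x' y' &
     forall (T : Type) (g : R -> R -> T), rotate s.2 g x y = g x' y'].
Proof.
move=> hx hy; have [x' [y' [h1 h2 h3 h4]]] := rotate_param s.2 hx hy.
by exists x', y'; split => //; exact: h3.
Qed.

Lemma geoS_inj (s : side D) x y x' y' : in01 x -> in01 y -> in01 x' -> in01 y' ->
  geoS s x y = geoS s x' y' -> x = x' /\ y = y'.
Proof.
move=> hx hy hx' hy'.
have [a [b [h1 h2 h3 h4]]] := rotate_param s.2 hx hy.
have [a' [b' [h1' h2' h3' h4']]] := rotate_param s.2 hx' hy'.
rewrite /geoS h3 h3' => /(geo_inj hD h1 h2 h1' h2')[Ea Eb]; subst a' b'.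
by split; [rewrite -(h4 _ (fun x _ => x)) h4'|rewrite -(h4 _ (fun _ y => y)) h4'].
Qed.

Lemma d1_geoS_rot (s : side D) x y : in01 x -> in01 y ->
  d1 (geoS (s.1, s.2 + 1)) x y = d2 (geoS s) (1 - y) x /\
  d2 (geoS (s.1, s.2 + 1)) x y = - d1 (geoS s) (1 - y) x.
Proof.
move=> hx hy.
have E : eqsq (geoS (s.1, s.2 + 1)) (rot1 (geoS s)).
  by move=> a b _ _; rewrite /geoS /= [s.2 + 1]addrC rotateD.
have [F1 [F1x [F1y [F2 [F2x [F2y [C1 C2 E0 E1 E2]]]]]]] := patch_ext_ex s.
split; first by rewrite (d1_eqsq E).
rewrite (d2_eqsq E) // E1 //; last exact: in01_rev.
have -> : - row2 (F1x (1 - y) x) (F2x (1 - y) x) = row2 (- F1x (1 - y) x) (- F2x (1 - y) x).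
  by rewrite [LHS]row2E !mxE.
apply: (d1_row (h := fun x y => rot1 (geoS s) y x) (g0 := fun x y => rot1 F1 y x)
  (g1 := fun x y => rot1 F2 y x)) => //.
- apply: (right0_le ltr01) => d _ t ht _; rewrite /rot1 E0 //; exact: in01_rev.
- exact: (sdiff_swap (sdiff_rot1 (C1 (1 - y) x))).
- exact: (sdiff_swap (sdiff_rot1 (C2 (1 - y) x))).
Qed.

Lemma det2_geoS (s : side D) x y : in01 x -> in01 y -> 0 < det2 (d1 (geoS s) x y) (d2 (geoS s) x y).
Proof.
case: s => i k; have [j -> ] : exists j : nat, k = j%:R by exists (k : nat); rewrite Zp_nat valZpK.
elim: j x y => [|j IH] x y hx hy.
  by have := geo_det hD i hx hy; rewrite det_row_mx2.
have [] := d1_geoS_rot (i, j%:R) hx hy; rewrite /= natr1 => -> ->.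
have alg (a b c d : R) : a * d - b * c = c * - b - d * - a by ring.
by have := IH _ _ (in01_rev hy) hx; rewrite /det2 !mxE alg.
Qed.

Lemma patch_ext_det s F1 F1x F1y F2 F2x F2y x y : patch_ext s F1 F1x F1y F2 F2x F2y ->
  in01 x -> in01 y -> 0 < F1x x y * F2y x y - F1y x y * F2x x y.
Proof.
move=> [_ _ _ E1 E2] hx hy; have := det2_geoS s hx hy.
by rewrite E1 // E2 // /det2 !row2_0 !row2_1 [F2x x y * _]mulrC.
Qed.

Lemma patch_ext_inj s F1 F1x F1y F2 F2x F2y x y x' y' : patch_ext s F1 F1x F1y F2 F2x F2y ->
  rect 0 1 0 1 x y -> rect 0 1 0 1 x' y' -> F1 x y = F1 x' y' -> F2 x y = F2 x' y' ->
  x = x' /\ y = y'.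
Proof.
move=> [_ _ E _ _] [h1 h2] [h3 h4] e1 e2; apply: (@geoS_inj s) => //.
by rewrite !E // e1 e2.
Qed.

End Ext.

(*FILE L*)
Section Geometry.
Variables (R : realType) (p r n : nat) (D : multipatch R).
Hypotheses (r0 : (0 < r)%N) (rp : (r < p)%N) (n0 : (0 < n)%N) (hD : is_multipatch p r n D).
Implicit Types (s : side D) (i j : patchI D) (x y t : R).

Local Notation ext_ex := (patch_ext_ex r0 rp n0 hD).
Local Notation rect01 := (rect (0 : R) 1 0 1).

Let le01 : (0 : R) <= 1 := ler01.

Lemma geoS0 i : geoS ((i, 0) : side D) = geo i.
Proof. by []. Qed.

Lemma near_patch i (z : 'rV[R]_2) (Q : R -> R -> Prop) :
  (forall x y, in01 x -> in01 y -> geo i x y = z ->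
     \forall d \near 0^'+, forall x' y', in01 x' -> in01 y' -> box x y d x' y' -> Q x' y') ->
  \forall d \near 0^'+, forall x y, in01 x -> in01 y ->
    box (z 0 0) (z 0 1) d (geo i x y 0 0) (geo i x y 0 1) -> Q x y.
Proof.
move=> H; have [F1 [F1x [F1y [F2 [F2x [F2y [C1 C2 E _ _]]]]]]] := ext_ex (i, 0).
have [c1 _ _] := C1_cont2 C1; have [c2 _ _] := C1_cont2 C2.
have Hf x y : rect01 x y -> F1 x y = z 0 0 -> F2 x y = z 0 1 ->
    \forall d \near 0^'+, forall x' y', rect01 x' y' -> box x y d x' y' -> Q x' y'.
  move=> [hx hy] e1 e2.
  have Ez : geo i x y = z by rewrite -geoS0 E // e1 e2 -row2E.
  by apply: filterS (H x y hx hy Ez) => d K x' y' [hx' hy'] b; apply: K.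
apply: filterS (rect_fiber c1 c2 Hf) => d K x y hx hy b; apply: K => //.
by move: b; rewrite -geoS0 E // row2_0 row2_1.
Qed.

Lemma near_patches (z : 'rV[R]_2) (P : 'rV[R]_2 -> Prop) :
  (forall i x y, in01 x -> in01 y -> geo i x y = z ->
     \forall d \near 0^'+, forall x' y', in01 x' -> in01 y' -> box x y d x' y' -> P (geo i x' y')) ->
  \forall z' \near z, closure (Omega D) z' -> P z'.
Proof.
move=> H; have K i := near_patch (Q := fun x y => P (geo i x y)) (H i).
have FF : Filter (0 : R)^'+ by apply: filter_filter.
have {}K := @filter_forall R (patchI D) _ _ FF K.
apply/near_row2; apply: filterS K => d K a b hb.
rewrite (Omega_cover hD) => -[i _ [x [y [hx hy E]]]].
by rewrite E; apply: (K i x y) => //; rewrite -E row2_0 row2_1.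
Qed.

Definition opp s s' := s.1 <> s'.1 /\ forall t, in01 t -> geoS s 0 t = geoS s' 0 (1 - t).

Lemma opp_sym s s' : opp s s' -> opp s' s.
Proof.
move=> [h1 h2]; split; first by move=> E; apply: h1.
by move=> t ht; rewrite h2 ?subKr //; exact: in01_rev.
Qed.

Lemma int01 t : 0 < t < 1 -> in01 t.
Proof. by move=> /andP[/ltW a /ltW b]; apply/andP. Qed.

Lemma sqr_sum_le0 (a b : R) : a ^+ 2 + b ^+ 2 <= 0 -> a = 0 /\ b = 0.
Proof.
move=> h; have h1 := sqr_ge0 a; have h2 := sqr_ge0 b.
have /eqP : a ^+ 2 = 0 by lra.
have /eqP : b ^+ 2 = 0 by lra.
by rewrite !expf_eq0 /= => /eqP -> /eqP ->.
Qed.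

(* The inner normal of the edge points into the open patch. *)
Lemma inner_normal s t : 0 < t < 1 ->
  \forall d \near 0^'+, open_patch s.1
    (row2 (geoS s 0 t 0 0 + d * d2 (geoS s) 0 t 0 1) (geoS s 0 t 0 1 - d * d2 (geoS s) 0 t 0 0)).
Proof.
move=> ht; have ht' := int01 ht.
have [F1 [F1x [F1y [F2 [F2x [F2y X]]]]]] := ext_ex s; have [C1 C2 E E1 E2] := X.
have J y : in01 y -> 0 < F1x 0 y * F2y 0 y - F1y 0 y * F2x 0 y.
  by move=> hy; apply: (patch_ext_det r0 rp n0 hD X) => //; exact: in01_0.
rewrite E ?E2 //; [|exact: in01_0..]; rewrite !row2_0 !row2_1.
set v1 := F1y 0 t; set v2 := F2y 0 t; set z1 := F1 0 t; set z2 := F2 0 t.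
have [C C0 L] := sdiff_LB (C1 0 t) (C2 0 t) (lt0r_neq0 (J _ ht')).
pose V := `|v1| + `|v2|; pose W := v1 ^+ 2 + v2 ^+ 2.
have V0 : 0 <= V by rewrite addr_ge0.
have W0 : 0 < W.
  rewrite lt_def addr_ge0 ?sqr_ge0 // andbT; apply: contraTneq (J _ ht') => W0.
  have /eqP := W0; rewrite paddr_eq0 ?sqr_ge0 // !expf_eq0 /= => /andP[/eqP e1 /eqP e2].
  by rewrite -/v1 -/v2 e1 e2 mulr0 mul0r subrr ltxx.
pose B := V + 4 * C * V * (2 * V + 2) + 1.
have B0 : 0 < B by rewrite ltr_wpDl // addr_ge0 // !mulr_ge0 ?addr_ge0 ?mulr_ge0 // ltW.
pose e := Num.min 1 (W / (2 * B)).
have e0 : 0 < e by rewrite lt_min ltr01 divr_gt0 // mulr_gt0.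
have e1 : e <= 1 by rewrite ge_min lexx.
have eB : e * B < W.
  have : e <= W / (2 * B) by rewrite ge_min lexx orbT.
  rewrite ler_pdivlMr ?mulr_gt0 // => h; have := mulr_gt0 e0 B0; lra.
have [_ _ c1y] := C1_cont2 C1; have [_ _ c2y] := C1_cont2 C2.
have Hd : \forall d \near 0^'+, forall x y, rect01 x y -> box 0 t d x y ->
   [/\ 0 < y < 1, x < 1 & x = 0 -> 
     [/\ `|y - t| <= C * (`|F1 0 y - z1| + `|F2 0 y - z2|),
         `|F1 0 y - z1 - v1 * (y - t)| <= e * `|y - t|,
         `|F2 0 y - z2 - v2 * (y - t)| <= e * `|y - t|,
         `|F1y 0 y - v1| <= e & `|F2y 0 y - v2| <= e]].
  move: ht => /andP[t0 t1]; near=> d => x y [hx hy] [b1 b2].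
  have d0 : 0 < d by near: d; exact: nbhs_right_gt.
  have dt : d < t by near: d; exact: nbhs_right_lt.
  have dt' : d < 1 - t by near: d; apply: nbhs_right_lt; rewrite subr_gt0.
  have dl : d < 1 by near: d; exact: nbhs_right_lt.
  split.
  - by move: b2; rewrite ltr_norml => /andP[? ?]; apply/andP; split; lra.
  - by move: b1; rewrite ltr_norml => /andP[? ?]; lra.
  move=> x0; rewrite x0 in b1.
  have by' : box 0 t d 0 y by split.
  have L1 : forall x y x' y', box 0 t d x y -> box 0 t d x' y' ->
    `|x' - x| + `|y' - y| <= C * (`|F1 x' y' - F1 x y| + `|F2 x' y' - F2 x y|) by near: d.
  have S1 : forall x y x' y', box 0 t d x y -> box 0 t d x' y' ->
    `|F1 x' y' - F1 x y - (F1x 0 t * (x' - x) + v1 * (y' - y))| <= e * (`|x' - x| + `|y' - y|).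
    by near: d; exact: C1.
  have S2 : forall x y x' y', box 0 t d x y -> box 0 t d x' y' ->
    `|F2 x' y' - F2 x y - (F2x 0 t * (x' - x) + v2 * (y' - y))| <= e * (`|x' - x| + `|y' - y|).
    by near: d; exact: C2.
  have T1 : forall x' y', box 0 t d x' y' -> `|F1y x' y' - F1y 0 t| < e by near: d; exact: c1y.
  have T2 : forall x' y', box 0 t d x' y' -> `|F2y x' y' - F2y 0 t| < e by near: d; exact: c2y.
  have c0 := box_center 0 t d0.
  split; [| | |exact: ltW (T1 _ _ by')|exact: ltW (T2 _ _ by')].
  - by have := L1 _ _ _ _ c0 by'; rewrite subrr normr0 add0r.
  - by have := S1 _ _ _ _ c0 by'; rewrite subrr normr0 add0r mulr0 add0r.
  - by have := S2 _ _ _ _ c0 by'; rewrite subrr normr0 add0r mulr0 add0r.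
have inj := patch_ext_inj hD X.
have Rt : rect01 0 t by split=> //; rewrite lexx ler01.
have [d dgt0 K] := right0_ex (rimage_near C1 C2 inj Rt Hd).
near=> dl.
have dl0 : 0 < dl by near: dl; exact: nbhs_right_gt.
have dlV : dl * (V + V + 1) < d / 2.
  rewrite -ltr_pdivlMr ?ltr_wpDl ?addr_ge0 //; near: dl; apply: nbhs_right_lt.
  by rewrite !divr_gt0 // ltr_wpDl ?addr_ge0.
set q1 := z1 + dl * v2; set q2 := z2 - dl * v1.
have N := rimage_nearest C1 C2 le01 le01.
have [m1 [m2 nm]] := N q1 q2; have [[x [y [hxy Em1 Em2]]] M] := nm.
have Mz : (q1 - m1) ^+ 2 + (q2 - m2) ^+ 2 <= dl ^+ 2 * W.
  have := M z1 z2; rewrite /q1 /q2 => /(_ _)/le_trans; apply; first by exists 0, t.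
  by rewrite le_eqVlt; apply/orP; left; apply/eqP; rewrite /W; ring.
have WV : W <= V ^+ 2.
  rewrite /W /V -(real_normK (num_real v1)) -(real_normK (num_real v2)).
  by have := mulr_ge0 (normr_ge0 v1) (normr_ge0 v2); clear -r0 rp n0 hD le01; lra.
have small (a b : R) : a ^+ 2 + b ^+ 2 <= dl ^+ 2 * W -> `|a| <= dl * V.
  move=> h; rewrite -ler_sqr ?nnegrE ?mulr_ge0 ?(ltW dl0) // real_normK ?num_real //.
  have := sqr_ge0 b; have := ler_wpM2l (sqr_ge0 dl) WV; rewrite exprMn; move: h; clear -r0 rp n0 hD le01; lra.
have s1 := small _ _ Mz.
have s2 : `|q2 - m2| <= dl * V by apply: (small _ (q1 - m1)); rewrite addrC.
have nv1 : `|v1| <= V by rewrite lerDl.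
have nv2 : `|v2| <= V by rewrite lerDr.
have w1 : `|m1 - z1| <= 2 * (dl * V).
  have -> : m1 - z1 = dl * v2 - (q1 - m1) by rewrite /q1; ring.
  apply: le_trans (ler_normB _ _) _; rewrite normrM (gtr0_norm dl0).
  by have := ler_wpM2l (ltW dl0) nv2; move: s1; clear -r0 rp n0 hD le01; lra.
have w2 : `|m2 - z2| <= 2 * (dl * V).
  have -> : m2 - z2 = - (dl * v1) - (q2 - m2) by rewrite /q2; ring.
  apply: le_trans (ler_normB _ _) _; rewrite normrN normrM (gtr0_norm dl0).
  by have := ler_wpM2l (ltW dl0) nv1; move: s2; clear -r0 rp n0 hD le01; lra.
have bm : box z1 z2 d (F1 x y) (F2 x y).
  by rewrite -Em1 -Em2; split; [apply: le_lt_trans w1 _|apply: le_lt_trans w2 _]; move: dlV dl0 (dgt0); clear -r0 rp n0 hD le01; lra.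
have [hy hx1 K0] := K _ _ hxy bm.
have tg (v w : R) : (\forall t \near 0^'+, rect01 (x + t * v) (y + t * w)) ->
    (q1 - m1) * (F1x x y * v + F1y x y * w) + (q2 - m2) * (F2x x y * v + F2y x y * w) <= 0.
  move=> h; apply: (nearest_tangent nm); rewrite Em1 Em2.
  exact: rimage_tangent.
have ymove (w : R) : \forall t \near 0^'+, 0 <= y + t * w <= 1.
  move: hy => /andP[y0 y1]; pose Q := `|w| + 1; have Q0 : 0 < Q by rewrite ltr_wpDl.
  near=> a; have a0 : 0 < a by near: a; exact: nbhs_right_gt.
  have ay : a * Q < y by rewrite -ltr_pdivlMr //; near: a; apply: nbhs_right_lt; rewrite divr_gt0.
  have ay' : a * Q < 1 - y.
    by rewrite -ltr_pdivlMr //; near: a; apply: nbhs_right_lt; rewrite divr_gt0 // subr_gt0.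
  have : `|a * w| <= a * Q by rewrite normrM (gtr0_norm a0) ler_wpM2l ?(ltW a0) // lerDl.
  by rewrite ler_norml => /andP[]; move: ay ay'; clear -r0 rp n0 hD le01; move=> ? ? ? ?; apply/andP; split; lra.
have [hx0 _] := hxy; case/andP: hx0 => x0 _.
have [x00|xn0] := eqVneq x 0; last first.
  have xpos : 0 < x by rewrite lt_def xn0.
  have ri : rect_int 0 1 0 1 x y by split; rewrite ?xpos.
  have Jxy : F1x x y * F2y x y - F1y x y * F2x x y != 0.
    rewrite gt_eqF //; apply: (patch_ext_det r0 rp n0 hD X); first by case: hxy.
    exact: int01.
  have T := rimage_full_tangent C1 C2 (q1 - m1) (q2 - m2) ri Jxy.
  rewrite -Em1 -Em2 in T; have := nearest_tangent nm T; rewrite -!expr2 => le0.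
  have [/eqP + /eqP] := sqr_sum_le0 le0; rewrite !subr_eq0 => /eqP Eq1 /eqP Eq2.
  have x1 : 0 < x < 1 by rewrite xpos.
  have [x' [y' [hx' hy' Exy]]] := rotate_param_int s.2 x1 hy.
  exists x', y'; split => //; rewrite -Exy -/(geoS s) E //; last by exact: int01.
    by rewrite -Em1 -Em2 -Eq1 -Eq2.
  by case: hxy.
have [Ly Sy1 Sy2 Ty1 Ty2] := K0 x00; rewrite {}x00 {x0 bm K0 hxy} in Em1 Em2 tg *.
have hy01 := int01 hy.
have ty (w : R) : (q1 - m1) * (F1y 0 y * w) + (q2 - m2) * (F2y 0 y * w) <= 0.
  have := tg 0 w; rewrite !mulr0 !add0r; apply; apply: filterS (ymove w) => a ha; split => //.
  by rewrite mulr0 addr0 lexx ler01.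
have tv : (q1 - m1) * F1y 0 y + (q2 - m2) * F2y 0 y = 0.
  by have := ty 1; have := ty (-1); rewrite !mulr1 !mulrN1 !mulrN; clear -r0 rp n0 hD le01; lra.
have tu : (q1 - m1) * F1x 0 y + (q2 - m2) * F2x 0 y <= 0.
  have := tg 1 0; rewrite !mulr0 !addr0 !mulr1; apply.
  apply: filterS (filterI (nbhs_right_gt 0) (nbhs_right_le ltr01)) => a [a0 a1].
  by split; rewrite ?mulr0 ?addr0 ?mulr1 ?add0r // ltW.
have Jy := J _ hy01.
have dle : (q1 - m1) * F2y 0 y - (q2 - m2) * F1y 0 y <= 0.
  rewrite leNgt; apply/negP => dpos.
  have Id : ((q1 - m1) ^+ 2 + (q2 - m2) ^+ 2) * (F1x 0 y * F2y 0 y - F1y 0 y * F2x 0 y) =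
    ((q1 - m1) * F2y 0 y - (q2 - m2) * F1y 0 y) * ((q1 - m1) * F1x 0 y + (q2 - m2) * F2x 0 y) +
    (F1x 0 y * (q2 - m2) - F2x 0 y * (q1 - m1)) * ((q1 - m1) * F1y 0 y + (q2 - m2) * F2y 0 y).
    by ring.
  have le0 : (q1 - m1) ^+ 2 + (q2 - m2) ^+ 2 <= 0.
    by rewrite -(pmulr_lle0 _ Jy) Id tv mulr0 addr0 pmulr_rle0.
  have [u1 u2] := sqr_sum_le0 le0.
  by rewrite u1 u2 !mul0r subrr ltxx in dpos.
exfalso; rewrite -Em1 -Em2 in Ly Sy1 Sy2.
set tau := y - t in Ly Sy1 Sy2; set rho1 := F1y 0 y - v1 in Ty1; set rho2 := F2y 0 y - v2 in Ty2.
set sg1 := m1 - z1 - v1 * tau in Sy1; set sg2 := m2 - z2 - v2 * tau in Sy2.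
have Key : dl * W <= - (dl * (v1 * rho1 + v2 * rho2)) + tau * (v1 * rho2 - v2 * rho1) +
    sg1 * (v2 + rho2) - sg2 * (v1 + rho1).
  rewrite -subr_ge0 (_ : _ - _ = - ((q1 - m1) * F2y 0 y - (q2 - m2) * F1y 0 y)) ?oppr_ge0 //.
  by rewrite /W /q1 /q2 /rho1 /rho2 /sg1 /sg2; ring.
have tb : `|tau| <= C * (4 * (dl * V)).
  by apply: le_trans Ly _; rewrite ler_wpM2l ?(ltW C0) //; move: w1 w2; clear -r0 rp n0 hD le01; lra.
have e0' := ltW e0; have dl0' := ltW dl0; have t0 := normr_ge0 tau.
have pp (a b A' B' : R) : `|a| <= A' -> `|b| <= B' -> `|a * b| <= A' * B'.
  by move=> h1 h2; rewrite normrM ler_pM.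
have P1 : - (dl * (v1 * rho1 + v2 * rho2)) <= dl * (e * V).
  rewrite -mulrN ler_wpM2l // (le_trans (ler_norm _)) // normrN.
  apply: le_trans (ler_normD _ _) _.
  by have := pp _ _ _ _ (lexx `|v1|) Ty1; have := pp _ _ _ _ (lexx `|v2|) Ty2; rewrite /V; clear -r0 rp n0 hD le01; lra.
have P2 : tau * (v1 * rho2 - v2 * rho1) <= `|tau| * (e * V).
  apply: le_trans (ler_norm _) _; rewrite normrM ler_wpM2l //; apply: le_trans (ler_normB _ _) _.
  by have := pp _ _ _ _ (lexx `|v1|) Ty2; have := pp _ _ _ _ (lexx `|v2|) Ty1; rewrite /V; clear -r0 rp n0 hD le01; lra.
have P3 : sg1 * (v2 + rho2) <= e * `|tau| * (`|v2| + e).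
  apply: le_trans (ler_norm _) _; apply: pp => //; apply: le_trans (ler_normD _ _) _.
  by rewrite lerD.
have P4 : - (sg2 * (v1 + rho1)) <= e * `|tau| * (`|v1| + e).
  rewrite -mulrN; apply: le_trans (ler_norm _) _; apply: pp => //; rewrite normrN.
  by apply: le_trans (ler_normD _ _) _; rewrite lerD.
have P5 : e * `|tau| * (2 * V + 2) <= e * (C * (4 * (dl * V))) * (2 * V + 2).
  by rewrite ler_wpM2r ?addr_ge0 ?mulr_ge0 // ler_wpM2l.
have P6 : e * `|tau| * (`|v2| + e) + e * `|tau| * (`|v1| + e) <= e * `|tau| * (V + 2).
  by rewrite -mulrDr ler_wpM2l ?mulr_ge0 // /V; move: e1; clear -r0 rp n0 hD le01; lra.
have P7 : dl * (e * B) < dl * W by rewrite ltr_pM2l.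
have P8 : 0 < dl * e by rewrite mulr_gt0.
by move: Key P1 P2 P3 P4 P5 P6 P7 P8; rewrite /B; clear -r0 rp n0 hD le01; lra.
Unshelve. all: by end_near. Qed.

End Geometry.

(*FILE M*)
Section Geometry2.
Variables (R : realType) (p r n : nat) (D : multipatch R).
Hypotheses (r0 : (0 < r)%N) (rp : (r < p)%N) (n0 : (0 < n)%N) (hD : is_multipatch p r n D).
Implicit Types (s : side D) (i j : patchI D) (x y t : R).

Local Notation ext_ex := (patch_ext_ex r0 rp n0 hD).
Local Notation rect01 := (rect (0 : R) 1 0 1).

Let le01 : (0 : R) <= 1 := ler01.

Lemma rev_int t : 0 < t < 1 -> 0 < 1 - t < 1.
Proof. by move=> /andP[h1 h2]; apply/andP; split; lra. Qed.

Lemma half_int : 0 < (1 / 2 : R) < 1.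
Proof. by apply/andP; split; lra. Qed.

Lemma no_same_orientation s s' : s.1 <> s'.1 ->
  (forall t, in01 t -> geoS s 0 t = geoS s' 0 t) -> False.
Proof.
move=> ns E; have hh := half_int.
have E2 : d2 (geoS s) 0 (1 / 2) = d2 (geoS s') 0 (1 / 2).
  by apply: der01_ext => //; exact: int01.
have [d _ [H1 H2]] := right0_ex (filterI (inner_normal r0 rp n0 hD s hh) (inner_normal r0 rp n0 hD s' hh)).
rewrite -E2 -E in H2; last exact: int01.
by have := patches_disjoint hD ns; rewrite -subset0 => /(_ _ (conj H1 H2)).
Qed.

Lemma side_uniq s s' t t' : s.1 = s'.1 -> geoS s 0 t = geoS s' 0 t' -> 0 < t < 1 -> in01 t' ->
  s = s' /\ t = t'.
Proof.
case: s s' => i k [i' k'] /= <- E ht ht'; have ht01 := int01 ht.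
have h0 := in01_0 R; have h1 := in01_1 R.
have rt := in01_rev ht01; have rt' := in01_rev ht'.
have H a b c d : geo i a b = geo i c d -> in01 a -> in01 b -> in01 c -> in01 d -> a = c /\ b = d.
  by move=> e ha hb hc hd; exact: (geo_inj hD ha hb hc hd e).
move: E; rewrite /geoS /=; case/andP: ht => t0 t1.
case: (Z4P k) => ->; case: (Z4P k') => -> ;
  rewrite ?rotate0 ?rotate1E ?rotate2E ?rotate3E ?subr0 => /H[] // a b;
  clear H h0 h1 rt rt' ht01 ht'; first [by split; [|lra]|by exfalso; lra].
Qed.

Lemma opp_uniq s s' s'' : opp s s' -> opp s s'' -> s' = s''.
Proof.
move=> [n1 E1] [n2 E2].
have E t : in01 t -> geoS s' 0 t = geoS s'' 0 t.
  by move=> ht; have := E1 _ (in01_rev ht); rewrite E2 ?subKr //; exact: in01_rev.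
have [e|/eqP ne] := eqVneq s'.1 s''.1; last by case: (no_same_orientation ne E).
have hh := half_int; have h01 := int01 hh.
by have [] := side_uniq e (E _ h01) hh h01.
Qed.

Definition cp i (a b : R) := closed_patch i (row2 a b).

Lemma closed_patch_side s z : closed_patch s.1 z -> exists x y, [/\ in01 x, in01 y & z = geoS s x y].
Proof.
move=> [x [y [hx hy ->]]].
have [x' [y' [h1 h2 _ h4]]] := rotate_param (- s.2) hx hy.
by exists x', y'; split => //; rewrite /geoS -[s.2]opprK h4.
Qed.

Lemma geoS_closed_patch s x y : in01 x -> in01 y -> closed_patch s.1 (geoS s x y).
Proof.
move=> hx hy; have [x' [y' [h1 h2 h3 _]]] := geoS_param s hx hy.
by exists x', y'; split.
Qed.

Lemma rimage_cp s F1 F1x F1y F2 F2x F2y a b : patch_ext s F1 F1x F1y F2 F2x F2y ->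
  rimage F1 F2 0 1 0 1 a b <-> cp s.1 a b.
Proof.
move=> [_ _ E _ _]; split.
  by move=> [x [y [[hx hy] -> ->]]]; rewrite /cp -E //; exact: geoS_closed_patch.
move=> /closed_patch_side[x [y [hx hy]]]; rewrite E // => /rowP e.
exists x, y; split=> //; first by have := e 0; rewrite !mxE.
by have := e 1; rewrite !mxE.
Qed.

Lemma cp_nearest i : has_nearest (cp i).
Proof.
have [F1 [F1x [F1y [F2 [F2x [F2y X]]]]]] := ext_ex (i, 0); have [C1 C2 _ _ _] := X.
move=> q1 q2; have [m1 [m2 [K M]]] := rimage_nearest C1 C2 le01 le01 q1 q2.
exists m1, m2; split; first exact/(rimage_cp _ _ X).
by move=> a b /(rimage_cp _ _ X); exact: M.
Qed.

Lemma cp_full s x y v1 v2 : 0 < x < 1 -> 0 < y < 1 ->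
  tangent (cp s.1) (geoS s x y 0 0) (geoS s x y 0 1) v1 v2.
Proof.
move=> hx hy.
have [F1 [F1x [F1y [F2 [F2x [F2y X]]]]]] := ext_ex s; have [C1 C2 E _ _] := X.
have hx' := int01 hx; have hy' := int01 hy.
rewrite E // row2_0 row2_1.
apply: (@tangentW _ (rimage F1 F2 0 1 0 1)); first by move=> a b /(rimage_cp _ _ X).
apply: (rimage_full_tangent C1 C2); first by split.
by rewrite gt_eqF // (patch_ext_det r0 rp n0 hD X).
Qed.

Lemma cp_half s y v1 v2 : 0 < y < 1 -> 0 <= det2 (row2 v1 v2) (d2 (geoS s) 0 y) ->
  tangent (cp s.1) (geoS s 0 y 0 0) (geoS s 0 y 0 1) v1 v2.
Proof.
move=> hy.
have [F1 [F1x [F1y [F2 [F2x [F2y X]]]]]] := ext_ex s; have [C1 C2 E _ E2] := X.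
have hy' := int01 hy; have h0 := in01_0 R.
rewrite E ?E2 // /det2 !row2_0 !row2_1 => dg.
apply: (@tangentW _ (rimage F1 F2 0 1 0 1)); first by move=> a b /(rimage_cp _ _ X).
have J := patch_ext_det r0 rp n0 hD X h0 hy'; have J0 := lt0r_neq0 J.
pose a := (v1 * F2y 0 y - v2 * F1y 0 y) / (F1x 0 y * F2y 0 y - F1y 0 y * F2x 0 y).
pose b := (v2 * F1x 0 y - v1 * F2x 0 y) / (F1x 0 y * F2y 0 y - F1y 0 y * F2x 0 y).
have a0 : 0 <= a by rewrite divr_ge0 // ltW.
have -> : v1 = F1x 0 y * a + F1y 0 y * b by rewrite /a /b; field.
have -> : v2 = F2x 0 y * a + F2y 0 y * b by rewrite /a /b; field.
apply: (rimage_tangent C1 C2) => //.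
move: hy => /andP[y0 y1].
pose Q := `|b| + 1; have Q0 : 0 < Q by rewrite ltr_wpDl.
pose P := a + 1; have P0 : 0 < P by rewrite ltr_wpDl.
near=> e; have e0 : 0 < e by near: e; exact: nbhs_right_gt.
have ey : e * Q < y by rewrite -ltr_pdivlMr //; near: e; apply: nbhs_right_lt; rewrite divr_gt0.
have ey' : e * Q < 1 - y.
  by rewrite -ltr_pdivlMr //; near: e; apply: nbhs_right_lt; rewrite divr_gt0 // subr_gt0.
have ex : e * P < 1 by rewrite -ltr_pdivlMr //; near: e; apply: nbhs_right_lt; rewrite divr_gt0.
have : `|e * b| <= e * Q by rewrite normrM (gtr0_norm e0) ler_wpM2l ?(ltW e0) // lerDl.
have ea : 0 <= e * a by rewrite mulr_ge0 // ltW.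
have ea' : e * a <= e * P by rewrite ler_wpM2l ?(ltW e0) // /P lerDl.
rewrite ler_norml add0r => /andP[]; move: ey ey' ex ea ea'; clear -r0 rp n0 hD le01.
by move=> ? ? ? ? ? ? ?; split; apply/andP; split; lra.
Unshelve. all: by end_near. Qed.

Lemma cp_near s x y (Q : R -> R -> Prop) : in01 x -> in01 y ->
  (\forall d \near 0^'+, forall x' y', in01 x' -> in01 y' -> box x y d x' y' -> Q x' y') ->
  \forall d \near 0^'+, forall x' y', in01 x' -> in01 y' ->
    box (geoS s x y 0 0) (geoS s x y 0 1) d (geoS s x' y' 0 0) (geoS s x' y' 0 1) -> Q x' y'.
Proof.
move=> hx hy H.
have [F1 [F1x [F1y [F2 [F2x [F2y X]]]]]] := ext_ex s; have [C1 C2 E _ _] := X.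
have H' : \forall d \near 0^'+, forall x' y', rect01 x' y' -> box x y d x' y' -> Q x' y'.
  by apply: filterS H => d K x' y' [a b]; apply: K.
have inj := patch_ext_inj hD X; have := rimage_near C1 C2 inj (conj hx hy) H'.
apply: filterS => d K x' y' hx' hy'; rewrite !E // !row2_0 !row2_1 => b.
exact: K.
Qed.

Lemma opp_tangent s s' t : opp s s' -> in01 t -> d2 (geoS s') 0 (1 - t) = - d2 (geoS s) 0 t.
Proof.
move=> [_ E] ht; have h0 := in01_0 R; have rt := in01_rev ht.
have [F1 [F1x [F1y [F2 [F2x [F2y X]]]]]] := ext_ex s'; have [C1 C2 E0 _ E2] := X.
rewrite E2 //.
rewrite [d2 (geoS s) 0 t](_ : _ = row2 (- F1y 0 (1 - t)) (- F2y 0 (1 - t))).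
  by rewrite [RHS]row2E !mxE !opprK.
apply: (d1_row (h := fun a b => geoS s b a) (g0 := fun a b => F1 b (1 - a))
  (g1 := fun a b => F2 b (1 - a))) => //.
- by apply: (right0_le ltr01) => d _ a ha _; rewrite E // E0 //; exact: in01_rev.
- exact: (sdiff_swap (sdiff_rot1 (sdiff_swap (C1 0 (1 - t))))).
- exact: (sdiff_swap (sdiff_rot1 (sdiff_swap (C2 0 (1 - t))))).
Qed.

Lemma opp_full_tangent s s' t : opp s s' -> 0 < t < 1 ->
  \forall d \near 0^'+, forall m1 m2, cp s.1 m1 m2 ->
    box (geoS s 0 t 0 0) (geoS s 0 t 0 1) d m1 m2 ->
    forall v1 v2, tangent (fun a b => cp s.1 a b \/ cp s'.1 a b) m1 m2 v1 v2.
Proof.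
move=> op ht; have ht' := int01 ht; have h0 := in01_0 R.
have Q : \forall d \near 0^'+, forall x y, in01 x -> in01 y -> box 0 t d x y -> x < 1 /\ 0 < y < 1.
  move: ht => /andP[t0 t1]; near=> d => x y hx hy [].
  have e1 : d < 1 by near: d; exact: nbhs_right_lt.
  have e2 : d < t by near: d; exact: nbhs_right_lt.
  have e3 : d < 1 - t by near: d; apply: nbhs_right_lt; rewrite subr_gt0.
  rewrite !ltr_norml; move: e1 e2 e3; clear -r0 rp n0 hD le01 => ? ? ? /andP[? ?] /andP[? ?].
  by split; [lra|apply/andP; split; lra].
apply: filterS (cp_near s h0 ht' Q) => d K m1 m2 /closed_patch_side[x [y [hx hy Em]]] b v1 v2.
have -> : m1 = geoS s x y 0 0 by rewrite -Em row2_0.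
have -> : m2 = geoS s x y 0 1 by rewrite -Em row2_1.
have [x1 y01] : x < 1 /\ 0 < y < 1.
  by apply: K => //; rewrite -Em row2_0 row2_1.
have [x00|xn0] := eqVneq x 0; last first.
  apply: (@tangentW _ (cp s.1)); first by move=> *; left.
  by apply: cp_full => //; rewrite x1 lt_def xn0; case/andP: hx => ->.
rewrite {}x00 in Em *.
have [dg|dg] := leP 0 (det2 (row2 v1 v2) (d2 (geoS s) 0 y)).
  by apply: (@tangentW _ (cp s.1)); [move=> *; left|apply: cp_half].
apply: (@tangentW _ (cp s'.1)); first by move=> *; right.
have [_ E] := op; rewrite E //; apply: cp_half; first exact: rev_int.
by rewrite (opp_tangent op hy) /det2 !mxE; move: dg; rewrite /det2 !mxE; lra.
Unshelve. all: by end_near. Qed.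

Lemma closed_patch_closure i z : closed_patch i z -> closure (Omega D) z.
Proof. by move=> h; rewrite (Omega_cover hD); exists i. Qed.

Lemma opp_Omega s s' t : opp s s' -> 0 < t < 1 -> Omega D (geoS s 0 t).
Proof.
move=> op ht; have ht' := int01 ht; have h0 := in01_0 R.
have op' := opp_sym op.
rewrite -(Omega_regular hD); apply/near_row2.
set z := geoS s 0 t.
have E : geoS s' 0 (1 - t) = z by case: op => _ E; rewrite -E.
pose K (a b : R) := cp s.1 a b \/ cp s'.1 a b.
have N : has_nearest K by apply: has_nearestU; exact: cp_nearest.
have Kz : K (z 0 0) (z 0 1).
  by left; rewrite /cp -row2E; exact: geoS_closed_patch.
have T1 := opp_full_tangent op ht; have T2 := opp_full_tangent op' (rev_int ht).
have T : \forall d \near 0^'+, forall m1 m2, K m1 m2 -> box (z 0 0) (z 0 1) d m1 m2 ->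
     forall v1 v2, tangent K m1 m2 v1 v2.
  apply: filterS2 T1 T2 => d H1 H2 m1 m2 [h|h] b v1 v2; first exact: H1.
  rewrite E in H2; apply: (@tangentW _ _ _ _ _ _ _ _ (H2 _ _ h b v1 v2)).
  by move=> a c [|]; [right|left].
apply: filterS (tangent_interior N Kz T) => d H a b /H[] h; exact: (closed_patch_closure h).
Qed.

Lemma vertexP s : exists v : vertexI D, vertex v = corner s.
Proof.
have : range (@corner R D) (corner s) by exists s.
by rewrite -(vertex_cover hD) => -[v _ <-]; exists v.
Qed.

Lemma geoS01 s : exists v : vertexI D, vertex v = geoS s 0 1.
Proof.
have [v Hv] := vertexP (s.1, s.2 + 3); exists v; rewrite Hv /corner /geoS /= addrC rotateD.
by rewrite rotate3E subr0.
Qed.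

Lemma opp_std s s' : opp s (snd_as_first s') <-> std_iface s s'.
Proof.
have E t : geoS (snd_as_first s') 0 (1 - t) = geoS s' t 0.
  by rewrite /geoS /= addrC rotateD rotate1E subKr.
by split=> -[h1 h2]; split => // t ht; rewrite h2 ?E.
Qed.

Lemma shared_point i j x y x' y' : i <> j -> in01 x -> in01 y -> in01 x' -> in01 y' ->
  geo i x y = geo j x' y' -> (forall v : vertexI D, vertex v <> geo i x y) ->
  exists s s' t, [/\ opp s s', s.1 = i, s'.1 = j, 0 < t < 1 & geoS s 0 t = geo i x y].
Proof.
move=> ij hx hy hx' hy' E nv.
have zi : (closed_patch i `&` closed_patch j) (geo i x y).
  by split; [exists x, y|exists x', y'].
case: (no_hanging hD ij) => [I0|[s [s' [_ _ _ I]]]|[s [s' [s1 s1' I Or]]]].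
- by rewrite I0 in zi.
- rewrite I /= in zi; have [v Hv] := vertexP s.
  by case: (nv v); rewrite Hv zi.
rewrite I in zi; case: zi => t [ht Et].
have h0 := in01_0 R.
have t01 : 0 < t < 1.
  have [v Hv] := vertexP s; have [v' Hv'] := geoS01 s.
  move: (ht) => /andP[t0 t1]; apply/andP; split; rewrite lt_neqAle ?t0 ?t1 andbT; apply/negP => /eqP e.
    by case: (nv v); rewrite Hv Et -e.
  by case: (nv v'); rewrite Hv' Et e.
have ns : s.1 <> s'.1 by rewrite s1 s1'.
exists s, s', t; split => //; split => //.
case: Or => // O.
by case: (no_same_orientation ns O).
Qed.

End Geometry2.

(*FILE N*)
Lemma jets_algebra (R : realType) (a b c e k1 k2 k3 k4 k5 k6 g0 g1 g00 g01 g11 h0 h1 h00 h01 h11 : R) :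
  a * e - b * c != 0 ->
  g0 * a + g1 * c = h0 * a + h1 * c -> g0 * b + g1 * e = h0 * b + h1 * e ->
  a * (g00 * a + g01 * c) + g0 * k1 + (c * (g01 * a + g11 * c) + g1 * k2) =
  a * (h00 * a + h01 * c) + h0 * k1 + (c * (h01 * a + h11 * c) + h1 * k2) ->
  b * (g00 * a + g01 * c) + g0 * k3 + (e * (g01 * a + g11 * c) + g1 * k4) =
  b * (h00 * a + h01 * c) + h0 * k3 + (e * (h01 * a + h11 * c) + h1 * k4) ->
  b * (g00 * b + g01 * e) + g0 * k5 + (e * (g01 * b + g11 * e) + g1 * k6) =
  b * (h00 * b + h01 * e) + h0 * k5 + (e * (h01 * b + h11 * e) + h1 * k6) ->
  [/\ g0 = h0, g1 = h1, g00 = h00, g01 = h01 & g11 = h11].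
Proof.
move=> J0 e2 e3 e4 e5 e6.
have q0 : g0 = h0.
  apply/eqP; rewrite -subr_eq0 -(mulrI_eq0 _ (mulfI J0)); apply/eqP.
  transitivity (e * ((g0 * a + g1 * c) - (h0 * a + h1 * c)) - c * ((g0 * b + g1 * e) - (h0 * b + h1 * e))).
    by ring.
  by rewrite e2 e3 !subrr !mulr0 subrr.
have q1 : g1 = h1.
  apply/eqP; rewrite -subr_eq0 -(mulrI_eq0 _ (mulfI J0)); apply/eqP.
  transitivity (a * ((g0 * b + g1 * e) - (h0 * b + h1 * e)) - b * ((g0 * a + g1 * c) - (h0 * a + h1 * c))).
    by ring.
  by rewrite e2 e3 !subrr !mulr0 subrr.
move: e4 e5 e6; rewrite q0 q1.
move=> {}e4 {}e5 {}e6.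
have Q4 : a * (g00 * a + g01 * c) + c * (g01 * a + g11 * c) - (a * (h00 * a + h01 * c) + c * (h01 * a + h11 * c)) = 0.
  by move/eqP: e4; rewrite -subr_eq0 => /eqP <-; ring.
have Q5 : b * (g00 * a + g01 * c) + e * (g01 * a + g11 * c) - (b * (h00 * a + h01 * c) + e * (h01 * a + h11 * c)) = 0.
  by move/eqP: e5; rewrite -subr_eq0 => /eqP <-; ring.
have Q6 : b * (g00 * b + g01 * e) + e * (g01 * b + g11 * e) - (b * (h00 * b + h01 * e) + e * (h01 * b + h11 * e)) = 0.
  by move/eqP: e6; rewrite -subr_eq0 => /eqP <-; ring.
have JJ : (a * e - b * c) ^+ 2 != 0 by rewrite expf_neq0.
have q00 : g00 = h00.
  apply/eqP; rewrite -subr_eq0 -(mulrI_eq0 _ (mulfI JJ)); apply/eqP.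
  transitivity (e ^+ 2 * (a * (g00 * a + g01 * c) + c * (g01 * a + g11 * c) - (a * (h00 * a + h01 * c) + c * (h01 * a + h11 * c)))
   - 2 * c * e * (b * (g00 * a + g01 * c) + e * (g01 * a + g11 * c) - (b * (h00 * a + h01 * c) + e * (h01 * a + h11 * c)))
   + c ^+ 2 * (b * (g00 * b + g01 * e) + e * (g01 * b + g11 * e) - (b * (h00 * b + h01 * e) + e * (h01 * b + h11 * e)))).
    by ring.
  by rewrite Q4 Q5 Q6 !mulr0 subrr addr0.
have q01 : g01 = h01.
  apply/eqP; rewrite -subr_eq0 -(mulrI_eq0 _ (mulfI JJ)); apply/eqP.
  transitivity (- (b * e) * (a * (g00 * a + g01 * c) + c * (g01 * a + g11 * c) - (a * (h00 * a + h01 * c) + c * (h01 * a + h11 * c)))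
   + (a * e + b * c) * (b * (g00 * a + g01 * c) + e * (g01 * a + g11 * c) - (b * (h00 * a + h01 * c) + e * (h01 * a + h11 * c)))
   - a * c * (b * (g00 * b + g01 * e) + e * (g01 * b + g11 * e) - (b * (h00 * b + h01 * e) + e * (h01 * b + h11 * e)))).
    by ring.
  by rewrite Q4 Q5 Q6 !mulr0 subr0 addr0.
have q11 : g11 = h11.
  apply/eqP; rewrite -subr_eq0 -(mulrI_eq0 _ (mulfI JJ)); apply/eqP.
  transitivity (b ^+ 2 * (a * (g00 * a + g01 * c) + c * (g01 * a + g11 * c) - (a * (h00 * a + h01 * c) + c * (h01 * a + h11 * c)))
   - 2 * a * b * (b * (g00 * a + g01 * c) + e * (g01 * a + g11 * c) - (b * (h00 * a + h01 * c) + e * (h01 * a + h11 * c)))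
   + a ^+ 2 * (b * (g00 * b + g01 * e) + e * (g01 * b + g11 * e) - (b * (h00 * b + h01 * e) + e * (h01 * b + h11 * e)))).
    by ring.
  by rewrite Q4 Q5 Q6 !mulr0 subrr addr0.
by split.
Qed.

Section ChainRule.
Variable R : realType.
Implicit Types (H W : R -> R -> R) (x y d : R).

Lemma corner_d H W Wx Wy d : 0 < d <= 1 ->
  (forall x y, 0 <= x < d -> 0 <= y < d -> H x y = W x y) ->
  (forall x y, 0 <= x < d -> 0 <= y < d -> sdiff W x y (Wx x y) (Wy x y)) ->
  forall x y, 0 <= x < d -> 0 <= y < d -> d1 H x y = Wx x y /\ d2 H x y = Wy x y.
Proof.
move=> /andP[d0 le1] E S x y hx hy; split.
  apply: (d1_sdiff (g := W)) (S x y hx hy); first exact: lt_in01 hx.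
  by apply: filterS (near_lt hx) => r K t t01 /(K t t01) ht; apply: E.
apply: (d2_sdiff (g := W)) (S x y hx hy); first exact: lt_in01 hy.
by apply: filterS (near_lt hy) => r K t t01 /(K t t01) ht; apply: E.
Qed.

Variables (G1 G1x G1y G1xx G1xy G1yx G1yy G2 G2x G2y G2xx G2xy G2yx G2yy : R -> R -> R).
Hypotheses (C1 : C1fun G1 G1x G1y) (C1x : C1fun G1x G1xx G1xy) (C1y : C1fun G1y G1yx G1yy).
Hypotheses (C2 : C1fun G2 G2x G2y) (C2x : C1fun G2x G2xx G2xy) (C2y : C1fun G2y G2yx G2yy).

Lemma sdiff_smooth_comp (U : set 'rV[R]_2) (g : 'rV[R]_2 -> R) x y :
  open U -> smooth_on U g -> U (row2 (G1 x y) (G2 x y)) ->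
  sdiff (fun x y => g (row2 (G1 x y) (G2 x y))) x y
    (pderiv 0 g (row2 (G1 x y) (G2 x y)) * G1x x y + pderiv 1 g (row2 (G1 x y) (G2 x y)) * G2x x y)
    (pderiv 0 g (row2 (G1 x y) (G2 x y)) * G1y x y + pderiv 1 g (row2 (G1 x y) (G2 x y)) * G2y x y).
Proof.
move=> oU Sg Ux; have := smooth_sdiff oU Ux Sg; rewrite row2_0 row2_1 => S.
exact: (sdiff_comp S (C1 x y) (C2 x y)).
Qed.

Lemma mixed_chain (U : set 'rV[R]_2) (g : 'rV[R]_2 -> R) H d :
  open U -> smooth_on U g -> 0 < d <= 1 ->
  (forall x y, 0 <= x < d -> 0 <= y < d -> U (row2 (G1 x y) (G2 x y)) /\
     H x y = g (row2 (G1 x y) (G2 x y))) ->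
  let v := row2 (G1 0 0) (G2 0 0) in
  let g0 := pderiv 0 g v in let g1 := pderiv 1 g v in
  let g00 := pderiv 0 (pderiv 0 g) v in let g01 := pderiv 1 (pderiv 0 g) v in
  let g11 := pderiv 1 (pderiv 1 g) v in
  [/\ mixed_der00 0 0 H = g v, mixed_der00 1 0 H = g0 * G1x 0 0 + g1 * G2x 0 0 &
      mixed_der00 0 1 H = g0 * G1y 0 0 + g1 * G2y 0 0] /\
  [/\ mixed_der00 2 0 H = G1x 0 0 * (g00 * G1x 0 0 + g01 * G2x 0 0) + g0 * G1xx 0 0
        + (G2x 0 0 * (g01 * G1x 0 0 + g11 * G2x 0 0) + g1 * G2xx 0 0),
      mixed_der00 1 1 H = G1y 0 0 * (g00 * G1x 0 0 + g01 * G2x 0 0) + g0 * G1yx 0 0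
        + (G2y 0 0 * (g01 * G1x 0 0 + g11 * G2x 0 0) + g1 * G2yx 0 0) &
      mixed_der00 0 2 H = G1y 0 0 * (g00 * G1y 0 0 + g01 * G2y 0 0) + g0 * G1yy 0 0
        + (G2y 0 0 * (g01 * G1y 0 0 + g11 * G2y 0 0) + g1 * G2yy 0 0)].
Proof.
move=> oU Sg hd E v g0 g1 g00 g01 g11.
have z0 : 0 <= (0 : R) < d by case/andP: hd => d0 _; rewrite lexx d0.
have Uv : U v by have [] := E 0 0 z0 z0.
have sch : pderiv 0 (pderiv 1 g) v = g01 by exact: schwarz oU Uv Sg.
have S0 := smooth_on_pderivs [:: 0] Sg; have S1 := smooth_on_pderivs [:: 1] Sg.
move: S0 S1 => /= S0 S1.
have F0 := fun x y hx hy => sdiff_smooth_comp oU Sg (E x y hx hy).1.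
have F1 := corner_d hd (fun x y hx hy => (E x y hx hy).2) F0.
have K (Ga Gax Gay Gb Gbx Gby : R -> R -> R) : C1fun Ga Gax Gay -> C1fun Gb Gbx Gby ->
    forall x y, 0 <= x < d -> 0 <= y < d ->
    sdiff (fun x y => pderiv 0 g (row2 (G1 x y) (G2 x y)) * Ga x y +
                      pderiv 1 g (row2 (G1 x y) (G2 x y)) * Gb x y) x y
     ((fun x y => Ga x y * (pderiv 0 (pderiv 0 g) (row2 (G1 x y) (G2 x y)) * G1x x y +
         pderiv 1 (pderiv 0 g) (row2 (G1 x y) (G2 x y)) * G2x x y) +
       pderiv 0 g (row2 (G1 x y) (G2 x y)) * Gax x y +
      (Gb x y * (pderiv 0 (pderiv 1 g) (row2 (G1 x y) (G2 x y)) * G1x x y +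
         pderiv 1 (pderiv 1 g) (row2 (G1 x y) (G2 x y)) * G2x x y) +
       pderiv 1 g (row2 (G1 x y) (G2 x y)) * Gbx x y)) x y)
     ((fun x y => Ga x y * (pderiv 0 (pderiv 0 g) (row2 (G1 x y) (G2 x y)) * G1y x y +
         pderiv 1 (pderiv 0 g) (row2 (G1 x y) (G2 x y)) * G2y x y) +
       pderiv 0 g (row2 (G1 x y) (G2 x y)) * Gay x y +
      (Gb x y * (pderiv 0 (pderiv 1 g) (row2 (G1 x y) (G2 x y)) * G1y x y +
         pderiv 1 (pderiv 1 g) (row2 (G1 x y) (G2 x y)) * G2y x y) +
       pderiv 1 g (row2 (G1 x y) (G2 x y)) * Gby x y)) x y).
  move=> Ca Cb x y hx hy; have Ux := (E x y hx hy).1.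
  exact: (sdiffD (sdiffM (sdiff_smooth_comp oU S0 Ux) (Ca x y))
                 (sdiffM (sdiff_smooth_comp oU S1 Ux) (Cb x y))).
have Kx := K _ _ _ _ _ _ C1x C2x; have Ky := K _ _ _ _ _ _ C1y C2y.
have D1 := corner_d hd (fun x y hx hy => (F1 x y hx hy).1) Kx.
have D2 := corner_d hd (fun x y hx hy => (F1 x y hx hy).2) Ky.
split; split; rewrite /mixed_der00 /=.
- by have [_ ->] := E 0 0 z0 z0.
- by have [-> _] := F1 0 0 z0 z0.
- by have [_ ->] := F1 0 0 z0 z0.
- by have [-> _] := D1 0 0 z0 z0; rewrite -/v sch.
- by have [-> _] := D2 0 0 z0 z0; rewrite -/v sch.
- by have [_ ->] := D2 0 0 z0 z0; rewrite -/v sch.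
Qed.

Lemma I2P (c : 'I_2) : c = 0 \/ c = 1.
Proof. by case: c => -[|[|c]] // h; [left|right]; apply/val_inj. Qed.

Lemma jets_determine (U U' : set 'rV[R]_2) (g g' : 'rV[R]_2 -> R) H H' d :
  G1x 0 0 * G2y 0 0 - G1y 0 0 * G2x 0 0 != 0 ->
  open U -> smooth_on U g -> open U' -> smooth_on U' g' -> 0 < d <= 1 ->
  (forall x y, 0 <= x < d -> 0 <= y < d -> U (row2 (G1 x y) (G2 x y)) /\
     H x y = g (row2 (G1 x y) (G2 x y))) ->
  (forall x y, 0 <= x < d -> 0 <= y < d -> U' (row2 (G1 x y) (G2 x y)) /\
     H' x y = g' (row2 (G1 x y) (G2 x y))) ->
  (forall m1 m2, (m1 + m2 <= 2)%N -> mixed_der00 m1 m2 H = mixed_der00 m1 m2 H') ->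
  forall s, (size s <= 2)%N ->
    pderivs s g (row2 (G1 0 0) (G2 0 0)) = pderivs s g' (row2 (G1 0 0) (G2 0 0)).
Proof.
move=> J0 oU Sg oU' Sg' hd E E' M.
have z0 : 0 <= (0 : R) < d by case/andP: hd => d0 _; rewrite lexx d0.
have [[a1 a2 a3] [a4 a5 a6]] := mixed_chain oU Sg hd E.
have [[b1 b2 b3] [b4 b5 b6]] := mixed_chain oU' Sg' hd E'.
have sch : pderiv 0 (pderiv 1 g) _ = _ := schwarz oU (E 0 0 z0 z0).1 Sg.
have sch' : pderiv 0 (pderiv 1 g') _ = _ := schwarz oU' (E' 0 0 z0 z0).1 Sg'.
have e1 := M 0%N 0%N isT; have e2 := M 1%N 0%N isT; have e3 := M 0%N 1%N isT.
have e4 := M 2%N 0%N isT; have e5 := M 1%N 1%N isT; have e6 := M 0%N 2%N isT.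
rewrite a1 b1 in e1; rewrite a2 b2 in e2; rewrite a3 b3 in e3.
rewrite a4 b4 in e4; rewrite a5 b5 in e5; rewrite a6 b6 in e6.
move=> {a1 a2 a3 a4 a5 a6 b1 b2 b3 b4 b5 b6}.
have [q0 q1 q00 q01 q11] := jets_algebra J0 e2 e3 e4 e5 e6.
case=> [|c1 [|c2 [|c3 s]]] hs; last by exact: (False_ind _ (notF hs)).
- exact: e1.
- by case: (I2P c1) => ->; [exact: q0|exact: q1].
case: (I2P c1) => ->; case: (I2P c2) => ->.
- exact: q00.
- exact: (etrans sch (etrans q01 (esym sch'))).
- exact: q01.
- exact: q11.
Qed.

End ChainRule.

Lemma rect_gradient_eq (R : realType) (F Fx Fy P Px Py : R -> R -> R) xl xr yl yr x y :
  C1fun F Fx Fy -> C1fun P Px Py -> xl < xr -> yl < yr ->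
  (forall x y, rect xl xr yl yr x y -> F x y = P x y) -> rect xl xr yl yr x y ->
  Fx x y = Px x y /\ Fy x y = Py x y.
Proof.
move=> CF CP hx hy E [rx ry].
have S : sdiff (fun x y => F x y + (-1) * P x y) x y (Fx x y + (-1) * Px x y) (Fy x y + (-1) * Py x y).
  exact: sdiffD (CF x y) (sdiffZ _ (CP x y)).
have step (l u c : R) : l < u -> l <= c <= u -> forall d, 0 < d -> exists h, [/\ h != 0, `|h| < d & l <= c + h <= u].
  move=> lu /andP[h1 h2] d d0; pose h := Num.min (d / 2) ((u - l) / 2).
  have h0 : 0 < h by rewrite lt_min !divr_gt0 // subr_gt0.
  have hd : h <= d / 2 by rewrite ge_min lexx.
  have hu : h <= (u - l) / 2 by rewrite ge_min lexx orbT.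
  have [cm|cm] := leP c ((l + u) / 2).
    exists h; rewrite gt_eqF ?(gtr0_norm h0) //; split => //; first by lra.
    by apply/andP; split; lra.
  exists (- h); rewrite oppr_eq0 gt_eqF ?normrN ?(gtr0_norm h0) //; split => //; first by lra.
  by apply/andP; split; lra.
have Z e : 0 < e -> `|Fx x y + (-1) * Px x y| <= e /\ `|Fy x y + (-1) * Py x y| <= e.
  move=> e0; have [d d0 K] := right0_ex (S e e0); split.
    have [h [h0 hd hr]] := step _ _ _ hx rx d d0.
    have b : box x y d (x + h) y by split; rewrite ?subrr ?normr0 // addrC addKr.
    have := K _ _ _ _ (box_center x y d0) b.
    rewrite !E; [|by split..]; rewrite !mulN1r !subrr mulr0 addr0 normr0 addr0 sub0r.
    rewrite [x + h]addrC addrK normrN normrM.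
    by rewrite ler_pM2r // normr_gt0.
  have [h [h0 hd hr]] := step _ _ _ hy ry d d0.
  have b : box x y d x (y + h) by split; rewrite ?subrr ?normr0 // addrC addKr.
  have := K _ _ _ _ (box_center x y d0) b.
  rewrite !E; [|by split..]; rewrite !mulN1r !subrr mulr0 sub0r !add0r normr0 !add0r.
  rewrite [y + h]addrC addrK normrN normrM.
  by rewrite ler_pM2r // normr_gt0.
by split; apply/eqP; rewrite -subr_eq0 -mulN1r -normr_le0; apply/ler_addgt0Pl => e e0;
   rewrite addr0; case: (Z e e0).
Qed.

Section CellChart.
Variables (R : realType) (p r n : nat) (D : multipatch R).
Hypotheses (r0 : (0 < r)%N) (rp : (r < p)%N) (n0 : (0 < n)%N) (hD : is_multipatch p r n D).
Implicit Types (s : side D) (i j : patchI D) (x y t : R).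

Local Notation cl a := (a%:R / n%:R : R) (only parsing).
Local Notation cu a := (a.+1%:R / n%:R : R) (only parsing).

Lemma cell_lt a : cl a < cu a.
Proof. by rewrite ltr_pM2r ?invr_gt0 ?ltr0n // ltr_nat. Qed.

Definition chart s a b (G1 G1x G1y G2 G2x G2y : R -> R -> R) :=
  [/\ bpoly G1 /\ bpoly G2, C1fun G1 G1x G1y, C1fun G2 G2x G2y,
     forall x y, cell n a x -> cell n b y -> geoS s x y = row2 (G1 x y) (G2 x y) &
     forall x y, cell n a x -> cell n b y -> 0 < G1x x y * G2y x y - G1y x y * G2x x y].

Lemma chart_ex s a b : (a < n)%N -> (b < n)%N -> exists G1 G1x G1y G2 G2x G2y,
  chart s a b G1 G1x G1y G2 G2x G2y.
Proof.
move=> an bn.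
have [F1 [F1x [F1y [F2 [F2x [F2y X]]]]]] := patch_ext_ex r0 rp n0 hD s; have [C1 C2 E _ _] := X.
have [P1 [b1 E1]] := (spl2_geoS r0 rp n0 hD s 0).1 a b an bn.
have [P2 [b2 E2]] := (spl2_geoS r0 rp n0 hD s 1).1 a b an bn.
have [P1x [P1y [_ _ K1]]] := bpoly_C1 b1; have [P2x [P2y [_ _ K2]]] := bpoly_C1 b2.
exists P1, P1x, P1y, P2, P2x, P2y; split => //.
  by move=> x y hx hy; rewrite [LHS]row2E E1 // E2.
have FP1 x y : rect (cl a) (cu a) (cl b) (cu b) x y -> F1 x y = P1 x y.
  move=> [hx hy]; rewrite -E1 // E ?row2_0 //; [exact: cell_in01 an hx|exact: cell_in01 bn hy].
have FP2 x y : rect (cl a) (cu a) (cl b) (cu b) x y -> F2 x y = P2 x y.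
  move=> [hx hy]; rewrite -E2 // E ?row2_1 //; [exact: cell_in01 an hx|exact: cell_in01 bn hy].
move=> x y hx hy.
have [<- <-] := rect_gradient_eq C1 K1 (cell_lt a) (cell_lt b) FP1 (conj hx hy).
have [<- <-] := rect_gradient_eq C2 K2 (cell_lt a) (cell_lt b) FP2 (conj hx hy).
by apply: (patch_ext_det r0 rp n0 hD X); [exact: cell_in01 an hx|exact: cell_in01 bn hy].
Qed.

Lemma chart_inj s a b G1 G1x G1y G2 G2x G2y x y x' y' : (a < n)%N -> (b < n)%N ->
  chart s a b G1 G1x G1y G2 G2x G2y ->
  rect (cl a) (cu a) (cl b) (cu b) x y -> rect (cl a) (cu a) (cl b) (cu b) x' y' ->
  G1 x y = G1 x' y' -> G2 x y = G2 x' y' -> x = x' /\ y = y'.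
Proof.
move=> an bn [_ _ _ E _] [hx hy] [hx' hy'] e1 e2; apply: (@geoS_inj _ _ _ _ _ hD s).
- exact: cell_in01 an hx.
- exact: cell_in01 bn hy.
- exact: cell_in01 an hx'.
- exact: cell_in01 bn hy'.
by rewrite !E // e1 e2.
Qed.

Lemma chart_extension s a b (h : R -> R -> R) : (a < n)%N -> (b < n)%N -> pwbpoly n h ->
  exists (U : set 'rV[R]_2) (f : 'rV[R]_2 -> R), [/\ open U, smooth_on U f &
    forall x y, cell n a x -> cell n b y -> U (geoS s x y) /\ f (geoS s x y) = h x y].
Proof.
move=> an bn ph.
have [G1 [G1x [G1y [G2 [G2x [G2y X]]]]]] := chart_ex s an bn; have [[b1 b2] C1 C2 E J] := X.
have [P [bP EP]] := ph a b an bn.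
have inj := fun x y x' y' => @chart_inj s a b _ _ _ _ _ _ x y x' y' an bn X.
have [U [f [oU Sf Hf]]] := cell_extension b1 b2 bP C1 C2 (ltW (cell_lt a)) (ltW (cell_lt b)) inj
  (fun x y h => J x y h.1 h.2).
exists U, f; split => // x y hx hy; rewrite E // EP //.
exact: (Hf x y (conj hx hy)).
Qed.

Lemma open_cell_image s a b : (a < n)%N -> (b < n)%N ->
  open [set z | exists x y, [/\ cl a < x < cu a, cl b < y < cu b & z = geoS s x y]].
Proof.
move=> an bn.
have [G1 [G1x [G1y [G2 [G2x [G2y X]]]]]] := chart_ex s an bn; have [[b1 b2] C1 C2 E J] := X.
have inj := fun x y x' y' => @chart_inj s a b _ _ _ _ _ _ x y x' y' an bn X.
have J' x y : rect_int (cl a) (cu a) (cl b) (cu b) x y -> G1x x y * G2y x y - G1y x y * G2x x y != 0.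
  by move=> /rect_int_rect[hx hy]; rewrite gt_eqF // J.
have := open_int_image C1 C2 (ltW (cell_lt a)) (ltW (cell_lt b)) inj J'.
congr (open _); apply/seteqP; split => z [x [y]].
  move=> [[hx hy] ->]; exists x, y; split => //; rewrite E //.
    by case/andP: hx => /ltW h1 /ltW h2; rewrite /cell h1.
  by case/andP: hy => /ltW h1 /ltW h2; rewrite /cell h1.
move=> [hx hy ->]; exists x, y; split => //; rewrite E //.
  by case/andP: hx => /ltW h1 /ltW h2; rewrite /cell h1.
by case/andP: hy => /ltW h1 /ltW h2; rewrite /cell h1.
Qed.

End CellChart.

Lemma pderivs_eq_open (R : realType) (O : set 'rV[R]_2) (f g : 'rV[R]_2 -> R) s : open O ->
  (forall z, O z -> f z = g z) -> forall z, O z -> pderivs s f z = pderivs s g z.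
Proof.
move=> oO E; elim: s => [|c s IH] z Oz /=; first exact: E.
rewrite /pderiv; apply: near_eq_derive.
by near=> z'; apply: IH; near: z'; exact: open_nbhs_nbhs.
Unshelve. all: by end_near. Qed.

(*FILE P*)
Section Vanishing.
Variables (R : realType) (n : nat).
Hypothesis n0 : (0 < n)%N.
Implicit Types (g h : R -> R -> R) (u w : R -> R) (k : 'Z_4).

Definition rev u : R -> R := fun x => u (1 - x).

Lemma spl_rev u : spl n u -> spl n (rev u).
Proof.
move=> [U [U' [H1 H2 H3]]]; exists (rev U), (fun x => - U' (1 - x)); split.
- by move=> x; apply: sd_comp_rev.
- move=> a an; have [|P HP] := H2 (n.-1 - a)%N; first by lia.
  exists (P \Po (1 - 'X)) => x hx; rewrite /rev HP ?horner_comp ?hornerE //.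
  exact: cell_rev.
- by move=> x hx; rewrite /rev H3 //; exact: in01_rev.
Qed.

Lemma ord1_rev (k : nat) u : ord1 k u = ord0 k (rev u). Proof. by []. Qed.

Lemma ord0_rev (k : nat) u : ord0 k u -> ord1 k (rev u).
Proof. by apply: eq_ord0 => x _; rewrite /rev subKr. Qed.

Lemma der01_rev u x : spl n u -> in01 x -> der01 (rev u) x = - der01 u (1 - x).
Proof.
move=> [U [U' [H1 H2 H3]]] hx.
rewrite (der01_spl H1 H3 (in01_rev hx)).
apply: (der01_spl (U := rev U) (U' := fun x => - U' (1 - x))) => //.
  by move=> y; apply: sd_comp_rev.
by move=> y hy; rewrite /rev H3 //; exact: in01_rev.
Qed.

Lemma ord1_der (k : nat) u : spl n u -> ord1 k.+1 u -> ord1 k (der01 u).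
Proof.
move=> su /ord0_der H.
have := ord0M (ord0_poly (-1)%:P) H; rewrite add0n; apply: eq_ord0 => x hx.
by rewrite hornerC (der01_rev su hx) mulN1r opprK.
Qed.

Definition zedge g := forall t, in01 t -> [/\ g 0 t = 0, d1 g 0 t = 0 & d2 g 0 t = 0].
Definition zjet g := forall m1 m2, (m1 + m2 <= 2)%N -> mixed_der00 m1 m2 g = 0.

Lemma zedge_tensor u w : spl n u -> spl n w -> ord0 2 u -> zedge (fun x y => u x * w y).
Proof.
move=> su sw ou t ht; have h0 := in01_0 R.
rewrite (d1_tensor su sw h0 ht) (d2_tensor su sw h0 ht).
by rewrite (ord0_val ou) // (ord0_der_val ou) // !mul0r.
Qed.

Lemma zjet_tensor i j u w : spl n u -> spl n w -> ord0 i u -> ord0 j w -> (3 <= i + j)%N ->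
  zjet (fun x y => u x * w y).
Proof.
move=> su sw ou ow ij m1 m2 mm.
rewrite (mixed_tensor n0 m1 m2 (spl_pwpoly n0 su) (spl_pwpoly n0 sw)).
have [h|h] := ltnP m1 i; first by rewrite (ord0_iter_der ou h) mul0r.
by rewrite (ord0_iter_der ow) ?mulr0 //; lia.
Qed.

Lemma eq_zedge g h : eqsq g h -> zedge g -> zedge h.
Proof.
move=> E Z t ht; have h0 := in01_0 R; have [z1 z2 z3] := Z t ht.
by rewrite -E // -(d1_eqsq E) // -(d2_eqsq E).
Qed.

Lemma eq_zjet g h : eqsq g h -> zjet g -> zjet h.
Proof. by move=> E Z m1 m2 mm; rewrite -(eq_mixed _ _ E) Z. Qed.

Lemma zedgeD g h : spl2 n g -> spl2 n h -> zedge g -> zedge h -> zedge (fun x y => g x y + h x y).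
Proof.
move=> sg sh Zg Zh t ht; have h0 := in01_0 R.
have [z1 z2 z3] := Zg t ht; have [y1 y2 y3] := Zh t ht.
by rewrite (d1D sg sh) // (d2D sg sh) // z1 z2 z3 y1 y2 y3 !addr0.
Qed.

Lemma zedgeZ c g : spl2 n g -> zedge g -> zedge (fun x y => c * g x y).
Proof.
move=> sg Zg t ht; have h0 := in01_0 R; have [z1 z2 z3] := Zg t ht.
by rewrite (d1Z c sg) // (d2Z c sg) // z1 z2 z3 !mulr0.
Qed.

Lemma zjetD g h : spl2 n g -> spl2 n h -> zjet g -> zjet h -> zjet (fun x y => g x y + h x y).
Proof. by move=> sg sh Zg Zh m1 m2 mm; rewrite (mixedD n0) // Zg // Zh // addr0. Qed.

Lemma zjetZ c g : spl2 n g -> zjet g -> zjet (fun x y => c * g x y).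
Proof. by move=> sg Zg m1 m2 mm; rewrite (mixedZ n0) // Zg // mulr0. Qed.

Lemma zedge0 : zedge (fun _ _ => 0).
Proof. by move=> t ht; have h0 := in01_0 R; rewrite d1_cst0 // d2_cst0. Qed.

Lemma zjet0 : zjet (fun _ _ => 0).
Proof.
move=> m1 m2 mm; rewrite -[RHS](mul0r (mixed_der00 m1 m2 (fun _ _ => 0 : R))).
rewrite -(mixedZ n0 m1 m2 0 (spl2_0 R n)).
by apply: eq_mixed => x y _ _; rewrite mul0r.
Qed.

(* Rotating a tensor product exchanges and reverses its factors. *)
Definition rotl k u w : R -> R :=
  if k == 0 then u else if k == 1 then w else if k == 2 then rev u else rev w.
Definition rotr k u w : R -> R :=
  if k == 0 then w else if k == 1 then rev u else if k == 2 then rev w else u.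

Lemma rotate_tensor k u w : eqsq (rotate k (fun x y => u x * w y))
  (fun x y => rotl k u w x * rotr k u w y).
Proof.
move=> x y _ _; rewrite /rotl /rotr.
case: (Z4P k) => -> /=; rewrite ?rotate0 ?rotate1E ?rotate2E ?rotate3E /rev //; exact: mulrC.
Qed.

Lemma spl_rotl k u w : spl n u -> spl n w -> spl n (rotl k u w).
Proof. by move=> su sw; rewrite /rotl; do ![case: ifP => _] => //; exact: spl_rev. Qed.

Lemma spl_rotr k u w : spl n u -> spl n w -> spl n (rotr k u w).
Proof. by move=> su sw; rewrite /rotr; do ![case: ifP => _] => //; exact: spl_rev. Qed.

(* The side [k] of the square is [x = 0], [y = 0], [x = 1], [y = 1] for
   [k = 0, 1, 2, 3]. *)
Lemma zedge_rot k u w : spl n u -> spl n w -> ord0 2 (rotl k u w) ->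
  zedge (rotate k (fun x y => u x * w y)).
Proof.
move=> su sw o; apply: (@eq_zedge (fun x y => rotl k u w x * rotr k u w y)).
  by move=> x y hx hy; rewrite rotate_tensor.
by apply: zedge_tensor => //; [exact: spl_rotl|exact: spl_rotr].
Qed.

Lemma zjet_rot k i j u w : spl n u -> spl n w -> ord0 i (rotl k u w) -> ord0 j (rotr k u w) ->
  (3 <= i + j)%N -> zjet (rotate k (fun x y => u x * w y)).
Proof.
move=> su sw o1 o2 ij; apply: (@eq_zjet (fun x y => rotl k u w x * rotr k u w y)).
  by move=> x y hx hy; rewrite rotate_tensor.
by apply: zjet_tensor o1 o2 ij => //; [exact: spl_rotl|exact: spl_rotr].
Qed.

Lemma rotateDfun k g h : eqsq (rotate k (fun x y => g x y + h x y))
  (fun x y => rotate k g x y + rotate k h x y).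
Proof.
rewrite /rotate; elim: (nat_of_ord k) => [//|j IH] x y hx hy /=.
by rewrite /rot1 IH //; exact: in01_rev.
Qed.

End Vanishing.

Section EdgeForm.
Variables (R : realType) (n : nat) (b0 b1 : R -> R).
Hypothesis n0 : (0 < n)%N.
Hypotheses (s0 : spl n b0) (s1 : spl n b1).
Hypotheses (o0 : ord1 3 b0) (o1 : ord1 3 b1) (z1 : ord0 1 b1).
Implicit Types (a b : R -> R) (k : 'Z_4).

Definition ef a b : R -> R -> R := fun x y => b0 x * a y + b1 x * b y.

Lemma spl2_ef a b : spl n a -> spl n b -> spl2 n (ef a b).
Proof. by move=> sa sb; apply: spl2D; apply: spl2_tensor. Qed.

Lemma ord0_0 (u : R -> R) : spl n u -> ord0 0 u.
Proof.
move=> su; have [P HP] := spl_pwpoly n0 su n0; have n0' : 0 < n%:R :> R by rewrite ltr0n.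
exists P, n%:R^-1; split; first by rewrite invr_gt0 n0' invf_le1 // ler1n.
by move=> x /andP[x0 x1]; rewrite mul1r HP // /cell mul0r mul1r x0 ltW.
Qed.

Lemma ef_split k a b : eqsq (fun x y => rotate k (fun x y => b0 x * a y) x y +
    rotate k (fun x y => b1 x * b y) x y) (rotate k (ef a b)).
Proof. by move=> x y hx hy; rewrite [RHS]rotateDfun. Qed.

Lemma ef_zedge k a b : spl n a -> spl n b -> k != 0 ->
  (k = 1 -> ord0 2 a /\ ord0 2 b) -> (k = 3 -> ord1 2 a /\ ord1 2 b) ->
  zedge (rotate k (ef a b)).
Proof.
move=> sa sb k0 k1 k3; apply: eq_zedge (ef_split k a b) _.
apply: (zedgeD (n := n)); try by apply: spl2_rotate => //; apply: spl2_tensor.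
  apply: (zedge_rot n0) => //.
  case: (Z4P k) k0 k1 k3 => -> //= _ k1 k3; rewrite /rotl /=.
  - by case: k1.
  - by apply: ord0W o0.
  - by case: k3.
apply: (zedge_rot n0) => //.
case: (Z4P k) k0 k1 k3 => -> //= _ k1 k3; rewrite /rotl /=.
- by case: k1.
- by apply: ord0W o1.
- by case: k3.
Qed.

Lemma ef_zjet k a b : spl n a -> spl n b ->
  (k = 0 -> ord0 3 a /\ ord0 2 b) -> (k = 3 -> ord1 3 a /\ ord1 2 b) ->
  zjet (rotate k (ef a b)).
Proof.
move=> sa sb k0 k3; apply: eq_zjet (ef_split k a b) _.
have za := ord0_0 sa; have zb := ord0_0 sb; have z0 := ord0_0 s0; have z1' := ord0_0 s1.
have zra := ord0_0 (spl_rev n0 sa); have zrb := ord0_0 (spl_rev n0 sb).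
apply: (zjetD n0); try by apply: spl2_rotate => //; apply: spl2_tensor.
  case: (Z4P k) k0 k3 => -> k0 k3.
  - by have [q _] := k0 erefl; apply: (@zjet_rot R n n0 _ 0 3).
  - by apply: (@zjet_rot R n n0 _ 0 3).
  - by apply: (@zjet_rot R n n0 _ 3 0).
  - by have [q _] := k3 erefl; apply: (@zjet_rot R n n0 _ 3 0).
case: (Z4P k) k0 k3 => -> k0 k3.
- by have [_ q] := k0 erefl; apply: (@zjet_rot R n n0 _ 1 2).
- by apply: (@zjet_rot R n n0 _ 0 3).
- by apply: (@zjet_rot R n n0 _ 3 0).
- by have [_ q] := k3 erefl; apply: (@zjet_rot R n n0 _ 2 1).
Qed.

End EdgeForm.

(*FILE Q*)
Section Summands.
Variables (R : realType) (p r n : nat) (D : multipatch R).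
Hypotheses (r0 : (0 < r)%N) (rp : (r.+1 < p)%N) (n0 : (0 < n)%N).
Hypothesis hN : (6 <= Nplus p r n)%N.
Hypothesis hD : is_multipatch p r n D.
Implicit Types (s t : side D) (phi psi : bfun D) (a b : R -> R) (g h : R -> R -> R).

Let rp' : (r < p)%N := ltnW rp.
Let h0 := in01_0 R.

Lemma pullback_on_patch s t g :
  pullback s (on_patch t g) = if s.1 == t.1 then rotate (s.2 - t.2) g else fun _ _ => 0.
Proof.
rewrite /pullback /on_patch; case: eqP => _; apply/funext => x; apply/funext => y.
  by rewrite -rotateD.
by rewrite (rotate_comp (fun _ : R => 0) (fun _ _ => 0)).
Qed.

Lemma pullback_rot s k phi : pullback (s.1, s.2 + k) phi = rotate k (pullback s phi).
Proof. by apply/funext => x; apply/funext => y; rewrite /pullback /= addrC rotateD. Qed.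

Lemma on_patch_rot s k g : on_patch s g = on_patch (s.1, s.2 + k) (rotate k g).
Proof.
apply/funext => i; rewrite /on_patch /=; case: eqP => // _.
by apply/funext => x; apply/funext => y; rewrite -rotateD opprD addrNK.
Qed.

Definition nice phi := forall i, spl2 n (phi i).

Lemma spl2_pullback s phi : nice phi -> spl2 n (pullback s phi).
Proof. by move=> np; apply: spl2_rotate. Qed.

Definition lincomb c phi psi : bfun D := fun i x y => c * phi i x y + psi i x y.

Definition linear_prop (Q : bfun D -> Prop) :=
  [/\ Q (fun _ _ _ => 0), forall c phi psi, Q phi -> Q psi -> Q (lincomb c phi psi) &
      forall phi psi, (forall i, eqsq (phi i) (psi i)) -> Q phi -> Q psi].

Lemma linear_sum Q (I : Type) (l : seq I) (P : pred I) (B : I -> bfun D) (c : I -> R) :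
  linear_prop Q -> (forall j, P j -> Q (B j)) ->
  Q (fun i x y => \sum_(j <- l | P j) c j * B j i x y).
Proof.
move=> [Q0 QL QE] H; elim: l => [|j l IH].
  by apply: QE Q0 => i x y _ _; rewrite big_nil.
have [Pj|nPj] := boolP (P j).
  by apply: QE (QL (c j) _ _ (H j Pj) IH) => i x y _ _; rewrite big_cons Pj.
by apply: QE IH => i x y _ _; rewrite big_cons (negbTE nPj).
Qed.

Lemma linear_bspan Q (J : finType) (P : pred J) (B : J -> bfun D) phi :
  linear_prop Q -> (forall j, P j -> Q (B j)) -> bspan P B phi -> Q phi.
Proof.
move=> LQ H [c Hc]; have [_ _ QE] := LQ.
by apply: QE (linear_sum _ c LQ H) => i x y hx hy; rewrite Hc.
Qed.

Lemma linearI Q Q' : linear_prop Q -> linear_prop Q' -> linear_prop (fun phi => Q phi /\ Q' phi).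
Proof.
move=> [a1 a2 a3] [b1 b2 b3]; split => //.
  by move=> c phi psi [h1 h2] [k1 k2]; split; [exact: a2|exact: b2].
by move=> phi psi E [h1 h2]; split; [exact: a3 E _|exact: b3 E _].
Qed.

Lemma linear_nice : linear_prop nice.
Proof.
split; first by move=> i; exact: spl2_0.
  by move=> c phi psi np nq i; apply: spl2D => //; apply: spl2Z.
by move=> phi psi E np i; apply: eq_spl2 (E i) (np i).
Qed.

Lemma pullbackL s c phi psi :
  pullback s (lincomb c phi psi) = fun x y => c * pullback s phi x y + pullback s psi x y.
Proof.
apply/funext => x; apply/funext => y; rewrite /pullback /lincomb /rotate.
by elim: (nat_of_ord s.2) x y => //= k IH x y; rewrite /rot1 IH.
Qed.

Lemma pullback0 s : pullback s (fun _ _ _ => 0 : R) = fun _ _ => 0.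
Proof.
apply/funext => x; apply/funext => y.
by rewrite /pullback (rotate_comp (fun _ : R => 0) (fun _ _ => 0)).
Qed.

Lemma eq_pullback s phi psi : (forall i, eqsq (phi i) (psi i)) -> eqsq (pullback s phi) (pullback s psi).
Proof. by move=> E; apply: eqsq_rotate. Qed.

Definition grad_on s phi (x y w1 w2 : R) :=
  d1 (pullback s phi) x y = w1 * d1 (geoS s) x y 0 0 + w2 * d1 (geoS s) x y 0 1 /\
  d2 (pullback s phi) x y = w1 * d2 (geoS s) x y 0 0 + w2 * d2 (geoS s) x y 0 1.

Definition matched s s' phi := forall t : R, in01 t ->
  pullback s phi 0 t = pullback s' phi 0 (1 - t) /\
  exists w1 w2, grad_on s phi 0 t w1 w2 /\ grad_on s' phi 0 (1 - t) w1 w2.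

Lemma grad_onL c phi psi s x y w1 w2 v1 v2 : nice phi -> nice psi -> in01 x -> in01 y ->
  grad_on s phi x y w1 w2 -> grad_on s psi x y v1 v2 ->
  grad_on s (lincomb c phi psi) x y (c * w1 + v1) (c * w2 + v2).
Proof.
move=> np nq hx hy [E1 E2] [K1 K2].
have sp := spl2_pullback s np; have sq := spl2_pullback s nq.
have alg (a b : R) : c * (w1 * a + w2 * b) + (v1 * a + v2 * b) = (c * w1 + v1) * a + (c * w2 + v2) * b.
  by ring.
have F1 := etrans (d1D (spl2Z c sp) sq hx hy) (congr2 +%R (d1Z c sp hx hy) erefl).
have F2 := etrans (d2D (spl2Z c sp) sq hx hy) (congr2 +%R (d2Z c sp hx hy) erefl).
rewrite E1 K1 in F1; rewrite E2 K2 in F2.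
by rewrite /grad_on pullbackL; split; [exact: etrans F1 (alg _ _)|exact: etrans F2 (alg _ _)].
Qed.

Lemma grad_on_ext phi psi s x y w1 w2 : (forall i, eqsq (phi i) (psi i)) -> in01 x -> in01 y ->
  grad_on s phi x y w1 w2 -> grad_on s psi x y w1 w2.
Proof.
move=> E hx hy [E1 E2].
have P := eq_pullback s E.
by split; [exact: etrans (esym (d1_eqsq P hx hy)) E1|exact: etrans (esym (d2_eqsq P hx hy)) E2].
Qed.

Lemma zedge_matched s s' phi : zedge (pullback s phi) -> zedge (pullback s' phi) -> matched s s' phi.
Proof.
move=> Z Z' t ht; have [z1 z2 z3] := Z t ht; have [y1 y2 y3] := Z' _ (in01_rev ht).
rewrite z1 y1; split=> //; exists 0, 0.
have alg (a b : R) : 0 = 0 * a + 0 * b by rewrite !mul0r addr0.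
by split; split; [exact: etrans z2 (alg _ _)|exact: etrans z3 (alg _ _)|
  exact: etrans y2 (alg _ _)|exact: etrans y3 (alg _ _)].
Qed.

Lemma linear_matched s s' : linear_prop (fun phi => nice phi /\ matched s s' phi).
Proof.
have [n1 n2 n3] := linear_nice; split.
- by split => //; apply: zedge_matched; rewrite pullback0; exact: zedge0.
- move=> c phi psi [np M] [nq K]; split; first exact: n2.
  move=> t ht; have [E [w1 [w2 [H1 H2]]]] := M t ht; have [F [v1 [v2 [L1 L2]]]] := K t ht.
  have rt := in01_rev ht; rewrite !pullbackL E F; split => //.
  by exists (c * w1 + v1), (c * w2 + v2); split; apply: grad_onL.
- move=> phi psi E [np M]; split; first exact: n3 E np.
  move=> t ht; have [F [w1 [w2 [H1 H2]]]] := M t ht; have rt := in01_rev ht.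
  rewrite -(eq_pullback s E) // -(eq_pullback s' E) //; split => //.
  by exists w1, w2; split; apply: grad_on_ext E _ _ _.
Qed.

Lemma linear_zedge s : linear_prop (fun phi => nice phi /\ zedge (pullback s phi)).
Proof.
have [n1 n2 n3] := linear_nice; split.
- by split => //; rewrite pullback0; exact: zedge0.
- move=> c phi psi [np M] [nq K]; split; first exact: n2.
  have sp := spl2_pullback s np; have sq := spl2_pullback s nq.
  by rewrite pullbackL; apply: (zedgeD (n := n)) => //; [exact: spl2Z|exact: zedgeZ sp M].
- move=> phi psi E [np M]; split; first exact: n3 E np.
  exact: eq_zedge (eq_pullback s E) M.
Qed.

Lemma linear_zjet s : linear_prop (fun phi => nice phi /\ zjet (pullback s phi)).
Proof.
have [n1 n2 n3] := linear_nice; split.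
- by split => //; rewrite pullback0; exact: (zjet0 R n0).
- move=> c phi psi [np M] [nq K]; split; first exact: n2.
  have sp := spl2_pullback s np; have sq := spl2_pullback s nq.
  by rewrite pullbackL; apply: (zjetD n0) => //; [exact: spl2Z|exact: zjetZ sp M].
- move=> phi psi E [np M]; split; first exact: n3 E np.
  exact: eq_zjet (eq_pullback s E) M.
Qed.

Lemma matched_sym s s' phi : matched s s' phi -> matched s' s phi.
Proof.
move=> M t ht; have [E [w1 [w2 [H1 H2]]]] := M _ (in01_rev ht); rewrite subKr in E H2.
by split=> //; exists w1, w2.
Qed.

End Summands.

(*FILE Q2*)
Section EdgeFunctions.
Variables (R : realType) (p r n : nat) (D : multipatch R).
Hypotheses (r0 : (0 < r)%N) (rp : (r.+1 < p)%N) (n0 : (0 < n)%N).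
Hypothesis hN : (6 <= Nplus p r n)%N.
Hypothesis hD : is_multipatch p r n D.
Implicit Types (s t : side D) (phi psi : bfun D) (a b : R -> R) (g h : R -> R -> R).

Let rp' : (r < p)%N := ltnW rp.
Let h0 := in01_0 R.

Let pN : (5 <= p + n.-1 * (p - r))%N.
Proof.
move: hN; rewrite /Nplus /dimS; nia.
Qed.
Let NpE : Nplus p r n = (p + n.-1 * (p - r.+1)).+1%N.
Proof. by rewrite /Nplus /dimS subn1 mulnC addn1 addnC. Qed.
Let NmE : Nminus p r n = (p + n.-1 * (p - r.+1))%N.
Proof.
rewrite /Nminus /dimS subn1 mulnC -addnA addnC; congr (_ + _)%N; first by lia.
by congr muln; lia.
Qed.

Let b0 : R -> R := bspline p r n 0.
Let b1 : R -> R := bspline p r n 1.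
Notation eff := (ef b0 b1).

Lemma spl_b j : spl n (bspline p r n j : R -> R).
Proof. exact: spl_bspline. Qed.

Lemma ord1_b j : (j <= 1)%N -> ord1 3 (bspline p r n j : R -> R).
Proof. by move=> j1; apply: ord0W (ord1_bspline R rp' n0 j); lia. Qed.

Lemma ord0_b1 : ord0 1 b1.
Proof. exact: ord0_bspline. Qed.

Definition rprof j1 j2 : R -> R := if j2 == 0%N then bplus p r n j1 else fun _ => 0.

Definition sprof (al be : {poly R}) j1 j2 : R -> R := fun y =>
  if j2 == 0%N then bplus p r n j1 y - n%:R^-1 / p%:R * (be.[y] * der01 (@bplus R p r n j1) y)
  else al.[y] * bminus p r n j1 y.

Lemma edge_profileE al be j1 j2 : edge_profile p r n al be j1 j2 = eff (rprof j1 j2) (sprof al be j1 j2).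
Proof.
apply/funext => x; apply/funext => y; rewrite /edge_profile /ef /rprof /sprof /c0 /c1.
by case: eqP => _; rewrite -/b0 -/b1; ring.
Qed.

Lemma spl_bplus j : spl n (bplus p r n j : R -> R).
Proof. by rewrite /bplus; apply: spl_bspline. Qed.

Lemma spl_rprof j1 j2 : spl n (rprof j1 j2).
Proof.
rewrite /rprof; case: eqP => _; first exact: spl_bplus.
by apply: eq_spl (spl_poly n 0) => x _; rewrite horner0.
Qed.

Lemma spl_sprof al be j1 j2 : spl n (sprof al be j1 j2).
Proof.
rewrite /sprof; case: eqP => _.
  apply: eq_spl (splD (spl_bplus j1) (splZ (- (n%:R^-1 / p%:R)) (spl_polyM be
    (spl_der_bspline R rp n0 j1 (r0 : 1 < r.+1)%N)))) => x _.
  by rewrite mulNr.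
by apply: spl_polyM => //; apply: spl_bspline => //; lia.
Qed.

Lemma ord0_rprof j1 j2 : ord0 j1 (rprof j1 j2).
Proof. by rewrite /rprof; case: eqP => _; [exact: ord0_bspline|exact: ord0_cst]. Qed.

Lemma rprof_ord i j1 j2 : (j2 <= 1)%N -> (i <= j1 + j2)%N -> ord0 i (rprof j1 j2).
Proof.
move=> j2l ij; rewrite /rprof; case: eqP => E; last exact: ord0_cst.
by apply: ord0W (ord0_bspline R rp n0 j1); lia.
Qed.

Lemma sprof_ord al be i j1 j2 : (j2 <= 1)%N -> (i <= j1 + j2)%N -> ord0 i.-1 (sprof al be j1 j2).
Proof.
move=> j2l ij; rewrite /sprof; case: eqP => E.
  case: i ij => [|i] ij /=.
    by apply: (ord0_0 n0); have := spl_sprof al be j1 j2; rewrite /sprof E.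
  have o : ord0 i.+1 (bplus p r n j1 : R -> R) by apply: ord0W (ord0_bspline R rp n0 j1); lia.
  apply: ord0D; first exact: ord0W o.
  have := ord0M (ord0_poly (- (n%:R^-1 / p%:R) *: be)) (ord0_der o); rewrite add0n.
  by apply: eq_ord0 => x _; rewrite hornerZ; ring.
have j1i : (i.-1 <= j1)%N by lia.
have o : ord0 i.-1 (bminus p r n j1 : R -> R) by apply: ord0W (ord0_bspline R _ n0 j1); lia.
by have := ord0M (ord0_poly al) o; rewrite add0n.
Qed.

Lemma rprof_ord1 j1 j2 : (j1 + 3 <= Nminus p r n)%N -> ord1 3 (rprof j1 j2).
Proof.
move=> H; rewrite /rprof; case: eqP => E; last exact: ord0_cst.
by apply: ord0W (ord1_bspline R rp n0 j1); lia.
Qed.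

Lemma sprof_ord1 al be j1 j2 : (j1 + 3 <= Nminus p r n)%N -> ord1 2 (sprof al be j1 j2).
Proof.
move=> H; rewrite /sprof; case: eqP => E.
  have o : ord1 3 (bplus p r n j1 : R -> R) by apply: ord0W (ord1_bspline R rp n0 j1); lia.
  apply: ord0D; first exact: ord0W o.
  have := ord0M (ord0_poly (- (n%:R^-1 / p%:R) *: be \Po (1 - 'X))) (ord1_der (spl_bplus j1) o).
  rewrite add0n; apply: eq_ord0 => x _.
  by rewrite horner_comp hornerZ !(hornerD, hornerN, hornerC, hornerX); ring.
have o : ord1 2 (bminus p r n j1 : R -> R).
  by apply: ord0W (ord1_bspline R _ n0 j1); lia.
have := ord0M (ord0_poly (al \Po (1 - 'X))) o; rewrite add0n; apply: eq_ord0 => x _.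
by rewrite horner_comp !hornerE.
Qed.

End EdgeFunctions.

(*FILE Q3*)
Section EdgeBasis.
Variables (R : realType) (p r n : nat) (D : multipatch R).
Hypotheses (r0 : (0 < r)%N) (rp : (r.+1 < p)%N) (n0 : (0 < n)%N).
Hypothesis hN : (6 <= Nplus p r n)%N.
Hypothesis hD : is_multipatch p r n D.
Implicit Types (s : side D) (phi psi : bfun D) (a b : R -> R) (g h : R -> R -> R).

Let rp' : (r < p)%N := ltnW rp.
Let h0 := in01_0 R.
Let b0 : R -> R := bspline p r n 0.
Let b1 : R -> R := bspline p r n 1.
Notation eff := (ef b0 b1).
Let pn : R := p%:R * n%:R.

Let sb0 : spl n b0. Proof. exact: spl_b. Qed.
Let sb1 : spl n b1. Proof. exact: spl_b. Qed.

Lemma eff0 a b t : eff a b 0 t = a t.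
Proof. by rewrite /ef /b0 /b1 !(bspline_0 R rp' n0) mul1r mul0r addr0. Qed.

Lemma d1_ef a b t : spl n a -> spl n b -> in01 t -> d1 (eff a b) 0 t = pn * (b t - a t).
Proof.
move=> sa sb ht; rewrite /ef (d1D (spl2_tensor n0 sb0 sa) (spl2_tensor n0 sb1 sb)) //.
rewrite (d1_tensor sb0 sa) // (d1_tensor sb1 sb) // /b0 /b1 !(der_bspline_0 R rp' n0) /pn /=.
by ring.
Qed.

Lemma d2_ef a b t : spl n a -> spl n b -> in01 t -> d2 (eff a b) 0 t = der01 a t.
Proof.
move=> sa sb ht; rewrite /ef (d2D (spl2_tensor n0 sb0 sa) (spl2_tensor n0 sb1 sb)) //.
rewrite (d2_tensor sb0 sa) // (d2_tensor sb1 sb) // /b0 /b1 !(bspline_0 R rp' n0) /=.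
by rewrite mul1r mul0r addr0.
Qed.

Lemma cramer (g1 g2 e1 e2 c d : R) : g1 * e2 - g2 * e1 != 0 ->
  exists w1 w2, c = w1 * g1 + w2 * g2 /\ d = w1 * e1 + w2 * e2.
Proof.
move=> hd; exists ((c * e2 - d * g2) / (g1 * e2 - g2 * e1)), ((d * g1 - c * e1) / (g1 * e2 - g2 * e1)).
by split; field.
Qed.

Lemma gradient_transfer (al al' be x1 x2 x3 y1 y2 y3 w1 w2 c : R) : al != 0 ->
  al * x1 + al' * x2 + be * x3 = 0 -> al * y1 + al' * y2 + be * y3 = 0 ->
  al * c + al' * (w1 * x2 + w2 * y2) + be * (w1 * x3 + w2 * y3) = 0 ->
  c = w1 * x1 + w2 * y1.
Proof.
move=> al0 X Y C; apply: (mulfI al0).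
have -> : al * c = - al' * (w1 * x2 + w2 * y2) - be * (w1 * x3 + w2 * y3) by lra.
have -> : al * (w1 * x1 + w2 * y1) = w1 * (al * x1) + w2 * (al * y1) by ring.
have -> : al * x1 = - (al' * x2 + be * x3) by lra.
have -> : al * y1 = - (al' * y2 + be * y3) by lra.
by ring.
Qed.

Lemma matched_ef s s' phi a b b' : opp s s' -> spl n a -> spl n b -> spl n b' ->
  eqsq (pullback s phi) (eff a b) -> eqsq (pullback s' phi) (eff (rev a) (rev b')) ->
  (forall t, in01 t -> exists al al' be : R, [/\ al != 0,
     al *: d1 (geoS s') 0 (1 - t) + al' *: d1 (geoS s) 0 t + be *: d2 (geoS s) 0 t = 0 &
     al * (pn * (b' t - a t)) + al' * (pn * (b t - a t)) + be * der01 a t = 0]) ->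
  matched s s' phi.
Proof.
move=> op sa sb sb' E E' H t ht; have rt := in01_rev ht.
have sra := spl_rev n0 sa; have srb := spl_rev n0 sb'.
rewrite E // E' // !eff0 /rev subKr; split => //.
have [al [al' [be [al0 G K]]]] := H t ht.
have det := det2_geoS r0 rp' n0 hD s h0 ht; rewrite /det2 in det.
have [w1 [w2 [W1 W2]]] := cramer (pn * (b t - a t)) (der01 a t) (lt0r_neq0 det).
have tr := opp_tangent r0 rp' n0 hD op ht.
have Q1 := etrans (d1_eqsq E' h0 rt) (d1_ef sra srb rt); rewrite /rev subKr in Q1.
have Q2 := der01_rev sa rt; rewrite subKr in Q2.
have {}Q2 := etrans (etrans (d2_eqsq E' h0 rt) (d2_ef sra srb rt)) Q2.
have row_eq (c : 'I_2) (A B C : 'rV[R]_2) : al *: A + al' *: B + be *: C = 0 ->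
    al * A 0 c + al' * B 0 c + be * C 0 c = 0.
  by move=> /(congr1 (fun M : 'rV[R]_2 => M 0 c)); rewrite !mxE.
have row_opp (A B : 'rV[R]_2) : A = - B ->
    - (w1 * B 0 0 + w2 * B 0 1) = w1 * A 0 0 + w2 * A 0 1.
  by move=> ->; rewrite !mxE; ring.
rewrite W1 W2 in K.
exists w1, w2; split; split.
- exact: etrans (etrans (d1_eqsq E h0 ht) (d1_ef sa sb ht)) W1.
- exact: etrans (etrans (d2_eqsq E h0 ht) (d2_ef sa sb ht)) W2.
- exact: etrans Q1 (gradient_transfer al0 (row_eq 0 _ _ _ G) (row_eq 1 _ _ _ G) K).
- exact: etrans Q2 (etrans (congr1 -%R W2) (row_opp _ _ tr)).
Qed.

Definition edge_form i k s phi := exists a b, [/\ spl n a, spl n b, ord0 i a /\ ord0 i.-1 b,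
  ord1 k a /\ ord1 k.-1 b & eqsq (pullback s phi) (eff a b)].

Lemma ord0Z (k : nat) (c : R) a : ord0 k a -> ord0 k (fun x => c * a x).
Proof.
move=> o; have := ord0M (ord0_poly c%:P) o; rewrite add0n; apply: eq_ord0 => x _.
by rewrite hornerC.
Qed.

Lemma linear_edge_form i k s : linear_prop (fun phi => nice n phi /\ edge_form i k s phi).
Proof.
have [n1 n2 n3] := linear_nice D n0; split.
- split => //; exists (fun _ => 0), (fun _ => 0).
  have s00 : spl n (fun _ : R => 0 : R) by apply: eq_spl (spl_poly n 0) => x _; rewrite horner0.
  split => //; try by split; exact: ord0_cst.
  by rewrite pullback0 => x y _ _; rewrite /ef !mulr0 addr0.
- move=> c phi psi [np [a [b [sa sb [oa ob] [oa' ob'] E]]]] [nq [a' [b' [sa' sb' [oc od] [oc' od'] E']]]].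
  split; first exact: n2.
  exists (fun x => c * a x + a' x), (fun x => c * b x + b' x); split.
  + by apply: splD => //; exact: splZ.
  + by apply: splD => //; exact: splZ.
  + by split; apply: ord0D => //; exact: ord0Z.
  + by split; [exact: ord0D (ord0Z c oa') oc'|exact: ord0D (ord0Z c ob') od'].
  + by rewrite pullbackL => x y hx hy; rewrite E // E' // /ef; ring.
- move=> phi psi E [np [a [b [sa sb oa ob H]]]]; split; first exact: n3 E np.
  exists a, b; split => // x y hx hy; rewrite -H //; symmetry; exact: (eq_pullback s E).
Qed.

Lemma nice_on_patch s g : spl2 n g -> nice n (on_patch s g).
Proof.
move=> sg i; rewrite /on_patch; case: eqP => _; first exact: spl2_rotate.
exact: spl2_0.
Qed.

Variable gd : side D -> side D -> gluing_polys R.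
Hypothesis hG1 : analysis_suitable_G1 gd.
Notation Np := (Nplus p r n).
Notation ebasis o1 o2 := (@edge_basis R p r n D gd o1 o2).
Implicit Type j : ('I_Np * 'I_2)%type.

Definition std_opt (o1 o2 : option (side D)) :=
  if o1 is Some s1 then if o2 is Some s2 then std_iface s1 s2 else True else True.

Definition first_data o1 o2 : {poly R} * {poly R} :=
  if o1 is Some s1 then if o2 is Some s2 then (al1 (gd s1 s2), be1 (gd s1 s2)) else (1, 0)
  else (1, 0).
Definition second_data o1 o2 : {poly R} * {poly R} :=
  if o1 is Some s1 then if o2 is Some s2 then (- al2 (gd s1 s2), be2 (gd s1 s2)) else (1, 0)
  else (1, 0).

Local Notation rp1 := (@rprof R p r n).
Local Notation sp1 d j := (@sprof R p r n d.1 d.2 j.1 j.2).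

Lemma pullback_first s o2 j : std_opt (Some s) o2 ->
  pullback s (ebasis (Some s) o2 j) = eff (rp1 j.1 j.2) (sp1 (first_data (Some s) o2) j).
Proof.
have E d : pullback s (on_patch s (eff (rp1 j.1 j.2) (sp1 d j))) = eff (rp1 j.1 j.2) (sp1 d j).
  by rewrite pullback_on_patch eqxx subrr.
case: o2 => [s2|] /= st; last by rewrite edge_profileE (E (1, 0)).
rewrite -[RHS](E (al1 (gd s s2), be1 (gd s s2))) /pullback !edge_profileE; congr rotate; apply/funext => x; apply/funext => y.
by rewrite {2}/on_patch; case: eqP => [|_]; [case: st => + _ => /[apply]|rewrite addr0].
Qed.

Lemma pullback_second s o1 j : std_opt o1 (Some s) ->
  pullback (snd_as_first s) (ebasis o1 (Some s) j) =
  eff (rev (rp1 j.1 j.2)) (rev (sp1 (second_data o1 (Some s)) j)).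
Proof.
have E d : pullback (snd_as_first s) (on_patch s (swap_args (eff (rp1 j.1 j.2) (sp1 d j)))) =
    eff (rev (rp1 j.1 j.2)) (rev (sp1 d j)).
  by rewrite pullback_on_patch eqxx /= (_ : s.2 + 1 - s.2 = 1) //; rewrite addrC addKr.
case: o1 => [s2|] /= st; last by rewrite edge_profileE (E (1, 0)).
rewrite -[RHS](E (- al2 (gd s2 s), be2 (gd s2 s))) /pullback !edge_profileE; congr rotate; apply/funext => x; apply/funext => y.
by rewrite {1}/on_patch /=; case: eqP => [e|_]; [case: st => + _; rewrite e|rewrite add0r].
Qed.

Lemma nice_basis o1 o2 j : nice n (ebasis o1 o2 j).
Proof.
have se (al be : {poly R}) : spl2 n (edge_profile p r n al be j.1 j.2).
  by rewrite edge_profileE; apply: spl2_ef => //; [exact: spl_rprof|exact: spl_sprof].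
case: o1 o2 => [s1|] [s2|] //=.
- move=> i; apply: spl2D; last by apply: nice_on_patch; exact: spl2_swap.
  exact: nice_on_patch.
- exact: nice_on_patch.
- by apply: nice_on_patch; exact: spl2_swap.
- by move=> i; exact: spl2_0.
Qed.

Lemma basis_other o1 o2 j i : (forall s, o1 = Some s -> s.1 <> i) -> (forall s, o2 = Some s -> s.1 <> i) ->
  ebasis o1 o2 j i = fun _ _ => 0.
Proof.
have Z s g : s.1 <> i -> on_patch s g i = fun _ _ => 0 by move=> ne; rewrite /on_patch; case: eqP => // e; case: ne.
case: o1 o2 => [s1|] [s2|] //= H1 H2.
- by apply/funext => x; apply/funext => y; rewrite Z ?Z ?addr0 //; [exact: H2|exact: H1].
- by apply: Z; exact: H1.
- by apply: Z; exact: H2.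
Qed.

Lemma ord2 j : (j.2 <= 1)%N. Proof. by case: j => j1 [[|[]]]. Qed.

Lemma basis_first i s o2 j : std_opt (Some s) o2 -> (i <= j.1 + j.2)%N -> (j.1 + 3 <= Nminus p r n)%N ->
  edge_form i 3 s (ebasis (Some s) o2 j).
Proof.
move=> st h1 h2; rewrite /edge_form (pullback_first j st); do 2!eexists; split; last by [].
- exact: spl_rprof.
- exact: spl_sprof.
- by split; [apply: rprof_ord => //; exact: ord2|apply: sprof_ord => //; exact: ord2].
- by split; [exact: rprof_ord1|exact: sprof_ord1].
Qed.

Lemma rev_rev a : rev (rev a) = a. Proof. by apply/funext => x; rewrite /rev subKr. Qed.

Lemma basis_second i s o1 j : std_opt o1 (Some s) -> (i <= j.1 + j.2)%N -> (j.1 + 3 <= Nminus p r n)%N ->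
  edge_form 3 i (snd_as_first s) (ebasis o1 (Some s) j).
Proof.
move=> st h1 h2; rewrite /edge_form (pullback_second j st); do 2!eexists; split; last by [].
- by apply: spl_rev => //; exact: spl_rprof.
- by apply: spl_rev => //; exact: spl_sprof.
- by split; [exact: rprof_ord1|exact: sprof_ord1].
- by split; apply: ord0_rev; [apply: rprof_ord => //; exact: ord2|apply: sprof_ord => //; exact: ord2].
Qed.

Lemma basis_matched s1 s2 j : std_iface s1 s2 -> matched s1 (snd_as_first s2) (ebasis (Some s1) (Some s2) j).
Proof.
move=> st; have op := (opp_std s1 s2).2 st.
set q := gd s1 s2.
apply: (@matched_ef _ _ _ (rp1 j.1 j.2) (sp1 (al1 q, be1 q) j) (sp1 (- al2 q, be2 q) j)) => //.
- exact: spl_rprof.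
- exact: spl_sprof.
- exact: spl_sprof.
- by rewrite (@pullback_first s1 (Some s2)).
- by rewrite (@pullback_second s2 (Some s1)).
move=> t ht; have [_ _ pos G _] := hG1 st.
exists (al1 q).[t], (al2 q).[t], (gluing_beta q).[t]; split.
- by have := pos t ht; rewrite -/q; case: eqP => // ->; rewrite mul0r ltxx.
- have [-> _] := d1_geoS_rot r0 rp' n0 hD s2 h0 (in01_rev ht); rewrite subKr.
  exact: G.
rewrite /gluing_beta hornerD !hornerM /rprof /sprof /= /pn.
have nn : n%:R != 0 :> R by rewrite pnatr_eq0 -lt0n.
have pp : p%:R != 0 :> R by rewrite pnatr_eq0; lia.
case: eqP => [E|E].
  by move: (bplus _ _ _ _ _) (der01 _ _) => u w; field; rewrite nn pp.
have -> : der01 (fun _ : R => 0 : R) t = 0 by exact: (d1_cst0 ht h0).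
by rewrite hornerN; ring.
Qed.

End EdgeBasis.

(*FILE Q4*)
Section Spaces.
Variables (R : realType) (p r n : nat) (D : multipatch R).
Hypotheses (r0 : (0 < r)%N) (rp : (r.+1 < p)%N) (n0 : (0 < n)%N).
Hypothesis hN : (6 <= Nplus p r n)%N.
Hypothesis hD : is_multipatch p r n D.
Variable gd : side D -> side D -> gluing_polys R.
Hypothesis hG1 : analysis_suitable_G1 gd.
Implicit Types (s t : side D) (phi psi : bfun D) (a b : R -> R) (g h : R -> R -> R).
Implicit Types (o : option (side D)).

Let rp' : (r < p)%N := ltnW rp.
Let h0 := in01_0 R.
Let b0 : R -> R := bspline p r n 0.
Let b1 : R -> R := bspline p r n 1.
Notation eff := (ef b0 b1).
Notation Np := (Nplus p r n).
Notation Nm := (Nminus p r n).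
Notation ebasis o1 o2 := (@edge_basis R p r n D gd o1 o2).
Notation eform := (@edge_form R p r n D).

Lemma pullback_same s t phi : s.1 = t.1 -> pullback t phi = rotate (t.2 - s.2) (pullback s phi).
Proof. by case: s t => i k [i' l] /= <-; rewrite -pullback_rot /= addrC subrK. Qed.

Lemma edge_form_zedge i k s t phi : eform i k s phi -> s.1 = t.1 -> t <> s ->
  (t = snd_as_first s -> (2 < i)%N) -> (s = snd_as_first t -> (2 < k)%N) -> zedge (pullback t phi).
Proof.
move=> [a [b [sa sb [oa ob] [oa' ob'] E]]] st ts h1 h3; rewrite (pullback_same _ st).
have W (j l : nat) u : (2 < j)%N -> (l <= 1)%N -> ord0 (j - l) u -> ord0 2 (u : R -> R).
  by move=> j3 l1; apply: ord0W; lia.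
have T e : t.2 - s.2 = e -> t = (s.1, s.2 + e) by move=> <-; case: (t) st => t1 t2 /= ->; rewrite addrC subrK.
apply: (@eq_zedge _ (rotate (t.2 - s.2) (eff a b))).
  by apply: eqsq_rotate => x y hx hy; rewrite E.
apply: (ef_zedge n0) => //.
- exact: spl_b.
- exact: spl_b.
- exact: ord1_b.
- exact: ord1_b.
- by apply/eqP => e; case: ts; rewrite (T _ e) addr0 -surjective_pairing.
- move=> e; have i3 := h1 (T _ e); split; first by apply: ord0W oa; lia.
  by apply: ord0W ob; lia.
- move=> e; have k3 : (2 < k)%N.
    apply: h3; rewrite (T _ e) /snd_as_first /= -addrA (_ : 3 + 1 = 0 :> 'Z_4); last by apply/eqP.
    by rewrite addr0 -surjective_pairing.
  split; first by apply: ord0W oa'; lia.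
  by apply: ord0W ob'; lia.
Qed.

Lemma edge_form_zjet i k s t phi : eform i k s phi -> s.1 = t.1 ->
  (t = s -> (2 < i)%N) -> (s = snd_as_first t -> (2 < k)%N) -> zjet (pullback t phi).
Proof.
move=> [a [b [sa sb [oa ob] [oa' ob'] E]]] st h1 h3; rewrite (pullback_same _ st).
have T e : t.2 - s.2 = e -> t = (s.1, s.2 + e) by move=> <-; case: (t) st => t1 t2 /= ->; rewrite addrC subrK.
apply: (@eq_zjet _ (rotate (t.2 - s.2) (eff a b))).
  by apply: eqsq_rotate => x y hx hy; rewrite E.
apply: (ef_zjet n0) => //.
- exact: spl_b.
- exact: spl_b.
- exact: ord1_b.
- exact: ord1_b.
- exact: ord0_b1.
- move=> e; have i3 : (2 < i)%N by apply: h1; rewrite (T _ e) addr0 -surjective_pairing.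
  by split; [by apply: ord0W oa; lia|apply: ord0W ob; lia].
- move=> e; have k3 : (2 < k)%N.
    apply: h3; rewrite (T _ e) /snd_as_first /= -addrA (_ : 3 + 1 = 0 :> 'Z_4); last by apply/eqP.
    by rewrite addr0 -surjective_pairing.
  split; first by apply: ord0W oa'; lia.
  by apply: ord0W ob'; lia.
Qed.

Section EdgeSpace.
Variables (i : nat) (P : pred ('I_Np * 'I_2)) (o1 o2 : option (side D)).
Hypothesis HP : forall j, P j -> (i <= j.1 + j.2)%N /\ (j.1 + 3 <= Nm)%N.
Hypothesis st : std_opt o1 o2.
Variable phi : bfun D.
Hypothesis Hphi : bspan P (ebasis o1 o2) phi.

Lemma space_nice : nice n phi.
Proof. by apply: linear_bspan (linear_nice D n0) _ Hphi => j _; exact: nice_basis. Qed.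

Lemma space_first s : o1 = Some s -> eform i 3 s phi.
Proof.
move=> E; have [] // := linear_bspan (linear_edge_form p r n0 i 3 s) _ Hphi.
move=> j /HP[h1 h2]; split; first exact: nice_basis.
by rewrite E; apply: basis_first => //; rewrite -E.
Qed.

Lemma space_second s : o2 = Some s -> eform 3 i (snd_as_first s) phi.
Proof.
move=> E; have [] // := linear_bspan (linear_edge_form p r n0 3 i (snd_as_first s)) _ Hphi.
move=> j /HP[h1 h2]; split; first exact: nice_basis.
by rewrite E; apply: basis_second => //; rewrite -E.
Qed.

Lemma space_other k : (forall s, o1 = Some s -> s.1 <> k) -> (forall s, o2 = Some s -> s.1 <> k) ->
  eqsq (phi k) (fun _ _ => 0).
Proof.
move=> H1 H2 x y hx hy; have [c ->] := Hphi => //.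
by rewrite big1 // => j _; rewrite basis_other // mulr0.
Qed.

Lemma space_matched s1 s2 : o1 = Some s1 -> o2 = Some s2 -> matched s1 (snd_as_first s2) phi.
Proof.
move=> E1 E2.
have [] // := linear_bspan (linear_matched n0 s1 (snd_as_first s2)) _ Hphi.
move=> j _; split; first exact: nice_basis.
by rewrite E1 E2; apply: basis_matched => //; move: st; rewrite E1 E2.
Qed.

End EdgeSpace.

Lemma zero_zedge s phi : eqsq (phi s.1) (fun _ _ => 0) -> zedge (pullback s phi).
Proof.
move=> E; apply: (@eq_zedge _ (fun _ _ => 0)); last exact: zedge0.
move=> x y hx hy; rewrite /pullback (eqsq_rotate _ E) //.
by rewrite (rotate_comp (fun _ : R => 0) (fun _ _ => 0)).
Qed.

Lemma zero_zjet s phi : eqsq (phi s.1) (fun _ _ => 0) -> zjet (pullback s phi).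
Proof.
move=> E; apply: (@eq_zjet _ (fun _ _ => 0)); last exact: (zjet0 R n0).
move=> x y hx hy; rewrite /pullback (eqsq_rotate _ E) //.
by rewrite (rotate_comp (fun _ : R => 0) (fun _ _ => 0)).
Qed.

Definition glued phi := nice n phi /\ forall s s', opp s s' -> matched s s' phi.

Lemma linear_glued : linear_prop glued.
Proof.
have [n1 n2 n3] := linear_nice D n0; split.
- by split=> // s s' _; have [[]] := linear_matched n0 s s'.
- move=> c phi psi [np M] [nq K]; split; first exact: n2.
  move=> s s' op; have [_ h _] := linear_matched n0 s s'.
  by have [] // := h c phi psi (conj np (M _ _ op)) (conj nq (K _ _ op)).
- move=> phi psi E [np M]; split; first exact: n3 E np.
  move=> s s' op; have [_ _ h] := linear_matched n0 s s'.
  by have [] // := h phi psi E (conj np (M _ _ op)).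
Qed.

Lemma gluedP phi : nice n phi ->
  (forall t, zedge (pullback t phi) \/ forall t', opp t t' -> matched t t' phi) -> glued phi.
Proof.
move=> np H; split=> // s s' op.
have [z|] := H s; last exact.
have [z'|h] := H s'; first exact: zedge_matched.
by apply: matched_sym; apply: h; exact: opp_sym.
Qed.

Definition flat phi := nice n phi /\ forall s, zjet (pullback s phi).

Lemma linear_flat : linear_prop flat.
Proof.
have [n1 n2 n3] := linear_nice D n0; split.
- by split=> // s; have [[]] := linear_zjet n0 s.
- move=> c phi psi [np M] [nq K]; split; first exact: n2.
  move=> s; have [_ h _] := linear_zjet n0 s.
  by have [] // := h c phi psi (conj np (M _)) (conj nq (K _)).
- move=> phi psi E [np M]; split; first exact: n3 E np.
  move=> s; have [_ _ h] := linear_zjet n0 s.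
  by have [] // := h phi psi E (conj np (M _)).
Qed.

Lemma patch_space_good i phi : @patch_space R p r n D i phi -> glued phi /\ flat phi.
Proof.
apply: (linear_bspan (linearI linear_glued linear_flat)) => -[j1 j2] /= /and4P[a1 a2 a3 a4].
have N1 : dimS p r n = (p + n.-1 * (p - r)).+1 by rewrite /dimS subn1 mulnC addn1 addnC.
have s1 : spl n (bspline p r n j1 : R -> R) by exact: spl_b.
have s2 : spl n (bspline p r n j2 : R -> R) by exact: spl_b.
have e1 : ord0 2 (bspline p r n j1 : R -> R) by apply: ord0W (ord0_bspline R rp' n0 j1).
have e2 : ord0 2 (bspline p r n j2 : R -> R) by apply: ord0W (ord0_bspline R rp' n0 j2).
have e3 : ord0 2 (rev (bspline p r n j1 : R -> R)).
  by apply: ord0W (ord1_bspline R rp' n0 j1); lia.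
have e4 : ord0 2 (rev (bspline p r n j2 : R -> R)).
  by apply: ord0W (ord1_bspline R rp' n0 j2); lia.
have np : nice n (@patch_basis R p r n D (i, 0) (j1, j2)).
  by apply: nice_on_patch => //; exact: spl2_tensor.
have L k : ord0 2 (rotl k (bspline p r n j1 : R -> R) (bspline p r n j2)).
  by rewrite /rotl; do ![case: ifP => _].
have L' k : ord0 2 (rotr k (bspline p r n j1 : R -> R) (bspline p r n j2)).
  by rewrite /rotr; do ![case: ifP => _].
split; last first.
  split=> // s; rewrite /patch_basis pullback_on_patch; case: eqP => _ /=; last exact: (zjet0 R n0).
  exact: (zjet_rot n0 s1 s2 (L _) (L' _)).
apply: gluedP => // t; left; rewrite /patch_basis pullback_on_patch; case: eqP => _ /=.
  exact: (zedge_rot n0 s1 s2 (L _)).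
exact: zedge0.
Qed.

End Spaces.

(*FILE Q5*)
Section GoodEdges.
Variables (R : realType) (p r n : nat) (D : multipatch R).
Hypotheses (r0 : (0 < r)%N) (rp : (r.+1 < p)%N) (n0 : (0 < n)%N).
Hypothesis hN : (6 <= Nplus p r n)%N.
Hypothesis hD : is_multipatch p r n D.
Variable gd : side D -> side D -> gluing_polys R.
Hypothesis hG1 : analysis_suitable_G1 gd.
Implicit Types (s t : side D) (phi psi : bfun D) (a b : R -> R) (g h : R -> R -> R).
Implicit Types (o : option (side D)).

Let rp' : (r < p)%N := ltnW rp.

Lemma Gamma_not_opp s t : open_edge s `<=` Gamma D -> ~ opp s t.
Proof.
move=> G op; have hh := half_int R.
have [_] : Gamma D (geoS s 0 (1 / 2)) by apply: G; exists (1 / 2).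
by apply; exact: (opp_Omega r0 rp' n0 hD op hh).
Qed.

Lemma iface_good s1 s2 phi : std_iface s1 s2 -> @edge_space R p r n D gd (Some s1) (Some s2) phi ->
  glued n phi /\ flat n phi.
Proof.
move=> st es; have op := (opp_std s1 s2).2 st.
have HP (j : 'I_(Nplus p r n) * 'I_2) : (3 <= j.1 + j.2)%N && (j.1 + 3 <= Nminus p r n)%N ->
  (3 <= j.1 + j.2)%N /\ (j.1 + 3 <= Nminus p r n)%N by move=> /andP.
have np := space_nice r0 rp n0 hN es.
have F1 := space_first r0 rp n0 hN HP (st : std_opt (Some s1) (Some s2)) es erefl.
have F2 := space_second r0 rp n0 hN HP (st : std_opt (Some s1) (Some s2)) es erefl.
have M := space_matched r0 rp n0 hN hD hG1 (st : std_opt (Some s1) (Some s2)) es erefl erefl.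
have Z k : s1.1 <> k -> s2.1 <> k -> eqsq (phi k) (fun _ _ => 0).
  by move=> n1 n2; apply: (space_other es) => s [<-].
split.
  apply: gluedP => // t.
  have [e1|n1] := eqVneq s1.1 t.1.
    have [e|ne] := pselect (t = s1).
      right=> t'; rewrite e => op'.
      by rewrite (opp_uniq r0 rp' n0 hD op' op).
    by left; apply: (edge_form_zedge r0 rp n0 hN F1 e1 ne).
  have [e2|n2] := eqVneq s2.1 t.1.
    have [e|ne] := pselect (t = snd_as_first s2).
      right=> t'; rewrite e => op'.
      rewrite (opp_uniq r0 rp' n0 hD op' (opp_sym op)); exact: matched_sym.
    by left; apply: (edge_form_zedge r0 rp n0 hN F2 e2 ne).
  by left; apply: zero_zedge; apply: Z; apply/eqP.
split=> // t.
have [e1|n1] := eqVneq s1.1 t.1; first by apply: (edge_form_zjet r0 rp n0 hN F1 e1).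
have [e2|n2] := eqVneq s2.1 t.1; first by apply: (edge_form_zjet r0 rp n0 hN F2 e2).
by apply: (zero_zjet n0); apply: Z; apply/eqP.
Qed.

Lemma bedge_good s phi : open_edge s `<=` Gamma D -> @edge_space R p r n D gd (Some s) None phi ->
  glued n phi /\ flat n phi.
Proof.
move=> G es.
have HP (j : 'I_(Nplus p r n) * 'I_2) : (3 <= j.1 + j.2)%N && (j.1 + 3 <= Nminus p r n)%N ->
  (3 <= j.1 + j.2)%N /\ (j.1 + 3 <= Nminus p r n)%N by move=> /andP.
have np := space_nice r0 rp n0 hN es.
have F1 := space_first r0 rp n0 hN HP (I : std_opt (Some s) None) es erefl.
have Z k : s.1 <> k -> eqsq (phi k) (fun _ _ => 0).
  by move=> n1; apply: (space_other es) => // t [<-].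
split.
  apply: gluedP => // t.
  have [e1|n1] := eqVneq s.1 t.1.
    have [e|ne] := pselect (t = s); first by right=> t'; rewrite e => /(Gamma_not_opp G).
    by left; apply: (edge_form_zedge r0 rp n0 hN F1 e1 ne).
  by left; apply: zero_zedge; apply: Z; apply/eqP.
split=> // t.
have [e1|n1] := eqVneq s.1 t.1; first by apply: (edge_form_zjet r0 rp n0 hN F1 e1).
by apply: (zero_zjet n0); apply: Z; apply/eqP.
Qed.

End GoodEdges.

(*FILE Q6*)
Section Corner.
Variables (R : realType) (p r n : nat) (D : multipatch R).
Hypotheses (r0 : (0 < r)%N) (rp : (r.+1 < p)%N) (n0 : (0 < n)%N).
Hypothesis hN : (6 <= Nplus p r n)%N.
Hypothesis hD : is_multipatch p r n D.
Implicit Types (s t : side D) (phi psi : bfun D) (a b : R -> R) (g h : R -> R -> R).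

Let rp' : (r < p)%N := ltnW rp.
Let b0 : R -> R := bspline p r n 0.
Let b1 : R -> R := bspline p r n 1.
Notation eff := (ef b0 b1).
Notation eform := (@edge_form R p r n D).

Let sb0 : spl n b0. Proof. exact: spl_b. Qed.
Let sb1 : spl n b1. Proof. exact: spl_b. Qed.

Lemma zedge_tensor0 a b : spl n a -> spl n b -> a 0 = 0 -> der01 a 0 = 0 ->
  zedge (fun x y => a x * b y).
Proof.
move=> sa sb z z' t ht; have h0 := in01_0 R.
by rewrite (d1_tensor sa sb h0 ht) (d2_tensor sa sb h0 ht) z z' !mul0r.
Qed.

Lemma mixed_ef a b m1 m2 : spl n a -> spl n b -> mixed_der00 m1 m2 (eff a b) =
  iter m1 (@der01 R R) b0 0 * iter m2 (@der01 R R) a 0 +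
  iter m1 (@der01 R R) b1 0 * iter m2 (@der01 R R) b 0.
Proof.
move=> sa sb; rewrite /ef (mixedD n0) //; try exact: spl2_tensor.
by rewrite !(mixed_tensor n0) //; exact: spl_pwpoly.
Qed.

Lemma mixed_ef_swap a b m1 m2 : spl n a -> spl n b -> mixed_der00 m1 m2 (swap_args (eff a b)) =
  iter m2 (@der01 R R) b0 0 * iter m1 (@der01 R R) a 0 +
  iter m2 (@der01 R R) b1 0 * iter m1 (@der01 R R) b 0.
Proof.
move=> sa sb; rewrite (_ : swap_args _ = (fun x y => a x * b0 y + b x * b1 y)); last first.
  by apply/funext => x; apply/funext => y; rewrite /swap_args /ef; congr (_ + _); exact: mulrC.
rewrite (mixedD n0) //; try exact: spl2_tensor.
rewrite !(mixed_tensor n0) //; try exact: spl_pwpoly.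
by congr (_ + _); exact: mulrC.
Qed.

Lemma ef_coefs (u v : nat -> R) : (forall m1 m2, (m1 <= 1)%N -> (m2 <= 1)%N ->
    iter m1 (@der01 R R) b0 0 * u m2 + iter m1 (@der01 R R) b1 0 * v m2 = 0) ->
  forall m, (m <= 1)%N -> u m = 0 /\ v m = 0.
Proof.
move=> H m hm; have := H 0%N m isT hm; have := H 1%N m isT hm.
rewrite /= /b0 /b1 !(bspline_0 R rp' n0) !(der_bspline_0 R rp' n0) /= mul1r mul0r addr0 => + u0.
rewrite u0 mulr0 add0r subr0 mulr1 => /eqP; rewrite !mulf_eq0 !pnatr_eq0.
by case: eqP => [|_]; [lia|case: eqP => [|_ /eqP]; [lia|]].
Qed.

Lemma edge_form_first_flat s phi : nice n phi -> eform 0 3 s phi ->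
  (forall m1 m2, (m1 <= 1)%N -> (m2 <= 1)%N -> mixed_der00 m1 m2 (pullback s phi) = 0) ->
  zedge (pullback (snd_as_first s) phi) /\
  forall m1 m2, (m2 <= 1)%N -> mixed_der00 m1 m2 (pullback s phi) = 0.
Proof.
move=> np [a [b [sa sb _ _ E]]] H.
have C := @ef_coefs (fun m => iter m (@der01 R R) a 0) (fun m => iter m (@der01 R R) b 0) _.
have {}C m : (m <= 1)%N -> iter m (@der01 R R) a 0 = 0 /\ iter m (@der01 R R) b 0 = 0.
  by apply: C => m1 m2 h1 h2; rewrite -mixed_ef // -(eq_mixed _ _ E) H.
split; last first.
  by move=> m1 m2 h2; rewrite (eq_mixed _ _ E) mixed_ef // (C _ h2).1 (C _ h2).2 !mulr0 addr0.
have [a0 b'0] := C 0%N isT; have [a1 b'1] := C 1%N isT.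
rewrite /snd_as_first pullback_rot.
apply: (@eq_zedge _ (fun x y => a x * rev b0 y + b x * rev b1 y)).
  by move=> x y hx hy; rewrite rotate1E E ?/ef /rev; [congr (_ + _); exact: mulrC|exact: in01_rev|].
apply: (zedgeD (n := n)).
- by apply: spl2_tensor => //; exact: spl_rev.
- by apply: spl2_tensor => //; exact: spl_rev.
- by apply: zedge_tensor0 => //; exact: spl_rev.
- by apply: zedge_tensor0 => //; exact: spl_rev.
Qed.

Lemma edge_form_second_swap i k s phi : eform i k (snd_as_first s) phi ->
  exists a b, [/\ spl n a, spl n b & eqsq (pullback s phi) (swap_args (eff a b))].
Proof.
move=> [a [b [sa sb _ _ E]]]; exists (rev a), (rev b); split; try exact: spl_rev.
move=> x y hx hy; rewrite /swap_args.
have := E y (1 - x) hy (in01_rev hx); rewrite /snd_as_first pullback_rot rotate1E subKr => ->.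
by [].
Qed.

Lemma edge_form_second_flat s phi : nice n phi -> eform 3 0 (snd_as_first s) phi ->
  (forall m1 m2, (m1 <= 1)%N -> (m2 <= 1)%N -> mixed_der00 m1 m2 (pullback s phi) = 0) ->
  zedge (pullback s phi) /\
  forall m1 m2, (m1 <= 1)%N -> mixed_der00 m1 m2 (pullback s phi) = 0.
Proof.
move=> np /edge_form_second_swap[a [b [sa sb E]]] H.
have C := @ef_coefs (fun m => iter m (@der01 R R) a 0) (fun m => iter m (@der01 R R) b 0) _.
have {}C m : (m <= 1)%N -> iter m (@der01 R R) a 0 = 0 /\ iter m (@der01 R R) b 0 = 0.
  by apply: C => m1 m2 h1 h2; rewrite -mixed_ef_swap // -(eq_mixed _ _ E) H.
split; last first.
  by move=> m1 m2 h2; rewrite (eq_mixed _ _ E) mixed_ef_swap // (C _ h2).1 (C _ h2).2 !mulr0 addr0.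
have [a0 b'0] := C 0%N isT; have [a1 b'1] := C 1%N isT.
apply: (@eq_zedge _ (fun x y => a x * b0 y + b x * b1 y)).
  by move=> x y hx hy; rewrite E // /swap_args /ef; congr (_ + _); exact: mulrC.
apply: (zedgeD (n := n)).
- exact: spl2_tensor.
- exact: spl2_tensor.
- exact: zedge_tensor0.
- exact: zedge_tensor0.
Qed.

Definition patch_form s phi := exists c00 c01 c10 c11, eqsq (pullback s phi)
  (fun x y => c00 * (b0 x * b0 y) + c01 * (b0 x * b1 y) + c10 * (b1 x * b0 y) + c11 * (b1 x * b1 y)).

Lemma linear_patch_form s : linear_prop (fun phi => nice n phi /\ patch_form s phi).
Proof.
have [n1 n2 n3] := linear_nice D n0; split.
- by split => //; exists 0, 0, 0, 0; rewrite pullback0 => x y _ _; ring.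
- move=> c phi psi [np [c00 [c01 [c10 [c11 E]]]]] [nq [d00 [d01 [d10 [d11 E']]]]].
  split; first exact: n2.
  exists (c * c00 + d00), (c * c01 + d01), (c * c10 + d10), (c * c11 + d11).
  by rewrite pullbackL => x y hx hy; rewrite E // E' //; ring.
- move=> phi psi E [np [c00 [c01 [c10 [c11 H]]]]]; split; first exact: n3 E np.
  exists c00, c01, c10, c11 => x y hx hy; rewrite -H //; symmetry; exact: (eq_pullback s E).
Qed.

Lemma span_patch_form s phi :
  bspan (fun j : 'I_(dimS p r n) * 'I_(dimS p r n) => (j.1 <= 1)%N && (j.2 <= 1)%N)
    (@patch_basis R p r n D s) phi -> nice n phi /\ patch_form s phi.
Proof.
apply: (linear_bspan (linear_patch_form s)) => -[j1 j2] /= /andP[h1 h2].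
split.
  by apply: nice_on_patch => //; apply: spl2_tensor => //; exact: spl_b.
rewrite /patch_form /patch_basis pullback_on_patch eqxx subrr /=.
case: j1 j2 h1 h2 => [[|[|k]] /= kN] [[|[|l]] /= lN] // _ _.
- by exists 1, 0, 0, 0 => x y _ _; rewrite rotate0 /b0 /b1; ring.
- by exists 0, 1, 0, 0 => x y _ _; rewrite rotate0 /b0 /b1; ring.
- by exists 0, 0, 1, 0 => x y _ _; rewrite rotate0 /b0 /b1; ring.
- by exists 0, 0, 0, 1 => x y _ _; rewrite rotate0 /b0 /b1; ring.
Qed.

Lemma patch_form_edge s phi : patch_form s phi -> eform 0 3 s phi /\ eform 3 0 (snd_as_first s) phi.
Proof.
move=> [c00 [c01 [c10 [c11 E]]]].
have sp (c d : R) : spl n (fun x => c * b0 x + d * b1 x) by apply: splD; exact: splZ.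
have o1 (c d : R) : ord1 3 (fun x => c * b0 x + d * b1 x).
  apply: (@ord0D _ _ (fun x => c * b0 (1 - x)) (fun x => d * b1 (1 - x))); apply: ord0Z.
    exact: (@ord1_b R p r n r0 rp n0 hN 0).
  exact: (@ord1_b R p r n r0 rp n0 hN 1).
split.
  exists (fun x => c00 * b0 x + c01 * b1 x), (fun x => c10 * b0 x + c11 * b1 x).
  split => //; first by split; apply: (ord0_0 n0).
    by split => //; apply: ord0W (o1 _ _).
  by move=> x y hx hy; rewrite E // /ef -/b0 -/b1; ring.
exists (rev (fun x => c00 * b0 x + c10 * b1 x)), (rev (fun x => c01 * b0 x + c11 * b1 x)).
split => //; try exact: spl_rev.
- by split; [exact: o1|apply: ord0W (o1 _ _)].
- by split; apply: (ord0_0 n0); rewrite -/(rev _) rev_rev.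
- move=> x y hx hy; rewrite /snd_as_first pullback_rot rotate1E E ?/ef /rev //; last exact: in01_rev.
  by rewrite -/b0 -/b1; ring.
Qed.

End Corner.

(*FILE Q7*)
Section Fan.
Variables (R : realType) (p r n : nat) (D : multipatch R).
Hypothesis hD : is_multipatch p r n D.
Implicit Types (s t : side D) (v : vertexI D).

Lemma onth_fan v s k : onth (fan v) k = Some s -> (k < size (fan v))%N /\ s = nth s (fan v) k.
Proof. by move=> e; rewrite -onthTE e (onth_nth s _ _ _ e). Qed.

Lemma fan_patch_mem v m s : fan_patch v m = Some s -> s \in fan v.
Proof.
rewrite /fan_patch; case: asboolP => _.
  by move=> /onth_fan[h ->]; exact: mem_nth.
by case: m => // m /onth_fan[h ->]; exact: mem_nth.
Qed.

Lemma onth_fan_inj v s t k l : onth (fan v) k = Some s -> onth (fan v) l = Some t -> s.1 = t.1 -> k = l.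
Proof.
move=> es et st; have [ks _] := onth_fan es.
apply: (onth_inj _ _ _ (fan_uniq hD v)); first by rewrite size_map (leq_ltn_trans (geq_minr _ _) ks).
by rewrite !onth_map es et /= st.
Qed.

Lemma fan_index v s : s \in fan v -> exists l m1 m2 : nat,
  [/\ [/\ (0 < l)%N, (l.*2 <= vertex_last v)%N & fan_patch v l = Some s],
      (m1.*2 < vertex_last v)%N /\ fan_patch v m1 = Some s,
      (m2.*2 < vertex_last v)%N /\ fan_patch v m2.+1 = Some s,
      m1 <> m2 &
      forall m t, t.1 = s.1 ->
        [/\ ((0 < m.*2 <= vertex_last v)%N -> fan_patch v m = Some t -> m = l),
            ((m.*2 < vertex_last v)%N -> fan_patch v m = Some t -> m = m1) &
            ((m.*2 < vertex_last v)%N -> fan_patch v m.+1 = Some t -> m = m2)]].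
Proof.
move=> /onthP[k ek]; set nu := size (fan v).
have [kn _] := onth_fan ek; rewrite -/nu in kn.
have inj t l : t.1 = s.1 -> onth (fan v) l = Some t -> l = k.
  by move=> ts /onth_fan_inj /(_ ek); apply.
have std := @fan_std _ _ _ _ _ hD v.
case: (asboolP (Omega D (vertex v))) => O; last first.
  have FS m : fan_patch v m.+1 = onth (fan v) m by rewrite /fan_patch; case: asboolP.
  have F0 : fan_patch v 0 = None by rewrite /fan_patch; case: asboolP.
  have -> : vertex_last v = nu.*2.+1 by rewrite /vertex_last; case: asboolP.
  exists k.+1, k.+1, k; rewrite FS; split => //; try by split=> //; lia.
  + by lia.
  + move=> [|m] t ts; rewrite ?F0 ?FS; split => // _ e; do ?[congr S]; exact: inj ts e.
have FS m : fan_patch v m = onth (fan v) ((m + nu - 1) %% nu).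
  by rewrite /fan_patch; case: asboolP.
have F1 m : (m < nu)%N -> fan_patch v m.+1 = onth (fan v) m.
  by move=> mn; rewrite FS addSn subn1 /= modnDr modn_small.
have F0 : fan_patch v 0 = onth (fan v) nu.-1 by rewrite FS add0n subn1 modn_small // ltn_predL; lia.
have -> : vertex_last v = nu.*2 by rewrite /vertex_last; case: asboolP.
have nu1 : (1 < nu)%N.
  rewrite ltn_neqAle (leq_ltn_trans _ kn) // andbT; apply/eqP => e.
  have [] // := std 1%N s s.
    by rewrite F1 -?e //; rewrite -ek; congr onth; lia.
  by rewrite FS -e modn1 -ek; congr onth; lia.
exists k.+1, (if k == nu.-1 then 0%N else k.+1), k; split.
- by split; [|lia|rewrite F1].
- by case: eqP => e; split; rewrite ?F1 ?F0 -?e //; lia.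
- by split; [lia|rewrite F1].
- by case: eqP => e; lia.
- case=> [|m] t ts; split => // h.
  + by rewrite F0 => /(inj _ _ ts) <-; rewrite eqxx.
  + by rewrite F1 => [/(inj _ _ ts)|]; lia.
  + by rewrite F1 => [/(inj _ _ ts) ->|]; lia.
  + rewrite F1 => [/(inj _ _ ts) e|]; last by lia.
    by rewrite e; case: eqP => //; lia.
  + by rewrite F1 => [/(inj _ _ ts)|]; lia.
Qed.

End Fan.

(*FILE Q8*)
Lemma sum_three (R : realType) (L a b c : nat) (F : nat -> R) :
  (0 < a <= L)%N -> (0 < b <= L)%N -> (0 < c <= L)%N -> a <> b -> a <> c -> b <> c ->
  (forall k, (0 < k <= L)%N -> k <> a -> k <> b -> k <> c -> F k = 0) ->
  \sum_(1 <= k < L.+1) F k = F a + F b + F c.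
Proof.
move=> ha hb hc ab ac bc H.
have one d (x : R) : (0 < d <= L)%N -> \sum_(1 <= k < L.+1) (if k == d then x else 0) = x.
  move=> hd; rewrite (bigD1_seq d) ?iota_uniq //= ?eqxx ?mem_index_iota ?ltnS //.
  by rewrite big1 ?addr0 // => k /negbTE ->.
rewrite -(one a (F a) ha) -(one b (F b) hb) -(one c (F c) hc) -!big_split /=.
rewrite big_nat_cond [RHS]big_nat_cond; apply: eq_bigr => k; rewrite andbT ltnS => hk.
have [->|ka] := eqVneq k a; first by rewrite (introF eqP ab) (introF eqP ac) !addr0.
have [->|kb] := eqVneq k b; first by rewrite (introF eqP bc) addr0 add0r.
have [->|kc] := eqVneq k c; first by rewrite !add0r.
by rewrite !addr0; apply: H => //; apply/eqP.
Qed.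

Section Vertex.
Variables (R : realType) (p r n : nat) (D : multipatch R).
Hypotheses (r0 : (0 < r)%N) (rp : (r.+1 < p)%N) (n0 : (0 < n)%N).
Hypothesis hN : (6 <= Nplus p r n)%N.
Hypothesis hD : is_multipatch p r n D.
Variable gd : side D -> side D -> gluing_polys R.
Hypothesis hG1 : analysis_suitable_G1 gd.
Implicit Types (s t : side D) (phi psi : bfun D) (v : vertexI D).

Let rp' : (r < p)%N := ltnW rp.
Notation eform := (@edge_form R p r n D).
Notation Np := (Nplus p r n).
Notation Nm := (Nminus p r n).

Lemma matched_of_diff s s' phi psi : nice n phi -> nice n psi -> matched s s' phi ->
  zedge (pullback s (lincomb (-1) phi psi)) -> zedge (pullback s' (lincomb (-1) phi psi)) ->
  matched s s' psi.
Proof.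
move=> np nq M Z Z'.
have nd : nice n (lincomb (-1) phi psi) by have [_ h _] := linear_nice D n0; exact: h.
have [_ L E] := linear_matched n0 s s'.
have [] // : nice n psi /\ matched s s' psi.
apply: (E (lincomb 1 phi (lincomb (-1) phi psi))).
  by move=> i x y _ _; rewrite /lincomb; ring.
by apply: L; split=> //; exact: zedge_matched.
Qed.

Lemma snd_as_first_inj : injective (@snd_as_first R D).
Proof.
move=> [i k] [j l] e; have /= -> := congr1 fst e; have /= /addIr -> // := congr1 snd e.
Qed.

Section Corner.
Variables (s : side D) (phi1 phi2 phi0 psi : bfun D) (F : nat -> nat -> R).
Hypotheses (np1 : nice n phi1) (np2 : nice n phi2) (np0 : nice n phi0) (nps : nice n psi).
Hypotheses (e1 : eform 0 3 s phi1) (e2 : eform 3 0 (snd_as_first s) phi2) (e0 : patch_form p r n s phi0).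
Hypothesis E : eqsq (psi s.1) (fun x y => phi1 s.1 x y + phi2 s.1 x y - phi0 s.1 x y).
Hypothesis J1 : forall m1 m2, (m1 + m2 <= 2)%N -> (m1 <= 1)%N -> mixed_der00 m1 m2 (pullback s phi1) = F m1 m2.
Hypothesis J2 : forall m1 m2, (m1 + m2 <= 2)%N -> (m2 <= 1)%N -> mixed_der00 m1 m2 (pullback s phi2) = F m1 m2.
Hypothesis J0 : forall m1 m2, (m1 <= 1)%N -> (m2 <= 1)%N -> mixed_der00 m1 m2 (pullback s phi0) = F m1 m2.

Let d2 := lincomb (-1) phi0 phi2.
Let d1 := lincomb (-1) phi0 phi1.
Let nd2 : nice n d2. Proof. by have [_ h _] := linear_nice D n0; exact: h. Qed.
Let nd1 : nice n d1. Proof. by have [_ h _] := linear_nice D n0; exact: h. Qed.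

Let mixed_diff phi m1 m2 : nice n phi -> mixed_der00 m1 m2 (pullback s (lincomb (-1) phi0 phi)) =
  mixed_der00 m1 m2 (pullback s phi) - mixed_der00 m1 m2 (pullback s phi0).
Proof.
move=> np; rewrite pullbackL (mixedD n0); try exact: spl2_pullback.
  by rewrite (mixedZ n0) ?mulN1r 1?addrC //; exact: spl2_pullback.
by apply: spl2Z; exact: spl2_pullback.
Qed.

Let flat2 : zedge (pullback s d2) /\
  forall m1 m2, (m1 <= 1)%N -> mixed_der00 m1 m2 (pullback s d2) = 0.
Proof.
apply: (edge_form_second_flat r0 rp n0 hN nd2).
  have [_ h _] := linear_edge_form p r n0 3 0 (snd_as_first s).
  have [_ e0'] := patch_form_edge r0 rp n0 hN e0.
  by have [] := h (-1) _ _ (conj np0 e0') (conj np2 e2).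
by move=> m1 m2 h1 h2; rewrite mixed_diff // J2 ?J0 ?subrr //; lia.
Qed.

Let flat1 : zedge (pullback (snd_as_first s) d1) /\
  forall m1 m2, (m2 <= 1)%N -> mixed_der00 m1 m2 (pullback s d1) = 0.
Proof.
apply: (edge_form_first_flat r0 rp n0 hN nd1).
  have [_ h _] := linear_edge_form p r n0 0 3 s.
  have [e0' _] := patch_form_edge r0 rp n0 hN e0.
  by have [] := h (-1) _ _ (conj np0 e0') (conj np1 e1).
by move=> m1 m2 h1 h2; rewrite mixed_diff // J1 ?J0 ?subrr //; lia.
Qed.

Let pull_psi t : t.1 = s.1 -> eqsq (pullback t psi)
  (pullback t (lincomb 1 phi1 (lincomb (-1) phi0 phi2))).
Proof.
move=> ts; apply: eqsq_rotate => x y hx hy; rewrite ts E // /lincomb; ring.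
Qed.

Lemma corner_jets m1 m2 : (m1 + m2 <= 2)%N -> mixed_der00 m1 m2 (pullback s psi) = F m1 m2.
Proof.
move=> h; rewrite (eq_mixed _ _ (pull_psi erefl)) pullbackL.
rewrite (mixedD n0); [|by apply: spl2Z; exact: spl2_pullback|exact: spl2_pullback].
rewrite (mixedZ n0) ?mul1r; last exact: spl2_pullback.
have [h1|h1] := leqP m1 1; first by rewrite flat2.2 // addr0 J1.
rewrite mixed_diff // addrCA -(mixed_diff m1 m2 np1) flat1.2 ?addr0 ?J2 //; lia.
Qed.

Lemma corner_zedge t : t.1 = s.1 -> t <> s -> t <> snd_as_first s -> zedge (pullback t psi).
Proof.
move=> ts n1 n2; apply: (@eq_zedge _ (pullback t (lincomb 1 phi1 (lincomb (-1) phi0 phi2)))).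
  by move=> x y hx hy; rewrite pull_psi.
have [e0' _] := patch_form_edge r0 rp n0 hN e0.
have ns : snd_as_first s <> snd_as_first t by move=> /snd_as_first_inj e; case: n1.
have Z1 phi : eform 0 3 s phi -> zedge (pullback t phi).
  by move=> ef; apply: (edge_form_zedge r0 rp n0 hN ef) => // /n2.
have Z2 phi : eform 3 0 (snd_as_first s) phi -> zedge (pullback t phi).
  by move=> ef; apply: (edge_form_zedge r0 rp n0 hN ef) => // /ns.
have [_ L _] := linear_zedge n0 t.
have nd := nd2.
have [] // := L 1 phi1 d2 (conj np1 (Z1 _ e1)) (conj nd _).
by have [] // := L (-1) phi0 phi2 (conj np0 (Z1 _ e0')) (conj np2 (Z2 _ e2)).
Qed.

Lemma corner_zjet t : t.1 = s.1 -> t <> s -> zjet (pullback t psi).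
Proof.
move=> ts n1; apply: (@eq_zjet _ (pullback t (lincomb 1 phi1 (lincomb (-1) phi0 phi2)))).
  by move=> x y hx hy; rewrite pull_psi.
have [e0' _] := patch_form_edge r0 rp n0 hN e0.
have ns : snd_as_first s <> snd_as_first t by move=> /snd_as_first_inj e; case: n1.
have Z1 phi : eform 0 3 s phi -> zjet (pullback t phi).
  by move=> ef; apply: (edge_form_zjet r0 rp n0 hN ef).
have Z2 phi : eform 3 0 (snd_as_first s) phi -> zjet (pullback t phi).
  by move=> ef; apply: (edge_form_zjet r0 rp n0 hN ef) => // /ns.
have [_ L _] := linear_zjet n0 t.
have nd := nd2.
have [] // := L 1 phi1 d2 (conj np1 (Z1 _ e1)) (conj nd _).
by have [] // := L (-1) phi0 phi2 (conj np0 (Z1 _ e0')) (conj np2 (Z2 _ e2)).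
Qed.

Lemma corner_diff1 : zedge (pullback s (lincomb (-1) phi1 psi)).
Proof.
apply: eq_zedge flat2.1 => x y hx hy; rewrite !pullbackL pull_psi // !pullbackL.
ring.
Qed.

Lemma corner_diff2 : zedge (pullback (snd_as_first s) (lincomb (-1) phi2 psi)).
Proof.
apply: eq_zedge flat1.1 => x y hx hy; rewrite !pullbackL pull_psi // !pullbackL.
ring.
Qed.

End Corner.
End Vertex.

(*FILE Q9*)
Section VertexGood.
Variables (R : realType) (p r n : nat) (D : multipatch R).
Hypotheses (r0 : (0 < r)%N) (rp : (r.+1 < p)%N) (n0 : (0 < n)%N).
Hypothesis hN : (6 <= Nplus p r n)%N.
Hypothesis hD : is_multipatch p r n D.
Variable gd : side D -> side D -> gluing_polys R.
Hypothesis hG1 : analysis_suitable_G1 gd.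
Implicit Types (s t : side D) (phi psi : bfun D) (v : vertexI D).

Let rp' : (r < p)%N := ltnW rp.
Notation eform := (@edge_form R p r n D).
Notation Np := (Nplus p r n).
Notation Nm := (Nminus p r n).

Lemma vertex_Gamma v : ~ Omega D (vertex v) -> Gamma D (vertex v).
Proof.
move=> O; split=> //.
have : range (@vertex R D) (vertex v) by exists v.
rewrite (vertex_cover hD) => -[s _ <-]; apply: (closed_patch_closure hD (i := s.1)).
by apply: geoS_closed_patch; exact: in01_0.
Qed.

Lemma fan_next_Gamma v m s : fan_patch v m = Some s -> fan_patch v m.+1 = None ->
  open_edge s `<=` Gamma D.
Proof.
move=> e1 e2; have sF := fan_patch_mem e1.
have nu0 : (0 < size (fan v))%N by case: (fan v) sF.
have [vO|vO] := pselect (Omega D (vertex v)).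
  have : onth (fan v) ((m.+1 + size (fan v) - 1) %% size (fan v)).
    by rewrite onthTE ltn_pmod.
  by move: e2; rewrite /fan_patch asboolT // => ->.
apply: (fan_last hD (vertex_Gamma vO)).
move: e1 e2; rewrite /fan_patch !asboolF //; case: m => // m e1 e2.
have [ms _] := onth_fan e1.
have := onthNE (fan v) m.+1; rewrite e2 /= => /esym ms'.
by rewrite (_ : size (fan v) = m.+1); last by apply/eqP; rewrite eqn_leq ms ms'.
Qed.

Lemma fan_prev_Gamma v m s : fan_patch v m.+1 = Some s -> fan_patch v m = None ->
  open_edge (snd_as_first s) `<=` Gamma D.
Proof.
move=> e1 e2; have sF := fan_patch_mem e1.
have nu0 : (0 < size (fan v))%N by case: (fan v) sF.
have [vO|vO] := pselect (Omega D (vertex v)).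
  have : onth (fan v) ((m + size (fan v) - 1) %% size (fan v)).
    by rewrite onthTE ltn_pmod.
  by move: e2; rewrite /fan_patch asboolT // => ->.
have m0 : m = 0%N.
  move: e1 e2; rewrite /fan_patch !asboolF //; case: m => // m e1 e2.
  have [ms _] := onth_fan e1.
  by have := onthNE (fan v) m; rewrite e2 /= leqNgt ltnW.
rewrite m0 in e1.
move=> z [t [ht ->]]; apply: (fan_first hD (vertex_Gamma vO) e1).
exists (1 - t); split; first exact: rev_int.
by rewrite /geoS /= addrC rotateD rotate1E.
Qed.

Section VertexFunction.
Variables (v : vertexI D) (f : 'rV[R]_2 -> R) (P : nat -> bfun D) (psi : bfun D).
Hypothesis HP : forall k, (1 <= k <= vertex_last v)%N -> is_Pi p r n gd v k f (P k).
Hypothesis Epsi : forall i x y, in01 x -> in01 y ->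
  psi i x y = \sum_(1 <= k < (vertex_last v).+1) (-1) ^+ k.+1 * P k i x y.

Notation L := (vertex_last v).

Let odd_Pi m : (m.*2 < L)%N -> is_Pi_edge p r n gd (fan_patch v m) (fan_patch v m.+1) f (P m.*2.+1).
Proof.
move=> h; have := HP (_ : (1 <= m.*2.+1 <= L)%N); rewrite /is_Pi /= odd_double /= uphalf_double.
by apply; rewrite h.
Qed.

Let even_Pi m : (0 < m.*2 <= L)%N -> exists2 s, fan_patch v m = Some s & is_Pi_patch p r n s f (P m.*2).
Proof. by move=> h; have := HP h; rewrite /is_Pi odd_double doubleK. Qed.

Let std m : std_opt (fan_patch v m) (fan_patch v m.+1).
Proof.
rewrite /std_opt; case e: (fan_patch v m) => [s|] //; case e': (fan_patch v m.+1) => [s'|] //.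
exact: (fan_std hD e e').
Qed.

Let HJ (j : 'I_Np * 'I_2) : (j.1 + j.2 <= 2)%N -> (0 <= j.1 + j.2)%N /\ (j.1 + 3 <= Nm)%N.
Proof.
move=> h; split=> //; have Nm5 : (5 <= Nm)%N.
  by move: hN; rewrite /Nplus /Nminus /dimS; nia.
by lia.
Qed.

Let nice_P k : (0 < k <= L)%N -> nice n (P k).
Proof.
move=> hk; have ek := odd_double_half k; case: (odd k) ek => ek.
  have := @odd_Pi k./2; rewrite -add1n ek.
  by case=> [|h _ _]; [lia|exact: (space_nice r0 rp n0 hN h)].
have := @even_Pi k./2; rewrite -[k./2.*2]add0n ek => /(_ hk)[s _ [h _]].
by have [] := span_patch_form r0 rp n0 h.
Qed.

Let P_other k i : (0 < k <= L)%N -> (forall m s, fan_patch v m = Some s -> s.1 = i ->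
    ~ (m = k./2 \/ odd k /\ m = k./2.+1)) -> eqsq (P k i) (fun _ _ => 0).
Proof.
move=> hk N; have ek := odd_double_half k; case ok: (odd k) ek => ek.
  have := @odd_Pi k./2; rewrite -add1n ek => -[|h _ _]; first by lia.
  apply: (space_other h) => s e si; first by apply: N e si _; left.
  by apply: N e si _; right.
have := @even_Pi k./2; rewrite -[k./2.*2]add0n ek => /(_ hk)[s e [[c Hc] _]] x y hx hy.
rewrite Hc // big1 // => j _; rewrite /patch_basis /on_patch; case: eqP => [si|_]; last by rewrite mulr0.
by case: (N _ _ e (esym si)); left.
Qed.

Lemma vertex_nice : nice n psi.
Proof.
have LN := linear_nice D n0; have [_ _ EN] := LN.
apply: (EN (fun i x y => \sum_(k <- index_iota 1 L.+1 | (0 < k <= L)%N) (-1) ^+ k.+1 * P k i x y)).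
  move=> i x y hx hy; rewrite Epsi // [RHS]big_nat_cond; apply: eq_bigl => k.
  by rewrite andbT.
exact: (linear_sum _ (fun k => (-1) ^+ k.+1) LN).
Qed.

Lemma vertex_off i : (forall s, s \in fan v -> s.1 <> i) -> eqsq (psi i) (fun _ _ => 0).
Proof.
move=> N x y hx hy; rewrite Epsi // big_nat_cond big1 // => k; rewrite andbT ltnS => hk.
by rewrite (P_other hk) ?mulr0 // => m s /fan_patch_mem /N.
Qed.

Lemma vertex_corner s : s \in fan v -> exists m1 m2,
  [/\ [/\ (m1.*2 < L)%N, fan_patch v m1 = Some s,
        (forall m, (m.*2 < L)%N -> fan_patch v m = Some s -> m = m1) &
        zedge (pullback s (lincomb (-1) (P m1.*2.+1) psi))],
      [/\ (m2.*2 < L)%N, fan_patch v m2.+1 = Some s,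
        (forall m, (m.*2 < L)%N -> fan_patch v m.+1 = Some s -> m = m2) &
        zedge (pullback (snd_as_first s) (lincomb (-1) (P m2.*2.+1) psi))],
      (forall t, t.1 = s.1 -> t <> s -> t <> snd_as_first s -> zedge (pullback t psi)),
      (forall t, t.1 = s.1 -> t <> s -> zjet (pullback t psi)) &
      (forall m1 m2, (m1 + m2 <= 2)%N ->
         mixed_der00 m1 m2 (pullback s psi) = mixed_der00 m1 m2 (fun x y => f (geoS s x y)))].
Proof.
move=> /(fan_index hD)[l [m1 [m2 [[l0 lL el] [h1 e1] [h2 e2] m12 U]]]].
have [S1 A1 _] := odd_Pi h1; have [S2 _ A2] := odd_Pi h2.
have h0 : (0 < l.*2 <= L)%N by lia.
have [s' es' [S0 A0]] := even_Pi h0.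
have ss' : s' = s by move: es'; rewrite el => -[].
rewrite ss' in S0 A0.
have e1f := space_first r0 rp n0 hN HJ (std m1) S1 e1.
have e2f := space_second r0 rp n0 hN HJ (std m2) S2 e2.
have [np0 e0f] := span_patch_form r0 rp n0 S0.
have np1 := space_nice r0 rp n0 hN S1; have np2 := space_nice r0 rp n0 hN S2.
have E : eqsq (psi s.1) (fun x y => P m1.*2.+1 s.1 x y + P m2.*2.+1 s.1 x y - P l.*2 s.1 x y).
  move=> x y hx hy; rewrite Epsi // (@sum_three _ _ m1.*2.+1 m2.*2.+1 l.*2); try lia.
    have sg m : (-1) ^+ m.*2 = 1 :> R by rewrite -signr_odd odd_double.
    by rewrite !exprS !sg; ring.
  move=> k hk k1 k2 k3; rewrite (P_other hk) ?mulr0 //.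
  move=> m t et ts; have [U0 U1 U2] := U m t ts.
  have ek := odd_double_half k.
  case=> [mk|[ok mk]].
    case ok: (odd k) ek => ek.
      by apply: k1; rewrite -ek add1n -(U1 _ et) ?mk //; lia.
    by apply: k3; rewrite -ek add0n -(U0 _ et) ?mk //; lia.
  rewrite ok in ek; have [_ _ U2'] := U k./2 t ts.
  by apply: k2; rewrite -ek add1n -(U2') -?mk //; lia.
have nps := vertex_nice.
have J1 := fun m1 m2 h h' => A1 s m1 m2 e1 h h'.
have J2 := fun m1 m2 h h' => A2 s m1 m2 e2 h h'.
exists m1, m2; split.
- split=> //; last exact: (corner_diff1 r0 rp n0 hN np2 np0 e2f e0f E J2 A0).
  by move=> m hm em; have [_ u _] := U m s erefl; exact: u.
- split=> //; last exact: (corner_diff2 r0 rp n0 hN np1 np0 e1f e0f E J1 A0).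
  by move=> m hm em; have [_ _ u] := U m s erefl; exact: u.
- exact: (corner_zedge r0 rp n0 hN np1 np2 np0 e1f e2f e0f E).
- exact: (corner_zjet r0 rp n0 hN np1 np2 np0 e1f e2f e0f E).
- exact: (corner_jets r0 rp n0 hN np1 np2 np0 e1f e2f e0f E J1 J2 A0).
Qed.

Lemma vertex_glued : glued n psi.
Proof.
apply: gluedP => //; first exact: vertex_nice.
move=> t; have [[s sF st]|N] := pselect (exists2 s, s \in fan v & s.1 = t.1); last first.
  by left; apply: zero_zedge; apply: vertex_off => s sF st; apply: N; exists s.
have [m1 [m2 [[h1 e1 u1 Z1] [h2 e2 u2 Z2] ZE _ _]]] := vertex_corner sF.
have [ts|n1] := pselect (t = s).
  right=> t' op; rewrite ts in op *.
  case e: (fan_patch v m1.+1) => [s'|]; last by case: (Gamma_not_opp r0 rp n0 hD (fan_next_Gamma e1 e) op).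
  have st' := fan_std hD e1 e; have op' := (opp_std s s').2 st'.
  rewrite (opp_uniq r0 rp' n0 hD op op').
  have [m1' [m2' [_ [_ _ u2' Z2'] _ _ _]]] := vertex_corner (fan_patch_mem e).
  have [S1 _ _] := odd_Pi h1.
  apply: (matched_of_diff n0 (phi := P m1.*2.+1)) => //; first by apply: nice_P; lia.
  - exact: vertex_nice.
  - exact: (space_matched r0 rp n0 hN hD hG1 (std m1) S1 e1 e).
  - by rewrite (u2' _ h1 e).
have [ts|n2] := pselect (t = snd_as_first s).
  right=> t' op; rewrite ts in op *.
  case e: (fan_patch v m2) => [s'|]; last by case: (Gamma_not_opp r0 rp n0 hD (fan_prev_Gamma e2 e) op).
  have st' := fan_std hD e e2; have op' := (opp_std s' s).2 st'.
  rewrite (opp_uniq r0 rp' n0 hD op (opp_sym op')).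
  have [m1' [m2' [[_ _ u1' Z1'] _ _ _ _]]] := vertex_corner (fan_patch_mem e).
  have [S2 _ _] := odd_Pi h2.
  apply: (matched_of_diff n0 (phi := P m2.*2.+1)) => //; first by apply: nice_P; lia.
  - exact: vertex_nice.
  - apply: matched_sym; exact: (space_matched r0 rp n0 hN hD hG1 (std m2) S2 e e2).
  - by rewrite (u1' _ h2 e).
by left; apply: ZE.
Qed.

Lemma vertex_zjet t : t \notin fan v -> zjet (pullback t psi).
Proof.
move=> tF; have [[s sF st]|N] := pselect (exists2 s, s \in fan v & s.1 = t.1).
  have [_ [_ [_ _ _ ZJ _]]] := vertex_corner sF.
  by apply: ZJ => // e; rewrite e sF in tF.
by apply: (zero_zjet n0); apply: vertex_off => s sF st; apply: N; exists s.
Qed.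

End VertexFunction.

Lemma vertex_good v psi : @vertex_space R p r n D gd v psi ->
  [/\ glued n psi, forall t, t \notin fan v -> zjet (pullback t psi) &
     exists2 f, C2_at n D (vertex v) f & forall s, s \in fan v -> forall m1 m2, (m1 + m2 <= 2)%N ->
       mixed_der00 m1 m2 (pullback s psi) = mixed_der00 m1 m2 (fun x y => f (geoS s x y))].
Proof.
move=> [f [P [C HP E]]]; split.
- exact: vertex_glued HP E.
- exact: vertex_zjet HP E.
- exists f => // s sF; have [_ [_ [_ _ _ _ J]]] := vertex_corner HP E sF; exact: J.
Qed.

End VertexGood.

(*FILE T1*)
Lemma Nplus_ge6 (p r n : nat) : (1 <= r <= p - 2)%N -> (1 <= n)%N ->
  (4 - r%:R) / (p%:R - r%:R - 1) <= n%:R :> rat -> (6 <= Nplus p r n)%N.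
Proof.
move=> /andP[r1 rp] n1; have rp' : (r.+1 <= p)%N by lia.
have -> : p%:R - r%:R - 1 = (p - r.+1)%:R :> rat by rewrite natrB // -natr1 opprD addrA.
rewrite ler_pdivrMr; last by rewrite ltr0n; lia.
rewrite lerBlDr -natrM -natrD ler_nat => h.
rewrite /Nplus /dimS; nia.
Qed.

Section Argyris.
Variables (R : realType) (p r n : nat) (D : multipatch R).
Hypotheses (r0 : (0 < r)%N) (rp : (r.+1 < p)%N) (n0 : (0 < n)%N).
Hypothesis hN : (6 <= Nplus p r n)%N.
Hypothesis hD : is_multipatch p r n D.
Variable gd : side D -> side D -> gluing_polys R.
Hypothesis hG1 : analysis_suitable_G1 gd.
Implicit Types (s t : side D) (phi psi : bfun D) (v : vertexI D).

Lemma linear_sum1 Q (I : finType) (P : pred I) (B : I -> bfun D) :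
  linear_prop Q -> (forall j, P j -> Q (B j)) -> Q (fun i x y => \sum_(j | P j) B j i x y).
Proof.
move=> LQ H; have [_ _ E] := LQ.
apply: E (linear_sum (index_enum I) (fun _ => 1) LQ H) => i x y _ _.
by apply: eq_bigr => j _; rewrite mul1r.
Qed.

Lemma linearD Q phi psi : linear_prop Q -> Q phi -> Q psi -> Q (fun i x y => phi i x y + psi i x y).
Proof.
move=> [_ L E] q1 q2; apply: E (L 1 _ _ q1 q2) => i x y _ _; by rewrite /lincomb mul1r.
Qed.

Lemma argyris_good phi : argyris p r n gd phi -> glued n phi /\
  forall v, exists2 f, C2_at n D (vertex v) f &
    forall s, s \in fan v -> forall m1 m2, (m1 + m2 <= 2)%N ->
      mixed_der00 m1 m2 (pullback s phi) = mixed_der00 m1 m2 (fun x y => f (geoS s x y)).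
Proof.
move=> [fP [fI [fB [fV [HP HI HB HV E]]]]].
have gP i := patch_space_good r0 rp n0 hN (HP i).
have gI e := iface_good r0 rp n0 hN hD hG1 (iface_std hD e) (HI e).
have gB e := bedge_good r0 rp n0 hN hD (bedge_boundary hD (e := e)) (HB e).
have gV v := vertex_good r0 rp n0 hN hD hG1 (HV v).
have LG := linear_glued D n0; have LF := linear_flat D n0; have [_ _ EG] := LG.
split.
  apply: (EG (fun i x y => \sum_k fP k i x y + \sum_e fI e i x y + \sum_e fB e i x y + \sum_v fV v i x y)).
    by move=> i x y hx hy; rewrite E.
  apply: linearD => //; last by apply: linear_sum1 => // v _; have [] := gV v.
  apply: linearD => //; last by apply: linear_sum1 => // e _; have [] := gB e.
  apply: linearD => //; last by apply: linear_sum1 => // e _; have [] := gI e.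
  by apply: linear_sum1 => // k _; have [] := gP k.
move=> v; have [[nV _] _ [f Cf Jf]] := gV v; exists f => // s sF m1 m2 h.
rewrite -Jf //.
have LZ := linear_zjet n0 s.
have F2 psi : flat n psi -> nice n psi /\ zjet (pullback s psi) by case=> np z; split.
pose A : bfun D := fun i x y => \sum_k fP k i x y + \sum_e fI e i x y + \sum_e fB e i x y +
  \sum_(u | u != v) fV u i x y.
have [nA ZA] : nice n A /\ zjet (pullback s A).
  rewrite /A; apply: (linearD LZ); last first.
    apply: (linear_sum1 LZ) => u uv; have [[nu _] zu _] := gV u; split=> //; apply: zu.
    apply: contra uv => sFu; apply/eqP; apply: (vertex_inj hD).
    by rewrite -(fan_corner hD sF) (fan_corner hD sFu).
  apply: F2; apply: linearD => //; last by apply: linear_sum1 => // e _; have [] := gB e.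
  apply: linearD => //; last by apply: linear_sum1 => // e _; have [] := gI e.
  by apply: linear_sum1 => // k _; have [] := gP k.
have EA i : eqsq (phi i) (lincomb 1 A (fV v) i).
  by move=> x y hx hy; rewrite E // /lincomb /A mul1r [\sum_u fV u i x y](bigD1 v) //= [X in _ + X = _]addrC addrA.
rewrite (eq_mixed _ _ (eq_pullback s EA)) pullbackL (mixedD n0); try exact: spl2_pullback.
  by rewrite (mixedZ n0) ?ZA ?mulr0 ?add0r //; exact: spl2_pullback.
by apply: spl2Z; exact: spl2_pullback.
Qed.

End Argyris.

(*FILE U1*)
Lemma cramer_uniq (R : realType) (a b c d w1 w2 v1 v2 : R) : 0 < a * d - b * c ->
  w1 * a + w2 * b = v1 * a + v2 * b -> w1 * c + w2 * d = v1 * c + v2 * d -> (w1, w2) = (v1, v2).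
Proof.
move=> det F1 F2.
have h1 : (w1 - v1) * (a * d - b * c) = 0.
  have -> : (w1 - v1) * (a * d - b * c) =
    (w1 * a + w2 * b - (v1 * a + v2 * b)) * d - (w1 * c + w2 * d - (v1 * c + v2 * d)) * b by ring.
  by rewrite F1 F2 !subrr !mul0r subrr.
have h2 : (w2 - v2) * (a * d - b * c) = 0.
  have -> : (w2 - v2) * (a * d - b * c) =
    (w1 * c + w2 * d - (v1 * c + v2 * d)) * a - (w1 * a + w2 * b - (v1 * a + v2 * b)) * c by ring.
  by rewrite F1 F2 !subrr !mul0r subrr.
move/eqP: h1; rewrite mulf_eq0 (gt_eqF det) orbF subr_eq0 => /eqP ->.
by move/eqP: h2; rewrite mulf_eq0 (gt_eqF det) orbF subr_eq0 => /eqP ->.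
Qed.

Lemma rotated_gradient (R : realType) (A1 A2 a1 a2 w1 w2 : R) (P Q P' Q' : 'rV[R]_2) :
  A1 = a2 -> A2 = - a1 -> P = Q' -> Q = - P' ->
  (A1 = w1 * P 0 0 + w2 * P 0 1 /\ A2 = w1 * Q 0 0 + w2 * Q 0 1) <->
  (a1 = w1 * P' 0 0 + w2 * P' 0 1 /\ a2 = w1 * Q' 0 0 + w2 * Q' 0 1).
Proof.
move=> -> -> -> ->; rewrite !mxE; split=> -[h1 h2]; split=> //.
  by apply: oppr_inj; rewrite h2; ring.
by rewrite h1; ring.
Qed.

Section Gradient.
Variables (R : realType) (p r n : nat) (D : multipatch R).
Hypotheses (r0 : (0 < r)%N) (rp : (r < p)%N) (n0 : (0 < n)%N).
Hypothesis hD : is_multipatch p r n D.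
Implicit Types (s : side D) (phi : bfun D) (v : vertexI D) (i j : patchI D) (w : R * R).

Definition grad s phi (x y : R) w := grad_on s phi x y w.1 w.2.

Lemma grad_uniq s phi x y w w' : in01 x -> in01 y -> grad s phi x y w -> grad s phi x y w' -> w = w'.
Proof.
case: w w' => [w1 w2] [v1 v2] hx hy [E1 E2] [F1 F2].
exact: (cramer_uniq (det2_geoS r0 rp n0 hD s hx hy) (etrans (esym E1) F1) (etrans (esym E2) F2)).
Qed.

Lemma grad_ex s phi x y : in01 x -> in01 y -> exists w, grad s phi x y w.
Proof.
move=> hx hy; have := det2_geoS r0 rp n0 hD s hx hy; rewrite /det2 => /lt0r_neq0 det.
have [w1 [w2 [E1 E2]]] := cramer (d1 (pullback s phi) x y) (d2 (pullback s phi) x y) det.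
exact: (ex_intro _ (w1, w2) (conj E1 E2)).
Qed.

Lemma grad_rot1 s phi x y w : nice n phi -> in01 x -> in01 y ->
  grad (s.1, s.2 + 1) phi x y w <-> grad s phi (1 - y) x w.
Proof.
move=> np hx hy; have sp := spl2_pullback n0 s np.
have [G1 G2] := d1_geoS_rot r0 rp n0 hD s hx hy.
have E : eqsq (pullback (s.1, s.2 + 1) phi) (rot1 (pullback s phi)) by rewrite pullback_rot.
exact: (rotated_gradient _ _ (etrans (d1_eqsq E hx hy) (d1_rot1 sp hx hy))
  (etrans (d2_eqsq E hx hy) (d2_rot1 sp hx hy)) G1 G2).
Qed.

Lemma grad_param i (k : nat) phi x y : nice n phi -> in01 x -> in01 y -> exists x' y',
  [/\ in01 x', in01 y', geoS (i, k%:R) x y = geo i x' y', pullback (i, k%:R) phi x y = phi i x' y' &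
      forall w, grad (i, k%:R) phi x y w <-> grad (i, 0) phi x' y' w].
Proof.
move=> np; elim: k x y => [|k IH] x y hx hy; first by exists x, y.
have [x' [y' [h1 h2 h3 h4 h5]]] := IH _ _ (in01_rev hy) hx.
exists x', y'; split; [exact: h1|exact: h2|..].
- by rewrite -h3 /geoS /= -natr1 addrC rotateD rotate1E.
- by rewrite -h4 -natr1 (pullback_rot (i, k%:R)) rotate1E.
- by move=> w; rewrite -natr1 (grad_rot1 (i, k%:R)) //; exact: h5.
Qed.

Lemma grad_transfer s phi a b x y : nice n phi -> in01 a -> in01 b -> in01 x -> in01 y ->
  geoS s a b = geo s.1 x y ->
  pullback s phi a b = phi s.1 x y /\ forall w, grad s phi a b w <-> grad (s.1, 0) phi x y w.
Proof.
move=> np ha hb hx hy; case: s => i k /=.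
have [m ->] : exists m : nat, k = m%:R by exists (k : nat); rewrite Zp_nat valZpK.
have [x' [y' [h1 h2 h3 h4 h5]]] := grad_param i m np ha hb.
by rewrite h3 => /(geo_inj hD h1 h2 hx hy)[<- <-].
Qed.

Lemma corner_cell s : exists a b : 'I_n, forall x y,
  (cell n 0 x -> cell n 0 y -> @closed_cell R n D s.1 a b (geoS s x y)) /\
  (0 < x < n%:R^-1 -> 0 < y < n%:R^-1 -> @open_cell R n D s.1 a b (geoS s x y)).
Proof.
have n0' : 0 < n%:R :> R by rewrite ltr0n.
pose o : 'I_n := Ordinal n0; have pn : (n.-1 < n)%N by rewrite ltn_predL.
pose l : 'I_n := Ordinal pn.
have c0 (x : R) : cell n 0 x = (o%:R / n%:R <= x <= o.+1%:R / n%:R) by [].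
have cl (x : R) : cell n 0 x -> l%:R / n%:R <= 1 - x <= l.+1%:R / n%:R.
  by move=> /(cell_rev n0 n0); rewrite subn0.
have i0 (x : R) : 0 < x < n%:R^-1 -> o%:R / n%:R < x < o.+1%:R / n%:R.
  by rewrite /= mul0r mul1r.
have il (x : R) : 0 < x < n%:R^-1 -> l%:R / n%:R < 1 - x < l.+1%:R / n%:R.
  have -> : l%:R / n%:R = 1 - n%:R^-1 :> R.
    by rewrite /= -subn1 natrB // mulrBl divff ?mul1r // gt_eqF.
  have -> : l.+1%:R / n%:R = 1 :> R by rewrite /= prednK // divff // gt_eqF.
  by move=> /andP[h1 h2]; apply/andP; split; lra.
rewrite /geoS; case: (Z4P s.2) => ->.
- exists o, o => x y; split=> hx hy; exists x, y; split=> //; exact: i0.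
- exists l, o => x y; split=> hx hy; exists (1 - y), x; rewrite rotate1E; split=> //; [exact: cl|exact: il|exact: i0].
- exists l, l => x y; split=> hx hy; exists (1 - x), (1 - y); rewrite rotate2E; split=> //; by [exact: cl|exact: il].
- exists o, l => x y; split=> hx hy; exists y, (1 - x); rewrite rotate3E; split=> //; [exact: cl|exact: i0|exact: il].
Qed.

End Gradient.

(*FILE U2*)
Lemma limit_smooth (R : realType) (S O U : set 'rV[R]_2) (f g : 'rV[R]_2 -> R) z (c : seq 'I_2) :
  open O -> O `<=` S -> closure O z -> open U -> U z -> smooth_on U g ->
  (forall y, O y -> f y = g y) -> cvg (pderivs c f y @[y --> within S (nbhs z)]) ->
  pderivs c g z = lim (pderivs c f y @[y --> within S (nbhs z)]).
Proof.
move=> oO OS cO oU Uz Sg E cv; set l := lim _.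
have [cg _] := Sg (size c) c (leqnn _) z Uz.
apply/eqP; rewrite -subr_eq0 -normr_le0; apply/ler_addgt0Pr => e e0; rewrite add0r.
have e2 : 0 < e / 2 by rewrite divr_gt0.
have h1 : \forall y \near z, S y -> `|l - pderivs c f y| < e / 2.
  by have /cvgrPdist_lt /(_ _ e2) := cv.
have h2 : \forall y \near z, `|pderivs c g z - pderivs c g y| < e / 2.
  by have /cvgrPdist_lt /(_ _ e2) := cg.
have [y [Oy [a b]]] := cO _ (filterI h1 h2).
move: (a (OS _ Oy)) b; rewrite (pderivs_eq_open c oO E Oy) => {}a b.
rewrite (_ : pderivs c g z - l = (pderivs c g z - pderivs c g y) - (l - pderivs c g y)); last by ring.
by apply: le_trans (ler_normB _ _) _; lra.
Qed.

Section Glued.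
Variables (R : realType) (p r n : nat) (D : multipatch R).
Hypotheses (r0 : (0 < r)%N) (rp : (r < p)%N) (n0 : (0 < n)%N).
Hypothesis hD : is_multipatch p r n D.
Implicit Types (s : side D) (v : vertexI D) (i j : patchI D) (w : R * R).

Local Notation ninv := (n%:R^-1 : R).

Let ninv0 : 0 < ninv <= 1.
Proof. exact: ninv01. Qed.

Lemma cell0 (x : R) : 0 <= x < ninv -> cell n 0 x.
Proof. by move=> /andP[h1 h2]; rewrite /cell mul0r mul1r h1 ltW. Qed.

Lemma cell0_in01 (x : R) : 0 <= x < ninv -> in01 x.
Proof. by move=> /cell0; exact: cell_in01. Qed.

Definition corner_open s := [set z | exists x y, [/\ 0 < x < ninv, 0 < y < ninv & z = geoS s x y]].

Lemma open_corner_open s : open (corner_open s).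
Proof.
have := open_cell_image r0 rp n0 hD (s := s) n0 n0; congr open; apply/seteqP.
by split=> z [x [y]]; rewrite ?mul0r ?mul1r => -[hx hy ->]; exists x, y; rewrite ?mul0r ?mul1r.
Qed.

Lemma closure_corner_open s : closure (corner_open s) (corner s).
Proof.
move=> B /near_row2 HB; have [d d0 {}HB] := right0_ex HB.
have h0 := in01_0 R.
have [F1 [F1x [F1y [F2 [F2x [F2y [C1 C2 E _ _]]]]]]] := patch_ext_ex r0 rp n0 hD s.
have [c1 _ _] := C1_cont2 C1; have [c2 _ _] := C1_cont2 C2.
have /andP[i0 _] := ninv0.
have [t t0 [a1 a2 tn]] : exists2 t, 0 < t & [/\ `|F1 t t - F1 0 0| < d, `|F2 t t - F2 0 0| < d & t < ninv].
  have [e1 e10 H1] := right0_ex (c1 0 0 d d0); have [e2 e20 H2] := right0_ex (c2 0 0 d d0).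
  pose t := Num.min ninv (Num.min e1 e2) / 2.
  have m0 : 0 < Num.min ninv (Num.min e1 e2) by rewrite !lt_min i0 e10 e20.
  have t0 : 0 < t by rewrite divr_gt0.
  have : t < Num.min ninv (Num.min e1 e2) by rewrite /t; lra.
  rewrite !lt_min => /and3P[t1 t2 t3]; exists t => //; split=> //.
    by apply: H1; split; rewrite subr0 gtr0_norm.
  by apply: H2; split; rewrite subr0 gtr0_norm.
have ht : in01 t by apply: cell0_in01; rewrite ltW.
exists (geoS s t t); split; first by exists t, t; rewrite t0 tn.
rewrite [geoS s t t]row2E; apply: HB; rewrite /corner !E // !row2_0 !row2_1; by split.
Qed.

Variable phi : bfun D.
Hypothesis gl : glued n phi.
Hypothesis jets : forall v, exists2 f, C2_at n D (vertex v) f &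
  forall s, s \in fan v -> forall m1 m2, (m1 + m2 <= 2)%N ->
    mixed_der00 m1 m2 (pullback s phi) = mixed_der00 m1 m2 (fun x y => f (geoS s x y)).

Let np : nice n phi := gl.1.

Lemma vertex_jet v : exists L : seq 'I_2 -> R, forall s, s \in fan v ->
  exists (U : set 'rV[R]_2) (g : 'rV[R]_2 -> R), [/\ open U, smooth_on U g,
    forall x y, cell n 0 x -> cell n 0 y -> U (geoS s x y) /\ g (geoS s x y) = pullback s phi x y &
    forall c, (size c <= 2)%N -> pderivs c g (vertex v) = L c].
Proof.
have [f [pf cf] J] := jets v.
exists (fun c => lim (pderivs c f y @[y --> within
  [set y | exists i (a b : 'I_n), open_cell i a b y] (nbhs (vertex v))])) => s sF.
have [a [b ab]] := corner_cell n0 s.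
have [U' [g' [oU' cU' Sg' fg']]] := pf s.1 a b.
have [U [g [oU Sg Ug]]] := chart_extension r0 rp n0 hD s n0 n0 (spl2_pullback n0 s np).1.
exists U, g; split=> // c hc.
have [G1 [G1x [G1y [G2 [G2x [G2y [[b1 b2] C1 C2 E Jac]]]]]]] := chart_ex r0 rp n0 hD s n0 n0.
have [P1x [P1y [/bpoly_C1[? [? [_ _ C1x]]] /bpoly_C1[? [? [_ _ C1y]]] C1']]] := bpoly_C1 b1.
have [P2x [P2y [/bpoly_C1[? [? [_ _ C2x]]] /bpoly_C1[? [? [_ _ C2y]]] C2']]] := bpoly_C1 b2.
have [d0 d1] := andP ninv0.
have z0 : 0 <= (0 : R) < ninv by rewrite lexx d0.
have Jac0 := Jac 0 0 (cell0 z0) (cell0 z0).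
have [e1 e2] := sdiff_uniq (C1 0 0) (C1' 0 0); have [e3 e4] := sdiff_uniq (C2 0 0) (C2' 0 0).
rewrite e1 e2 e3 e4 in Jac0.
have Ev : vertex v = row2 (G1 0 0) (G2 0 0).
  by rewrite -(fan_corner hD sF); apply: E; exact: (cell0 z0).
have fg x y : cell n 0 x -> cell n 0 y -> f (geoS s x y) = g' (geoS s x y).
  by move=> hx hy; apply: fg'; apply/mem_set; exact: (ab x y).1.
transitivity (pderivs c g' (vertex v)).
  rewrite Ev; apply: (jets_determine (H' := fun x y => f (geoS s x y)) C1' C1x C1y C2' C2x C2y
    (lt0r_neq0 Jac0) oU Sg oU' Sg' ninv0 _ _ (J s sF) hc) => x y /cell0 hx /cell0 hy.
    by have [u1 u2] := Ug x y hx hy; rewrite -E.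
  by rewrite -E //; split; [apply: cU'; exact: (ab x y).1|exact: fg].
- apply: (@limit_smooth R _ (corner_open s) U' f g' (vertex v) c (@open_corner_open s) _ _ oU' _ Sg' _ (cf c hc)).
  + by move=> z [x [y [hx hy ->]]]; exists s.1, a, b; exact: (ab x y).2.
  + by rewrite -(fan_corner hD sF); exact: closure_corner_open.
  + by apply: cU'; rewrite Ev -E; [apply: (ab 0 0).1|..]; exact: cell0.
  + move=> y [x1 [x2 [hx hy ->]]]; apply: fg; apply: cell0.
      by case/andP: hx => /ltW -> ->.
    by case/andP: hy => /ltW -> ->.
Qed.


Lemma jet_grad v s (U : set 'rV[R]_2) (g : 'rV[R]_2 -> R) : s \in fan v -> open U -> smooth_on U g ->
  (forall x y, cell n 0 x -> cell n 0 y -> U (geoS s x y) /\ g (geoS s x y) = pullback s phi x y) ->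
  grad s phi 0 0 (pderivs [:: 0] g (vertex v), pderivs [:: 1] g (vertex v)).
Proof.
move=> sF oU Sg Ug; have h0 := in01_0 R.
have [F1 [F1x [F1y [F2 [F2x [F2y [C1 C2 E Ex Ey]]]]]]] := patch_ext_ex r0 rp n0 hD s.
have K x y : 0 <= x < ninv -> 0 <= y < ninv -> geoS s x y = row2 (F1 x y) (F2 x y).
  by move=> hx hy; apply: E; exact: cell0_in01.
have [d0 d1] := andP ninv0.
have z0 : 0 <= (0 : R) < ninv by rewrite lexx d0.
have Ev : vertex v = row2 (F1 0 0) (F2 0 0) by rewrite -(fan_corner hD sF) /corner K.
have Hs x y : 0 <= x < ninv -> 0 <= y < ninv ->
    pullback s phi x y = g (row2 (F1 x y) (F2 x y)).
  by move=> hx hy; rewrite -K // (Ug x y (cell0 hx) (cell0 hy)).2.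
have HU x y : 0 <= x < ninv -> 0 <= y < ninv -> U (row2 (F1 x y) (F2 x y)).
  by move=> hx hy; rewrite -K //; exact: (Ug x y (cell0 hx) (cell0 hy)).1.
have [E1 E2] := corner_d ninv0 Hs (fun x y hx hy => sdiff_smooth_comp C1 C2 oU Sg (HU x y hx hy)) z0 z0.
rewrite /grad /grad_on E1 E2 Ex // Ey // !row2_0 !row2_1 Ev.
by split.
Qed.

Lemma vertex_data v : exists (c : R) w, forall i x y, in01 x -> in01 y -> geo i x y = vertex v ->
  phi i x y = c /\ grad (i, 0) phi x y w.
Proof.
have [L HL] := vertex_jet v; exists (L [::]), (L [:: 0], L [:: 1]) => i x y hx hy e.
have : i \in [seq s.1 | s <- fan v] by apply/(fan_patches hD); exists x, y.
move=> /mapP[s sF es]; subst i.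
have [U [g [oU Sg Ug HgL]]] := HL s sF.
have h0 := in01_0 R.
have ec : geoS s 0 0 = geo s.1 x y by rewrite e -(fan_corner hD sF).
have [E1 E2] := grad_transfer r0 rp n0 hD np h0 h0 hx hy ec.
have [d0 d1] := andP ninv0.
have c0 : cell n 0 (0 : R) by apply: cell0; rewrite lexx d0.
have [_ Eg] := Ug 0 0 c0 c0.
split.
  by rewrite -E1 -Eg -(HgL [::]) //= -(fan_corner hD sF).
by apply/E2; rewrite -(HgL [:: 0]) // -(HgL [:: 1]) //; exact: jet_grad Sg Ug.
Qed.

Lemma grad_common i j x y x' y' : in01 x -> in01 y -> in01 x' -> in01 y' -> geo i x y = geo j x' y' ->
  phi i x y = phi j x' y' /\ forall w, grad (i, 0) phi x y w -> grad (j, 0) phi x' y' w.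
Proof.
move=> hx hy hx' hy' e.
have [ij|ij] := eqVneq i j.
  by subst j; have [-> ->] := geo_inj hD hx hy hx' hy' e.
have [[v ev]|nv] := pselect (exists v, geo i x y = vertex v).
  have [c [w H]] := vertex_data v.
  have [-> gi] := H i x y hx hy ev; have [-> gj] := H j x' y' hx' hy' (etrans (esym e) ev).
  split; first by [].
  by move=> w' gw; rewrite -(grad_uniq r0 rp n0 hD hx hy gi gw); exact: gj.
have nv' v : vertex v <> geo i x y by move=> ev; apply: nv; exists v.
have [s [s' [t [op es es' ht et]]]] := shared_point r0 rp n0 hD (elimN eqP ij) hx hy hx' hy' e nv'.
subst i j; have t01 := int01 ht; have rt := in01_rev t01; have h0 := in01_0 R.
have et' : geoS s' 0 (1 - t) = geo s'.1 x' y' by have [_ <-] := op; rewrite ?et.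
have [E1 E2] := grad_transfer r0 rp n0 hD np h0 t01 hx hy et.
have [E1' E2'] := grad_transfer r0 rp n0 hD np h0 rt hx' hy' et'.
have [M [w1 [w2 [H1 H2]]]] := gl.2 _ _ op t t01.
split; first by rewrite -E1 -E1'.
have gi : grad (s.1, 0) phi x y (w1, w2) := (E2 (w1, w2)).1 H1.
by move=> w' gw; rewrite -(grad_uniq r0 rp n0 hD hx hy gi gw); exact: (E2' (w1, w2)).1 H2.
Qed.

End Glued.

(*FILE U3*)
Lemma ratio_near (R : realType) (g J : R -> R -> R) x y e : cont2 g -> cont2 J -> J x y != 0 -> 0 < e ->
  \forall d \near 0^'+, forall x' y', box x y d x' y' -> `|g x' y' / J x' y' - g x y / J x y| < e.
Proof.
move=> /cont2P cg /cont2P cJ J0 e0.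
have C : {for (x, y), continuous (fun u : R * R => g u.1 u.2 / J u.1 u.2)}.
  by apply: cvgM; [exact: cg|apply: cvgV => //; exact: cJ].
have /cvgrPdist_lt /(_ _ e0) := C; rewrite -nbhs_ballE => -[r /= rr H].
apply: (right0_le rr) => d /andP[d0 dr] x' y' [h1 h2]; rewrite distrC.
by apply: (H (x', y')); split; rewrite /ball /= distrC; [apply: lt_le_trans h1 _|apply: lt_le_trans h2 _].
Qed.

Section Final.
Variables (R : realType) (p r n : nat) (D : multipatch R).
Hypotheses (r0 : (0 < r)%N) (rp : (r < p)%N) (n0 : (0 < n)%N).
Hypothesis hD : is_multipatch p r n D.
Implicit Types (s : side D) (v : vertexI D) (i j : patchI D) (w : R * R) (z : 'rV[R]_2).

Variable phi : bfun D.
Hypothesis gl : glued n phi.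
Hypothesis jets : forall v, exists2 f, C2_at n D (vertex v) f &
  forall s, s \in fan v -> forall m1 m2, (m1 + m2 <= 2)%N ->
    mixed_der00 m1 m2 (pullback s phi) = mixed_der00 m1 m2 (fun x y => f (geoS s x y)).

Let np : nice n phi := gl.1.
Let common := grad_common r0 rp n0 hD gl jets.

Lemma represents_ex : exists f, represents f phi.
Proof.
exists (fun z => xget 0 [set c | exists i x y, [/\ in01 x, in01 y, geo i x y = z & phi i x y = c]]).
move=> i x y hx hy; case: xgetP => [c _ [j [x' [y' [hx' hy' e <-]]]]|/(_ (phi i x y))[]].
  by have [] := common hx hy hx' hy' (esym e).
by exists i, x, y.
Qed.

Lemma gradient_ex : exists W : 'rV[R]_2 -> R * R, forall i x y, in01 x -> in01 y ->
  grad (i, 0) phi x y (W (geo i x y)).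
Proof.
exists (fun z => xget (0, 0) [set w | exists i x y, [/\ in01 x, in01 y, geo i x y = z & grad (i, 0) phi x y w]]).
move=> i x y hx hy; case: xgetP => [w _ [j [x' [y' [hx' hy' e gw]]]]|H].
  by have [_] := common hx' hy' hx hy e; apply.
have [w gw] := grad_ex r0 rp n0 hD (i, 0) phi hx hy.
by case: (H w); exists i, x, y.
Qed.

Lemma local_data i : exists h hx hy F1 F1x F1y F2 F2x F2y,
  [/\ C1fun h hx hy, eqsq (phi i) h, patch_ext ((i, 0) : side D) F1 F1x F1y F2 F2x F2y &
    forall x y w, in01 x -> in01 y -> grad (i, 0) phi x y w ->
      hx x y = w.1 * F1x x y + w.2 * F2x x y /\ hy x y = w.1 * F1y x y + w.2 * F2y x y].
Proof.
have [_ [h [hx [hy [Ch Eh]]]]] := np i.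
have [F1 [F1x [F1y [F2 [F2x [F2y X]]]]]] := patch_ext_ex r0 rp n0 hD (i, 0).
exists h, hx, hy, F1, F1x, F1y, F2, F2x, F2y; split=> // x y w x01 y01 [].
have [_ _ _ Ex Ey] := X.
rewrite Ex // Ey // !row2_0 !row2_1 => <- <-.
by rewrite (d1_C1 Ch Eh) // (d2_C1 Ch Eh).
Qed.

Variable (f : 'rV[R]_2 -> R) (W : 'rV[R]_2 -> R * R).
Hypothesis fphi : represents f phi.
Hypothesis HW : forall i x y, in01 x -> in01 y -> grad (i, 0) phi x y (W (geo i x y)).

Lemma near_Omega z (P : 'rV[R]_2 -> Prop) : Omega D z ->
  (\forall z' \near z, closure (Omega D) z' -> P z') -> \forall z' \near z, P z'.
Proof.
move=> Oz H; have NO : \forall z' \near z, Omega D z'.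
  by apply: open_nbhs_nbhs; split => //; exact: Omega_open hD.
by apply: filterS2 H NO => z' H /subset_closure.
Qed.

Lemma rep_fdiff z : Omega D z -> fdiff f z (W z).1 (W z).2.
Proof.
move=> Oz e e0.
suff /near_row2 : \forall z' \near z,
    `|f z' - f z - ((W z).1 * (z' 0 0 - z 0 0) + (W z).2 * (z' 0 1 - z 0 1))| <=
      e * (`|z' 0 0 - z 0 0| + `|z' 0 1 - z 0 1|).
  by apply: filterS => d H u v /H; rewrite row2_0 row2_1.
apply: near_Omega => //; apply: (near_patches r0 rp n0 hD) => i x y hx hy ez.
have [h [kx [ky [F1 [F1x [F1y [F2 [F2x [F2y [Ch Eh X H]]]]]]]]]] := local_data i.
have [C1 C2 E _ _] := X; have J := patch_ext_det r0 rp n0 hD X hx hy.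
have [g1 g2] := H x y _ hx hy (HW i hx hy); rewrite ez in g1 g2.
have EF (a b : R) : in01 a -> in01 b -> geo i a b = row2 (F1 a b) (F2 a b) by move=> hu hv; exact: E.
apply: filterS (chart_strict C1 C2 (Ch x y) (lt0r_neq0 J) g1 g2 e0) => d K x' y' hx' hy' b.
have d0 : 0 < d by case: b => b _; exact: le_lt_trans (normr_ge0 _) b.
have := K x y x' y' (box_center x y d0) b.
have e1 : F1 x y = z 0 0 by rewrite -ez EF // row2_0.
have e2 : F2 x y = z 0 1 by rewrite -ez EF // row2_1.
have e1' : F1 x' y' = geo i x' y' 0 0 by rewrite EF // row2_0.
have e2' : F2 x' y' = geo i x' y' 0 1 by rewrite EF // row2_1.
by rewrite e1 e2 e1' e2' -!Eh // -!fphi // ez.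
Qed.

Lemma gradient_near z e : 0 < e -> \forall z' \near z, closure (Omega D) z' ->
  `|(W z').1 - (W z).1| < e /\ `|(W z').2 - (W z).2| < e.
Proof.
move=> e0; apply: (near_patches r0 rp n0 hD) => i x y hx hy ez.
have [h [kx [ky [F1 [F1x [F1y [F2 [F2x [F2y [Ch Eh X H]]]]]]]]]] := local_data i.
have [C1 C2 E _ _] := X; have J := patch_ext_det r0 rp n0 hD X.
have [_ ckx cky] := C1_cont2 Ch; have [_ c1x c1y] := C1_cont2 C1; have [_ c2x c2y] := C1_cont2 C2.
pose JJ := fun x y => F1x x y * F2y x y - F1y x y * F2x x y.
have cJ : cont2 JJ := jac_cont2 C1 C2.
have EW (u v : R) : in01 u -> in01 v ->
    (W (geo i u v)).1 = (kx u v * F2y u v - ky u v * F2x u v) / JJ u v /\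
    (W (geo i u v)).2 = (ky u v * F1x u v - kx u v * F1y u v) / JJ u v.
  move=> hu hv; have [-> ->] := H u v _ hu hv (HW i hu hv).
  have Ju := lt0r_neq0 (J u v hu hv).
  by split; rewrite /JJ; field.
have cn1 : cont2 (fun x y => kx x y * F2y x y - ky x y * F2x x y).
  by apply: cont2D; [|apply: cont2N]; exact: cont2M.
have cn2 : cont2 (fun x y => ky x y * F1x x y - kx x y * F1y x y).
  by apply: cont2D; [|apply: cont2N]; exact: cont2M.
have J0 : JJ x y != 0 := lt0r_neq0 (J x y hx hy).
apply: filterS2 (ratio_near cn1 cJ J0 e0) (ratio_near cn2 cJ J0 e0) => d K1 K2 x' y' hx' hy' b.
have [e1 e2] := EW x' y' hx' hy'; have [e3 e4] := EW x y hx hy; rewrite ez in e3 e4.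
by rewrite e1 e2 e3 e4; split; [exact: K1|exact: K2].
Qed.

Lemma rep_C1 : Ck 1 (Omega D) f.
Proof.
have DD z (c : 'I_2) : Omega D z -> is_derive z (delta_mx 0 c) f (if c == 0 then (W z).1 else (W z).2).
  by move=> Oz; apply: fdiff_derive; exact: rep_fdiff.
case=> [|c [|c' s]] // _ z Oz; split=> //=.
- exact: fdiff_cont (rep_fdiff Oz).
- by move=> _ c; have [] := DD z c Oz.
have PE z' : Omega D z' -> pderiv c f z' = if c == 0 then (W z').1 else (W z').2.
  by move=> Oz'; have [_ <-] := DD z' c Oz'.
apply/(@cvgrPdist_lt R R _ (nbhs z) (nbhs_filter z)) => e e0.
have NO : \forall z' \near z, Omega D z'.
  by apply: open_nbhs_nbhs; split => //; exact: Omega_open hD.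
apply: filterS2 (gradient_near z e0) NO => z' /[swap] Oz' /(_ (subset_closure Oz'))[h1 h2].
by rewrite (PE z Oz) (PE z' Oz') distrC; case: eqP.
Qed.

Lemma rep_piecewise : piecewise_smooth n D f.
Proof.
move=> i a b.
have [U [g [oU Sg Hg]]] := chart_extension r0 rp n0 hD (i, 0) (ltn_ord a) (ltn_ord b) (np i).1.
exists U, g; split=> //.
  by move=> z [x [y [hx hy ->]]]; have [] := Hg x y hx hy.
move=> z /set_mem [x [y [hx hy ->]]]; transitivity (phi i x y).
  by apply: fphi; [exact: cell_in01 (ltn_ord a) hx|exact: cell_in01 (ltn_ord b) hy].
exact: esym (Hg x y hx hy).2.
Qed.

Lemma corner_coords s x y d x' y' : in01 x -> in01 y -> geoS s 0 0 = geo s.1 x y ->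
  in01 x' -> in01 y' -> box x y d x' y' ->
  exists a b, [/\ 0 <= a < d, 0 <= b < d, in01 a, in01 b & geo s.1 x' y' = geoS s a b].
Proof.
move=> hx hy + hx' hy' [b1 b2]; have h0 := in01_0 R; have h1 := in01_1 R.
have /andP[x0 x1] := hx'; have /andP[y0 y1] := hy'.
have lo (t : R) : 0 <= t -> `|t - 0| < d -> 0 <= t < d by move=> t0; rewrite subr0 ger0_norm // t0.
have hi (t : R) : t <= 1 -> `|t - 1| < d -> 0 <= 1 - t < d.
  move=> t1; have t2 : 0 <= 1 - t by lra.
  by rewrite distrC ger0_norm // t2.
rewrite /geoS; case: (Z4P s.2) => ->.
- rewrite rotate0 => /(geo_inj hD h0 h0 hx hy)[ex ey]; subst x y.
  by exists x', y'; split=> //; exact: lo.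
- rewrite rotate1E subr0 => /(geo_inj hD h1 h0 hx hy)[ex ey]; subst x y.
  by exists y', (1 - x'); rewrite rotate1E subKr; split=> //; [exact: lo|exact: hi|exact: in01_rev].
- rewrite rotate2E subr0 => /(geo_inj hD h1 h1 hx hy)[ex ey]; subst x y.
  by exists (1 - x'), (1 - y'); rewrite rotate2E !subKr; split=> //; by [exact: hi|exact: in01_rev].
- rewrite rotate3E subr0 => /(geo_inj hD h0 h1 hx hy)[ex ey]; subst x y.
  by exists (1 - y'), x'; rewrite rotate3E subKr; split=> //; [exact: hi|exact: lo|exact: in01_rev].
Qed.

Lemma rep_side s a b : in01 a -> in01 b -> f (geoS s a b) = pullback s phi a b.
Proof.
move=> ha hb; have [x [y [hx hy -> H]]] := geoS_param s ha hb.
by rewrite fphi // /pullback H.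
Qed.

Lemma open_cell_corner s a b (k l : 'I_n) : 0 <= a < n%:R^-1 -> 0 <= b < n%:R^-1 ->
  open_cell s.1 k l (geoS s a b) -> corner_open n s (geoS s a b).
Proof.
move=> ha hb [x [y [hx hy e]]].
have int (m : 'I_n) (t : R) : m%:R / n%:R < t < m.+1%:R / n%:R -> 0 < t < 1.
  have n0' : 0 < n%:R :> R by rewrite ltr0n.
  move=> /andP[h1 h2]; apply/andP; split.
    by apply: le_lt_trans h1; rewrite divr_ge0.
  by apply: lt_le_trans h2 _; rewrite ler_pdivrMr // mul1r ler_nat.
have [x' [y' [hx' hy' H]]] := rotate_param_int (- s.2) (int _ _ hx) (int _ _ hy).
have := H _ (geoS s); rewrite /geoS -rotateD addNr rotate0 -e.
move=> /(geoS_inj hD (cell0_in01 n0 ha) (cell0_in01 n0 hb) (int01 hx') (int01 hy'))[ea eb].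
case/andP: ha => _ ha; case/andP: hb => _ hb; case/andP: hx' => hx' _; case/andP: hy' => hy' _.
by exists a, b; rewrite ha hb {1}ea {1}eb hx' hy'.
Qed.

Lemma rep_C2 v : C2_at n D (vertex v) f.
Proof.
split; first exact: rep_piecewise.
have [L HL] := vertex_jet r0 rp n0 hD gl jets v.
move=> c hc; apply: (cvgP (L c)).
apply/(@cvgrPdist_lt R R _ (within _ (nbhs (vertex v))) (within_filter _ (nbhs_filter (vertex v)))).
move=> e e0.
suff K i : \forall z \near vertex v, forall a b : 'I_n, open_cell i a b z -> `|L c - pderivs c f z| < e.
  have := @filter_forall _ (patchI D) _ _ (nbhs_filter (vertex v)) K.
  by apply: filterS => z H [i [a [b]]]; exact: H.
have n0' : 0 < n%:R^-1 :> R by rewrite invr_gt0 ltr0n.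
have cin j a b z : @open_cell R n D j a b z -> exists x y, [/\ in01 x, in01 y & z = geo j x y].
  move=> [x [y [/andP[/ltW h1 /ltW h2] /andP[/ltW h3 /ltW h4] ->]]]; exists x, y.
  have hx : cell n a x by rewrite /cell h1.
  have hy : cell n b y by rewrite /cell h3.
  by split=> //; [exact: cell_in01 (ltn_ord a) hx|exact: cell_in01 (ltn_ord b) hy].
have [/mapP[s sF es]|ni] := boolP (i \in [seq s.1 | s <- fan v]); last first.
  have := @near_patch _ _ _ _ _ r0 rp n0 hD i (vertex v) (fun _ _ => False).
  case=> [x y hx hy ev|]; first by case/negP: ni; apply/(fan_patches hD); exists x, y.
  move=> /= d d0 H; apply/near_row2; exists d => //= t ht t0 a b hab k l /cin [x [y [hx hy ez]]].
  by case: (H t ht t0 x y hx hy); rewrite -ez row2_0 row2_1.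
subst i; have [U [g [oU Sg Ug HgL]]] := HL s sF.
have Uv : U (vertex v).
  by rewrite -(fan_corner hD sF); apply: (Ug 0 0 _ _).1; apply: cell0; rewrite // lexx.
have cg : \forall z \near vertex v, `|pderivs c g (vertex v) - pderivs c g z| < e.
  have [cg _] := Sg (size c) c (leqnn _) _ Uv.
  by have /(@cvgrPdist_lt R R _ (nbhs (vertex v)) (nbhs_filter (vertex v))) /(_ _ e0) := cg.
have NP : \forall z \near vertex v, forall x y, in01 x -> in01 y -> z = geo s.1 x y ->
    exists a b, [/\ 0 <= a < n%:R^-1, 0 <= b < n%:R^-1 & z = geoS s a b].
  apply/near_row2.
  apply: filterS (near_patch r0 rp n0 hD (i := s.1) (z := vertex v) (Q := fun x y =>
    exists a b, [/\ 0 <= a < n%:R^-1, 0 <= b < n%:R^-1 & geo s.1 x y = geoS s a b]) _).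
    move=> d H u w hb x y hx hy ez; rewrite ez; apply: H => //.
    by rewrite -ez row2_0 row2_1.
  move=> x y hx hy ev; apply: (right0_le n0') => d /andP[_ dn] x' y' hx' hy' hb.
  have ec : geoS s 0 0 = geo s.1 x y by rewrite ev -(fan_corner hD sF).
  have [a [b [/andP[a0 ad] /andP[b0 bd] _ _ E]]] := corner_coords hx hy ec hx' hy' hb.
  by exists a, b; rewrite a0 b0 (lt_le_trans ad) // (lt_le_trans bd).
apply: filterS2 cg NP => z cgz NPz k l hz; have [x [y [hx hy ez]]] := cin _ _ _ _ hz.
have [a [b [ha hb eab]]] := NPz x y hx hy ez.
have Oz : corner_open n s z by rewrite eab; apply: (open_cell_corner (k := k) (l := l)); rewrite // -eab.
rewrite (pderivs_eq_open c (@open_corner_open R p r n D r0 rp n0 hD s) (g := g) _ Oz).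
  by rewrite -(HgL c hc).
move=> _ [x1 [y1 [/andP[/ltW u1 v1] /andP[/ltW u2 v2] ->]]].
have hx1 : 0 <= x1 < n%:R^-1 by rewrite u1. have hy1 : 0 <= y1 < n%:R^-1 by rewrite u2.
rewrite rep_side; [|exact: cell0_in01 hx1|exact: cell0_in01 hy1].
by rewrite (Ug x1 y1 (cell0 hx1) (cell0 hy1)).2.
Qed.

End Final.

(*FILE V*)
Theorem proposition4 (R : realType) (p r n : nat)
  (hr : (1 <= r <= p - 2)%N) (hn : (1 <= n)%N)
  (hn' : (4 - r%:R) / (p%:R - r%:R - 1) <= n%:R :> rat)
  (D : multipatch R) (hD : is_multipatch p r n D)
  (gd : side D -> side D -> gluing_polys R)
  (hG1 : analysis_suitable_G1 gd)
  (phi : bfun D) (hphi : argyris p r n gd phi) :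
  exists f : 'rV[R]_2 -> R,
    [/\ represents f phi,
        Ck 1 (Omega D) f &
        forall v : vertexI D, C2_at n D (vertex v) f].
Proof.
have hN := Nplus_ge6 hr hn hn'.
have [r0 rp] : (0 < r)%N /\ (r.+1 < p)%N by lia.
have rp' := ltnW rp.
have [gl jets] := argyris_good r0 rp hn hN hD hG1 hphi.
have [f fphi] := represents_ex r0 rp' hn hD gl jets.
have [W HW] := gradient_ex r0 rp' hn hD gl jets.
exists f; split; [exact: fphi|exact: (rep_C1 r0 rp' hn hD gl fphi HW)|move=> v].
exact: (rep_C2 r0 rp' hn hD gl jets fphi).
Qed.
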